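(* Consider a two-input control-affine system $$\dot x = a(x) + b_1(x)u^1 + b_2(x)u^2$$ with smooth vector fields $a,b_1,b_2$ on an $n$-dimensional smooth manifold $\mathcal X$. Define $D_0=\{0\}$, $D_1=\mathrm{span}\{b_1,b_2\}$ and $D_{i+1}=D_i+[a,D_i]$ for $i\ge 1$, and let $n_3\ge 0$ be the smallest integer such that $D_{n_3+1}$ is not involutive (such an integer is assumed to exist). Let $\overline{D}_{n_3+1}$ be the involutive closure of $D_{n_3+1}$, and let $n_2$ be the smallest integer such that $D_{n_3+1}^{(n_2-2)}=\overline{D}_{n_3+1}$. Set $G_0=\overline{D}_{n_3+1}$ and $G_{i+1}=G_i+[a,G_i]$ for $i\ge 0$. (I) Suppose $\overline{D}_{n_3+1}\neq \mathcal T(\mathcal X)$. Then the system is static feedback equivalent to the triangular form (described in the context, for some values of its length parameters) if and only if all of the following hold: (a) $\mathcal C(D_{n_3+1})=D_{n_3}$. (b) $\dim(D_{n_3+1}^{(i)})=\dim(D_{n_3+1})+i$ for $i=1,\ldots,n_2-2$. (c) The drift satisfies $$[a,\mathcal C(D_{n_3+1}^{(i)})]\subset D_{n_3+1}^{(i)},\qquad i=1,\ldots,n_2-3,$$ and $$\dim\bigl(\overline{D}_{n_3+1}+[a,D_{n_3+1}^{(n_2-3)}]\bigr)=\dim(\overline{D}_{n_3+1})+1.$$ (d) The distributions $G_{i+1}$, $i\ge 0$, are involutive. (e) $G_s=\mathcal T(\mathcal X)$ for some integer $s$. (II) Suppose $\overline{D}_{n_3+1}=\mathcal T(\mathcal X)$.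 Then the system is static feedback equivalent to the triangular form with $p_1=p_2=0$ (no $x_1$-subsystem) if and only if (a), (b) and the first condition of (c), that is $[a,\mathcal C(D_{n_3+1}^{(i)})]\subset D_{n_3+1}^{(i)}$ for $i=1,\ldots,n_2-3$, hold.
   Context: **Notation.** $\mathcal T(\mathcal X)$ is the tangent bundle of $\mathcal X$. For a vector field $v$ and distributions $D,E$: $[v,D]$ is the distribution spanned by the Lie brackets of $v$ with the vector fields of a basis of $D$; it is used in sums such as $D+[v,D]$, which do not depend on the basis. $[D,E]$ is the distribution spanned by the Lie brackets of all pairs of basis vector fields of $D$ and $E$. The derived flag of $D$ is $D^{(0)}=D$, $D^{(i+1)}=D^{(i)}+[D^{(i)},D^{(i)}]$. The involutive closure $\overline D$ is the smallest involutive distribution containing $D$. The Cauchy characteristic distribution $\mathcal C(D)$ is spanned by all vector fields $v\in D$ with $[v,D]\subset D$. An index range such as $i=1,\ldots,n_2-3$ is empty if $n_2=3$. **Static feedback equivalence.** Two systems $\dot x=a(x)+b_j(x)u^j$ and $\dot{\bar x}=\bar a(\bar x)+\bar b_j(\bar x)\bar u^j$ ($j=1,2$, summation over $j$) are static feedback equivalent if one is transformed into the other by a diffeomorphism $\bar x=\Phi(x)$ of the state space and an invertible feedback transformation $\bar u^j=g^j(x)+m^j_k(x)u^k$ (the matrix $(m^j_k)$ being invertible). **Standing conventions.** All vector fields and functions are smooth. All distributions that occur are assumed to have locally constant dimension. Everything is local and only generic points are considered: conditions and equivalences are understood locally around generic points (points of an open dense subset), and the transformation to the triangular form may have singularities at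 non-generic points. **The triangular form.** Its length parameters are integers $p_1,p_2\ge 0$, $q\ge 3$, $r\ge 0$ with $n=p_1+p_2+q+2r$. The state is $(x_1,x_2,x_3)$ with $x_1=(x_{1,1}^1,\ldots,x_{1,1}^{p_1},x_{1,2}^1,\ldots,x_{1,2}^{p_2})$, $x_2=(x_2^1,\ldots,x_2^{q})$, $x_3=(x_{3,1}^1,\ldots,x_{3,1}^{r},x_{3,2}^1,\ldots,x_{3,2}^{r})$ (upper indices are labels, not powers), and the inputs are $u^1,u^2$. The dynamics are as follows. - $x_1$-subsystem (two integrator chains, of lengths $p_1$ and $p_2$, driven by $x_2^1$ and $x_2^2$): $\dot x_{1,1}^k=x_{1,1}^{k+1}$ for $1\le k<p_1$, $\dot x_{1,1}^{p_1}=x_2^1$; $\dot x_{1,2}^k=x_{1,2}^{k+1}$ for $1\le k<p_2$, $\dot x_{1,2}^{p_2}=x_2^2$. A chain of length zero is absent. - $x_2$-subsystem (essentially in extended chained form): $\dot x_2^1=x_{3,2}^1$; $\dot x_2^k=x_2^{k+1}x_{3,2}^1+a_2^k(x_1,x_2^1,\ldots,x_2^{k+1})$ for $k=2,\ldots,q-1$; $\dot x_2^{q}=x_{3,1}^1$, where the $a_2^k$ are arbitrary smooth functions of the indicated arguments. - $x_3$-subsystem (two integrator chains of equal length $r$): $\dot x_{3,j}^k=x_{3,j}^{k+1}$ for $1\le k<r$ and $\dot x_{3,j}^{r}=u^j$, $j=1,2$. If $r=0$, the $x_3$-subsystem is absent and $x_{3,1}^1,x_{3,2}^1$ are replaced by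 $u^1,u^2$ in the $x_2$-subsystem. *)

(* Defs.v *)
From HB Require Import structures.
From mathcomp Require Import all_boot all_order all_algebra.
From mathcomp Require Import all_classical all_reals all_analysis.

Set Implicit Arguments.
Unset Strict Implicit.
Unset Printing Implicit Defensive.

Import Order.TTheory GRing.Theory Num.Theory.
Import numFieldNormedType.Exports.

Local Open Scope classical_set_scope.
Local Open Scope ring_scope.

Section Smooth.
Context {R : realType} {V W : normedModType R}.

(* On an open set [U] of a finite-dimensional [V] this is the class C^k:
   for k > 0, [f] is differentiable and all its directional derivatives are
   of class C^(k-1). *)
Fixpoint Ck_on (k : nat) (U : set V) (f : V -> W) : Prop :=
  if k is k'.+1 then
    (forall x, U x -> differentiable f x) /\
    (forall v : V, Ck_on k' U (fun x => 'D_v f x))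
  else forall x, U x -> {for x, continuous f}.

Definition smooth_on (U : set V) (f : V -> W) : Prop :=
  forall k, Ck_on k U f.

Definition smooth_near (x : V) (f : V -> W) : Prop :=
  exists U : set V, [/\ open U, U x & smooth_on U f].

End Smooth.

(* The atlas need not be maximal. [mpoint c] is the inverse of the chart
   [mcoord c : mdom c -> 'rV_n]; both maps are irrelevant outside [mdom c] and
   its image. *)
Record smoothManifold (R : realType) (n : nat) := SmoothManifold {
  mspace :> topologicalType;
  mchart : Type;
  mdom : mchart -> set mspace;
  mcoord : mchart -> mspace -> 'rV[R]_n;
  mpoint : mchart -> 'rV[R]_n -> mspace;
  m_hausdorff : hausdorff_space mspace;
  m_second_countable : @second_countable mspace;
  m_cover : forall p : mspace, exists c, mdom c p;
  mdom_open : forall c, open (mdom c);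
  mimage_open : forall c, open (mcoord c @` mdom c);
  mcoordK : forall c p, mdom c p -> mpoint c (mcoord c p) = p;
  mcoord_continuous : forall c p, mdom c p -> {for p, continuous (mcoord c)};
  mpoint_continuous : forall c p, mdom c p ->
    {for mcoord c p, continuous (mpoint c)};
  mtransition_smooth : forall c d,
    smooth_on (mcoord c @` (mdom c `&` mdom d)) (mcoord d \o mpoint c)
}.

(* A smooth vector field is the family of its coordinate representations,
   related on overlaps by the Jacobians of the transition maps. *)
Record vectorField (R : realType) (n : nat) (X : smoothManifold R n) :=
  VectorField {
  vf_coord :> mchart X -> 'rV[R]_n -> 'rV[R]_n;
  vf_smooth : forall c, smooth_on (mcoord c @` mdom c) (vf_coord c);
  vf_compat : forall c d p, mdom c p -> mdom d p ->
    vf_coord d (mcoord d p) =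
    'D_(vf_coord c (mcoord c p)) (mcoord d \o mpoint c) (mcoord c p)
}.

Section Span.
Context {K : fieldType} {vT : vectType K}.
Local Open Scope vspace_scope.

Definition is_span (S : set vT) (V : {vspace vT}) : Prop :=
  (forall v, S v -> v \in V) /\
  (forall W : {vspace vT}, (forall v, S v -> v \in W) -> V <= W).

Definition vspan (S : set vT) : {vspace vT} := xget 0%VS [set V | is_span S V].

Lemma vspanP (S : set vT) : is_span S (vspan S).
Proof.
suff [V SV] : exists V, is_span S V.
  rewrite /vspan; case: xgetP => [W -> //|/(_ V)/(_ SV)[]].
pose P (d : nat) := `[< exists s : seq vT, (forall v, v \in s -> S v) /\ \dim (span s) = d >].
have exP : exists d, P d.
  by exists (\dim (span ([::] : seq vT))); apply/asboolP; exists [::].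
have ubP d : P d -> (d <= \dim {:vT})%N.
  by move=> /asboolP[s [_ <-]]; apply: dimvS; apply: subvf.
case: (ex_maxnP exP ubP) => d /asboolP[s [sS sd]] dmax.
exists (span s); split=> [v Sv|W SW]; last by apply/span_subvP => v /sS /SW.
have sv : span s <= span (v :: s) by rewrite span_cons addvSr.
have : span s == span (v :: s).
  rewrite eqEdim sv /= sd; apply: dmax; apply/asboolP; exists (v :: s).
  by split=> // w; rewrite inE => /orP[/eqP->//|/sS].
by move=> /eqP ->; apply: memv_span; rewrite inE eqxx.
Qed.

End Span.

Section Distributions.
Context {R : realType} {n : nat}.
Implicit Types (v w a b : 'rV[R]_n -> 'rV[R]_n) (x y : 'rV[R]_n).

(* Distributions as fields of subspaces; [distribution] would clash with the
   law of a random variable. *)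
Definition tdistribution := 'rV[R]_n -> {vspace 'rV[R]_n}.
Implicit Types D E F : tdistribution.

Definition lie_bracket v w x : 'rV[R]_n := 'D_(v x) w x - 'D_(w x) v x.

Definition section_near D x v : Prop :=
  smooth_near x v /\ \forall y \near x, v y \in D y.

(* Brackets are taken with all local smooth sections instead of with a basis.
   For D of locally constant dimension, D + [v,D] and D + [D,D] are then those
   computed from any local basis of D, by the Leibniz rule. *)
Definition bracket_vd v D : tdistribution := fun x =>
  vspan [set lie_bracket v w x | w in section_near D x].

Definition bracket_dd D E : tdistribution := fun x =>
  vspan [set z | exists v w,
    [/\ section_near D x v, section_near E x w & z = lie_bracket v w x]].

Definition addd D E : tdistribution := fun x => (D x + E x)%VS.

Fixpoint derived_flag D (i : nat) : tdistribution :=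
  if i is i'.+1 then
    addd (derived_flag D i') (bracket_dd (derived_flag D i') (derived_flag D i'))
  else D.

Definition cauchy_char D : tdistribution := fun x =>
  vspan [set z | exists v, [/\ section_near D x v,
    \forall y \near x, (bracket_vd v D y <= D y)%VS & z = v x]].

Definition germ_le x D E : Prop := \forall y \near x, (D y <= E y)%VS.

Definition germ_eq x D E : Prop := \forall y \near x, D y = E y.

Definition germ_full x D : Prop := \forall y \near x, D y = fullv.

Definition germ_involutive x D : Prop := germ_le x (bracket_dd D D) D.

Definition loc_const_dim x D : Prop := \forall y \near x, \dim (D y) = \dim (D x).

Definition is_involutive_closure x D E : Prop :=
  [/\ germ_le x D E, germ_involutive x E
    & forall F, germ_le x D F -> germ_involutive x F -> germ_le x E F].

Fixpoint Dseq a b1 b2 (i : nat) : tdistribution :=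
  match i with
  | 0 => fun _ => 0%VS
  | 1 => fun x => (<[b1 x]> + <[b2 x]>)%VS
  | i'.+1 => addd (Dseq a b1 b2 i') (bracket_vd a (Dseq a b1 b2 i'))
  end.

Fixpoint Gseq a (G0 : tdistribution) (i : nat) : tdistribution :=
  if i is i'.+1 then addd (Gseq a G0 i') (bracket_vd a (Gseq a G0 i')) else G0.

Definition is_n3 x a b1 b2 (n3 : nat) : Prop :=
  ~ germ_involutive x (Dseq a b1 b2 n3.+1) /\
  (forall m, (m < n3)%N -> germ_involutive x (Dseq a b1 b2 m.+1)).

Definition is_n2 x D Dbar (n2 : nat) : Prop :=
  [/\ (2 <= n2)%N, germ_eq x (derived_flag D (n2 - 2)%N) Dbar
    & forall m, (2 <= m < n2)%N -> ~ germ_eq x (derived_flag D (m - 2)%N) Dbar].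

(* The distributions occurring in the theorem have locally constant dimension;
   here Dbar is the involutive closure of D_(n3+1). *)
Definition regular_near x a b1 b2 Dbar (n3 n2 : nat) : Prop :=
  [/\ forall i, loc_const_dim x (Dseq a b1 b2 i),
      forall i, loc_const_dim x (derived_flag (Dseq a b1 b2 n3.+1) i),
      forall i, loc_const_dim x
                  (cauchy_char (derived_flag (Dseq a b1 b2 n3.+1) i)),
      forall i, loc_const_dim x (Gseq a Dbar i)
    & loc_const_dim x (addd Dbar
        (bracket_vd a (derived_flag (Dseq a b1 b2 n3.+1) (n2 - 3)%N)))].

End Distributions.
Arguments tdistribution : clear implicits.

Section Feedback.
Context {R : realType} {n : nat}.
Implicit Types (a b : 'rV[R]_n -> 'rV[R]_n) (x : 'rV[R]_n).

Definition dynamics a b1 b2 x (u : 'cV[R]_2) : 'rV[R]_n :=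
  a x + u 0 0 *: b1 x + u 1 0 *: b2 x.

(* Some open neighborhood [U] of [x0] is mapped by the diffeomorphism [Phi]
   onto [V]; the new inputs are [g x + m x *m u]. *)
Definition sf_equivalent_near x0 a b1 b2
    (V : set 'rV[R]_n) abar b1bar b2bar : Prop :=
  exists (U : set 'rV[R]_n) (Phi Psi : 'rV[R]_n -> 'rV[R]_n)
         (g : 'rV[R]_n -> 'cV[R]_2) (m : 'rV[R]_n -> 'M[R]_2),
    [/\ [/\ open U, U x0, open V & Phi @` U = V],
        [/\ smooth_on U Phi, smooth_on V Psi
          & forall x, U x -> Psi (Phi x) = x],
        [/\ smooth_on U g, smooth_on U m & forall x, U x -> m x \in unitmx]
      & forall x u, U x ->
          'D_(dynamics a b1 b2 x u) Phi x =
          dynamics abar b1bar b2bar (Phi x) (g x + m x *m u)].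

End Feedback.

Section Triangular.
Context {R : realType} {n : nat} (p1 p2 q r : nat).
Implicit Types (x : 'rV[R]_n) (u : 'cV[R]_2) (k : nat) (j : 'I_2).

Definition entry x (i : nat) : R := if insub i is Some j then x 0 j else 0.

(* The labels k start at 1. The index j : 'I_2 of the x_3-chains and of the
   inputs starts at 0: j = 0, 1 stands for the labels 1, 2. *)
Definition x11 x k : R := entry x k.-1.
Definition x12 x k : R := entry x (p1 + k.-1)%N.
Definition x2 x k : R := entry x (p1 + p2 + k.-1)%N.
Definition x3 j x k : R := entry x (p1 + p2 + q + j * r + k.-1)%N.

Definition x2_input j x u : R := if r == 0%N then u j 0 else x3 j x 1.

Definition triangular_eqs (a2 : nat -> 'rV[R]_n -> R) x u (dx : 'rV[R]_n) :=
  [/\ [/\ forall k, (1 <= k < p1)%N -> x11 dx k = x11 x k.+1,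
          (0 < p1)%N -> x11 dx p1 = x2 x 1,
          forall k, (1 <= k < p2)%N -> x12 dx k = x12 x k.+1
        & (0 < p2)%N -> x12 dx p2 = x2 x 2],
      [/\ x2 dx 1 = x2_input 1 x u,
          forall k, (2 <= k <= q.-1)%N ->
            x2 dx k = x2 x k.+1 * x2_input 1 x u + a2 k x
        & x2 dx q = x2_input 0 x u]
    & forall j,
        (forall k, (1 <= k < r)%N -> x3 j dx k = x3 j x k.+1) /\
        ((0 < r)%N -> x3 j dx r = u j 0)].

(* a2 k only depends on x_1 and x_2^1, ..., x_2^(k+1), that is on the first
   p1 + p2 + k + 1 entries of the state. *)
Definition triangular_form (V : set 'rV[R]_n)
    (a b1 b2 : 'rV[R]_n -> 'rV[R]_n) : Prop :=
  [/\ (3 <= q)%N, n = (p1 + p2 + q + 2 * r)%N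
    & exists a2 : nat -> 'rV[R]_n -> R,
      [/\ forall k, (2 <= k <= q.-1)%N -> smooth_on V (a2 k),
          forall k, (2 <= k <= q.-1)%N -> forall x y, V x -> V y ->
            (forall i : 'I_n, (i < p1 + p2 + k.+1)%N -> x 0 i = y 0 i) ->
            a2 k x = a2 k y
        & forall x u, V x -> triangular_eqs a2 x u (dynamics a b1 b2 x u)]].

End Triangular.

Definition equivalent_to_triangular (R : realType) (n : nat) (x0 : 'rV[R]_n)
    (a b1 b2 : 'rV[R]_n -> 'rV[R]_n) (p1 p2 q r : nat) : Prop :=
  exists (V : set 'rV[R]_n) (abar b1bar b2bar : 'rV[R]_n -> 'rV[R]_n),
    triangular_form p1 p2 q r V abar b1bar b2bar /\
    sf_equivalent_near x0 a b1 b2 V abar b1bar b2bar.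

(* Main.v *)
(** Sufficiency: by Frobenius, conditions (d) and (e) provide functions whose successive drift
    derivatives cut out Dbar, and at a generic point some u in D moves a last function y1 of
    these chains; a second function y2 is the end of the other chain or comes from Frobenius
    applied to the kernel of y1 in the next to last distribution of the derived flag. With
    v in D, v y1 = 1, put X_1 = y1, X_2 = y2, X_{k+1} = v X_k. The Goursat condition (b) makes
    the derived flag the common kernels in Dbar of the contact forms dX_k - X_{k+1} dX_1, and
    (a) and the drift derivatives of X_1 and X_q complete a coordinate system; (c) is exactly
    what makes a X_k - X_{k+1} a X_1 depend on the earlier coordinates only. Necessity: in
    triangular coordinates all flags are explicit joint kernels of coordinate differentials and
    contact forms. The generic points are those where the ranks of finitely many lists of
    iterated brackets are locally constant: there, inclusions such as [a, D] in Dbar hold near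
    the point as soon as they hold at it. *)
Require Import Defs.
From HB Require Import structures.
From mathcomp Require Import all_boot all_order all_algebra.
From mathcomp Require Import all_classical all_reals all_analysis.
From mathcomp Require Import ring lra zify.

Set Implicit Arguments.
Unset Strict Implicit.
Unset Printing Implicit Defensive.

Import Order.TTheory GRing.Theory Num.Theory.
Import numFieldNormedType.Exports.

Local Open Scope classical_set_scope.
Local Open Scope ring_scope.

(** * Smooth maps *)

(** Why some u in D moves a last function: otherwise [a, D] lies in Dbar, by the Jacobi identity so
    does [a, Dbar], and the extra dimension in (c) disappears. The same dimension leaves at most two
    chains and, with two of them, forces dy2 = X_3 dy1 on the next to last member D' of the flag. In
    case (II) there are no chains: y1 is a first integral of C(D'), and D cannot lie in C(D'),
    because Dbar, the smallest involutive distribution containing D, would then lie there too. The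
    lengths q and r are not free: r = n3 and q = n2. All the analysis rests on one flow theorem for
    fields that vanish at the base point, whose nearby trajectories live for unit time; the flow
    time, or the target of an inverse map, is adjoined to the state as a constant. Frobenius needs
    no straightening chart: a reduced frame of an involutive distribution commutes, and projecting
    along its members one after the other yields first integrals with any admissible differential at
    x. In the converse direction the dimension in (c) is critical only where p1 = 0 and X_3
    vanishes; there the constancy of dimensions decides. *)

Section NearLinear.
Context {R : realType} {V W : normedModType R}.

Lemma differentiable_epsP (f : V -> W) (x : V) (df : {linear V -> W}) :
  continuous df ->
  (forall e, 0 < e -> \forall h \near 0,
     `|f (h + x) - f x - df h| <= e * `|h|) ->
  differentiable f x /\ 'd f x = df :> (V -> W).
Proof.
move=> dfc fe.
have E : f \o shift x = cst (f x) + df +o_ 0 id.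
  apply/eqaddoP => e e0; near=> h.
  have -> : (f \o shift x - (cst (f x) + df)) h = f (h + x) - f x - df h.
    by rewrite -addrA -opprD.
  by near: h; exact: fe.
have dE := diff_unique dfc E.
by split=> //; apply/diff_locallyP; rewrite dE.
Unshelve. all: by end_near. Qed.

Lemma differentiable_eps (f : V -> W) (x : V) : differentiable f x ->
  forall e, 0 < e -> \forall h \near 0,
     `|f (h + x) - f x - 'd f x h| <= e * `|h|.
Proof.
move=> /diff_locallyP[_ /eqaddoP fx] e /fx; apply: filterS => h.
suff -> : (f \o shift x - (cst (f x) + 'd f x)) h = f (h + x) - f x - 'd f x h.
  by [].
by rewrite -addrA -opprD.
Qed.

Lemma near_eq_differentiable (f g : V -> W) x :
  (\near x, f x = g x) -> differentiable f x -> differentiable g x.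
Proof.
move=> fg fx.
have [//|] := @differentiable_epsP g x ('d f x) (diff_continuous fx).
move=> e /(differentiable_eps fx) fe.
have gx : g x = f x by rewrite (nbhs_singleton fg).
have fg0 : \forall h \near 0, f (h + x) = g (h + x).
  by move: fg; rewrite (near_shift 0 x); apply: filterS => h; rewrite /= subr0.
by rewrite gx; near=> h; rewrite -(near fg0 h) //; near: h.
Unshelve. all: by end_near. Qed.

End NearLinear.

Section CkBasic.
Context {R : realType} {V W : normedModType R}.
Implicit Types (U : set V) (f g : V -> W).

Lemma Ck_onSr k U f : Ck_on k.+1 U f -> Ck_on k U f.
Proof.
elim: k f => [|k IH] f; first by move=> [df _] x /df /differentiable_continuous.
by move=> [df Df]; split=> // v; exact/IH/Df.
Qed.

Lemma Ck_on_le k m U f : (k <= m)%N -> Ck_on m U f -> Ck_on k U f.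
Proof. by move=> /subnK <-; elim: (m - k)%N => // j IH /Ck_onSr/IH. Qed.

Lemma Ck_on_subset k U U' f : U' `<=` U -> Ck_on k U f -> Ck_on k U' f.
Proof.
move=> UU; elim: k f => [|k IH] f; first by move=> fc x /UU /fc.
by move=> [df Df]; split=> [x /UU /df//|v]; exact/IH/Df.
Qed.

(** Derivatives see germs only; on an open [U] equality of values is equality of germs at each
    point, so it passes to the directional derivatives. *)
Lemma Ck_on_eq k U f g : open U -> (forall x, U x -> f x = g x) ->
  Ck_on k U f -> Ck_on k U g.
Proof.
move=> Uo; elim: k f g => [|k IH] f g fg; have fgn x : U x -> \near x, f x = g x.
- by move=> Ux; near=> y; apply: fg; near: y; exact: open_nbhs_nbhs.
- move=> fc x Ux; have := fc x Ux; rewrite /prop_for /continuous_at -(fg _ Ux).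
  by apply: cvg_trans; apply: near_eq_cvg; apply: filterS (fgn _ Ux).
- by move=> Ux; near=> y; apply: fg; near: y; exact: open_nbhs_nbhs.
- move=> [df Df]; split=> [x Ux|v]; first exact: near_eq_differentiable (fgn _ Ux) (df _ Ux).
  by apply: IH (Df v) => x /fgn /near_eq_derive ->.
Unshelve. all: by end_near. Qed.

Lemma Ck_cst k U (c : W) : Ck_on k U (fun=> c).
Proof.
elim: k c => [|k IH] c; first by move=> x _; exact: cst_continuous.
split=> [x _|v]; first exact: differentiable_cst.
have -> : (fun x => 'D_v (fun=> c) x) = (fun=> 0 : W).
  by apply/funext => x; rewrite derive_cst.
exact: IH.
Qed.

Lemma CkD k U f g : open U -> Ck_on k U f -> Ck_on k U g ->
  Ck_on k U (fun x => f x + g x).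
Proof.
move=> Uo; elim: k f g => [|k IH] f g.
  by move=> fc gc x Ux; apply: cvgD; [exact: fc|exact: gc].
move=> [df Df] [dg Dg]; split=> [x Ux|v]; first by apply: differentiableD; [exact: df|exact: dg].
apply: Ck_on_eq (IH _ _ (Df v) (Dg v)) => // x Ux.
by apply/esym/deriveD; apply: diff_derivable; [exact: df|exact: dg].
Qed.

Lemma CkZ k U f (c : R) : open U -> Ck_on k U f -> Ck_on k U (fun x => c *: f x).
Proof.
move=> Uo; elim: k f => [|k IH] f; first by move=> fc x Ux; apply: cvgZl_tmp; exact: fc.
move=> [df Df]; split=> [x Ux|v]; first by apply: differentiableZ; exact: df.
apply: Ck_on_eq (IH _ (Df v)) => // x Ux.
by apply/esym/deriveZ; apply: diff_derivable; exact: df.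
Qed.

Lemma CkN k U f : open U -> Ck_on k U f -> Ck_on k U (fun x => - f x).
Proof.
move=> Uo fk; apply: Ck_on_eq (CkZ (-1) Uo fk) => // x _.
by rewrite scaleN1r.
Qed.

Lemma CkB k U f g : open U -> Ck_on k U f -> Ck_on k U g ->
  Ck_on k U (fun x => f x - g x).
Proof. by move=> Uo fk gk; apply: CkD => //; exact: CkN. Qed.

Lemma Ck_sum k U (I : Type) (s : seq I) (P : pred I) (F : I -> V -> W) :
  open U -> (forall i, P i -> Ck_on k U (F i)) ->
  Ck_on k U (fun x => \sum_(i <- s | P i) F i x).
Proof.
move=> Uo Fk; elim: s => [|i s IH].
  by apply: Ck_on_eq (Ck_cst k U (0 : W)) => // x _; rewrite big_nil.
have [Pi|Pi] := boolP (P i).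
  by apply: Ck_on_eq (CkD Uo (Fk i Pi) IH) => // x _; rewrite big_cons Pi.
by apply: Ck_on_eq IH => // x _; rewrite big_cons (negbTE Pi).
Qed.

End CkBasic.

Section CkReal.
Context {R : realType} {V : normedModType R}.
Implicit Types (U : set V) (f g : V -> R).

Lemma CkM k U f g : open U -> Ck_on k U f -> Ck_on k U g ->
  Ck_on k U (fun x => f x * g x).
Proof.
move=> Uo; elim: k f g => [|k IH] f g.
  by move=> fc gc x Ux; apply: cvgM; [exact: fc|exact: gc].
move=> Hf Hg; have [[df Df] [dg Dg]] := (Hf, Hg).
split=> [x Ux|v]; first by apply: differentiableM; [exact: df|exact: dg].
have Hfg := CkD Uo (IH _ _ (Ck_onSr Hf) (Dg v)) (IH _ _ (Ck_onSr Hg) (Df v)).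
apply: Ck_on_eq Hfg => // x Ux.
by apply/esym/deriveM; apply: diff_derivable; [exact: df|exact: dg].
Qed.

Lemma CkV k U f : open U -> (forall x, U x -> f x != 0) -> Ck_on k U f ->
  Ck_on k U (fun x => (f x)^-1).
Proof.
move=> Uo f0; elim: k => [|k IH].
  by move=> fc x Ux; apply: cvgV; [exact: f0|exact: fc].
move=> Hf; have [df Df] := Hf; split=> [x Ux|v].
  by apply: differentiableV; [exact: df|exact: f0].
have IH' := IH (Ck_onSr Hf).
have H := CkN Uo (CkM Uo (CkM Uo IH' IH') (Df v)).
apply: Ck_on_eq H => // x Ux.
rewrite deriveV ?f0 //; last by apply: diff_derivable; exact: df.
by rewrite expr2 invfM scaleNr.
Qed.

End CkReal.

Section CkVector.
Context {R : realType} {V : normedModType R} {m : nat}.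
Implicit Types (U : set V) (f : V -> 'rV[R]_m).

Lemma row_sumE (v : 'rV[R]_m) : v = \sum_(j < m) v 0 j *: delta_mx 0 j.
Proof. exact: row_sum_delta. Qed.

Lemma differentiable_rVP f x :
  differentiable f x <-> forall j, differentiable (fun y => f y 0 j) x.
Proof.
split=> [fx j|fx].
  exact: (@differentiable_comp _ _ _ _ f (fun M : 'rV[R]_m => M 0 j) x fx
            (differentiable_coord (f x) 0 j)).
have -> : f = \sum_(j < m) (fun y => f y 0 j *: (delta_mx 0 j : 'rV[R]_m)).
  by apply/funext => y; rewrite fct_sumE -row_sumE.
by apply: differentiable_sum => j; exact: differentiableZl.
Qed.

Lemma derive_rV f x v j : derivable f x v ->
  ('D_v f x) 0 j = 'D_v (fun y => f y 0 j) x.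
Proof. by move=> fx; rewrite derive_mx // mxE. Qed.

Lemma Ck_rVP k U f : open U ->
  Ck_on k U f <-> forall j, Ck_on k U (fun y => f y 0 j).
Proof.
move=> Uo; elim: k f => [|k IH] f.
  split=> [fc j x Ux|fc x Ux].
    have := cvg_comp _ _ (fc x Ux) (@coord_continuous _ _ _ 0 j (f x)).
    exact.
  rewrite /prop_for /continuous_at.
  rewrite [X in X @ _](_ : f = fun y => \sum_(j < m) f y 0 j *: (delta_mx 0 j : 'rV[R]_m)); last first.
    by apply/funext => y; exact: row_sumE.
  rewrite [X in _ --> X](row_sumE (f x)).
  apply: cvg_big => [|j _].
    by apply: add_continuous.
  by apply: cvgZr_tmp; exact: fc.
split=> [[df Df] j|H].
  split=> [x Ux|v]; first exact: (differentiable_rVP f x).1 (df x Ux) j.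
  apply: Ck_on_eq ((IH _).1 (Df v) j) => // x Ux.
  by rewrite derive_rV //; apply: diff_derivable; exact: df.
have df x : U x -> differentiable f x.
  by move=> Ux; apply/differentiable_rVP => j; have [+ _] := H j; exact.
split=> // v; apply/IH => j; apply: Ck_on_eq ((H j).2 v) => // x Ux.
by rewrite derive_rV //; apply: diff_derivable; exact: df.
Qed.

End CkVector.

Section CkComp.
Context {R : realType} {V : normedModType R}.

Lemma derive_rVE {Z : normedModType R} {m : nat} (g : 'rV[R]_m -> Z) y v : differentiable g y ->
  'D_v g y = \sum_(j < m) v 0 j *: 'D_(delta_mx 0 j) g y.
Proof.
move=> gy; rewrite deriveE // {1}(row_sumE v) linear_sum.
by apply: eq_bigr => j _; rewrite linearZ deriveE.
Qed.

Lemma derive_comp {m : nat} {Z : normedModType R} (f : V -> 'rV[R]_m)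
    (g : 'rV[R]_m -> Z) x v :
  differentiable f x -> differentiable g (f x) ->
  'D_v (g \o f) x = 'D_('D_v f x) g (f x).
Proof.
move=> fx gx; rewrite (deriveE _ (differentiable_comp fx gx)) (deriveE _ fx).
by rewrite (deriveE _ gx) (diff_comp fx gx).
Qed.

(** By the chain rule a directional derivative of the composite is a finite sum of products of
    components of the derivative of [f] with partial derivatives of [g] along [f], all of class one
    lower. *)
Lemma Ck_comp {m : nat} k (U : set V) (U' : set 'rV[R]_m) (f : V -> 'rV[R]_m)
    (g : 'rV[R]_m -> R) : open U -> open U' ->
  (forall x, U x -> U' (f x)) -> Ck_on k U f -> Ck_on k U' g ->
  Ck_on k U (g \o f).
Proof.
move=> Uo Uo' UU; elim: k g => [|k IH] g.
  by move=> fc gc x Ux; apply: continuous_comp; [exact: fc|exact/gc/UU].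
move=> Hf Hg; have [[df Df] [dg Dg]] := (Hf, Hg).
split=> [x Ux|v]; first by apply: differentiable_comp; [exact: df|exact/dg/UU].
have H : Ck_on k U (fun x => \sum_(j < m) ('D_v f x) 0 j * 'D_(delta_mx 0 j) g (f x)).
  apply: Ck_sum => // j _; apply: CkM => //.
    by have := (Ck_rVP k _ Uo).1 (Df v) j.
  exact: IH (Ck_onSr Hf) (Dg _).
apply: Ck_on_eq H => // x Ux.
rewrite derive_comp ?(derive_rVE (g := g)) //; [exact/dg/UU|exact: df|exact/dg/UU].
Qed.

Lemma Ck_comp_rV {m p : nat} k (U : set V) (U' : set 'rV[R]_m) (f : V -> 'rV[R]_m)
    (g : 'rV[R]_m -> 'rV[R]_p) : open U -> open U' ->
  (forall x, U x -> U' (f x)) -> Ck_on k U f -> Ck_on k U' g ->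
  Ck_on k U (g \o f).
Proof.
move=> Uo Uo' UU fk gk; apply/Ck_rVP => // j.
exact: (Ck_comp Uo Uo' UU fk ((Ck_rVP _ _ Uo').1 gk j)).
Qed.

Lemma Ck_id k (U : set V) : open U -> Ck_on k U id.
Proof.
move=> Uo; case: k => [|k]; first by move=> x _; exact: cvg_id.
split=> [x _|v]; first exact: ex_diff.
by apply: Ck_on_eq (Ck_cst k U v) => // x _; rewrite derive_id.
Qed.

End CkComp.

Section Near.
Context {T : topologicalType}.
Implicit Types (x : T) (P Q S Z : T -> Prop).

Lemma near_imp x P Q : (forall y, P y -> Q y) ->
  (\forall y \near x, P y) -> \forall y \near x, Q y.
Proof. exact: filterS. Qed.

Lemma near_imp2 x P Q S : (forall y, P y -> Q y -> S y) ->
  (\forall y \near x, P y) -> (\forall y \near x, Q y) -> \forall y \near x, S y.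
Proof. exact: filterS2. Qed.

Lemma near_imp3 x P Q S Z : (forall y, P y -> Q y -> S y -> Z y) ->
  (\forall y \near x, P y) -> (\forall y \near x, Q y) ->
  (\forall y \near x, S y) -> \forall y \near x, Z y.
Proof. exact: filterS3. Qed.

Lemma near_W x P : (forall y, P y) -> \forall y \near x, P y.
Proof. exact: nearW. Qed.

Lemma near_at x P : (\forall y \near x, P y) -> P x.
Proof. exact: nbhs_singleton. Qed.

Lemma near_near x P : (\forall y \near x, P y) ->
  \forall y \near x, \forall z \near y, P z.
Proof. exact: nbhs_interior. Qed.

Lemma near_all x (I : finType) (P : I -> T -> Prop) :
  (forall i, \forall y \near x, P i y) -> \forall y \near x, forall i, P i y.
Proof. exact: filter_forall. Qed.

Lemma near_lt x m (P : nat -> T -> Prop) :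
  (forall i, (i < m)%N -> \forall y \near x, P i y) ->
  \forall y \near x, forall i, (i < m)%N -> P i y.
Proof.
move=> nP; have := @near_all x 'I_m (fun i => P i) (fun i => nP i (ltn_ord i)).
by apply: near_imp => y Py i im; exact: Py (Ordinal im).
Qed.

Lemma near_open x (U : set T) : open U -> U x -> \forall y \near x, U y.
Proof. by move=> Uo Ux; exact: open_nbhs_nbhs. Qed.

End Near.

Section Lines.
Context {R : realType} {V W : normedModType R}.

Lemma derive_line (f : V -> W) y v s :
  'D_1 (fun t : R => f (y + t *: v)) s = 'D_v f (y + s *: v).
Proof.
rewrite /derive.
suff -> : (fun h : R => h^-1 *: (((fun t : R => f (y + t *: v)) \o shift s) (h *: 1) - f (y + s *: v))) =
  (fun h : R => h^-1 *: ((f \o shift (y + s *: v)) (h *: v) - f (y + s *: v))) by [].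
apply/funext => h /=; by rewrite scalerDl [h *: (1 : R)]mulr1 addrCA.
Qed.

Lemma derivable_line (f : V -> W) y v s : derivable f (y + s *: v) v ->
  derivable (fun t : R => f (y + t *: v)) s 1.
Proof.
rewrite /derivable.
suff -> : (fun h : R => h^-1 *: ((f \o shift (y + s *: v)) (h *: v) - f (y + s *: v))) =
  (fun h : R => h^-1 *: (((fun t : R => f (y + t *: v)) \o shift s) (h *: 1) - f (y + s *: v))) by [].
apply/funext => h /=; by rewrite scalerDl [h *: (1 : R)]mulr1 addrCA.
Qed.

End Lines.

Section Directions.
Context {R : realType} {V W : normedModType R}.
Implicit Types (f : V -> W).

Lemma derive_dirZ f y (h : R) v : differentiable f y ->
  'D_(h *: v) f y = h *: 'D_v f y.
Proof. by move=> fy; rewrite (deriveE _ fy) (deriveE _ fy) linearZ. Qed.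

Lemma derive_dirD f y v w : differentiable f y ->
  'D_(v + w) f y = 'D_v f y + 'D_w f y.
Proof.
by move=> fy; rewrite (deriveE _ fy) (deriveE v fy) (deriveE w fy) linearD.
Qed.

Lemma derive_dirN f y v : differentiable f y -> 'D_(- v) f y = - 'D_v f y.
Proof. by move=> fy; rewrite -scaleN1r derive_dirZ // scaleN1r. Qed.

Lemma derive_dirB f y v w : differentiable f y ->
  'D_(v - w) f y = 'D_v f y - 'D_w f y.
Proof. by move=> fy; rewrite derive_dirD // derive_dirN. Qed.

Lemma derive_dir_sum f y (I : Type) (r : seq I) (P : pred I) (v : I -> V) :
  differentiable f y ->
  'D_(\sum_(i <- r | P i) v i) f y = \sum_(i <- r | P i) 'D_(v i) f y.
Proof.
move=> fy; elim: r => [|i r IH]; first by rewrite !big_nil derive0.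
by rewrite !big_cons; case: (P i) => //; rewrite derive_dirD // IH.
Qed.

End Directions.

Section MeanValue.
Context {R : realType} {V : normedModType R}.

Lemma segment_MVT (f : V -> R) y v :
  (forall s : R, 0 <= s <= 1 -> derivable f (y + s *: v) v) ->
  exists2 c : R, 0 <= c <= 1 & f (y + v) - f y = 'D_v f (y + c *: v).
Proof.
move=> df; pose g (t : R) := f (y + t *: v).
have dg (s : R) : s \in `[0, 1]%R -> is_derive s 1 g ('D_v f (y + s *: v)).
  rewrite in_itv /= => s01; rewrite -derive_line.
  by apply: derivableP; exact/derivable_line/df.
have dg' (s : R) : s \in `]0, 1[%R -> is_derive s 1 g ('D_v f (y + s *: v)).
  by rewrite in_itv /= => /andP[s0 s1]; apply: dg; rewrite in_itv /= !ltW.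
have gc : {within `[0, 1], continuous g}.
  by apply: derivable_within_continuous => s /dg [].
have [c c01] := MVT_segment (ler01 : (0 : R) <= 1) dg' gc.
rewrite subr0 mulr1 /g scale1r scale0r addr0 => E.
by exists c => //; move: c01; rewrite in_itv.
Qed.

Lemma normv_le {m : nat} (v : 'rV[R]_m) (M : R) : 0 <= M ->
  (forall j, `|v 0 j| <= M) -> `|v| <= M.
Proof.
move=> M0 vM; rewrite [leLHS]/Num.Def.normr /= mx_normrE.
by apply: bigmax_le => // -[i j] _ /=; rewrite ord1.
Qed.

Lemma le_normv {m : nat} (v : 'rV[R]_m) j : `|v 0 j| <= `|v|.
Proof.
rewrite [leRHS]/Num.Def.normr /= mx_normrE.
exact: (@le_bigmax _ _ _ _ (fun ij : 'I_1 * 'I_m => `|v ij.1 ij.2|) (0, j)).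
Qed.

(** The norm of row vectors is the maximum norm, so the scalar mean value theorem is used in each
    coordinate with its own intermediate point. *)
Lemma mean_value_le {m : nat} (f : V -> 'rV[R]_m) y v M :
  (forall s : R, 0 <= s <= 1 -> differentiable f (y + s *: v)) ->
  (forall s : R, 0 <= s <= 1 -> `|'D_v f (y + s *: v)| <= M) ->
  `|f (y + v) - f y| <= M.
Proof.
move=> df dM; have M0 : 0 <= M.
  by apply: le_trans (dM 0 _); rewrite ?lexx ?ler01.
apply: normv_le => // j; rewrite mxE [X in _ + X]mxE.
have dj (s : R) : 0 <= s <= 1 -> derivable f (y + s *: v) v.
  by move=> /df; exact: diff_derivable.
have [s s01|c c01 ->] := @segment_MVT (fun x => f x 0 j) y v.
  by apply: diff_derivable; apply: ((differentiable_rVP _ _).1 (df s s01)).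
rewrite -derive_rV; last exact: dj.
exact: le_trans (le_normv _ _) (dM c c01).
Qed.

End MeanValue.

Lemma dist_half_le {R : realType} (q1 q2 q3 d : R) :
  `|q1 - q3| < d / 2 -> `|q2 - q3| < d / 2 -> `|q1 - q2| <= d.
Proof. by move=> H H'; have := ler_distD q3 q1 q2; rewrite (distrC q3); lra. Qed.

Section Schwarz.
Context {R : realType} {V : normedModType R}.
Implicit Types (f : V -> R) (U : set V).

(** The mean value theorem is applied twice: to the difference [g] along v, then to the v-derivative
    of [f] along w. *)
Let sq2 f U x v w (h : R) : Ck_on 2 U f ->
  (forall s t : R, 0 <= s <= 1 -> 0 <= t <= 1 -> U (x + (s * h) *: v + (t * h) *: w)) ->
  exists s t : R, [/\ 0 <= s <= 1, 0 <= t <= 1 &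
    f (x + h *: v + h *: w) - f (x + h *: v) - f (x + h *: w) + f x =
    h * h * 'D_w (fun y => 'D_v f y) (x + (s * h) *: v + (t * h) *: w)].
Proof.
move=> [df Df] Uh.
pose g := (fun y => f (y + h *: w) - f y).
have dfd y : U y -> derivable f y (h *: v) by move=> Uy; apply: diff_derivable; exact: df.
have Ux1 (s : R) : 0 <= s <= 1 -> U (x + s *: (h *: v) + h *: w).
  by move=> s01; have := Uh s 1 s01; rewrite mul1r scalerA; apply; rewrite ler01 lexx.
have Ux0 (s : R) : 0 <= s <= 1 -> U (x + s *: (h *: v)).
  move=> s01; have := Uh s 0 s01; rewrite mul0r scale0r addr0 scalerA; apply.
  by rewrite ler01 lexx.
have dfw (s : R) : 0 <= s <= 1 -> derivable (fun y => f (y + h *: w)) (x + s *: (h *: v)) (h *: v).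
  move=> s01; have := dfd _ (Ux1 s s01); rewrite /derivable.
  suff -> : (fun k : R => k^-1 *: ((f \o shift (x + s *: (h *: v) + h *: w)) (k *: (h *: v)) - f (x + s *: (h *: v) + h *: w))) =
    (fun k : R => k^-1 *: (((fun y => f (y + h *: w)) \o shift (x + s *: (h *: v))) (k *: (h *: v)) - f (x + s *: (h *: v) + h *: w))) by [].
  by apply/funext => k /=; rewrite -!addrA.
have [s s01|s s01] := @segment_MVT _ _ g x (h *: v).
  by apply: derivableB; [exact: dfw|exact/dfd/Ux0].
rewrite /g => E.
have E1 : 'D_(h *: v) g (x + s *: (h *: v)) =
   h * 'D_v f (x + s *: (h *: v) + h *: w) - h * 'D_v f (x + s *: (h *: v)).
  rewrite /g deriveB; [|exact: dfw|exact/dfd/Ux0].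
  have -> : 'D_(h *: v) (fun y => f (y + h *: w)) (x + s *: (h *: v)) =
            'D_(h *: v) f (x + s *: (h *: v) + h *: w).
    rewrite /derive.
    suff -> : (fun k : R => k^-1 *: (((fun y => f (y + h *: w)) \o shift (x + s *: (h *: v))) (k *: (h *: v)) - f (x + s *: (h *: v) + h *: w))) =
      (fun k : R => k^-1 *: ((f \o shift (x + s *: (h *: v) + h *: w)) (k *: (h *: v)) - f (x + s *: (h *: v) + h *: w))) by [].
    by apply/funext => k /=; rewrite -!addrA.
  by rewrite (derive_dirZ _ _ (df _ (Ux1 s s01))) (derive_dirZ _ _ (df _ (Ux0 s s01))).
have [dDf _] := Df v.
have Ut (t : R) : 0 <= t <= 1 -> U (x + s *: (h *: v) + t *: (h *: w)).
  by move=> t01; have := Uh s t s01 t01; rewrite !scalerA.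
have [t t01|t t01 E2] := @segment_MVT _ _ (fun y => 'D_v f y) (x + s *: (h *: v)) (h *: w).
  by apply: diff_derivable; apply: dDf; exact: Ut.
exists s, t; split=> //.
rewrite -[x + h *: v + h *: w]addrA.
have -> : f (x + (h *: v + h *: w)) - f (x + h *: v) - f (x + h *: w) + f x =
          f (x + h *: v + h *: w) - f (x + h *: v) - (f (x + h *: w) - f x).
  by rewrite !addrA; ring.
rewrite E E1 -mulrBr E2 (derive_dirZ _ _ (dDf _ (Ut t t01))).
by rewrite !scalerA mulrA.
Qed.

(** The second difference over a small parallelogram is symmetric in v and w, so the two mixed
    derivatives take a common value at points of it; continuity of both moves these points to x. *)
Lemma schwarz f U x v w : open U -> U x -> Ck_on 2 U f ->
  'D_w (fun y => 'D_v f y) x = 'D_v (fun y => 'D_w f y) x.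
Proof.
move=> Uo Ux f2; have [_ Df] := f2.
have cont a b : {for x, continuous (fun y => 'D_a (fun y => 'D_b f y) y)}.
  by have [_ DDf] := Df b; exact: DDf.
apply/eqP; rewrite -subr_eq0 -normr_le0; apply/ler_addgt0Pl => e e0; rewrite addr0.
have e2 : 0 < e / 2 by rewrite divr_gt0.
(* The summand 1 keeps the denominator of d / M positive when both directions are zero. *)
pose M := `|v| + `|w| + 1.
have M0 : 0 < M by rewrite ltr_wpDl ?addr_ge0.
have near_pt (P : set V) : nbhs x P -> exists2 h : R, 0 < h &
    forall s t : R, 0 <= s <= 1 -> 0 <= t <= 1 -> P (x + (s * h) *: v + (t * h) *: w).
  move=> /nbhs_ballP[d /= d0 dP]; exists (d / M); first by rewrite divr_gt0.
  move=> s t /andP[s0 s1] /andP[t0 t1]; apply: dP.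
  rewrite -ball_normE /= -addrA opprD addNKr normrN.
  have dM : 0 < d / M by rewrite divr_gt0.
  have H (q : R) : 0 <= q -> q <= 1 -> `|q * (d / M)| <= d / M.
    by move=> q0 q1; rewrite ger0_norm; [apply: ler_piMl => //; exact: ltW|apply: mulr_ge0 => //; exact: ltW].
  apply: le_lt_trans (ler_normD _ _) _.
  rewrite (normrZ (s * (d / M))) (normrZ (t * (d / M))).
  apply: (@le_lt_trans _ _ (d / M * (`|v| + `|w|))).
    by rewrite mulrDr; apply: lerD; apply: ler_wpM2r => //; exact: H.
  by rewrite -[ltRHS](@divfK _ M) ?gt_eqF // ltr_pM2l // /M ltrDl.
have Un : nbhs x U by exact: open_nbhs_nbhs.
pose Q y := [/\ U y, `|'D_w (fun y => 'D_v f y) x - 'D_w (fun y => 'D_v f y) y| < e / 2 &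
   `|'D_v (fun y => 'D_w f y) x - 'D_v (fun y => 'D_w f y) y| < e / 2].
have Pn : nbhs x Q.
  have /cvgrPdist_lt/(_ _ e2) c1 := cont w v; have /cvgrPdist_lt/(_ _ e2) c2 := cont v w.
  refine (near_imp3 _ Un c1 c2) => y Uy y1 y2; exact: And3 Uy y1 y2.
have [h h0 hP] := near_pt _ Pn.
have [s [t [s01 t01 E1]]] : exists s t : R, [/\ 0 <= s <= 1, 0 <= t <= 1 &
    f (x + h *: v + h *: w) - f (x + h *: v) - f (x + h *: w) + f x =
    h * h * 'D_w (fun y => 'D_v f y) (x + (s * h) *: v + (t * h) *: w)].
  by apply: sq2 f2 _ => s t s01 t01; have [] := hP s t s01 t01.
have [s' [t' [s01' t01' E2]]] : exists s t : R, [/\ 0 <= s <= 1, 0 <= t <= 1 &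
    f (x + h *: w + h *: v) - f (x + h *: w) - f (x + h *: v) + f x =
    h * h * 'D_v (fun y => 'D_w f y) (x + (s * h) *: w + (t * h) *: v)].
  by apply: sq2 f2 _ => s' t' s01' t01'; have [+ _ _] := hP t' s' t01' s01'; rewrite addrAC.
have [_ H1 _] := hP s t s01 t01; have [_ _ H2] := hP t' s' t01' s01'.
rewrite [x + (t' * h) *: v + _]addrAC in H2.
have hh : h * h != 0 by rewrite mulf_neq0 ?gt_eqF.
have E : 'D_w (fun y => 'D_v f y) (x + (s * h) *: v + (t * h) *: w) =
         'D_v (fun y => 'D_w f y) (x + (s' * h) *: w + (t' * h) *: v).
  have gen (p q k a b : R) : k != 0 -> p = k * a -> q = k * b -> p = q -> a = b.
    by move=> k0 -> ->; exact: mulfI.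
  apply: (gen _ _ _ _ _ hh E1 E2); rewrite [x + h *: w + h *: v]addrAC.
  have gen2 (q1 q2 q3 q4 : R) : q1 - q2 - q3 + q4 = q1 - q3 - q2 + q4 by ring.
  exact: gen2.
rewrite E in H1; move: H1 H2.
set A := 'D_w _ x; set B := 'D_v _ x; set C := 'D_v _ _ => H1 H2.
exact: dist_half_le H1 H2.
Qed.

End Schwarz.

Section SmoothNear.
Context {R : realType} {V : normedModType R}.

Lemma smooth_near_near {W : normedModType R} (x : V) (f : V -> W) :
  smooth_near x f -> \forall y \near x, smooth_near y f.
Proof.
move=> [U [Uo Ux sf]]; apply: near_imp (near_open Uo Ux) => y Uy.
by exists U.
Qed.

Lemma smooth_near_on {W : normedModType R} (U : set V) (f : V -> W) x :
  open U -> U x -> smooth_on U f -> smooth_near x f.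
Proof. by move=> Uo Ux sf; exists U. Qed.

Lemma smooth_near_eq {W : normedModType R} (x : V) (f g : V -> W) :
  (\forall y \near x, f y = g y) -> smooth_near x f -> smooth_near x g.
Proof.
move=> fg [U [Uo Ux sf]]; have [V' [V'o V'x] V'fg] : exists2 V', open_nbhs x V' & V' `<=` [set y | f y = g y].
  by have : nbhs x [set y | f y = g y] by []; rewrite nbhsE.
exists (U `&` V'); split; [exact: openI|by []|move=> k].
have UV : open (U `&` V') by exact: openI.
apply: (Ck_on_eq UV (f := f)) => [y [_ /V'fg] //|].
by apply: Ck_on_subset (sf k) => y [].
Qed.

Lemma smooth_near_diff {W : normedModType R} (x : V) (f : V -> W) :
  smooth_near x f -> differentiable f x.
Proof. by move=> [U [Uo Ux sf]]; have [+ _] := sf 1%N; exact. Qed.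

Lemma smooth_near_derivable {W : normedModType R} (x v : V) (f : V -> W) :
  smooth_near x f -> derivable f x v.
Proof. by move=> /smooth_near_diff; exact: diff_derivable. Qed.

Lemma smooth_near_continuous {W : normedModType R} (x : V) (f : V -> W) :
  smooth_near x f -> {for x, continuous f}.
Proof. by move=> [U [Uo Ux sf]]; exact: sf 0%N x Ux. Qed.

Lemma smooth_near_dir {W : normedModType R} (x v : V) (f : V -> W) :
  smooth_near x f -> smooth_near x (fun y => 'D_v f y).
Proof.
move=> [U [Uo Ux sf]]; exists U; split=> // k.
by have [_ +] := sf k.+1; exact.
Qed.

Lemma smooth_near_cst {W : normedModType R} (x : V) (c : W) : smooth_near x (fun=> c).
Proof. by exists setT; split=> //; [exact: openT|move=> k; exact: Ck_cst]. Qed.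

Lemma smooth_near_id (x : V) : smooth_near x (fun y => y).
Proof. by exists setT; split=> //; [exact: openT|move=> k; apply: Ck_id; exact: openT]. Qed.

Lemma smooth_near2 {W1 W2 W3 : normedModType R} (x : V) (f : V -> W1) (g : V -> W2) (h : V -> W3) :
  (forall k U, open U -> Ck_on k U f -> Ck_on k U g -> Ck_on k U h) ->
  smooth_near x f -> smooth_near x g -> smooth_near x h.
Proof.
move=> H [U [Uo Ux sf]] [U' [Uo' Ux' sg]]; exists (U `&` U').
split; [exact: openI|by []|move=> k]; apply: H; first exact: openI.
- by apply: Ck_on_subset (sf k) => y [].
- by apply: Ck_on_subset (sg k) => y [].
Qed.

Lemma smooth_nearD {W : normedModType R} x (f g : V -> W) :
  smooth_near x f -> smooth_near x g -> smooth_near x (fun y => f y + g y).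
Proof. by apply: smooth_near2 => k U; exact: CkD. Qed.

Lemma smooth_nearZc {W : normedModType R} x (c : R) (f : V -> W) :
  smooth_near x f -> smooth_near x (fun y => c *: f y).
Proof. by move=> sf; apply: (smooth_near2 _ sf sf) => k U ? ? _; exact: CkZ. Qed.

Lemma smooth_nearB {W : normedModType R} x (f g : V -> W) :
  smooth_near x f -> smooth_near x g -> smooth_near x (fun y => f y - g y).
Proof. by apply: smooth_near2 => k U; exact: CkB. Qed.

Lemma smooth_near_sum {W : normedModType R} x (I : eqType) (s : seq I) (P : pred I) (F : I -> V -> W) :
  (forall i, i \in s -> P i -> smooth_near x (F i)) ->
  smooth_near x (fun y => \sum_(i <- s | P i) F i y).
Proof.
elim: s => [|i s IH] sF.
  apply: smooth_near_eq (smooth_near_cst x (0 : W)).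
  by apply: near_W => y; rewrite big_nil.
have {}IH := IH (fun j js => sF j (mem_behead (s := i :: s) js)).
have [Pi|Pi] := boolP (P i).
  apply: smooth_near_eq (smooth_nearD (sF i (mem_head _ _) Pi) IH).
  by apply: near_W => y; rewrite big_cons Pi.
by apply: smooth_near_eq IH; apply: near_W => y; rewrite big_cons (negbTE Pi).
Qed.

Lemma smooth_near_ord {W : normedModType R} x m (F : nat -> V -> W) :
  (forall i, (i < m)%N -> smooth_near x (F i)) ->
  smooth_near x (fun y => \sum_(i < m) F i y).
Proof. by move=> sF; apply: (smooth_near_sum (F := fun i : 'I_m => F i)) => i _ _; exact: sF. Qed.

Lemma smooth_nearM x (f g : V -> R) :
  smooth_near x f -> smooth_near x g -> smooth_near x (fun y => f y * g y).
Proof. by apply: smooth_near2 => k U; exact: CkM. Qed.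

Lemma near_neq0 x (f : V -> R) : {for x, continuous f} -> f x != 0 ->
  \forall y \near x, f y != 0.
Proof.
move=> fc fx; have /cvgrPdist_lt/(_ `|f x|) := fc; rewrite normr_gt0 => /(_ fx).
apply: near_imp => y; apply: contraTneq => ->; by rewrite subr0 ltxx.
Qed.

Lemma smooth_nearV x (f : V -> R) : f x != 0 ->
  smooth_near x f -> smooth_near x (fun y => (f y)^-1).
Proof.
move=> fx sf; have [U [Uo Ux sfU]] := sf.
have : nbhs x [set y | f y != 0] by exact: near_neq0 (smooth_near_continuous sf) fx.
rewrite nbhsE => -[V' [V'o V'x] V'f].
have UV : open (U `&` V') by exact: openI.
exists (U `&` V'); split=> // k; apply: CkV => [//|y [_ /V'f] //|].
by apply: Ck_on_subset (sfU k) => y [].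
Qed.

Lemma smooth_near_rVP {m} x (f : V -> 'rV[R]_m) :
  smooth_near x f <-> forall j, smooth_near x (fun y => f y 0 j).
Proof.
split=> [[U [Uo Ux sf]] j|H].
  by exists U; split=> // k; exact: (Ck_rVP k f Uo).1 (sf k) j.
have sc : smooth_near x (fun y => \sum_(j < m) (f y 0 j *: (delta_mx 0 j : 'rV[R]_m))).
  apply: smooth_near_sum => j _ _; have [U [Uo Ux sfj]] := H j.
  exists U; split=> // k; apply/Ck_rVP => // i.
  have := CkZ ((delta_mx 0 j : 'rV[R]_m) 0 i) Uo (sfj k).
  by apply: Ck_on_eq => // y _; rewrite [RHS]mxE; exact: mulrC.
by apply: smooth_near_eq sc; apply: near_W => y; rewrite -row_sumE.
Qed.

Lemma smooth_near_coord {m} x j (f : V -> 'rV[R]_m) :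
  smooth_near x f -> smooth_near x (fun y => f y 0 j).
Proof. by move=> /smooth_near_rVP. Qed.

Lemma smooth_nearZ {m} x (s : V -> R) (f : V -> 'rV[R]_m) :
  smooth_near x s -> smooth_near x f -> smooth_near x (fun y => s y *: f y).
Proof.
move=> ss sf; apply/smooth_near_rVP => j.
apply: smooth_near_eq (smooth_nearM ss (smooth_near_coord j sf)).
by apply: near_W => y; rewrite mxE.
Qed.

End SmoothNear.

Section SmoothNearComp.
Context {R : realType} {V : normedModType R}.

Lemma smooth_near_comp_rV {m p : nat} x (f : V -> 'rV[R]_m) (g : 'rV[R]_m -> 'rV[R]_p) :
  smooth_near x f -> smooth_near (f x) g -> smooth_near x (fun y => g (f y)).
Proof.
move=> sf [U' [Uo' Ux' sg]].
have : nbhs x (f @^-1` U') by exact: smooth_near_continuous sf U' (open_nbhs_nbhs (conj Uo' Ux')).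
rewrite nbhsE => -[A [Ao Ax] AU'].
have [U [Uo Ux sfU]] := sf.
have UA : open (U `&` A) by exact: openI.
exists (U `&` A); split=> // k; apply: (Ck_comp_rV UA Uo' _ _ (sg k)) => [y [_ /AU'] //|].
by apply: Ck_on_subset (sfU k) => y [].
Qed.

Lemma smooth_near_comp {m : nat} x (f : V -> 'rV[R]_m) (g : 'rV[R]_m -> R) :
  smooth_near x f -> smooth_near (f x) g -> smooth_near x (fun y => g (f y)).
Proof.
move=> sf sg.
have sg' : smooth_near (f x) (fun z => g z *: (const_mx 1 : 'rV[R]_1)).
  apply/smooth_near_rVP => j; apply: smooth_near_eq sg.
  by apply: near_W => y; rewrite !mxE mulr1.
have := smooth_near_coord 0 (smooth_near_comp_rV sf sg').
by apply: smooth_near_eq; apply: near_W => y; rewrite !mxE mulr1.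
Qed.

End SmoothNearComp.

(** * Lie derivatives, brackets and the Jacobi identity *)

Section Lie.
Context {R : realType} {n : nat}.
Local Notation vf := ('rV[R]_n -> 'rV[R]_n).
Implicit Types (x y : 'rV[R]_n) (a v w : vf) (f g : 'rV[R]_n -> R).

Definition lied v f : 'rV[R]_n -> R := fun y => 'D_(v y) f y.

Lemma smooth_near_deriv_rV {m} x v (f : 'rV[R]_n -> 'rV[R]_m) :
  smooth_near x v -> smooth_near x f -> smooth_near x (fun y => 'D_(v y) f y).
Proof.
move=> sv sf.
have sc : smooth_near x (fun y => \sum_(j < n) (v y 0 j *: 'D_(delta_mx 0 j) f y)).
  apply: smooth_near_sum => j _ _; apply: smooth_nearZ.
    exact: smooth_near_coord.
  exact: smooth_near_dir.
apply: smooth_near_eq sc; apply: near_imp (smooth_near_near sf) => y.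
by move=> /smooth_near_diff /derive_rVE <-.
Qed.

Lemma smooth_near_lied x v f :
  smooth_near x v -> smooth_near x f -> smooth_near x (lied v f).
Proof.
move=> sv sf.
have sc : smooth_near x (fun y => \sum_(j < n) (v y 0 j * 'D_(delta_mx 0 j) f y)).
  apply: smooth_near_sum => j _ _; apply: smooth_nearM.
    exact: smooth_near_coord.
  exact: smooth_near_dir.
apply: smooth_near_eq sc; apply: near_imp (smooth_near_near sf) => y.
by move=> /smooth_near_diff /derive_rVE <-.
Qed.

Lemma near_lied_eq x v f g : (\forall y \near x, f y = g y) ->
  \forall y \near x, lied v f y = lied v g y.
Proof. by move=> /near_near; apply: near_imp => y fg; exact: near_eq_derive. Qed.

Lemma smooth_near_bracket x v w :
  smooth_near x v -> smooth_near x w -> smooth_near x (lie_bracket v w).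
Proof. by move=> sv sw; apply: smooth_nearB; exact: smooth_near_deriv_rV. Qed.

Lemma lied_cst v (c : R) y : lied v (fun=> c) y = 0.
Proof. by rewrite /lied derive_cst. Qed.

Lemma liedD v f g y : smooth_near y f -> smooth_near y g ->
  lied v (fun z => f z + g z) y = lied v f y + lied v g y.
Proof.
move=> sf sg; rewrite /lied.
by apply: (@deriveD _ _ _ f g y (v y)); exact: smooth_near_derivable.
Qed.

Lemma liedB v f g y : smooth_near y f -> smooth_near y g ->
  lied v (fun z => f z - g z) y = lied v f y - lied v g y.
Proof.
move=> sf sg; rewrite /lied.
by apply: (@deriveB _ _ _ f g y (v y)); exact: smooth_near_derivable.
Qed.

Lemma liedM v f g y : smooth_near y f -> smooth_near y g ->
  lied v (fun z => f z * g z) y = f y * lied v g y + g y * lied v f y.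
Proof.
move=> sf sg; rewrite /lied.
by apply: (@deriveM _ _ f g y (v y)); exact: smooth_near_derivable.
Qed.

Lemma lied_sum v m (F : nat -> 'rV[R]_n -> R) y :
  (forall i, (i < m)%N -> smooth_near y (F i)) ->
  lied v (fun z => \sum_(i < m) F i z) y = \sum_(i < m) lied v (F i) y.
Proof.
elim: m => [|m IH] sF.
  rewrite big_ord0 -[RHS](lied_cst v 0 y); apply: near_eq_derive.
  by apply: near_W => z; rewrite big_ord0.
have sF' i : (i < m)%N -> smooth_near y (F i) by move=> im; apply: sF; exact: ltnW.
rewrite big_ord_recr /= -IH // -liedD; [|exact: smooth_near_ord|exact: sF].
by apply: near_eq_derive; apply: near_W => z; rewrite big_ord_recr.
Qed.

Lemma derive_coord (u : 'rV[R]_n) y j : ('D_u (fun z : 'rV[R]_n => z 0 j) y) = u 0 j.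
Proof.
have sid := smooth_near_id y.
by rewrite -(derive_rV j (@smooth_near_derivable _ _ _ _ u _ sid)) derive_id.
Qed.

Lemma lied_deriv_rV v {m} (f : 'rV[R]_n -> 'rV[R]_m) y j : smooth_near y f ->
  ('D_(v y) f y) 0 j = lied v (fun z => f z 0 j) y.
Proof. by move=> sf; rewrite (derive_rV j (smooth_near_derivable sf)). Qed.

(** Only the first-order term survives in a commutator; the second-order term is symmetric in v and
    w by [schwarz]. *)
Lemma lied_lied v w f y : smooth_near y v -> smooth_near y w -> smooth_near y f ->
  lied v (lied w f) y =
  'D_('D_(v y) w y) f y +
  \sum_(j < n) w y 0 j * 'D_(v y) (fun z => 'D_(delta_mx 0 j) f z) y.
Proof.
move=> sv sw sf.
(* [lied_sum] expects a family indexed by natural numbers, so the summands are continued by 0 beyond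
   n. *)
pose F (i : nat) z := if insub i is Some j then w z 0 j * 'D_(delta_mx 0 j) f z else 0.
have FE (j : 'I_n) z : F j z = w z 0 j * 'D_(delta_mx 0 j) f z by rewrite /F valK.
have sF i : (i < n)%N -> smooth_near y (F i).
  move=> lt_in; apply: smooth_near_eq (smooth_nearM (smooth_near_coord (Ordinal lt_in) sw)
     (smooth_near_dir (delta_mx 0 (Ordinal lt_in)) sf)).
  by apply: near_W => z; rewrite -FE.
have -> : lied v (lied w f) y = lied v (fun z => \sum_(j < n) F j z) y.
  apply: near_eq_derive; apply: near_imp (smooth_near_near sf) => z /smooth_near_diff fz.
  by rewrite /lied derive_rVE //; apply: eq_bigr => j _; rewrite FE.
rewrite lied_sum // (derive_rVE ('D_(v y) w y) (smooth_near_diff sf)) -big_split /=.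
apply: eq_bigr => j _; have -> : lied v (F j) y = lied v (fun z => w z 0 j * 'D_(delta_mx 0 j) f z) y.
  by apply: near_eq_derive; apply: near_W => z; exact: FE.
rewrite (liedM v (smooth_near_coord j sw) (smooth_near_dir (delta_mx 0 j) sf)).
rewrite (lied_deriv_rV _ _ sw) addrC; congr (_ + _); exact: mulrC.
Qed.

Let second_sum (u u' : 'rV[R]_n) f y : smooth_near y f ->
  \sum_(j < n) u 0 j * 'D_(u') (fun z => 'D_(delta_mx 0 j) f z) y =
  \sum_(j < n) \sum_(i < n) u 0 j * (u' 0 i * 'D_(delta_mx 0 i) (fun z => 'D_(delta_mx 0 j) f z) y).
Proof.
move=> sf; apply: eq_bigr => j _; rewrite -mulr_sumr; congr (_ * _).
exact: (derive_rVE u' (smooth_near_diff (smooth_near_dir (delta_mx 0 j) sf))).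
Qed.

Let second_sym (u u' : 'rV[R]_n) f y : smooth_near y f ->
  \sum_(j < n) u 0 j * 'D_(u') (fun z => 'D_(delta_mx 0 j) f z) y =
  \sum_(j < n) u' 0 j * 'D_u (fun z => 'D_(delta_mx 0 j) f z) y.
Proof.
move=> sf; apply: etrans (second_sum u u' sf) _.
apply: etrans _ (esym (second_sum u' u sf)); apply: etrans (exchange_big _ _ _ _ _ _) _.
apply: eq_bigr => j _; apply: eq_bigr => i _ /=.
have [U [Uo Uy sfU]] := sf.
by rewrite (schwarz (delta_mx 0 i) (delta_mx 0 j) Uo Uy (sfU 2%N)) mulrCA.
Qed.

Lemma lied_bracket v w f y : smooth_near y v -> smooth_near y w -> smooth_near y f ->
  lied (lie_bracket v w) f y = lied v (lied w f) y - lied w (lied v f) y.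
Proof.
move=> sv sw sf.
have gen (L A B P Q S T : R) : A = P + S -> B = Q + T -> S = T -> L = P - Q -> L = A - B.
  by move=> -> -> -> ->; ring.
apply: (gen _ _ _ _ _ _ _ (lied_lied sv sw sf) (lied_lied sw sv sf)).
  exact: second_sym.
exact: derive_dirB (smooth_near_diff sf).
Qed.

Lemma bracket_coord v w y j : smooth_near y v -> smooth_near y w ->
  lie_bracket v w y 0 j = lied v (fun z => w z 0 j) y - lied w (fun z => v z 0 j) y.
Proof. by move=> sv sw; rewrite mxE [X in _ + X]mxE !lied_deriv_rV. Qed.

Lemma bracketN v w y : lie_bracket v w y = - lie_bracket w v y.
Proof. by rewrite /lie_bracket opprB. Qed.

Lemma lied_ext_eq (u w : 'rV[R]_n) y :
  (forall f, smooth_near y f -> 'D_u f y = 'D_w f y) -> u = w.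
Proof.
move=> H; apply/rowP => j; have := H (fun z => z 0 j).
by rewrite !derive_coord; apply; apply: smooth_near_coord (smooth_near_id y).
Qed.

End Lie.

Section Jacobi.
Context {R : realType} {n : nat}.
Implicit Types (u v w : 'rV[R]_n -> 'rV[R]_n).

(** Both sides are tested on smooth functions, where a bracket acts as a commutator of derivations;
    the identity is then the formal one for commutators. *)
Lemma jacobi u v w y : smooth_near y u -> smooth_near y v -> smooth_near y w ->
  lie_bracket u (lie_bracket v w) y =
  lie_bracket (lie_bracket u v) w y + lie_bracket v (lie_bracket u w) y.
Proof.
move=> su sv sw; apply: (@lied_ext_eq _ _ _ _ y) => f sf.
have E1 (a b : 'rV[R]_n -> 'rV[R]_n) g : smooth_near y a -> smooth_near y b -> smooth_near y g ->
   'D_(lie_bracket a b y) g y = lied a (lied b g) y - lied b (lied a g) y.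
  exact: lied_bracket.
have E2 (a b c : 'rV[R]_n -> 'rV[R]_n) : smooth_near y a -> smooth_near y b -> smooth_near y c ->
   lied c (lied (lie_bracket a b) f) y =
   lied c (lied a (lied b f)) y - lied c (lied b (lied a f)) y.
  move=> sa sb sc; rewrite -liedB; [|exact: (smooth_near_lied sa (smooth_near_lied sb sf))
    |exact: (smooth_near_lied sb (smooth_near_lied sa sf))].
  apply: near_eq_derive.
  apply: near_imp3 (smooth_near_near sa) (smooth_near_near sb) (smooth_near_near sf) => z.
  exact: lied_bracket.
have E3 : forall p q t : 'rV[R]_n -> 'rV[R]_n, smooth_near y p -> smooth_near y q -> smooth_near y t ->
   lied (lie_bracket p q) (lied t f) y =
   lied p (lied q (lied t f)) y - lied q (lied p (lied t f)) y.
  by move=> p q t sp sq st; apply: lied_bracket => //; exact: (smooth_near_lied st sf).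
rewrite (derive_dirD (lie_bracket (lie_bracket u v) w y) (lie_bracket v (lie_bracket u w) y) (smooth_near_diff sf)).
have gen (L M N p1 p2 p3 p4 p5 p6 q1 q2 q3 q4 q5 q6 : R) :
    L = p1 - p2 -> M = p3 - p4 -> N = p5 - p6 ->
    p1 = q1 - q2 -> p2 = q3 - q4 -> p3 = q1 - q5 -> p4 = q6 - q4 ->
    p5 = q5 - q3 -> p6 = q2 - q6 -> L = M + N.
  by move=> -> -> -> -> -> -> -> -> ->; ring.
have := (gen _ _ _ _ _ _ _ _ _ _ _ _ _ _ _
  (E1 _ _ f su (smooth_near_bracket sv sw) sf) (E1 _ _ f (smooth_near_bracket su sv) sw sf)
  (E1 _ _ f sv (smooth_near_bracket su sw) sf) (E2 v w u sv sw su) (E3 v w u sv sw su)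
  (E3 u v w su sv sw) (E2 u v w su sv sw) (E2 u w v su sw sv) (E3 u w v su sw sv)).
exact.
Qed.
End Jacobi.

(** * Real curves: limits, primitives, comparison and the Gronwall inequality *)

Section RealCurves.
Context {R : realType}.

(** The intervals of radius B / 2^k around u k are nested; the limit is the supremum of their left
    end points, so the rate of convergence comes with it. *)
Lemma geometric_limit (u : nat -> R) (B : R) :
  (forall k, `|u k.+1 - u k| <= B / 2 ^+ k.+1) ->
  exists l, forall k, `|l - u k| <= B / 2 ^+ k.
Proof.
move=> uB; have half k : B / 2 ^+ k = B / 2 ^+ k.+1 + B / 2 ^+ k.+1.
  by rewrite exprS; field; rewrite expf_neq0.
have aS k : u k - B / 2 ^+ k <= u k.+1 - B / 2 ^+ k.+1.
  by have := uB k; rewrite (half k) ler_norml => /andP[]; lra.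
have bS k : u k.+1 + B / 2 ^+ k.+1 <= u k + B / 2 ^+ k.
  by have := uB k; rewrite (half k) ler_norml => /andP[]; lra.
have B0 k : 0 <= B / 2 ^+ k by rewrite (half k); have := uB k; have := normr_ge0 (u k.+1 - u k); lra.
have am k m : (k <= m)%N -> u k - B / 2 ^+ k <= u m - B / 2 ^+ m.
  by move=> /subnK <-; elim: (m - k)%N => // j IH; rewrite addSn; exact: le_trans IH (aS _).
have bm k m : (k <= m)%N -> u m + B / 2 ^+ m <= u k + B / 2 ^+ k.
  by move=> /subnK <-; elim: (m - k)%N => // j IH; rewrite addSn; exact: le_trans (bS _) IH.
have ab k m : u k - B / 2 ^+ k <= u m + B / 2 ^+ m.
  have [km|/ltnW mk] := leqP k m.
    by apply: le_trans (am k m km) _; have := B0 m; lra.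
  by apply: le_trans _ (bm m k mk); have := B0 k; lra.
pose A := range (fun k => u k - B / 2 ^+ k).
have A0 : A !=set0 by exists (u 0%N - B / 2 ^+ 0), 0%N.
exists (sup A) => k; rewrite ler_norml.
have h1 : u k - B / 2 ^+ k <= sup A.
  by apply: ub_le_sup; [exists (u 0%N + B / 2 ^+ 0) => _ [m _ <-]; exact: ab|exists k].
have h2 : sup A <= u k + B / 2 ^+ k.
  by apply: ge_sup => // _ [m _ <-]; exact: ab.
by apply/andP; split; lra.
Qed.

(** Integrating from -T rather than from 0 makes 0 an interior point, where the fundamental theorem
    gives a two-sided derivative. *)
Lemma antiderivative (g : R -> R) (T : R) : 0 < T -> continuous g ->
  exists G : R -> R, G 0 = 0 /\ forall t : R, - T < t -> t < T -> is_derive t 1 G (g t).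
Proof.
move=> T0 gc.
pose F (t : R) := (\int[@lebesgue_measure R]_(s in [set` `[- T, t]]) g s)%R.
exists (fun t => F t - F 0); split; first by rewrite subrr.
move=> t Tt tT.
have gi : (@lebesgue_measure R).-integrable `[- T, T] (EFin \o g).
  apply: continuous_compact_integrable; first exact: segment_compact.
  exact: continuous_subspaceT.
have [dF F't] := @continuous_FTC1_closed R g (- T) t T tT gi Tt (gc t).
have H : is_derive t 1 F (g t).
  exact: (DeriveDef dF (etrans (esym (derive1E F t)) F't)).
by have := is_deriveB H (is_derive_cst (F 0) t 1); rewrite subr0.
Qed.

(** Solutions are controlled on [0, 1] only; composing with this retraction keeps the curves
    continuous on the whole line, as [antiderivative] asks. *)
Definition clamp01 (t : R) : R := Num.max 0 (Num.min t 1).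

Lemma clamp01_ge0 t : 0 <= clamp01 t.
Proof. by rewrite /clamp01 le_max lexx. Qed.

Lemma clamp01_le1 t : clamp01 t <= 1.
Proof. by rewrite /clamp01 ge_max ler01 ge_min lexx orbT. Qed.

Lemma clamp01_id t : 0 <= t <= 1 -> clamp01 t = t.
Proof.
move=> /andP[t0 t1]; rewrite /clamp01.
by rewrite (min_idPl t1) (max_idPr t0).
Qed.

Lemma clamp01_continuous : continuous clamp01.
Proof.
move=> t; have c1 := @cst_continuous R R 1 t.
have cm := @continuous_min R R id (fun=> 1) t cvg_id c1.
exact: (@continuous_max R R (fun=> 0) (fun s => Num.min s 1) t (@cst_continuous R R 0 t) cm).
Qed.

Lemma ndecr01 (f f' : R -> R) :
  (forall t : R, 0 <= t <= 1 -> is_derive t 1 f (f' t)) ->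
  (forall t : R, 0 <= t <= 1 -> 0 <= f' t) ->
  forall t : R, 0 <= t <= 1 -> f 0 <= f t.
Proof.
move=> df f0 t /andP[t0 t1].
have df1 (s : R) : s \in `]0, t[%R -> is_derive s 1 f (f' s).
  rewrite in_itv /= => /andP[s0 st]; apply: df.
  by rewrite (ltW s0) (le_trans (ltW st) t1).
have fc : {within `[0, t], continuous f}.
  apply: derivable_within_continuous => s; rewrite in_itv /= => /andP[s0 st].
  by have [] := df s; rewrite ?s0 ?(le_trans st t1).
have [c + E] := MVT_segment t0 df1 fc.
rewrite in_itv /= => /andP[c0 ct].
rewrite -subr_ge0 E subr0 mulr_ge0 // f0 // c0; exact: le_trans ct t1.
Qed.

End RealCurves.

Section Curves.
Context {R : realType} {N : nat}.
Local Notation V := 'rV[R]_N.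
Implicit Types (e xi : R -> V).

Lemma is_derive_rVP e t (d : V) :
  is_derive t (1 : R) e d <-> forall j, is_derive t 1 (fun s => e s 0 j) (d 0 j).
Proof.
split=> [[de <-] j|H].
  apply: DeriveDef; first exact: (derivable_mxP _ _ _).1 de 0 j.
  by rewrite (derive_rV j de).
have de : derivable e t 1.
  by apply/derivable_mxP => i j; rewrite ord1; have [] := H j.
apply: DeriveDef => //; apply/rowP => j; rewrite (derive_rV j de).
by have [_ ->] := H j.
Qed.

(** For every coordinate both phi - e_j and phi + e_j are nondecreasing, so no vector-valued
    integral is needed. *)
Lemma curve_le e e' (phi phi' : R -> R) :
  (forall t : R, 0 <= t <= 1 -> is_derive t (1 : R) e (e' t)) ->
  (forall t : R, 0 <= t <= 1 -> is_derive t 1 phi (phi' t)) ->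
  (forall t : R, 0 <= t <= 1 -> `|e' t| <= phi' t) ->
  forall t : R, 0 <= t <= 1 -> `|e t - e 0| <= phi t - phi 0.
Proof.
move=> de dphi le t t01.
have dj j (s : R) : 0 <= s <= 1 -> is_derive s 1 (fun s => e s 0 j) (e' s 0 j).
  by move=> /de /is_derive_rVP.
have lej j (s : R) : 0 <= s <= 1 -> `|e' s 0 j| <= phi' s.
  by move=> s01; apply: le_trans (le_normv _ _) (le s s01).
have H j : `|e t 0 j - e 0 0 j| <= phi t - phi 0.
  have h1 := @ndecr01 R (fun s => phi s - e s 0 j) (fun s => phi' s - e' s 0 j).
  have h2 := @ndecr01 R (fun s => phi s + e s 0 j) (fun s => phi' s + e' s 0 j).
  have {}h1 : phi 0 - e 0 0 j <= phi t - e t 0 j.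
    apply: h1 => // s s01; first exact: is_deriveB (dphi s s01) (dj j s s01).
    by have := lej j s s01; rewrite ler_norml => /andP[]; lra.
  have {}h2 : phi 0 + e 0 0 j <= phi t + e t 0 j.
    apply: h2 => // s s01; first exact: is_deriveD (dphi s s01) (dj j s s01).
    by have := lej j s s01; rewrite ler_norml => /andP[]; lra.
  by rewrite ler_norml; apply/andP; split; lra.
(* Without coordinates there is no instance of [H] to show that the bound is nonnegative;
   monotonicity of phi gives it. *)
case: (posnP N) => [N0|N0].
  have -> : e t - e 0 = 0.
    by apply/rowP => i; exfalso; move: (leq_ltn_trans (leq0n i) (ltn_ord i)); rewrite N0.
  rewrite normr0 subr_ge0; apply: (ndecr01 dphi) => // s s01.
  exact: le_trans (le s s01).
apply: normv_le => [|j]; last by rewrite mxE [X in _ + X]mxE; exact: H.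
by apply: le_trans (H (Ordinal N0)).
Qed.

Lemma is_derive_expM (K c t : R) :
  is_derive t 1 (fun s => c * expR (K * s)) (c * K * expR (K * t)).
Proof.
have d1 : is_derive t 1 (fun s => K * s) K.
  have := is_deriveM (is_derive_cst K t 1) (is_derive_id t 1).
  by rewrite scaler0 addr0 [_ *: _]mulr1.
have d2 : is_derive t 1 (fun s => expR (K * s)) (K * expR (K * t)).
  have := @is_derive1_comp R expR (fun s => K * s) t _ _ (is_derive_expR (K * t)) d1.
  by rewrite mulrC.
have := is_deriveM (is_derive_cst c t 1) d2.
by rewrite scaler0 addr0 -mulrA.
Qed.

(* With the weight exp(-2Lt) the maximum of |e| is bounded by the data plus one
   half of itself. *)
Lemma gronwall e e' (L eta : R) : 0 < L -> 0 <= eta ->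
  (forall t : R, 0 <= t <= 1 -> is_derive t (1 : R) e (e' t)) ->
  (forall t : R, 0 <= t <= 1 -> `|e' t| <= L * `|e t| + eta) ->
  forall t : R, 0 <= t <= 1 -> `|e t| <= 2 * expR (2 * L) * (`|e 0| + eta).
Proof.
move=> L0 eta0 de le.
have ec (t : R) : 0 <= t <= 1 -> {for t, continuous e}.
  by move=> /de [+ _] => /derivable1_diffP/differentiable_continuous.
pose f t := expR (- (2 * L) * t) * `|e t|.
have fc : {within `[0, 1], continuous f}.
  apply: continuous_in_subspaceT => t; rewrite inE /= in_itv /= => t01.
  apply: cvgM.
    have E : (fun s => expR (- (2 * L) * s)) = (fun s => 1 * expR (- (2 * L) * s)).
      by apply/funext => s; rewrite mul1r.
    rewrite [X in X @ _ --> _]E -[X in _ --> X]mul1r.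
    have [+ _] := is_derive_expM (- (2 * L)) 1 t.
    by move=> /derivable1_diffP/differentiable_continuous.
  exact: (continuous_comp (ec t t01) (@norm_continuous _ _ (e t))).
have [c + fmax] := EVT_max (ler01 : (0 : R) <= 1) fc.
rewrite in_itv /= => c01; set m := f c.
have fm (t : R) : 0 <= t <= 1 -> `|e t| <= m * expR (2 * L * t).
  move=> t01; have : f t <= m by apply: fmax; rewrite in_itv.
  by rewrite /f mulNr expRN mulrC ler_pdivrMr ?expR_gt0.
have m0 : 0 <= m by rewrite mulr_ge0 ?expR_ge0.
have bnd (t : R) : 0 <= t <= 1 -> `|e t| <= `|e 0| + eta + m / 2 * expR (2 * L * t).
  move=> t01.
  have H0 := @curve_le e e' (fun s => m / 2 * expR (2 * L * s) + eta * s)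
    (fun s => m / 2 * (2 * L) * expR (2 * L * s) + eta) de.
  have h1 (s : R) : 0 <= s <= 1 -> is_derive s 1 (fun s => m / 2 * expR (2 * L * s) + eta * s)
      (m / 2 * (2 * L) * expR (2 * L * s) + eta).
    move=> _; apply: is_deriveD; first exact: is_derive_expM.
    have := is_deriveM (is_derive_cst eta s 1) (is_derive_id s 1).
    by rewrite scaler0 addr0 [_ *: _]mulr1.
  have h2 (s : R) : 0 <= s <= 1 -> `|e' s| <= m / 2 * (2 * L) * expR (2 * L * s) + eta.
    move=> s01; apply: le_trans (le s s01) _; rewrite lerD2r.
    have -> : m / 2 * (2 * L) = L * m by field.
    by rewrite -mulrA ler_pM2l // fm.
  have := H0 h1 h2 t t01; rewrite !mulr0 expR0 mulr1 addr0 => H.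
  have := ler_normD (e t - e 0) (e 0); rewrite subrK => H2.
  have [t0 t1] := andP t01; have : eta * t <= eta by rewrite ler_piMr.
  have : 0 <= m / 2 by rewrite divr_ge0.
  by move: H H2; lra.
have mb : m <= 2 * (`|e 0| + eta).
  have := bnd c c01; have [c0 c1] := andP c01.
  have E0 : 0 < expR (2 * L * c) by exact: expR_gt0.
  have E1 : 1 <= expR (2 * L * c) by rewrite -expR0 ler_expR !mulr_ge0 // ltW.
  have mE : `|e c| = m * expR (2 * L * c).
    by rewrite /m /f mulNr expRN mulrAC mulVf ?mul1r // gt_eqF.
  rewrite mE => H.
  have H2 : m / 2 * expR (2 * L * c) <= `|e 0| + eta by move: H; lra.
  have : m / 2 <= m / 2 * expR (2 * L * c) by rewrite ler_peMr // divr_ge0.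
  by move: H2; lra.
move=> t t01; apply: le_trans (fm t t01) _.
have [t0 t1] := andP t01.
rewrite [leRHS]mulrAC.
apply: (ler_pM m0 (expR_ge0 _) mb).
by rewrite ler_expR ler_piMr // mulr_ge0 // ltW.
Qed.

End Curves.

(** * Flows *)

Section Picard.
Context {R : realType} {N : nat}.
Local Notation V := 'rV[R]_N.

Lemma is_derive_continuous {W : normedModType R} (e : R -> W) (t : R) d :
  is_derive t (1 : R) e d -> {for t, continuous e}.
Proof. by move=> [+ _] => /derivable1_diffP/differentiable_continuous. Qed.

Let antiderivative_rV (g : R -> V) : continuous g ->
  exists G : R -> V, G 0 = 0 /\ forall t : R, 0 <= t <= 1 -> is_derive t (1 : R) G (g t).
Proof.
move=> gc.
have gcj j : continuous (fun t => g t 0 j).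
  by move=> t; exact: (continuous_comp (gc t) (@coord_continuous _ _ _ 0 j (g t))).
pose G j := sval (cid (antiderivative (ltr0Sn R 1) (gcj j))).
have G0 j : G j 0 = 0 by have [] := svalP (cid (antiderivative (ltr0Sn R 1) (gcj j))).
have G1 j (t : R) : -2 < t -> t < 2 -> is_derive t 1 (G j) (g t 0 j).
  by have [_ +] := svalP (cid (antiderivative (ltr0Sn R 1) (gcj j))); exact.
exists (fun t => \row_j G j t); split; first by apply/rowP => j; rewrite !mxE.
move=> t /andP[t0 t1]; apply/is_derive_rVP => j.
have -> : (fun s => (\row_j0 G j0 s) 0 j) = G j by apply/funext => s; rewrite mxE.
by apply: G1; lra.
Qed.

Variables (f : R -> V -> V) (L : R).
Hypothesis L0 : 0 < L.
Hypothesis fL : forall (t : R) x y, 0 <= t <= 1 -> `|f t x - f t y| <= L * `|x - y|.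
Hypothesis fc : forall xi : R -> V, continuous xi -> continuous (fun t => f t (xi t)).

Let prim (xi : R -> V) : R -> V := xget (fun=> 0) [set G | G 0 = 0 /\
  forall t : R, 0 <= t <= 1 -> is_derive t (1 : R) G (f t (xi t))].

Let primP xi : continuous xi -> prim xi 0 = 0 /\
  forall t : R, 0 <= t <= 1 -> is_derive t (1 : R) (prim xi) (f t (xi t)).
Proof.
move=> cxi; rewrite /prim; case: xgetP => [G _ //|].
by have [G HG] := antiderivative_rV (fc cxi) => /(_ G).
Qed.

Let step x xi (t : R) := x + prim xi (clamp01 t).

Let step_continuous x xi : continuous xi -> continuous (step x xi).
Proof.
move=> cxi t; have [_ dp] := primP cxi.
have c01 : 0 <= clamp01 t <= 1 by rewrite clamp01_ge0 clamp01_le1.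
have c1 := continuous_comp (@clamp01_continuous R t) (is_derive_continuous (dp _ c01)).
by apply: cvgD; [exact: cvg_cst|exact: c1].
Qed.

(** In the supremum norm with weight exp(-2Lt) the Picard operator contracts by 1/2 whatever L is,
    so no short time interval has to be chosen. *)
Let step_diff x xi zeta (c : R) : continuous xi -> continuous zeta ->
  (forall t : R, 0 <= t <= 1 -> `|xi t - zeta t| <= c * expR (2 * L * t)) ->
  forall t : R, 0 <= t <= 1 ->
    `|step x xi t - step x zeta t| <= c / 2 * expR (2 * L * t).
Proof.
move=> cxi czeta h t t01.
have [p0 dp] := primP cxi; have [q0 dq] := primP czeta.
have := @curve_le R N (fun s => prim xi s - prim zeta s) (fun s => f s (xi s) - f s (zeta s))
  (fun s => c / 2 * expR (2 * L * s)) (fun s => c / 2 * (2 * L) * expR (2 * L * s)).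
have h1 (s : R) : 0 <= s <= 1 -> is_derive s (1 : R) (fun s => prim xi s - prim zeta s) (f s (xi s) - f s (zeta s)).
  by move=> s01; exact: (is_deriveB (dp s s01) (dq s s01)).
have h2 (s : R) : 0 <= s <= 1 -> is_derive s 1 (fun s => c / 2 * expR (2 * L * s)) (c / 2 * (2 * L) * expR (2 * L * s)).
  by move=> _; exact: is_derive_expM.
have h3 (s : R) : 0 <= s <= 1 -> `|f s (xi s) - f s (zeta s)| <= c / 2 * (2 * L) * expR (2 * L * s).
  move=> s01; apply: le_trans (fL _ _ s01) _.
  have -> : c / 2 * (2 * L) * expR (2 * L * s) = L * (c * expR (2 * L * s)) by field.
  by rewrite ler_pM2l //; exact: h.
move=> /(_ h1 h2 h3 t t01); rewrite p0 q0 subrr subr0 => H.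
rewrite /step (clamp01_id t01).
have -> : x + prim xi t - (x + prim zeta t) = prim xi t - prim zeta t.
  by rewrite opprD addrACA subrr add0r.
apply: le_trans H _; rewrite mulr0 expR0 mulr1 lerBlDr lerDl.
have := h 0; rewrite lexx ler01 mulr0 expR0 mulr1 => /(_ isT) c0.
by rewrite divr_ge0 // (le_trans _ c0).
Qed.

Theorem picard x : exists xi : R -> V, xi 0 = x /\
  forall t : R, 0 <= t <= 1 -> is_derive t (1 : R) xi (f t (xi t)).
Proof.
pose xi k := iter k (step x) (fun=> x).
have cxi k : continuous (xi k).
  by elim: k => [|k IH]; [move=> t; exact: cvg_cst|exact: step_continuous].
have [c c0 hc] : exists2 c : R, 0 <= c & forall t : R, 0 <= t <= 1 -> `|xi 1%N t - xi 0%N t| <= c.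
  have d (t : R) : {for t, continuous (fun t => xi 1%N t - xi 0%N t)}.
    by apply: cvgB; [exact: (cxi 1%N t)|exact: (cxi 0%N t)].
  have dc : {within `[0, 1], continuous (fun t => `|xi 1%N t - xi 0%N t|)}.
    apply: continuous_subspaceT => t.
    exact: (continuous_comp (d t) (@norm_continuous _ _ _)).
  have [s _ smax] := EVT_max (ler01 : (0 : R) <= 1) dc.
  by exists `|xi 1%N s - xi 0%N s| => // t t01; apply: smax; rewrite in_itv.
have E1 (t : R) : 0 <= t <= 1 -> 1 <= expR (2 * L * t).
  by move=> /andP[t0 t1]; rewrite -expR0 ler_expR !mulr_ge0 // ltW.
have hk k (t : R) : 0 <= t <= 1 -> `|xi k.+1 t - xi k t| <= c / 2 ^+ k * expR (2 * L * t).
  elim: k t => [|k IH] t t01.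
    by rewrite expr0 divr1; apply: le_trans (hc t t01) _; rewrite ler_peMr ?E1.
  have -> : c / 2 ^+ k.+1 = (c / 2 ^+ k) / 2 by rewrite exprS; field; rewrite expf_neq0.
  exact: (step_diff x (cxi k.+1) (cxi k) IH t01).
(* Undoing the weight costs at most exp(2L); the factor 2 turns 1/2^k into the 1/2^(k+1) that
   [geometric_limit] expects. *)
pose B := 2 * c * expR (2 * L).
have hB k (t : R) : 0 <= t <= 1 -> `|xi k.+1 t - xi k t| <= B / 2 ^+ k.+1.
  move=> t01; apply: le_trans (hk k t t01) _; have [t0 t1] := andP t01.
  have -> : B / 2 ^+ k.+1 = c / 2 ^+ k * expR (2 * L).
    by rewrite /B exprS; field; rewrite expf_neq0.
  apply: ler_wpM2l; first by rewrite divr_ge0 // exprn_ge0.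
  by rewrite ler_expR ler_piMr // mulr_ge0 // ltW.
have clamp01P (t : R) : 0 <= clamp01 t <= 1 by rewrite clamp01_ge0 clamp01_le1.
have lim_ex (t : R) : exists z : V, forall k, `|z - xi k (clamp01 t)| <= B / 2 ^+ k.
  have lj j : exists l, forall k, `|l - xi k (clamp01 t) 0 j| <= B / 2 ^+ k.
    apply: geometric_limit => k; apply: le_trans _ (hB k _ (clamp01P t)).
    by apply: le_trans _ (le_normv _ j); rewrite [in leRHS]mxE [X in _ <= `|_ + X|]mxE.
  exists (\row_j sval (cid (lj j))) => k; apply: normv_le => [|j].
    by rewrite divr_ge0 ?exprn_ge0 // /B !mulr_ge0 ?expR_ge0.
  by rewrite mxE [X in _ + X]mxE mxE; exact: (svalP (cid (lj j))).
pose z t := sval (cid (lim_ex t)).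
have zP t k : `|z t - xi k (clamp01 t)| <= B / 2 ^+ k by exact: (svalP (cid (lim_ex t))).
have B0 : 0 <= B by rewrite /B !mulr_ge0 // ?expR_ge0.
have small (b e : R) : 0 < e -> exists k, b / 2 ^+ k < e.
  move=> e0; have [k hk2] : exists k : nat, b / e < k%:R.
    by exists (Num.truncn (b / e)).+1; exact: truncnS_gt.
  exists k; rewrite ltr_pdivrMr ?exprn_gt0 // mulrC -ltr_pdivrMr //.
  apply: lt_le_trans hk2 _; rewrite -natrX ler_nat; apply: ltnW; exact: ltn_expl.
have zc : continuous z.
  move=> t; apply/cvgrPdist_lt => e e0.
  have [k kB] := small B (e / 3) (divr_gt0 e0 (ltr0Sn R 2)).
  have ck : {for t, continuous (fun s => xi k (clamp01 s))}.
    exact: (continuous_comp (@clamp01_continuous R t) (cxi k _)).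
  have /cvgrPdist_lt/(_ (e / 3) (divr_gt0 e0 (ltr0Sn R 2))) := ck.
  apply: near_imp => s hs; have h1 := zP t k; have h2 := zP s k.
  have T1 := ler_distD (xi k (clamp01 t)) (z t) (z s).
  have T2 := ler_distD (xi k (clamp01 s)) (xi k (clamp01 t)) (z s).
  rewrite (distrC (xi k (clamp01 s))) in T2.
  have gen (p q r u v w b d : R) : p <= q + r -> r <= u + v -> q <= b -> v <= b -> u < d / 3 -> b < d / 3 -> p < d by lra.
  exact: gen T1 T2 h1 h2 hs kB.
have [p0 dp] := primP zc.
(* The solution is [x + prim z], not the limit [z]: they agree on [0, 1], but [z] is frozen outside
   by the clamp, while the primitive has two-sided derivatives at 0 and 1. *)
exists (fun t => x + prim z t); split; first by rewrite p0 addr0.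
have zE (t : R) : 0 <= t <= 1 -> z t = x + prim z t.
  move=> t01; apply/eqP; rewrite -subr_eq0 -normr_le0; apply/ler_addgt0Pl => e e0.
  rewrite addr0; have [k kB] := small (B * (1 + expR (2 * L))) e e0.
  have h1 := zP t k.+1; rewrite (clamp01_id t01) in h1.
  have h2 : `|step x z t - step x (xi k) t| <= B / 2 ^+ k / 2 * expR (2 * L * t).
    apply: step_diff => // s s01; have := zP s k; rewrite (clamp01_id s01) => /le_trans; apply.
    by rewrite ler_peMr ?E1 // divr_ge0 // exprn_ge0.
  have [t0 t1] := andP t01.
  have h3 : `|xi k.+1 t - step x z t| <= B / 2 ^+ k * expR (2 * L).
    rewrite distrC; apply: le_trans h2 _.
    apply: ler_pM; rewrite ?expR_ge0 ?divr_ge0 ?exprn_ge0 //.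
      by rewrite ler_piMr ?divr_ge0 ?exprn_ge0 // invf_le1 ?ler1n.
    by rewrite ler_expR ler_piMr // mulr_ge0 // ltW.
  have h4 : B / 2 ^+ k.+1 <= B / 2 ^+ k.
    by rewrite ler_wpM2l // lef_pV2 ?posrE ?exprn_gt0 // ler_weXn2l ?ler1n.
  have T1 := ler_distD (xi k.+1 t) (z t) (step x z t).
  have <- : step x z t = x + prim z t by rewrite /step (clamp01_id t01).
  have gen (p q r b b' E : R) : p <= q + r -> q <= b' -> b' <= b -> r <= b * E -> b * (1 + E) < e -> p <= e.
    by rewrite mulrDr mulr1; lra.
  by apply: gen T1 h1 h4 h3 _; rewrite mulrAC.
move=> t t01; rewrite -(zE t t01).
by have := is_deriveD (is_derive_cst x t 1) (dp t t01); rewrite add0r.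
Qed.


End Picard.

Lemma derive_linear {R : realType} {V W : normedModType R} (f : {linear V -> W}) h y :
  continuous f -> 'D_h f y = f h.
Proof.
by move=> fc; rewrite (deriveE h (linear_differentiable y fc)) (diff_lin y fc).
Qed.

Lemma continuous_sum_at {R : realType} {T : topologicalType} {W : normedModType R} m
    (F : 'I_m -> T -> W) x : (forall i, {for x, continuous (F i)}) ->
  {for x, continuous (fun y => \sum_(i < m) F i y)}.
Proof. by move=> Fc; apply: cvg_big => [|i _]; [exact: add_continuous|exact: Fc]. Qed.

Section ConvexBody.
Context {R : realType} {N : nat}.
Local Notation V := 'rV[R]_N.
Implicit Types (K O : set V).

(** Closed and bounded gives compactness, hence bounds on derivatives; convexity keeps segments
    inside, so that these bounds become Lipschitz and Taylor estimates. *)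
Definition convex_body K := [/\ closed K, (exists B, forall p, K p -> `|p| <= B) &
  forall (p q : V) (s : R), K p -> K q -> 0 <= s <= 1 -> K (p + s *: (q - p))].

Lemma convex_body_compact K : convex_body K -> compact K.
Proof.
move=> [Kc [B KB] _]; apply: bounded_closed_compact => //.
exists B; split; first exact: num_real.
by move=> M BM p /KB pB; exact: le_trans pB (ltW BM).
Qed.

Lemma convex_body_bounded {W : normedModType R} K O (f : V -> W) : convex_body K -> K `<=` O ->
  Ck_on 0 O f -> exists2 M, 0 <= M & forall p, K p -> `|f p| <= M.
Proof.
move=> /convex_body_compact Kc KO fc.
have cK : {within K, continuous (fun p => `|f p|)}.
  apply: continuous_in_subspaceT => p; rewrite inE => /KO Op.
  exact: (continuous_comp (fc p Op) (@norm_continuous _ _ (f p))).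
have [[p0 Kp0]|K0] := pselect (K !=set0); last first.
  by exists 0 => // p Kp; exfalso; apply: K0; exists p.
have [c Kc' cm] := @compact_EVT_max _ R _ K (ex_intro _ p0 Kp0) Kc cK.
by exists `|f c| => // p Kp; apply: cm; rewrite inE.
Qed.

Lemma sumv_le {W : normedModType R} (h : V) (F : 'I_N -> W) (M : 'I_N -> R) :
  (forall j, `|F j| <= M j) -> `|\sum_(j < N) h 0 j *: F j| <= (\sum_(j < N) M j) * `|h|.
Proof.
move=> FM; apply: le_trans (ler_norm_sum _ _ _) _; rewrite mulr_suml; apply: ler_sum => j _.
rewrite normrZ mulrC; apply: ler_pM => //; exact: le_normv.
Qed.

Lemma convex_body_diff {m : nat} K O (f : V -> 'rV[R]_m) : convex_body K -> K `<=` O ->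
  Ck_on 1 O f -> exists2 L, 0 < L & forall p h, K p -> `|'D_h f p| <= L * `|h|.
Proof.
move=> Kb KO [df Df].
have bM j : exists M, 0 <= M /\ forall p, K p -> `|'D_(delta_mx 0 j) f p| <= M.
  by have [M M0 H] := convex_body_bounded Kb KO (Df (delta_mx 0 j)); exists M.
pose M j := sval (cid (bM j)).
have MP j : 0 <= M j /\ forall p, K p -> `|'D_(delta_mx 0 j) f p| <= M j by exact: (svalP (cid (bM j))).
have S0 : 0 <= \sum_j M j by apply: sumr_ge0 => j _; have [] := MP j.
exists (\sum_j M j + 1) => [|p h Kp]; first by rewrite ltr_wpDl.
rewrite (derive_rVE h (df p (KO p Kp))).
apply: le_trans (sumv_le h (fun j => (MP j).2 p Kp)) _.
by rewrite ler_wpM2r // lerDl.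
Qed.

Lemma convex_body_lip {m : nat} K O (f : V -> 'rV[R]_m) : convex_body K -> K `<=` O ->
  Ck_on 1 O f -> exists2 L, 0 < L & forall p q, K p -> K q -> `|f q - f p| <= L * `|q - p|.
Proof.
move=> Kb KO f1; have [L L0 HL] := convex_body_diff Kb KO f1.
exists L => // p q Kp Kq; have [_ _ Kconv] := Kb; have [df _] := f1.
have H := @mean_value_le R V m f p (q - p) (L * `|q - p|).
have E : p + (q - p) = q by rewrite addrC subrK.
rewrite E in H; apply: H => s s01; first exact/df/KO/Kconv.
exact/HL/Kconv.
Qed.

Lemma convex_body_taylor {m : nat} K O (f : V -> 'rV[R]_m) : convex_body K -> K `<=` O ->
  Ck_on 2 O f -> exists2 L, 0 < L & forall p q, K p -> K q ->
    `|f q - f p - 'D_(q - p) f p| <= L * `|q - p| ^+ 2.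
Proof.
move=> Kb KO [df Df].
have bM j : exists M, 0 < M /\ forall p q, K p -> K q ->
    `|'D_(delta_mx 0 j) f q - 'D_(delta_mx 0 j) f p| <= M * `|q - p|.
  by have [M M0 H] := convex_body_lip Kb KO (Df (delta_mx 0 j)); exists M.
pose M j := sval (cid (bM j)).
have MP j : 0 < M j /\ forall p q, K p -> K q ->
    `|'D_(delta_mx 0 j) f q - 'D_(delta_mx 0 j) f p| <= M j * `|q - p|.
  exact: (svalP (cid (bM j))).
have S0 : 0 <= \sum_j M j by apply: sumr_ge0 => j _; have [/ltW] := MP j.
exists (\sum_j M j + 1) => [|p q Kp Kq]; first by rewrite ltr_wpDl.
have [_ _ Kconv] := Kb; set h := q - p.
(* [f] minus its linearization at [p]: its derivative along h is a difference of derivatives of [f],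
   of order |h|^2 because the partial derivatives are Lipschitz. *)
pose g y := f y - ('d f p y - 'd f p p).
have dfp := df p (KO p Kp).
have dlin (y : V) : differentiable ('d f p) y by apply: linear_differentiable; exact: diff_continuous.
have dg (s : R) : 0 <= s <= 1 -> differentiable g (p + s *: h).
  move=> s01; apply: differentiableB; first exact/df/KO/Kconv.
  by apply: differentiableB; [exact: dlin|exact: differentiable_cst].
have Dg (s : R) : 0 <= s <= 1 -> 'D_h g (p + s *: h) = 'D_h f (p + s *: h) - 'D_h f p.
  move=> s01; have dfs : differentiable f (p + s *: h) by exact/df/KO/Kconv.
  have e1 : 'D_h (fun y => 'd f p y - 'd f p p) (p + s *: h) = 'D_h f p.
    have := deriveB (diff_derivable (v := h) (dlin (p + s *: h))) (derivable_cst ('d f p p) (p + s *: h) h).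
    rewrite derive_cst subr0 => E; apply: etrans E _.
    apply: etrans (derive_linear h (p + s *: h) (diff_continuous dfp)) _.
    exact: (esym (deriveE h dfp)).
  rewrite -e1; apply: deriveB; first exact: diff_derivable.
  by apply: diff_derivable; apply: differentiableB; [exact: dlin|exact: differentiable_cst].
have H := @mean_value_le R V m g p h ((\sum_j M j + 1) * `|h| ^+ 2) dg.
have hE : p + h = q by rewrite /h addrC subrK.
have -> : f q - f p - 'D_h f p = g (p + h) - g p.
  rewrite hE /g subrr subr0 (deriveE h dfp) /h linearB.
  by rewrite addrAC.
apply: H => s s01; rewrite (Dg s s01) (derive_rVE h (df _ (KO _ (Kconv _ _ _ Kp Kq s01)))).
rewrite (derive_rVE h dfp) -sumrB.
have -> : \sum_(i < N) (h 0 i *: 'D_(delta_mx 0 i) f (p + s *: h) - h 0 i *: 'D_(delta_mx 0 i) f p) =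
  \sum_(i < N) h 0 i *: ('D_(delta_mx 0 i) f (p + s *: h) - 'D_(delta_mx 0 i) f p).
  by apply: eq_bigr => i _; exact: (esym (scalerBr _ _ _)).
have FM j : `|'D_(delta_mx 0 j) f (p + s *: h) - 'D_(delta_mx 0 j) f p| <= M j * `|h|.
  apply: le_trans ((MP j).2 _ _ Kp (Kconv _ _ _ Kp Kq s01)) _.
  rewrite addrAC subrr add0r ler_wpM2l //; first by have [/ltW] := MP j.
  have [s0 s1] := andP s01.
  by rewrite normrZ ger0_norm // ler_piMl.
apply: le_trans (sumv_le h FM) _; rewrite -mulr_suml -mulrA -expr2.
by rewrite ler_wpM2r ?exprn_ge0 // lerDl.
Qed.

End ConvexBody.

Section FlowFamily.
Context {R : realType} {N : nat}.
Local Notation V := 'rV[R]_N.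
Variables (K O U : set V) (Y : V -> V) (xi : V -> R -> V).

Definition flow_family := forall z, U z -> xi z 0 = z /\
  forall t : R, 0 <= t <= 1 -> K (xi z t) /\ is_derive t (1 : R) (xi z) (Y (xi z t)).

(** The linearized equation along the trajectory of z. Its solutions are the derivatives of the flow
    with respect to the initial point, see [flow_diff]. *)
Definition variational z (H : R -> V) := forall t : R, 0 <= t <= 1 ->
  is_derive t (1 : R) H ('D_(H t) Y (xi z t)).

Hypothesis Kb : convex_body K.
Hypothesis KO : K `<=` O.
Hypothesis Y1 : Ck_on 1 O Y.
Hypothesis fam : flow_family.

Lemma flow_lipschitz : exists2 C, 0 < C & forall z z' (t : R), U z -> U z' -> 0 <= t <= 1 ->
  `|xi z' t - xi z t| <= C * `|z' - z|.
Proof.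
have [L L0 HL] := convex_body_lip Kb KO Y1.
exists (2 * expR (2 * L)) => [|z z' t Uz Uz' t01]; first by rewrite mulr_gt0 ?expR_gt0.
have [z0 dz] := fam Uz; have [z0' dz'] := fam Uz'.
have := @gronwall R N (fun t => xi z' t - xi z t) (fun t => Y (xi z' t) - Y (xi z t)) L 0 L0 (lexx 0).
rewrite z0 z0' addr0; apply => // s s01.
  exact: (is_deriveB (dz' s s01).2 (dz s s01).2).
by rewrite addr0; apply: HL; [exact: (dz s s01).1|exact: (dz' s s01).1].
Qed.

(** The equation is linear with bounded coefficients, so [picard] covers all of [0, 1]; the
    trajectory is clamped in time because it is controlled there only. *)
Lemma variation_exists z h : U z -> exists H, H 0 = h /\ variational z H.
Proof.
move=> Uz; have [z0 dz] := fam Uz; have [L L0 HL] := convex_body_diff Kb KO Y1.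
have [dY DY] := Y1.
have clampP (t : R) : 0 <= clamp01 t <= 1 by rewrite clamp01_ge0 clamp01_le1.
have Kx (t : R) : K (xi z (clamp01 t)) by exact: (dz _ (clampP t)).1.
pose f (t : R) (y : V) := 'D_y Y (xi z (clamp01 t)).
have fL (t : R) x y : 0 <= t <= 1 -> `|f t x - f t y| <= L * `|x - y|.
  move=> _; rewrite /f -derive_dirB; last exact/dY/KO.
  exact: HL.
have fc (H : R -> V) : continuous H -> continuous (fun t => f t (H t)).
  move=> Hc t.
  have -> : (fun t => f t (H t)) = fun t => \sum_(j < N) H t 0 j *: 'D_(delta_mx 0 j) Y (xi z (clamp01 t)).
    by apply/funext => s; rewrite /f (derive_rVE (H s)) //; exact/dY/KO.
  apply: cvg_big => [|j _]; first exact: add_continuous.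
  apply: cvgZ; first exact: (continuous_comp (Hc t) (@coord_continuous _ _ _ 0 j (H t))).
  have c1 : {for t, continuous (fun s => xi z (clamp01 s))}.
    exact: (continuous_comp (@clamp01_continuous R t) (is_derive_continuous (dz _ (clampP t)).2)).
  exact: (continuous_comp c1 (DY (delta_mx 0 j) _ (KO (Kx t)))).
have [H [H0 dH]] := picard L0 fL fc h.
exists H; split=> // t t01; have := dH t t01.
by rewrite /f (clamp01_id t01).
Qed.

Lemma variation_bound : exists2 C, 0 < C & forall z H (t : R), U z -> variational z H ->
  0 <= t <= 1 -> `|H t| <= C * `|H 0|.
Proof.
have [L L0 HL] := convex_body_diff Kb KO Y1.
exists (2 * expR (2 * L)) => [|z H t Uz dH t01]; first by rewrite mulr_gt0 ?expR_gt0.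
have [z0 dz] := fam Uz.
have := @gronwall R N H (fun t => 'D_(H t) Y (xi z t)) L 0 L0 (lexx 0) dH.
rewrite addr0; apply => // s s01.
by rewrite addr0; apply: HL; exact: (dz s s01).1.
Qed.

Lemma variation_comb z (m : nat) (c : 'I_m -> R) (F : 'I_m -> R -> V) : U z ->
  (forall i, variational z (F i)) -> variational z (fun t => \sum_(i < m) c i *: F i t).
Proof.
move=> Uz dF t t01; have [z0 dz] := fam Uz; have [dY _] := Y1.
have -> : 'D_(\sum_(i < m) c i *: F i t) Y (xi z t) = \sum_(i < m) c i *: 'D_(F i t) Y (xi z t).
  rewrite derive_dir_sum; last exact/dY/KO/(dz t t01).1.
  by apply: eq_bigr => i _; rewrite derive_dirZ //; exact/dY/KO/(dz t t01).1.
have -> : (fun t => \sum_(i < m) c i *: F i t) = \sum_(i < m) (c i *: F i).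
  by apply/funext => s; rewrite fct_sumE.
by apply: is_derive_sum => i; apply: is_deriveZ; exact: dF.
Qed.

Lemma variation_uniq z H H' : U z -> variational z H -> variational z H' -> H 0 = H' 0 ->
  forall t : R, 0 <= t <= 1 -> H t = H' t.
Proof.
move=> Uz dH dH' E t t01; have [C C0 HC] := variation_bound.
pose F (i : 'I_2) := if i == 0 then H else H'.
pose c (i : 'I_2) : R := if i == 0 then 1 else -1.
have dF i : variational z (F i) by rewrite /F; case: (i == 0).
have := HC _ _ t Uz (variation_comb c Uz dF) t01.
rewrite !big_ord_recl !big_ord0 /F /c /= !scale1r !scaleN1r !addr0 E subrr normr0 mulr0.
by rewrite normr_le0 subr_eq0 => /eqP.
Qed.

(** The error of the approximation by a variational solution satisfies a linear inequality whose
    inhomogeneity is quadratic in h, by the Taylor estimate and [flow_lipschitz]; Gronwall makes the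
    error itself quadratic. *)
Lemma flow_diff z (t : R) : open U -> Ck_on 2 O Y -> U z -> 0 <= t <= 1 ->
  differentiable (fun y => xi y t) z /\
  forall H, variational z H -> 'D_(H 0) (fun y => xi y t) z = H t.
Proof.
move=> Uo Y2 Uz t01.
have [z0 dz] := fam Uz; have [L L0 HL] := convex_body_diff Kb KO Y1.
have [L2 L20 HL2] := convex_body_taylor Kb KO Y2.
have [C C0 HC] := flow_lipschitz; have [dY _] := Y1.
pose S j := sval (cid (variation_exists (delta_mx 0 j) Uz)).
have SP j : S j 0 = delta_mx 0 j /\ variational z (S j).
  exact: (svalP (cid (variation_exists (delta_mx 0 j) Uz))).
pose Hl (h : V) (s : R) := \sum_(j < N) h 0 j *: S j s.
have Hl0 h : Hl h 0 = h.
  by rewrite /Hl [RHS]row_sumE; apply: eq_bigr => j _; rewrite (SP j).1.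
have dHl h : variational z (Hl h) by apply: variation_comb => // j; exact: (SP j).2.
(* The fundamental matrix: its rows solve the variational equation from the unit vectors. *)
pose M : 'M[R]_N := \matrix_(j, i) S j t 0 i.
have ME h : h *m M = Hl h t.
  apply/rowP => i; rewrite mxE /Hl summxE; apply: eq_bigr => j _.
  by rewrite !mxE.
have Mc : continuous (mulmxr M : V -> V).
  move=> h; have -> : (mulmxr M : V -> V) = fun h => \sum_(j < N) h 0 j *: S j t.
    by apply/funext => h'; rewrite /= ME.
  apply: continuous_sum_at => j.
  have cj : (fun h : V => h 0 j) h' @[h' --> h] --> h 0 j by exact: coord_continuous.
  exact: (@cvgZ _ _ _ _ _ (fun h : V => h 0 j) (fun=> S j t) _ _ cj (cvg_cst (S j t))).
pose B := 2 * expR (2 * L) * (L2 * C ^+ 2).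
have B0 : 0 < B by rewrite !mulr_gt0 ?expR_gt0 ?exprn_gt0.
have est h : U (h + z) -> `|xi (h + z) t - xi z t - Hl h t| <= B * `|h| ^+ 2.
  move=> Uhz; have [zh0 dzh] := fam Uhz.
  have := @gronwall R N (fun s => xi (h + z) s - xi z s - Hl h s)
    (fun s => Y (xi (h + z) s) - Y (xi z s) - 'D_(Hl h s) Y (xi z s)) L (L2 * C ^+ 2 * `|h| ^+ 2) L0.
  rewrite zh0 z0 Hl0 addrK subrr normr0 add0r => G.
  have -> : B * `|h| ^+ 2 = 2 * expR (2 * L) * (L2 * C ^+ 2 * `|h| ^+ 2) by rewrite /B !mulrA.
  apply: G => // [|s s01|s s01].
  - by rewrite !mulr_ge0 ?exprn_ge0 // ltW.
  - exact: (is_deriveB (is_deriveB (dzh s s01).2 (dz s s01).2) (dHl h s s01)).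
  set q := xi (h + z) s; set p := xi z s; set w := Hl h s.
  have Kq : K q by exact: (dzh s s01).1.
  have Kp : K p by exact: (dz s s01).1.
  have -> : Y q - Y p - 'D_w Y p = 'D_(q - p - w) Y p + (Y q - Y p - 'D_(q - p) Y p).
    rewrite (derive_dirB (q - p) w (dY p (KO Kp))).
    by rewrite [RHS]addrC addrA subrK.
  apply: le_trans (ler_normD _ _) _; apply: lerD; first exact: HL.
  apply: le_trans (HL2 p q Kp Kq) _; rewrite -mulrA ler_pM2l //.
  have := HC z (h + z) s Uz Uhz s01; rewrite addrK -/q -/p => H2.
  rewrite -exprMn; apply: lerXn2r => //; rewrite nnegrE // mulr_ge0 //; exact: ltW.
have [|dx dE] := @differentiable_epsP R V V (fun y => xi y t) z (mulmxr M) Mc.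
  move=> e e0.
  have Un : \forall h \near (0 : V), U (h + z).
    have := near_open Uo Uz; rewrite (near_shift 0 z).
    by apply: near_imp => h /=; rewrite subr0.
  have hn : \forall h \near (0 : V), `|h| < e / B.
    have /cvgrPdist_lt/(_ (e / B) (divr_gt0 e0 B0)) := @cvg_id _ (nbhs (0 : V)).
    by apply: near_imp => h; rewrite sub0r normrN.
  apply: near_imp2 Un hn => h Uh hB; rewrite /= ME.
  apply: le_trans (est h Uh) _; rewrite expr2 mulrA ler_wpM2r //.
  by rewrite mulrC -ler_pdivlMr // ltW.
split=> // H dH; rewrite (deriveE _ dx) dE /= ME.
by apply: (variation_uniq Uz (dHl (H 0)) dH) => //; rewrite Hl0.
Qed.

End FlowFamily.

Lemma continuous_eps {R : realType} {V W : normedModType R} (f : V -> W) x :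
  (forall e, 0 < e -> \forall y \near x, `|f x - f y| < e) -> {for x, continuous f}.
Proof. by move=> H; apply/cvgrPdist_lt. Qed.

Section Blocks.
Context {R : realType} {N M : nat}.

Lemma lsubmx_coord (z : 'rV[R]_(N + M)) j : lsubmx z 0 j = z 0 (lshift M j).
Proof. by rewrite mxE. Qed.

Lemma rsubmx_coord (z : 'rV[R]_(N + M)) j : rsubmx z 0 j = z 0 (rshift N j).
Proof. by rewrite mxE. Qed.

Lemma Ck_coord k (U : set 'rV[R]_(N + M)) j : open U -> Ck_on k U (fun z => z 0 j).
Proof. by move=> Uo; exact: (Ck_rVP k id Uo).1 (Ck_id k Uo) j. Qed.

Lemma Ck_lsubmx k (U : set 'rV[R]_(N + M)) : open U ->
  Ck_on k U (lsubmx : _ -> 'rV[R]_N).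
Proof.
move=> Uo; apply/Ck_rVP => // j; apply: Ck_on_eq (Ck_coord k (lshift M j) Uo) => // z _.
by rewrite lsubmx_coord.
Qed.

Lemma Ck_rsubmx k (U : set 'rV[R]_(N + M)) : open U ->
  Ck_on k U (rsubmx : _ -> 'rV[R]_M).
Proof.
move=> Uo; apply/Ck_rVP => // j; apply: Ck_on_eq (Ck_coord k (rshift N j) Uo) => // z _.
by rewrite rsubmx_coord.
Qed.

Lemma Ck_row_mx {V : normedModType R} k (U : set V) (f : V -> 'rV[R]_N) (g : V -> 'rV[R]_M) :
  open U -> Ck_on k U f -> Ck_on k U g -> Ck_on k U (fun x => row_mx (f x) (g x)).
Proof.
move=> Uo fk gk; apply/Ck_rVP => // j; case: (splitP j) => i ji.
  have -> : j = lshift M i by exact: val_inj.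
  apply: Ck_on_eq ((Ck_rVP k f Uo).1 fk i) => // x _; by rewrite row_mxEl.
have -> : j = rshift N i by exact: val_inj.
apply: Ck_on_eq ((Ck_rVP k g Uo).1 gk i) => // x _; by rewrite row_mxEr.
Qed.

Lemma is_derive_row_mx (e : R -> 'rV[R]_N) (e' : R -> 'rV[R]_M) (t : R) d d' :
  is_derive t (1 : R) e d -> is_derive t (1 : R) e' d' ->
  is_derive t (1 : R) (fun s => row_mx (e s) (e' s)) (row_mx d d').
Proof.
move=> /is_derive_rVP de /is_derive_rVP de'; apply/is_derive_rVP => j.
case: (splitP j) => i ji.
  have -> : j = lshift M i by exact: val_inj.
  rewrite row_mxEl; suff -> : (fun s => row_mx (e s) (e' s) 0 (lshift M i)) = fun s => e s 0 i by [].
  by apply/funext => s; rewrite row_mxEl.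
have -> : j = rshift N i by exact: val_inj.
rewrite row_mxEr; suff -> : (fun s => row_mx (e s) (e' s) 0 (rshift N i)) = fun s => e' s 0 i by [].
by apply/funext => s; rewrite row_mxEr.
Qed.

Lemma open_lsubmx (U : set 'rV[R]_N) : open U -> open [set z : 'rV[R]_(N + M) | U (lsubmx z)].
Proof. by move=> Uo; apply: (open_comp (f := lsubmx)) => // z _; exact: continuous_lsubmx. Qed.

Lemma open_rsubmx (U : set 'rV[R]_M) : open U -> open [set z : 'rV[R]_(N + M) | U (rsubmx z)].
Proof. by move=> Uo; apply: (open_comp (f := rsubmx)) => // z _; exact: continuous_rsubmx. Qed.

Lemma closed_lsubmx (U : set 'rV[R]_N) : closed U -> closed [set z : 'rV[R]_(N + M) | U (lsubmx z)].
Proof. by move=> Uc; apply: (preimage_closed (f := lsubmx)) => // z _; exact: continuous_lsubmx. Qed.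

Lemma closed_rsubmx (U : set 'rV[R]_M) : closed U -> closed [set z : 'rV[R]_(N + M) | U (rsubmx z)].
Proof. by move=> Uc; apply: (preimage_closed (f := rsubmx)) => // z _; exact: continuous_rsubmx. Qed.

Lemma normv_row_mx (a : 'rV[R]_N) (b : 'rV[R]_M) : `|row_mx a b| <= `|a| + `|b|.
Proof.
apply: normv_le => [|j]; first exact: addr_ge0.
case: (splitP j) => i ji.
  have -> : j = lshift M i by exact: val_inj.
  by rewrite row_mxEl; apply: le_trans (le_normv a i) _; rewrite lerDl.
have -> : j = rshift N i by exact: val_inj.
by rewrite row_mxEr; apply: le_trans (le_normv b i) _; rewrite lerDr.
Qed.

End Blocks.

Section Extension.
Context {R : realType} {N : nat}.
Local Notation V := 'rV[R]_N.

(** The tangent lift of [Y]: its trajectories are pairs of a trajectory of [Y] and a solution of the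
    variational equation along it. *)
Definition tangent_field (Y : V -> V) (z : 'rV[R]_(N + N)) : 'rV[R]_(N + N) :=
  row_mx (Y (lsubmx z)) ('D_(rsubmx z) Y (lsubmx z)).

Lemma Ck_tangent_field k (O : set V) (Y : V -> V) : open O -> Ck_on k.+1 O Y ->
  Ck_on k [set z : 'rV[R]_(N + N) | O (lsubmx z)] (tangent_field Y).
Proof.
move=> Oo Yk; have Oo2 := @open_lsubmx R N N O Oo; have [dY DY] := Yk.
apply: Ck_row_mx => //.
  apply: (Ck_comp_rV Oo2 Oo _ (Ck_lsubmx k Oo2) (Ck_onSr Yk)).
  by move=> z.
apply/Ck_rVP => // i.
have H : Ck_on k [set z : 'rV[R]_(N + N) | O (lsubmx z)]
   (fun z => \sum_(j < N) rsubmx z 0 j * ('D_(delta_mx 0 j) Y (lsubmx z)) 0 i).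
  apply: Ck_sum => // j _; apply: CkM => //.
    exact: ((Ck_rVP k _ Oo2).1 (Ck_rsubmx k Oo2) j).
  apply: (Ck_comp Oo2 Oo (f := lsubmx) (g := fun p => ('D_(delta_mx 0 j) Y p) 0 i)) => [z //||].
    exact: Ck_lsubmx.
  exact: ((Ck_rVP k _ Oo).1 (DY (delta_mx 0 j)) i).
apply: Ck_on_eq H => // z Oz; rewrite (derive_rVE (rsubmx z) (dY _ Oz)) summxE.
by apply: eq_bigr => j _; rewrite [RHS]mxE.
Qed.

Lemma convex_body_tangent (K : set V) (H : R) : convex_body K -> 0 <= H ->
  convex_body [set z : 'rV[R]_(N + N) | K (lsubmx z) /\ `|rsubmx z| <= H].
Proof.
move=> [Kc [B KB] Kconv] H0; split.
- have C1 := @closed_lsubmx R N N K Kc.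
  have C2 : closed [set z : 'rV[R]_(N + N) | `|rsubmx z| <= H].
    apply: (@closed_rsubmx R N N [set h | `|h| <= H]); apply: (preimage_closed (f := fun h : V => `|h|) (D := [set r | r <= H])).
      by move=> h _; exact: norm_continuous.
    exact: closed_le.
  exact: closedI C1 C2.
- exists (B + H) => z [/KB Kz zH]; rewrite -(hsubmxK z).
  by apply: le_trans (normv_row_mx _ _) _; rewrite lerD.
- move=> p q s [Kp pH] [Kq qH] s01; split.
    have := Kconv _ _ s Kp Kq s01; congr (K _).
    by apply/rowP => j; rewrite !mxE.
  have -> : rsubmx (p + s *: (q - p)) = (1 - s) *: rsubmx p + s *: rsubmx q.
    by apply/rowP => j; rewrite !mxE; ring.
  have [s0 s1] := andP s01; apply: le_trans (ler_normD _ _) _; rewrite !normrZ.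
  rewrite (ger0_norm s0) ger0_norm ?subr_ge0 //.
  have -> : H = (1 - s) * H + s * H by ring.
  by apply: lerD; apply: ler_wpM2l => //; rewrite subr_ge0.
Qed.

End Extension.

Section FlowSmooth.
Context {R : realType}.

(* The directional derivatives of a flow are components of the flow of the
   tangent field, which costs one order of differentiability. *)
Lemma flow_Ck k : forall N (K O U : set 'rV[R]_N) Y xi, convex_body K -> open O -> K `<=` O ->
  open U -> Ck_on k.+1 O Y -> flow_family K U Y xi ->
  forall t : R, 0 <= t <= 1 -> Ck_on k U (fun z => xi z t).
Proof.
elim: k => [|k IH] N K O U Y xi Kb Oo KO Uo Yk fam t t01.
  have [C C0 HC] := flow_lipschitz Kb KO Yk fam.
  move=> z Uz; apply: continuous_eps => e e0.
  have hz : \forall y \near z, `|z - y| < e / C.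
    by have /cvgrPdist_lt/(_ (e / C) (divr_gt0 e0 C0)) := @cvg_id _ (nbhs z).
  apply: near_imp2 (near_open Uo Uz) hz => y Uy yz.
  rewrite distrC; apply: le_lt_trans (HC z y t Uz Uy t01) _.
  by rewrite mulrC -ltr_pdivlMr // distrC.
have Y1 : Ck_on 1 O Y by apply: Ck_on_le Yk.
have Y2 : Ck_on 2 O Y by apply: Ck_on_le Yk.
have D z (Uz : U z) := flow_diff Kb KO Y1 fam Uo Y2 Uz t01.
split=> [z Uz|h]; first exact: (D z Uz).1.
have [C C0 HC] := variation_bound Kb KO Y1 fam.
(* Room for the fixed direction [h] inside an open ball of initial velocities; the factor [C] of
   [variation_bound] confines the velocities during [0, 1]. *)
pose rho := `|h| + 1.
have rho0 : 0 <= rho by rewrite addr_ge0.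
pose Kh := [set z : 'rV[R]_(N + N) | K (lsubmx z) /\ `|rsubmx z| <= C * rho].
pose Oh := [set z : 'rV[R]_(N + N) | O (lsubmx z)].
pose Uh := [set z : 'rV[R]_(N + N) | U (lsubmx z) /\ `|rsubmx z| < rho].
have Khb : convex_body Kh by apply: convex_body_tangent => //; rewrite mulr_ge0 // ltW.
have Uho : open Uh.
  have C2 : open [set z : 'rV[R]_(N + N) | `|rsubmx z| < rho].
    apply: (@open_rsubmx R N N [set h | `|h| < rho]); apply: (open_comp (f := fun h : 'rV[R]_N => `|h|) (D := [set r | r < rho])).
      by move=> x _; exact: norm_continuous.
    exact: open_lt.
  exact: openI (@open_lsubmx R N N U Uo) C2.
pose S z (Hz : U z) w := sval (cid (variation_exists Kb KO Y1 fam w Hz)).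
have SP z (Hz : U z) w : S z Hz w 0 = w /\ variational Y xi z (S z Hz w).
  exact: (svalP (cid (variation_exists Kb KO Y1 fam w Hz))).
pose xih (z : 'rV[R]_(N + N)) s := row_mx (xi (lsubmx z) s)
  (if pselect (U (lsubmx z)) is left Hz then S _ Hz (rsubmx z) s else 0).
have famh : flow_family Kh Uh (tangent_field Y) xih.
  move=> z [Uz zrho]; have [z0 dz] := fam _ Uz; rewrite /xih.
  case: pselect => [Hz|//]; have [S0 dS] := SP _ Hz (rsubmx z).
  split=> [|s s01]; first by rewrite z0 S0 hsubmxK.
  split.
    rewrite /Kh /= row_mxKl row_mxKr; split; first exact: (dz s s01).1.
    apply: le_trans (HC _ _ s Hz dS s01) _; rewrite S0 ler_pM2l //; exact: ltW.
  rewrite /tangent_field row_mxKl row_mxKr.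
  by apply: is_derive_row_mx; [exact: (dz s s01).2|exact: dS].
have KOh : Kh `<=` Oh by move=> z [/KO].
have CkH := IH _ _ _ _ _ _ Khb (open_lsubmx Oo) KOh Uho (Ck_tangent_field Oo Yk) famh t t01.
have CkR := Ck_comp_rV Uo Uho (f := fun z => row_mx z h) (g := fun z => xih z t) _ _ CkH.
have {}CkR : Ck_on k U ((fun z => xih z t) \o (fun z => row_mx z h)).
  apply: CkR => [z Uz|]; first by rewrite /Uh /= row_mxKl row_mxKr; split=> //; rewrite ltrDl.
  by apply: Ck_row_mx => //; [exact: Ck_id|exact: Ck_cst].
have CkRr := Ck_comp_rV Uo (@openT _) (fun _ _ => I) CkR (Ck_rsubmx k (@openT _)).
apply: Ck_on_eq CkRr => // z Uz /=.
rewrite /xih row_mxKr !row_mxKl; case: pselect => [Hz|//].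
have [S0 dS] := SP _ Hz (rsubmx (row_mx z h)).
by rewrite -((D z Uz).2 _ dS) S0 row_mxKr.
Qed.

End FlowSmooth.

Section LocalFlow.
Context {R : realType} {N : nat}.
Local Notation V := 'rV[R]_N.

Let clampr (a b x : R) : R := Num.max a (Num.min x b).

Let clampr_bounds (a b x : R) : a <= b -> a <= clampr a b x <= b.
Proof. by move=> ab; rewrite /clampr; case: (leP x b) => h; case: (leP a x) => h'; case: (leP a b) => h2; apply/andP; split; lra. Qed.

Let clampr_id (a b x : R) : a <= x <= b -> clampr a b x = x.
Proof. by rewrite /clampr => /andP[]; case: (leP x b) => h; case: (leP a x) => h'; case: (leP a b) => h2; lra. Qed.

Let clampr_lip (a b x y : R) : a <= b -> `|clampr a b x - clampr a b y| <= `|x - y|.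
Proof.
move=> ab; rewrite ler_norml; have h1 := ler_norm (x - y); have h2 := ler_norm (y - x).
rewrite distrC in h2; have h3 := normr_ge0 (x - y); rewrite /clampr.
by case: (leP x b) => h; case: (leP y b) => h'; case: (leP a x) => h''; case: (leP a y) => h'''; case: (leP a b) => h4; apply/andP; split; lra.
Qed.

Lemma convex_body_ball (z0 : V) (rho : R) : convex_body [set p | `|p - z0| <= rho].
Proof.
split.
- apply: (preimage_closed (f := fun p : V => `|p - z0|) (D := [set r | r <= rho])); last exact: closed_le.
  move=> p _; have c1 : {for p, continuous (fun p : V => p - z0)}.
    exact: (smooth_near_continuous (smooth_nearB (smooth_near_id p) (smooth_near_cst p z0))).
  exact: (continuous_comp c1 (@norm_continuous _ _ _)).
- exists (rho + `|z0|) => p /= pr; rewrite -[p](subrK z0).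
  by apply: le_trans (ler_normD _ _) _; rewrite lerD2r.
- move=> p q s /= Kp Kq /andP[s0 s1].
  have -> : p + s *: (q - p) - z0 = (1 - s) *: (p - z0) + s *: (q - z0).
    by apply/rowP => j; rewrite !mxE; ring.
  apply: le_trans (ler_normD _ _) _; rewrite !normrZ (ger0_norm s0) ger0_norm ?subr_ge0 //.
  have -> : rho = (1 - s) * rho + s * rho by ring.
  by apply: lerD; apply: ler_wpM2l => //; rewrite subr_ge0.
Qed.

Lemma near_ball_le (z0 : V) (P : V -> Prop) : (\forall z \near z0, P z) ->
  exists2 rho : R, 0 < rho & forall z, `|z - z0| <= rho -> P z.
Proof.
move=> /nbhs_ballP[d /= d0 dP]; exists (d / 2) => [|z zd]; first by rewrite divr_gt0.
apply: dP; rewrite -ball_normE /= distrC; apply: le_lt_trans zd _.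
by rewrite ltr_pdivrMr // ltr_pMr // ltr1n.
Qed.

Lemma near_ball_lt (z0 : V) (P : V -> Prop) (rho : R) : 0 < rho -> (forall z, `|z - z0| < rho -> P z) ->
  \forall z \near z0, P z.
Proof.
move=> r0 H; apply/nbhs_ballP; exists rho => //= z; rewrite -ball_normE /= distrC.
exact: H.
Qed.

Lemma open_ball_norm (z0 : V) (rho : R) : open [set z | `|z - z0| < rho].
Proof.
apply: (open_comp (f := fun p : V => `|p - z0|) (D := [set r | r < rho])); last exact: open_lt.
move=> p _; have c1 : {for p, continuous (fun p : V => p - z0)}.
  exact: (smooth_near_continuous (smooth_nearB (smooth_near_id p) (smooth_near_cst p z0))).
exact: (continuous_comp c1 (@norm_continuous _ _ _)).
Qed.

(** Since [Y] vanishes at z0, Gronwall bounds the distance to z0 along a trajectory by a constant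
    times the initial distance, so trajectories from nearby points live for unit time and stay
    close. Picard needs a globally Lipschitz field: [Y] is composed with the retraction [cl] onto a
    cube, the ball of the maximum norm, which these trajectories never leave. *)
Theorem local_flow (z0 : V) (Y : V -> V) : smooth_near z0 Y -> Y z0 = 0 ->
  exists (U : set V) (xi : V -> R -> V), [/\ open U, U z0,
    forall z, U z -> xi z 0 = z /\
      forall t : R, 0 <= t <= 1 -> smooth_near (xi z t) Y /\ is_derive t (1 : R) (xi z) (Y (xi z t)),
    smooth_on U (fun z => xi z 1) &
    (forall z H, U z -> variational Y xi z H -> 'D_(H 0) (fun z => xi z 1) z = H 1) /\
    forall Q : V -> Prop, (\forall z \near z0, Q z) ->
      \forall z \near z0, forall t : R, 0 <= t <= 1 -> Q (xi z t)].
Proof.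
move=> [Om [Oo Oz0 sO]] Yz0.
have [rho rho0 rO] := near_ball_le (near_open Oo Oz0).
pose K := [set p : V | `|p - z0| <= rho].
have Kb : convex_body K by exact: convex_body_ball.
have KO : K `<=` Om by move=> p; exact: rO.
have [L L0 HL] := convex_body_lip Kb KO (sO 1%N).
pose cl (p : V) : V := \row_j clampr (z0 0 j - rho) (z0 0 j + rho) (p 0 j).
have rr j : z0 0 j - rho <= z0 0 j + rho by lra.
have Kcl p : K (cl p).
  apply: normv_le => [|j]; first exact: ltW.
  by rewrite !mxE ler_norml; have /andP[h1 h2] := clampr_bounds (p 0 j) (rr j); apply/andP; split; lra.
have cl_id p : K p -> cl p = p.
  move=> Kp; apply/rowP => j; rewrite mxE; apply: clampr_id.
  have := le_trans (le_normv _ j) Kp; rewrite !mxE ler_norml => /andP[h1 h2]; apply/andP; split; lra.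
have cl_lip p q : `|cl p - cl q| <= `|p - q|.
  apply: normv_le => // j; rewrite !mxE; apply: le_trans (clampr_lip _ _ (rr j)) _.
  by apply: le_trans _ (le_normv _ j); rewrite !mxE.
have Yl p q : `|Y (cl p) - Y (cl q)| <= L * `|p - q|.
  by apply: le_trans (HL _ _ (Kcl q) (Kcl p)) _; rewrite ler_pM2l.
have Yc (H : R -> V) : continuous H -> continuous (fun t => Y (cl (H t))).
  move=> Hc t; have c1 : {for H t, continuous (Y \o cl)}.
    apply: continuous_eps => e e0.
    apply: (@near_ball_lt _ _ (e / L)) => [|z zr]; first by rewrite divr_gt0.
    by apply: le_lt_trans (Yl _ _) _; rewrite distrC mulrC -ltr_pdivlMr.
  exact: (continuous_comp (Hc t) c1).
have pic z := @picard R N (fun _ p => Y (cl p)) L L0 (fun _ p q _ => Yl p q) Yc z.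
pose xi z := sval (cid (pic z)).
have xiP z : xi z 0 = z /\ forall t : R, 0 <= t <= 1 -> is_derive t (1 : R) (xi z) (Y (cl (xi z t))).
  exact: (svalP (cid (pic z))).
have Kz0 : K z0 by rewrite /K /= subrr normr0 ltW.
pose C := 2 * expR (2 * L).
have C0 : 0 < C by rewrite mulr_gt0 ?expR_gt0.
have xiC z (t : R) : 0 <= t <= 1 -> `|xi z t - z0| <= C * `|z - z0|.
  move=> t01; have [z00 dz] := xiP z.
  have := @gronwall R N (fun t => xi z t - z0) (fun t => Y (cl (xi z t))) L 0 L0 (lexx 0).
  rewrite z00 addr0; apply => // s s01.
    by have := is_deriveB (dz s s01) (is_derive_cst z0 s 1); rewrite subr0.
  by rewrite addr0 -[X in `|X|]subr0 -{1}Yz0 -{1}(cl_id z0 Kz0).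
pose U := [set z : V | `|z - z0| < rho / C].
have UK z (t : R) : U z -> 0 <= t <= 1 -> K (xi z t).
  move=> Uz t01; apply: le_trans (xiC z t t01) _.
  by rewrite mulrC -ler_pdivlMr // ltW.
have Uo : open U by exact: open_ball_norm.
have fam : flow_family K U Y xi.
  move=> z Uz; have [z00 dz] := xiP z; split=> // t t01; have Kt := UK z t Uz t01.
  by split=> //; have := dz t t01; rewrite (cl_id _ Kt).
have one01 : 0 <= (1 : R) <= 1 by apply/andP; split; [exact: ler01|exact: lexx].
exists U, xi; split=> //.
- by rewrite /U /= subrr normr0 divr_gt0.
- move=> z Uz; have [z00 dz] := fam z Uz; split=> // t t01; split; last exact: (dz t t01).2.
  by exists Om; split=> //; exact/KO/(dz t t01).1.
- by move=> k; apply: (flow_Ck Kb Oo KO Uo (sO k.+1) fam one01).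
split=> [z H Uz dH|Q nQ].
  exact: (flow_diff Kb KO (sO 1%N) fam Uo (sO 2%N) Uz one01).2.
have [r r0 rQ] := near_ball_le nQ.
apply: (@near_ball_lt _ _ (r / C)) => [|z zr t t01]; first by rewrite divr_gt0.
apply: rQ; apply: le_trans (xiC z t t01) _.
by rewrite mulrC -ler_pdivlMr // ltW.
Qed.

End LocalFlow.

Section CurveCalculus.
Context {R : realType}.

Lemma is_derive_comp_curve {n m} (e : R -> 'rV[R]_n) (g : 'rV[R]_n -> 'rV[R]_m) (t : R) d :
  is_derive t (1 : R) e d -> differentiable g (e t) ->
  is_derive t (1 : R) (fun s => g (e s)) ('D_d g (e t)).
Proof.
move=> [de <-] gd; have de' : differentiable e t by apply/derivable1_diffP.
have dc : differentiable (g \o e) t by exact: differentiable_comp.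
by apply: DeriveDef; [exact: diff_derivable|exact: derive_comp].
Qed.

Lemma is_derive_constant {n} (e : R -> 'rV[R]_n) :
  (forall t : R, 0 <= t <= 1 -> is_derive t (1 : R) e 0) ->
  forall t : R, 0 <= t <= 1 -> e t = e 0.
Proof.
move=> de t t01.
have h1 (s : R) : 0 <= s <= 1 -> is_derive s 1 (fun=> 0 : R) 0.
  by move=> _; exact: (is_derive_cst (0 : R) s 1).
have h2 (s : R) : 0 <= s <= 1 -> `|(0 : 'rV[R]_n)| <= (0 : R) by rewrite normr0.
have H : `|e t - e 0| <= 0 - 0 by exact: (curve_le de h1 h2 t01).
by apply/eqP; rewrite -subr_eq0 -normr_le0 (le_trans H) // subrr.
Qed.

Lemma smooth_near_lsubmx {n m} (p : 'rV[R]_(n + m)) : smooth_near p (lsubmx : _ -> 'rV[R]_n).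
Proof. by exists setT; split=> // [|k]; [exact: openT|apply: Ck_lsubmx; exact: openT]. Qed.

Lemma smooth_near_rsubmx {n m} (p : 'rV[R]_(n + m)) : smooth_near p (rsubmx : _ -> 'rV[R]_m).
Proof. by exists setT; split=> // [|k]; [exact: openT|apply: Ck_rsubmx; exact: openT]. Qed.

Lemma derive_lsubmx {n m} (q p : 'rV[R]_(n + m)) : 'D_q (lsubmx : 'rV[R]_(n + m) -> 'rV[R]_n) p = lsubmx q.
Proof.
apply/rowP => j; rewrite (derive_rV j (@smooth_near_derivable _ _ _ _ q _ (smooth_near_lsubmx p))).
have -> : (fun y : 'rV[R]_(n + m) => lsubmx y 0 j) = fun y => y 0 (lshift m j).
  by apply/funext => y; rewrite mxE.
by rewrite derive_coord mxE.
Qed.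

Lemma derive_rsubmx {n m} (q p : 'rV[R]_(n + m)) : 'D_q (rsubmx : 'rV[R]_(n + m) -> 'rV[R]_m) p = rsubmx q.
Proof.
apply/rowP => j; rewrite (derive_rV j (@smooth_near_derivable _ _ _ _ q _ (smooth_near_rsubmx p))).
have -> : (fun y : 'rV[R]_(n + m) => rsubmx y 0 j) = fun y => y 0 (rshift n j).
  by apply/funext => y; rewrite mxE.
by rewrite derive_coord mxE.
Qed.

Lemma smooth_near_row_mx {V : normedModType R} {n m} x (f : V -> 'rV[R]_n) (g : V -> 'rV[R]_m) :
  smooth_near x f -> smooth_near x g -> smooth_near x (fun y => row_mx (f y) (g y)).
Proof. by apply: smooth_near2 => k U; exact: Ck_row_mx. Qed.

Lemma derive_row_mx {V : normedModType R} {n m} x v (f : V -> 'rV[R]_n) (g : V -> 'rV[R]_m) :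
  smooth_near x f -> smooth_near x g ->
  'D_v (fun y => row_mx (f y) (g y)) x = row_mx ('D_v f x) ('D_v g x).
Proof.
move=> sf sg; have srow := smooth_near_row_mx sf sg.
apply/rowP => j; rewrite (derive_rV j (@smooth_near_derivable _ _ _ _ v _ srow)).
case: (splitP j) => i ji.
  have -> : j = lshift m i by exact: val_inj.
  rewrite row_mxEl (derive_rV i (@smooth_near_derivable _ _ _ _ v _ sf)).
  by apply: near_eq_derive; apply: near_W => y; rewrite row_mxEl.
have -> : j = rshift n i by exact: val_inj.
rewrite row_mxEr (derive_rV i (@smooth_near_derivable _ _ _ _ v _ sg)).
by apply: near_eq_derive; apply: near_W => y; rewrite row_mxEr.
Qed.

End CurveCalculus.

(** * Projection along the flow of a normalized field *)

Section FlowProjection.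
Context {R : realType} {n : nat}.
Local Notation V := 'rV[R]_n.
Variables (v : V -> V) (x0 : V) (c : 'I_n).
Hypothesis sv : smooth_near x0 v.
Hypothesis vc : \forall y \near x0, v y 0 c = 1.

Let Z := 'rV[R]_(n + 1).
Let tau (z : Z) : R := rsubmx z 0 0.
(** The time is a constant component of the state: the unit-time flow of [Y] is the time-tau flow of
    [v], and [Y] vanishes at tau = 0 as [local_flow] asks. *)
Let Y (z : Z) : Z := row_mx (tau z *: v (lsubmx z)) (0 : 'rV[R]_1).
Let z0 : Z := row_mx x0 0.

Let smooth_tau p : smooth_near p tau.
Proof. exact: smooth_near_coord (smooth_near_rsubmx p). Qed.

Let smooth_Y p : smooth_near (lsubmx p) v -> smooth_near p Y.
Proof.
move=> sp; apply: smooth_near_row_mx (smooth_near_cst _ _).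
apply: smooth_nearZ (smooth_tau p) _.
exact: smooth_near_comp_rV (smooth_near_lsubmx p) sp.
Qed.

Let derive_Y p q : smooth_near (lsubmx p) v ->
  'D_q Y p = row_mx (tau p *: 'D_(lsubmx q) v (lsubmx p) + tau q *: v (lsubmx p)) 0.
Proof.
move=> sp; have svl := smooth_near_comp_rV (smooth_near_lsubmx p) sp.
have s1 := smooth_nearZ (smooth_tau p) svl.
rewrite (derive_row_mx q s1 (smooth_near_cst p (0 : 'rV[R]_1))) derive_cst; congr row_mx.
apply/rowP => j; rewrite (derive_rV j (@smooth_near_derivable _ _ _ _ q _ s1)).
have -> : 'D_q (fun y => (tau y *: v (lsubmx y)) 0 j) p = 'D_q (fun y => tau y * v (lsubmx y) 0 j) p.
  by apply: near_eq_derive; apply: near_W => y; rewrite mxE.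
have svj := smooth_near_coord j svl.
have -> : 'D_q (fun y => tau y * v (lsubmx y) 0 j) p =
    tau p *: 'D_q (fun y => v (lsubmx y) 0 j) p + v (lsubmx p) 0 j *: 'D_q tau p.
  by apply: (@deriveM _ _ tau (fun y => v (lsubmx y) 0 j)); exact: smooth_near_derivable.
rewrite -(derive_rV j (@smooth_near_derivable _ _ _ _ q _ svl)).
have -> : 'D_q (fun y => v (lsubmx y)) p = 'D_(lsubmx q) v (lsubmx p).
  by rewrite -(derive_lsubmx q p); apply: derive_comp; apply: smooth_near_diff => //; exact: smooth_near_lsubmx.
have -> : 'D_q tau p = tau q.
  rewrite /tau -(derive_rV 0 (@smooth_near_derivable _ _ _ _ q _ (smooth_near_rsubmx p))).
  by rewrite derive_rsubmx.
rewrite [RHS]mxE [X in _ = X + _]mxE [X in _ = _ + X]mxE.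
by congr (_ + _); rewrite [LHS]mulrC.
Qed.

(** [pi] slides a point along [v] until its coordinate [c] equals that of x0. Sliding forgets
    displacements along [v]; a field commuting with [v] is preserved by the flow, and if its
    coordinate [c] vanishes the sliding time does not vary along it either. *)
Theorem flow_projection : exists pi : V -> V,
  [/\ smooth_near x0 pi, pi x0 = x0,
      \forall y \near x0, 'D_(v y) pi y = 0,
      forall h : V, 'D_h pi x0 = h - h 0 c *: v x0 &
      forall w : V -> V, smooth_near x0 w -> (\forall y \near x0, lie_bracket v w y = 0) ->
        (\forall y \near x0, w y 0 c = 0) -> \forall y \near x0, 'D_(w y) pi y = w (pi y)].
Proof.
have lz0 : lsubmx z0 = x0 by rewrite row_mxKl.
have tz0 : tau z0 = 0 by rewrite /tau row_mxKr mxE.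
have sY : smooth_near z0 Y by apply: smooth_Y; rewrite lz0.
have Yz0 : Y z0 = 0 by rewrite /Y tz0 scale0r row_mx0.
have [U [xi [Uo Uz0 fam sF [varF stay]]]] := local_flow sY Yz0.
pose F z := xi z 1; pose gam z s := lsubmx (xi z s).
have near_gam (P : V -> Prop) : (\forall y \near x0, P y) ->
    \forall z \near z0, forall t : R, 0 <= t <= 1 -> P (gam z t).
  move=> nP; apply: (stay (fun z => P (lsubmx z))).
  have := smooth_near_continuous (smooth_near_lsubmx z0).
  rewrite /prop_for /continuous_at lz0; apply.
  exact: nP.
have one01 : 0 <= (1 : R) <= 1 by apply/andP; split; [exact: ler01|exact: lexx].
have gam1 z : gam z 1 = lsubmx (F z) by [].
have tauE z : U z -> forall t : R, 0 <= t <= 1 -> rsubmx (xi z t) = rsubmx z.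
  move=> Uz t t01; have [e0 dz] := fam z Uz.
  have de (s : R) : 0 <= s <= 1 -> is_derive s (1 : R) (fun s => rsubmx (xi z s)) (0 : 'rV[R]_1).
    move=> s01; have := is_derive_comp_curve (dz s s01).2 (smooth_near_diff (smooth_near_rsubmx (xi z s))).
    by rewrite derive_rsubmx row_mxKr.
  by rewrite (is_derive_constant de t01) e0.
have dgam z : U z -> forall t : R, 0 <= t <= 1 -> is_derive t (1 : R) (gam z) (tau z *: v (gam z t)).
  move=> Uz t t01; have [e0 dz] := fam z Uz.
  have := is_derive_comp_curve (dz t t01).2 (smooth_near_diff (smooth_near_lsubmx (xi z t))).
  by rewrite derive_lsubmx row_mxKl /tau (tauE z Uz t t01).
have nU : \forall z \near z0, U z by exact: near_open.
have nv := near_gam _ (smooth_near_near sv).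
have DYxi z (t : R) q : U z -> 0 <= t <= 1 -> smooth_near (gam z t) v ->
    'D_q Y (xi z t) = row_mx (tau z *: 'D_(lsubmx q) v (gam z t) + tau q *: v (gam z t)) 0.
  by move=> Uz t01 svt; rewrite derive_Y // /tau (tauE z Uz t t01).
have flow_v : \forall z \near z0, 'D_(row_mx (v (lsubmx z)) (const_mx (-1) : 'rV[R]_1)) F z =
    row_mx 0 (const_mx (-1) : 'rV[R]_1).
  apply: near_imp2 nU nv => z Uz svz.
  (* Displacing the start by [v] and shortening the time by the same amount fixes the end point; at
     parameter s the remaining displacement is 1 - s times [v]. *)
  pose H (s : R) : Z := row_mx ((1 - s) *: v (gam z s)) (const_mx (-1) : 'rV[R]_1).
  have H0 : H 0 = row_mx (v (lsubmx z)) (const_mx (-1) : 'rV[R]_1).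
    by rewrite /H subr0 scale1r /gam (fam z Uz).1.
  have H1 : H 1 = row_mx 0 (const_mx (-1) : 'rV[R]_1) by rewrite /H subrr scale0r.
  rewrite -H0 -H1; apply: varF => // t t01; rewrite (DYxi _ _ _ Uz t01 (svz t t01)) row_mxKl.
  have -> : tau (H t) = -1 by rewrite /tau row_mxKr mxE.
  apply: is_derive_row_mx.
  have svt := smooth_near_diff (svz t t01).
  have dv := is_derive_comp_curve (dgam z Uz t t01) svt.
  apply/is_derive_rVP => j; have /is_derive_rVP/(_ j) dvj := dv.
  have dt : is_derive t 1 (fun s : R => 1 - s) (-1).
    by have := is_deriveB (is_derive_cst (1 : R) t 1) (is_derive_id t 1); rewrite add0r.
  have := is_deriveM dt dvj.
  rewrite (derive_dirZ (tau z) (v (gam z t)) svt) (derive_dirZ (1 - t) (v (gam z t)) svt).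
  set D := 'D_(v (gam z t)) v (gam z t).
  have -> : (fun s => ((1 - s) *: v (gam z s)) 0 j) = (fun s : R => 1 - s) * (fun s => v (gam z s) 0 j).
    by apply/funext => s; rewrite mxE.
  suff -> : (1 - t) *: (tau z *: D) 0 j + v (gam z t) 0 j *: (-1) =
    (tau z *: ((1 - t) *: D) + -1 *: v (gam z t)) 0 j by [].
  rewrite !mxE; have gen (a b p q : R) : a *: (b * p) + q *: -1 = b * (a * p) + -1 * q.
    by rewrite /GRing.scale /=; ring.
  exact: gen.
have flow_w (w : V -> V) : smooth_near x0 w -> (\forall y \near x0, lie_bracket v w y = 0) ->
    \forall z \near z0, 'D_(row_mx (w (lsubmx z)) (0 : 'rV[R]_1)) F z = row_mx (w (gam z 1)) 0.
  move=> sw bw; have := near_imp2 (fun z => @conj _ _) (near_gam _ (smooth_near_near sw)) (near_gam _ bw).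
  apply: near_imp3 nU nv => z Uz svz [swz bwz].
  (* Commutation says exactly that [w] along a trajectory of [v] solves the variational equation. *)
  pose H (s : R) : Z := row_mx (w (gam z s)) 0.
  have H0 : H 0 = row_mx (w (lsubmx z)) 0 by rewrite /H /gam (fam z Uz).1.
  rewrite -H0 -/(H 1); apply: varF => // t t01; rewrite (DYxi _ _ _ Uz t01 (svz t t01)) row_mxKl.
  have -> : tau (H t) = 0 by rewrite /tau row_mxKr mxE.
  rewrite scale0r addr0; apply: is_derive_row_mx.
  have := is_derive_comp_curve (dgam z Uz t t01) (smooth_near_diff (swz t t01)).
  rewrite (derive_dirZ (tau z) (v (gam z t)) (smooth_near_diff (swz t t01))).
  by have := bwz t t01; rewrite /lie_bracket => /eqP; rewrite subr_eq0 => /eqP ->.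
(* The sliding time is x0_c - x_c because coordinate [c] grows at unit speed along [v]. *)
pose io (x : V) : Z := row_mx x (const_mx (x0 0 c - x 0 c) : 'rV[R]_1).
have sio x : smooth_near x io.
  apply: smooth_near_row_mx (smooth_near_id x) _.
  apply/smooth_near_rVP => j; have := smooth_nearB (smooth_near_cst x (x0 0 c)) (smooth_near_coord c (smooth_near_id x)).
  by apply: smooth_near_eq; apply: near_W => y; rewrite mxE.
have io0 : io x0 = z0.
  by rewrite /io subrr; congr row_mx; apply/rowP => j; rewrite !mxE.
have Dio x h : 'D_h io x = row_mx h (const_mx (- h 0 c) : 'rV[R]_1).
  have s2 : smooth_near x (fun y : V => const_mx (x0 0 c - y 0 c) : 'rV[R]_1).
    apply/smooth_near_rVP => j; have := smooth_nearB (smooth_near_cst x (x0 0 c)) (smooth_near_coord c (smooth_near_id x)).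
    by apply: smooth_near_eq; apply: near_W => y; rewrite mxE.
  rewrite /io (derive_row_mx h (smooth_near_id x) s2) derive_id; congr row_mx.
  apply/rowP => j; rewrite (derive_rV j (@smooth_near_derivable _ _ _ _ h _ s2)) mxE.
  have -> : 'D_h (fun y : V => (const_mx (x0 0 c - y 0 c) : 'rV[R]_1) 0 j) x = 'D_h (fun y : V => x0 0 c - y 0 c) x.
    by apply: near_eq_derive; apply: near_W => y; rewrite mxE.
  have E := @deriveB _ _ _ (fun=> x0 0 c) (fun y : V => y 0 c) x h (derivable_cst _ _ _)
    (smooth_near_derivable (smooth_near_coord c (smooth_near_id x))).
  by apply: etrans E _; rewrite derive_cst derive_coord sub0r.
have sFz z : U z -> smooth_near z F by move=> Uz; exact: smooth_near_on Uo Uz sF.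
pose pi x := lsubmx (F (io x)).
have nio (P : Z -> Prop) : (\forall z \near z0, P z) -> \forall x \near x0, P (io x).
  by move=> nP; have := smooth_near_continuous (sio x0); rewrite /prop_for /continuous_at io0; apply.
have spi x : U (io x) -> smooth_near x pi.
  move=> Ux; apply: smooth_near_comp_rV (smooth_near_lsubmx _).
  exact: smooth_near_comp_rV (sio x) (sFz _ Ux).
have Dpi x h : U (io x) -> 'D_h pi x = lsubmx ('D_(row_mx h (const_mx (- h 0 c) : 'rV[R]_1)) F (io x)).
  move=> Ux; have dF := smooth_near_diff (sFz _ Ux); have di := smooth_near_diff (sio x).
  have dFi : differentiable (F \o io) x by exact: differentiable_comp.
  have := @derive_comp R V (n + 1) V (F \o io) lsubmx x h dFi (smooth_near_diff (smooth_near_lsubmx _)).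
  by rewrite derive_lsubmx (derive_comp h di dF) Dio.
have Ui : \forall x \near x0, U (io x) by exact: nio.
have xi0 (t : R) : 0 <= t <= 1 -> xi z0 t = z0.
  move=> t01; have [e0 dz] := fam z0 Uz0.
  have dg (s : R) : 0 <= s <= 1 -> is_derive s (1 : R) (gam z0) 0.
    by move=> s01; have := dgam z0 Uz0 s s01; rewrite tz0 scale0r.
  rewrite -(hsubmxK (xi z0 t)) (tauE z0 Uz0 t t01) -/(gam z0 t) (is_derive_constant dg t01).
  by rewrite /gam e0 hsubmxK.
exists pi; split.
- by apply: spi; rewrite io0.
- by rewrite /pi io0 /F (xi0 1 one01) lz0.
- apply: near_imp3 vc Ui (nio _ flow_v) => y vy Uy E.
  rewrite (Dpi _ _ Uy) vy; move: E; rewrite /io row_mxKl => ->.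
  by rewrite row_mxKl.
- move=> h; rewrite Dpi io0 //.
  (* At z0 the trajectory is constant and the time is 0, so variations in the state directions are
     transported unchanged. *)
  have Fk (k : V) : 'D_(row_mx k (0 : 'rV[R]_1)) F z0 = row_mx k 0.
    pose H (s : R) : Z := row_mx k 0; rewrite -/(H 0) -[RHS]/(H 1).
    apply: varF => // t t01; rewrite (xi0 t t01) derive_Y ?lz0 // tz0 scale0r add0r.
    have -> : tau (H t) = 0 by rewrite /tau row_mxKr mxE.
    by rewrite scale0r row_mx0; exact: (is_derive_cst (row_mx k 0 : Z) t 1).
  have -> : row_mx h (const_mx (- h 0 c) : 'rV[R]_1) =
     row_mx (h - h 0 c *: v x0) 0 + h 0 c *: row_mx (v x0) (const_mx (-1) : 'rV[R]_1).
    rewrite scale_row_mx add_row_mx subrK add0r; congr row_mx.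
    by apply/rowP => j; rewrite !mxE mulrN1.
  have dF := smooth_near_diff (sFz _ Uz0).
  rewrite (derive_dirD _ _ dF) (derive_dirZ _ _ dF) Fk.
  have := near_at flow_v; rewrite lz0 => ->.
  by rewrite scale_row_mx add_row_mx row_mxKl scaler0 addr0.
- move=> w sw bw wc; apply: near_imp3 wc Ui (nio _ (flow_w w sw bw)) => y wy Uy E.
  rewrite (Dpi _ _ Uy) wy oppr0; move: E; rewrite /io row_mxKl gam1 => E.
  have -> : (const_mx 0 : 'rV[R]_1) = 0 by apply/rowP => j; rewrite !mxE.
  by rewrite E row_mxKl.
Qed.

End FlowProjection.

Lemma near_comp {T1 T2 : topologicalType} (f : T1 -> T2) x (P : T2 -> Prop) :
  {for x, continuous f} -> (\forall y \near f x, P y) -> \forall y \near x, P (f y).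
Proof. by move=> fc; exact: fc. Qed.

Section SmoothMatrix.
Context {R : realType} {V : normedModType R}.

Lemma smooth_near_prod x (I : eqType) (s : seq I) (P : pred I) (F : I -> V -> R) :
  (forall i, smooth_near x (F i)) -> smooth_near x (fun y => \prod_(i <- s | P i) F i y).
Proof.
move=> sF; elim: s => [|i s IH].
  by apply: smooth_near_eq (smooth_near_cst x (1 : R)); apply: near_W => y; rewrite big_nil.
have [Pi|Pi] := boolP (P i).
  by apply: smooth_near_eq (smooth_nearM (sF i) IH); apply: near_W => y; rewrite big_cons Pi.
by apply: smooth_near_eq IH; apply: near_W => y; rewrite big_cons (negbTE Pi).
Qed.

Lemma smooth_near_det n x (M : V -> 'M[R]_n) :
  (forall i j, smooth_near x (fun y => M y i j)) -> smooth_near x (fun y => \det (M y)).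
Proof.
move=> sM; rewrite /determinant; apply: smooth_near_sum => s _ _.
by apply: smooth_nearM; [exact: smooth_near_cst|exact: smooth_near_prod].
Qed.

Lemma near_unitmx n x (M : V -> 'M[R]_n) : (forall i j, smooth_near x (fun y => M y i j)) ->
  M x \in unitmx -> \forall y \near x, M y \in unitmx.
Proof.
move=> sM; rewrite unitmxE unitfE => Mx.
have := near_neq0 (smooth_near_continuous (smooth_near_det sM)) Mx.
by apply: near_imp => y; rewrite unitmxE unitfE.
Qed.

Lemma smooth_near_invmx n x (M : V -> 'M[R]_n) : (forall i j, smooth_near x (fun y => M y i j)) ->
  M x \in unitmx -> forall i j, smooth_near x (fun y => invmx (M y) i j).
Proof.
move=> sM Mx i j.
have Dx : \det (M x) != 0 by rewrite -unitfE -unitmxE.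
have s1 : smooth_near x (fun y => (\det (M y))^-1 * ((-1) ^+ (j + i) * \det (row' j (col' i (M y))))).
  apply: smooth_nearM; first exact: smooth_nearV (smooth_near_det sM).
  apply: smooth_nearM; first exact: smooth_near_cst.
  apply: smooth_near_det => i' j'.
  apply: smooth_near_eq (sM (lift j i') (lift i j')).
  by apply: near_W => y; rewrite !mxE.
apply: smooth_near_eq s1; apply: near_imp (near_unitmx sM Mx) => y My.
by rewrite /invmx My !mxE.
Qed.

End SmoothMatrix.

(** * The smooth inverse function theorem *)

Section InverseFunction.
Context {R : realType} {n : nat}.
Local Notation V := 'rV[R]_n.
Implicit Types (Phi Psi : V -> V).

Lemma mulmx_injective_unit (A : 'M[R]_n) : (forall h : V, h *m A = 0 -> h = 0) -> A \in unitmx.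
Proof.
move=> inj; rewrite -row_free_unit -kermx_eq0; apply/eqP/row_matrixP => i.
rewrite row0; apply: inj; rewrite -row_mul; apply/rowP => j.
by rewrite mulmx_ker !mxE.
Qed.

Let jac Phi (x : V) : 'M[R]_n := \matrix_i 'D_(delta_mx 0 i) Phi x.

Let jacE Phi x h : differentiable Phi x -> h *m jac Phi x = 'D_h Phi x.
Proof.
move=> dP; rewrite (derive_rVE h dP); apply/rowP => j; rewrite mxE summxE.
by apply: eq_bigr => i _; rewrite !mxE.
Qed.

Let smooth_jac Phi x i j : smooth_near x Phi -> smooth_near x (fun y => jac Phi y i j).
Proof.
move=> sP; apply: smooth_near_eq (smooth_near_coord j (smooth_near_dir (delta_mx 0 i) sP)).
by apply: near_W => y; rewrite mxE.
Qed.

(* The inverse is obtained by flowing x0 along (D Phi)^-1 w during unit time. *)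
Lemma right_inverse Phi x0 : smooth_near x0 Phi -> (forall h, 'D_h Phi x0 = 0 -> h = 0) ->
  exists Psi, [/\ smooth_near (Phi x0) Psi, Psi (Phi x0) = x0 &
    \forall y \near Phi x0, Phi (Psi y) = y].
Proof.
move=> sP inj.
have Ju : jac Phi x0 \in unitmx.
  apply: mulmx_injective_unit => h; rewrite jacE; [exact: inj|exact: smooth_near_diff].
pose Z := 'rV[R]_(n + n).
pose Y (z : Z) : Z := row_mx (rsubmx z *m invmx (jac Phi (lsubmx z))) (0 : V).
pose z0 : Z := row_mx x0 0.
have lz0 : lsubmx z0 = x0 by rewrite row_mxKl.
have sY : smooth_near z0 Y.
  apply: smooth_near_row_mx (smooth_near_cst _ _); apply/smooth_near_rVP => j.
  have H : smooth_near z0 (fun z : Z => \sum_(i < n) rsubmx z 0 i * invmx (jac Phi (lsubmx z)) i j).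
    apply: smooth_near_sum => i _ _; apply: smooth_nearM.
      exact: smooth_near_coord (smooth_near_rsubmx z0).
    apply: (smooth_near_comp (f := lsubmx) (g := fun y => invmx (jac Phi y) i j) (smooth_near_lsubmx z0)).
    rewrite lz0; apply: smooth_near_invmx => // i' j'; exact: smooth_jac.
  by apply: smooth_near_eq H; apply: near_W => z; rewrite mxE.
have Yz0 : Y z0 = 0 by rewrite /Y row_mxKr mul0mx row_mx0.
have [U [xi [Uo Uz0 fam sF [_ stay]]]] := local_flow sY Yz0.
pose Q (x : V) := smooth_near x Phi /\ jac Phi x \in unitmx.
have nQ : \forall z \near z0, forall t : R, 0 <= t <= 1 -> Q (lsubmx (xi z t)).
  apply: (stay (fun z => Q (lsubmx z))).
  apply: (near_comp (smooth_near_continuous (smooth_near_lsubmx z0))); rewrite lz0.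
  apply: near_imp2 (smooth_near_near sP) (near_unitmx _ Ju) => [y ? ?|i j]; first by split.
  exact: smooth_jac.
have one01 : 0 <= (1 : R) <= 1 by apply/andP; split; [exact: ler01|exact: lexx].
pose io (y : V) : Z := row_mx x0 (y - Phi x0).
have sio y : smooth_near y io.
  apply: smooth_near_row_mx; first exact: smooth_near_cst.
  exact: smooth_nearB (smooth_near_id y) (smooth_near_cst y _).
have io0 : io (Phi x0) = z0 by rewrite /io subrr.
have nio (P : Z -> Prop) : (\forall z \near z0, P z) -> \forall y \near Phi x0, P (io y).
  by move=> nP; have := smooth_near_continuous (sio (Phi x0)); rewrite /prop_for /continuous_at io0; apply.
pose Psi y := lsubmx (xi (io y) 1).
have key y : U (io y) -> (forall t : R, 0 <= t <= 1 -> Q (lsubmx (xi (io y) t))) -> Phi (Psi y) = y.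
  move=> Uy Qy; have [e0 dz] := fam _ Uy; set z := io y; set w := y - Phi x0.
  have rE (t : R) : 0 <= t <= 1 -> rsubmx (xi z t) = w.
    have de (s : R) : 0 <= s <= 1 -> is_derive s (1 : R) (fun s => rsubmx (xi z s)) (0 : V).
      move=> s01; have := is_derive_comp_curve (dz s s01).2 (smooth_near_diff (smooth_near_rsubmx (xi z s))).
      by rewrite derive_rsubmx row_mxKr.
    by move=> t01; rewrite (is_derive_constant de t01) e0 row_mxKr.
  (* Along the trajectory [Phi] moves with the constant velocity [w], so after unit time it has
     reached Phi x0 + w = y. *)
  have dP (s : R) : 0 <= s <= 1 -> is_derive s (1 : R) (fun s => Phi (lsubmx (xi z s)) - s *: w) (0 : V).
    move=> s01; have [sPs us] := Qy s s01.
    have dl := is_derive_comp_curve (dz s s01).2 (smooth_near_diff (smooth_near_lsubmx (xi z s))).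
    have := is_derive_comp_curve dl (smooth_near_diff sPs).
    rewrite derive_lsubmx row_mxKl (rE s s01) -(jacE _ (smooth_near_diff sPs)) mulmxKV // => d1.
    apply/is_derive_rVP => j; have /is_derive_rVP/(_ j) d1j := d1.
    have d2 : is_derive s 1 (fun s : R => s * w 0 j) (w 0 j).
      have := is_deriveM (is_derive_id s 1) (is_derive_cst (w 0 j) s 1).
      by rewrite scaler0 add0r [_ *: _]mulr1.
    have H := is_deriveB d1j d2; rewrite subrr in H.
    have -> : (0 : V) 0 j = 0 by rewrite mxE.
    have -> : (fun s => (Phi (lsubmx (xi z s)) - s *: w) 0 j) =
      (fun s => Phi (lsubmx (xi z s)) 0 j) - (fun s : R => s * w 0 j).
      by apply/funext => t; rewrite mxE [X in _ + X]mxE [X in _ - X]mxE.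
    exact: H.
  have := is_derive_constant dP one01; rewrite scale1r scale0r subr0 e0 /z /io row_mxKl => E.
  have wE : Phi x0 + w = y by rewrite /w addrC subrK.
  by move: E => /eqP; rewrite subr_eq wE => /eqP.
exists Psi; split.
- have Uio : U (io (Phi x0)) by rewrite io0.
  have sxi := smooth_near_comp_rV (sio (Phi x0)) (smooth_near_on Uo Uio sF).
  exact: (smooth_near_comp_rV sxi (smooth_near_lsubmx _)).
- rewrite /Psi io0; have [e0 dz] := fam z0 Uz0.
  have rE (t : R) : 0 <= t <= 1 -> rsubmx (xi z0 t) = 0.
    have de (s : R) : 0 <= s <= 1 -> is_derive s (1 : R) (fun s => rsubmx (xi z0 s)) (0 : V).
      move=> s01; have := is_derive_comp_curve (dz s s01).2 (smooth_near_diff (smooth_near_rsubmx (xi z0 s))).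
      by rewrite derive_rsubmx row_mxKr.
    by move=> t01; rewrite (is_derive_constant de t01) e0 row_mxKr.
  have de (s : R) : 0 <= s <= 1 -> is_derive s (1 : R) (fun s => lsubmx (xi z0 s)) (0 : V).
    move=> s01; have := is_derive_comp_curve (dz s s01).2 (smooth_near_diff (smooth_near_lsubmx (xi z0 s))).
    by rewrite derive_lsubmx row_mxKl (rE s s01) mul0mx.
  by rewrite (is_derive_constant de one01) e0.
- apply: near_imp2 (nio _ (near_open Uo Uz0)) (nio _ nQ) => y.
  exact: key.
Qed.

(** A right inverse of the right inverse [Psi] must coincide with [Phi] near x0, so [Psi] is also a
    left inverse. The image is cut down to a ball: its convexity later turns vanishing partial
    derivatives into independence of coordinates. *)
Theorem inverse_function Phi x0 (P : V -> Prop) : smooth_near x0 Phi ->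
  (forall h, 'D_h Phi x0 = 0 -> h = 0) -> (\forall y \near x0, P y) ->
  exists (U : set V) Psi (rho : R), [/\ 0 < rho, open U, U x0,
    Phi @` U = [set y | `|y - Phi x0| < rho] &
    [/\ smooth_on U Phi, smooth_on [set y | `|y - Phi x0| < rho] Psi,
      (forall x, U x -> Psi (Phi x) = x) & forall x, U x -> P x]].
Proof.
move=> sP inj nP.
have [Psi [sPsi Psi0 PPsi]] := right_inverse sP inj.
have injP h : 'D_h Psi (Phi x0) = 0 -> h = 0.
  move=> Dh; have dPsi := smooth_near_diff sPsi.
  have dPhi : differentiable Phi (Psi (Phi x0)) by rewrite Psi0; exact: smooth_near_diff.
  have E := derive_comp h dPsi dPhi; rewrite Dh derive0 in E.
  have E2 : 'D_h (Phi \o Psi) (Phi x0) = h.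
    by rewrite -[RHS](derive_id (Phi x0) h); apply: near_eq_derive.
  by rewrite -E2 E.
have [Phi' [sPhi' Phi'0 PPhi']] := right_inverse sPsi injP.
rewrite Psi0 in sPhi' Phi'0 PPhi'.
have left_inv : \forall x \near x0, Psi (Phi x) = x.
  have c' : \forall x \near x0, Phi (Psi (Phi' x)) = Phi' x.
    apply: (near_comp (P := fun y => Phi (Psi y) = y) (smooth_near_continuous sPhi')).
    by rewrite Phi'0; exact: PPsi.
  apply: near_imp2 c' PPhi' => x h1 h2.
  by rewrite -{1}h2 h1 h2.
have [U0 [U0o U0x sU0]] := sP.
have : nbhs x0 [set x | Psi (Phi x) = x /\ P x].
  by apply: near_imp2 left_inv nP => x; split.
rewrite nbhsE => -[A [Ao Ax] HA].
pose P' := U0 `&` A.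
have P'o : open P' by exact: openI.
have [V0 [V0o V0y sV0]] := sPsi.
have nPsi : \forall y \near Phi x0, P' (Psi y).
  apply: (near_comp (smooth_near_continuous sPsi)); rewrite Psi0.
  by apply: near_open.
have [rho rho0 rH] := near_ball_le (near_imp3 (fun y a b c => And3 a b c) (near_open V0o V0y) PPsi nPsi).
pose B := [set y : V | `|y - Phi x0| < rho].
have Bo : open B by exact: open_ball_norm.
exists (P' `&` Phi @^-1` B), Psi, rho; split=> //.
- rewrite openE => x [P'x Bx].
  have sx : smooth_near x Phi by exists U0; split=> //; have [] := P'x.
  exact: filterI (near_open P'o P'x) (near_comp (smooth_near_continuous sx) (near_open Bo Bx)).
- by split; [split|rewrite /= /B /= subrr normr0].
- apply/seteqP; split=> [y [x [_ Bx] <-] //|y By].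
  have [_ h2 h3] := rH y (ltW By).
  by exists (Psi y) => //; split=> //; rewrite /= h2.
split.
- by move=> k; apply: Ck_on_subset (sU0 k) => x [[]].
- by move=> k; apply: Ck_on_subset (sV0 k) => y By; have [] := rH y (ltW By).
- by move=> x [[_ /HA[]]].
- by move=> x [[_ /HA[]]].
Qed.

End InverseFunction.

(** * Frames and the Frobenius theorem *)

Section SpanSeq.
Context {K : fieldType} {vT : vectType K}.
Implicit Types (X : seq vT) (w : vT).

Lemma mem_spanP X w :
  w \in <<X>>%VS <-> exists b : nat -> K, w = \sum_(i < size X) b i *: X`_i.
Proof.
split=> [wX|[b ->]].
  have wX' : w \in <<in_tuple X>>%VS by [].
  exists (fun i => if insub i is Some j then coord (in_tuple X) j w else 0).
  rewrite {1}(coord_span wX'); apply: eq_bigr => i _.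
  by rewrite valK.
by apply: memv_suml => i _; rewrite memvZ // memv_span // mem_nth.
Qed.

Lemma vspan_sub (S : set vT) (W : {vspace vT}) : (forall v, S v -> v \in W) -> (vspan S <= W)%VS.
Proof. by have [_ +] := vspanP S; exact. Qed.

Lemma mem_vspan (S : set vT) v : S v -> v \in vspan S.
Proof. by have [+ _] := vspanP S; exact. Qed.

Lemma vspan_seq (S : set vT) : exists s : seq vT, (forall v, v \in s -> S v) /\ vspan S = << s >>%VS.
Proof.
pose P (d : nat) := `[< exists s : seq vT, (forall v, v \in s -> S v) /\ \dim << s >> = d >].
have exP : exists d, P d.
  by exists (\dim <<([::] : seq vT)>>); apply/asboolP; exists [::].
have ubP d : P d -> (d <= \dim {:vT})%N.
  by move=> /asboolP[s [_ <-]]; apply: dimvS; apply: subvf.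
case: (ex_maxnP exP ubP) => d /asboolP[s [sS sd]] dmax.
exists s; split=> //; apply/eqP; rewrite eqEsubv; apply/andP; split; last first.
  by apply/span_subvP => v /sS; exact: mem_vspan.
apply: vspan_sub => v Sv.
have sv : (<< s >> <= <<v :: s>>)%VS by rewrite span_cons addvSr.
have : << s >>%VS == <<v :: s>>%VS.
  rewrite eqEdim sv /= sd; apply: dmax; apply/asboolP; exists (v :: s).
  by split=> // w; rewrite inE => /orP[/eqP->//|/sS].
by move=> /eqP ->; apply: memv_span; rewrite inE eqxx.
Qed.

End SpanSeq.

Section Frames.
Context {R : realType} {n : nat}.
Local Notation V := 'rV[R]_n.
Local Notation vf := (V -> V).
Implicit Types (x y : V) (D E : tdistribution R n) (s : seq vf) (u w : vf) (v : nat -> vf) (c : nat -> nat).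

Definition evals s y : seq V := [seq u y | u <- s].

Lemma evals_nth s y i : (i < size s)%N -> (evals s y)`_i = nth (fun=> 0) s i y.
Proof. by move=> si; rewrite (nth_map (fun=> 0)). Qed.

(** Membership in the module over germs of smooth functions generated by [s]. Pointwise membership
    in spans would not do, since brackets differentiate the coefficients. *)
Definition smod x s w := exists a : nat -> V -> R,
  (forall i, smooth_near x (a i)) /\
  \forall y \near x, w y = \sum_(i < size s) a i y *: nth (fun=> 0) s i y.

Lemma smod0 x s : smod x s (fun=> 0).
Proof.
exists (fun=> fun=> 0); split=> [i|]; first exact: smooth_near_cst.
by apply: near_W => y; rewrite big1 // => i _; rewrite scale0r.
Qed.

Lemma smodD x s u w : smod x s u -> smod x s w -> smod x s (fun y => u y + w y).
Proof.
move=> [a [sa ua]] [b [sb wb]]; exists (fun i y => a i y + b i y); split=> [i|].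
  exact: smooth_nearD.
apply: near_imp2 ua wb => y -> ->; rewrite -big_split; apply: eq_bigr => i _.
by rewrite scalerDl.
Qed.

Lemma smodZ x s (f : V -> R) w : smooth_near x f -> smod x s w -> smod x s (fun y => f y *: w y).
Proof.
move=> sf [b [sb wb]]; exists (fun i y => f y * b i y); split=> [i|].
  exact: smooth_nearM.
apply: near_imp wb => y ->; rewrite scaler_sumr; apply: eq_bigr => i _.
by rewrite scalerA.
Qed.

Lemma smodB x s u w : smod x s u -> smod x s w -> smod x s (fun y => u y - w y).
Proof.
move=> su sw; have [a [sa H]] := smodD su (smodZ (smooth_near_cst x (-1 : R)) sw).
by exists a; split=> //; apply: near_imp H => y <-; rewrite scaleN1r.
Qed.

Lemma smod_sum x s m (F : nat -> vf) : (forall i, (i < m)%N -> smod x s (F i)) ->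
  smod x s (fun y => \sum_(i < m) F i y).
Proof.
elim: m => [|m IH] sF.
  have [a [sa H]] := smod0 x s; exists a; split=> //.
  by apply: near_imp H => y <-; rewrite big_ord0.
have [a [sa H]] := smodD (IH (fun i im => sF i (ltnW im))) (sF m (ltnSn m)).
by exists a; split=> //; apply: near_imp H => y <-; rewrite big_ord_recr.
Qed.

Lemma smod_near x s u w : (\forall y \near x, u y = w y) -> smod x s u -> smod x s w.
Proof.
by move=> uw [a [sa H]]; exists a; split=> //; apply: near_imp2 uw H => y <-.
Qed.

Lemma smod_mem x s i : (i < size s)%N -> smod x s (nth (fun=> 0) s i).
Proof.
move=> si; exists (fun j => fun=> (j == i)%:R); split=> [j|]; first exact: smooth_near_cst.
apply: near_W => y; rewrite (bigD1 (Ordinal si)) //= eqxx scale1r big1 ?addr0 // => j.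
by rewrite -val_eqE /= => /negbTE ->; rewrite scale0r.
Qed.

Lemma smod_cons x s u w : smod x s w -> smod x (u :: s) w.
Proof.
move=> [a [sa H]]; exists (fun i => if i is i'.+1 then a i' else fun=> 0); split=> [[|i]|].
- exact: smooth_near_cst.
- exact: sa.
by apply: near_imp H => y ->; rewrite big_ord_recl scale0r add0r; apply: eq_bigr.
Qed.

Lemma entry_ord (z : V) (j : 'I_n) : entry z j = z 0 j.
Proof. by rewrite /entry valK. Qed.

Lemma entryD (z z' : V) k : entry (z + z') k = entry z k + entry z' k.
Proof. by rewrite /entry; case: insubP => [j _ _|_]; rewrite ?mxE ?addr0. Qed.

Lemma entryZ (b : R) (z : V) k : entry (b *: z) k = b * entry z k.
Proof. by rewrite /entry; case: insubP => [j _ _|_]; rewrite ?mxE ?mulr0. Qed.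

Lemma entryB (z z' : V) k : entry (z - z') k = entry z k - entry z' k.
Proof. by rewrite entryD -scaleN1r entryZ mulN1r. Qed.

Lemma entry0 k : entry (0 : V) k = 0.
Proof. by rewrite -(scale0r (0 : V)) entryZ mul0r. Qed.

Lemma entry_sum (I : Type) (r : seq I) (P : pred I) (F : I -> V) k :
  entry (\sum_(i <- r | P i) F i) k = \sum_(i <- r | P i) entry (F i) k.
Proof. by apply: (big_morph (fun z => entry z k)) => [a b|]; [exact: entryD|exact: entry0]. Qed.

Lemma smooth_near_entry x w k : smooth_near x w -> smooth_near x (fun y => entry (w y) k).
Proof.
by move=> sw; rewrite /entry; case: insubP => [j _ _|_]; [exact: smooth_near_coord|exact: smooth_near_cst].
Qed.

(** Frames are kept reduced: in the selected coordinates [c] they form the identity matrix. The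
    coefficients of a section are then entries of it, hence smooth, and brackets of frame fields
    have zero selected entries. *)
Definition dual_at d v c y :=
  forall i j, (i < d)%N -> (j < d)%N -> entry (v i y) (c j) = (i == j)%:R.

Definition in_frame d v y (z : V) := exists b : nat -> R, z = \sum_(i < d) b i *: v i y.

Lemma in_frameD d v y z z' : in_frame d v y z -> in_frame d v y z' -> in_frame d v y (z + z').
Proof.
move=> [a ->] [b ->]; exists (fun i => a i + b i); rewrite -big_split.
by apply: eq_bigr => i _; rewrite scalerDl.
Qed.

Lemma in_frameZ d v y (b : R) z : in_frame d v y z -> in_frame d v y (b *: z).
Proof.
move=> [a ->]; exists (fun i => b * a i); rewrite scaler_sumr.
by apply: eq_bigr => i _; rewrite scalerA.
Qed.

Lemma in_frame_sum d v y m (F : 'I_m -> V) : (forall i, in_frame d v y (F i)) ->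
  in_frame d v y (\sum_(i < m) F i).
Proof.
move=> H; apply: (big_ind (in_frame d v y)) => // [|a b]; last exact: in_frameD.
by exists (fun=> 0); rewrite big1 // => i _; rewrite scale0r.
Qed.

Lemma in_frame_mem d v y i : (i < d)%N -> in_frame d v y (v i y).
Proof.
move=> id; exists (fun j => (j == i)%:R); rewrite (bigD1 (Ordinal id)) //= eqxx scale1r.
by rewrite big1 ?addr0 // => j; rewrite -val_eqE /= => /negbTE ->; rewrite scale0r.
Qed.

Lemma dual_coord d v c y (b : nat -> R) j : dual_at d v c y -> (j < d)%N ->
  entry (\sum_(i < d) b i *: v i y) (c j) = b j.
Proof.
move=> dv jd; rewrite entry_sum (bigD1 (Ordinal jd)) //= entryZ dv // eqxx mulr1.
rewrite big1 ?addr0 // => i; rewrite -val_eqE /= => /negbTE ij.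
by rewrite entryZ dv // ij mulr0.
Qed.

Lemma in_frameE d v c y z : dual_at d v c y -> in_frame d v y z ->
  z = \sum_(i < d) entry z (c i) *: v i y.
Proof.
move=> dv [b zE]; rewrite [LHS]zE; apply: eq_bigr => i _.
by rewrite zE (dual_coord _ dv).
Qed.

Lemma in_frame_span d v y z : in_frame d v y z <-> z \in <<mkseq (fun i => v i y) d>>%VS.
Proof.
rewrite mem_spanP size_mkseq.
by split=> -[b ->]; exists b; apply: eq_bigr => i _; rewrite nth_mkseq.
Qed.

Lemma dual_free d v c y : dual_at d v c y -> \dim <<mkseq (fun i => v i y) d>> = d.
Proof.
move=> dv; suff /eqP -> : free (mkseq (fun i => v i y) d) by rewrite size_mkseq.
pose X := in_tuple (mkseq (fun i => v i y) d).
rewrite -[mkseq _ _]/(tval X); apply/freeP => k H i.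
have sz : size (mkseq (fun i => v i y) d) = d by rewrite size_mkseq.
have id' : (i < d)%N by rewrite -{2}sz.
pose b j := if insub j is Some l then k l else 0.
have bE : b i = k i by rewrite /b valK.
rewrite -bE -(dual_coord b dv id').
suff -> : \sum_(i0 < d) b i0 *: v i0 y = 0 by rewrite entry0.
have gen (f : nat -> V) : \sum_(l < d) f l = \sum_(l < size (mkseq (fun i => v i y) d)) f l.
  by rewrite sz.
rewrite (gen (fun l => b l *: v l y)) -[RHS]H; apply: eq_bigr => j _.
by rewrite /b valK nth_mkseq // -{2}sz.
Qed.

(* A new field is reduced modulo the frame, normalized on one of its nonzero
   coordinates, and that coordinate is cleared from the old frame. *)
Lemma frame_of_list x s : (forall i, (i < size s)%N -> smooth_near x (nth (fun=> 0) s i)) ->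
  exists d v c, [/\ forall i, (i < d)%N -> smooth_near x (v i),
    \forall y \near x, dual_at d v c y,
    forall i, (i < d)%N -> smod x s (v i) &
    forall i, (i < size s)%N -> in_frame d v x (nth (fun=> 0) s i x)].
Proof.
elim: s => [|u s IH] ss.
  by exists 0%N, (fun=> fun=> 0), (fun=> 0%N); split=> //; exact: near_W.
have [d [v [c [sv dv mv spv]]]] := IH (fun i si => ss i.+1 si).
have su : smooth_near x u := ss 0%N isT.
pose w y := u y - \sum_(i < d) entry (u y) (c i) *: v i y.
have sw : smooth_near x w.
  apply: (smooth_nearB su); apply: (smooth_near_ord (F := fun i y => entry (u y) (c i) *: v i y)) => i id.
  by apply: smooth_nearZ; [exact: (smooth_near_entry (c i) su)|exact: sv].
have wc y j : dual_at d v c y -> (j < d)%N -> entry (w y) (c j) = 0.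
  by move=> dy jd; rewrite entryB (dual_coord (fun i => entry (u y) (c i)) dy) // subrr.
have mw : smod x (u :: s) w.
  apply: smodB; first exact: (@smod_mem x (u :: s) 0).
  apply: (smod_sum (F := fun i y => entry (u y) (c i) *: v i y)) => i id.
  by apply: smodZ; [exact: (smooth_near_entry (c i) su)|exact/smod_cons/mv].
have [w0|/eqP w0] := eqVneq (w x) 0.
  exists d, v, c; split=> // [i id|[|i] si]; first exact/smod_cons/mv.
    exists (fun i => entry (u x) (c i)); apply/eqP; rewrite -subr_eq0; exact/eqP.
  exact: spv.
have [k wk] : exists k, entry (w x) k != 0.
  apply: contra_notP w0 => H; apply/rowP => j; rewrite [RHS]mxE -entry_ord.
  by have [//|jk] := eqVneq (entry (w x) j) 0; case: H; exists j.
have swk := smooth_near_entry k sw.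
pose h y := (entry (w y) k)^-1 *: w y.
have sh : smooth_near x h by exact: smooth_nearZ (smooth_nearV wk swk) sw.
have mh : smod x (u :: s) h by exact: smodZ (smooth_nearV wk swk) mw.
pose v' i := if (i < d)%N then (fun y => v i y - entry (v i y) k *: h y) else h.
pose c' i := if (i < d)%N then c i else k.
exists d.+1, v', c'; split.
- move=> i _; rewrite /v'; case: ifP => // id.
  by apply: smooth_nearB (sv i id) _; apply: smooth_nearZ sh; exact: (smooth_near_entry k (sv i id)).
- apply: near_imp2 dv (near_neq0 (smooth_near_continuous swk) wk) => y dy wky i j.
  have hk : entry (h y) k = 1 by rewrite entryZ mulVf.
  have hc l : (l < d)%N -> entry (h y) (c l) = 0 by move=> ld; rewrite entryZ wc // mulr0.
  rewrite !ltnS /v' /c' => ilt jlt.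
  case: (ltnP i d) => id; case: (ltnP j d) => jd.
  + by rewrite entryB entryZ hc // mulr0 subr0 dy.
  + rewrite entryB entryZ hk mulr1 subrr.
    by have -> : (i == j) = false by apply/negbTE; rewrite neq_ltn (leq_trans id jd).
  + rewrite hc //.
    by have -> : (i == j) = false by apply/negbTE; rewrite neq_ltn (leq_trans jd id) orbT.
  + have -> : i = d by apply/eqP; rewrite eqn_leq ilt.
    have -> : j = d by apply/eqP; rewrite eqn_leq jlt.
    by rewrite eqxx.
- move=> i _; rewrite /v'; case: ifP => // id.
  apply: smodB; first exact/smod_cons/mv.
  by apply: smodZ mh; exact: (smooth_near_entry k (sv i id)).
have inh : in_frame d.+1 v' x (h x).
  by have := @in_frame_mem d.+1 v' x d (ltnSn d); rewrite /v' ltnn.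
have inv i : (i < d)%N -> in_frame d.+1 v' x (v i x).
  move=> id; have := in_frameD (@in_frame_mem d.+1 v' x i (ltnW id)) (in_frameZ (entry (v i x) k) inh).
  by rewrite /v' id subrK.
have sub z : in_frame d v x z -> in_frame d.+1 v' x z.
  by move=> [b ->]; apply: in_frame_sum => i; apply: in_frameZ; exact: inv.
move=> [|i] si /=; last exact/sub/spv.
have -> : u x = entry (w x) k *: h x + \sum_(i < d) entry (u x) (c i) *: v i x.
  by rewrite /h scalerA mulfV // scale1r /w subrK.
apply: in_frameD; first exact: in_frameZ.
by apply: in_frame_sum => i; apply: in_frameZ; exact: inv.
Qed.

Definition nframe x D d v c := [/\ forall i, (i < d)%N -> smooth_near x (v i),
  \forall y \near x, dual_at d v c y &
  \forall y \near x, forall z, z \in D y <-> in_frame d v y z].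

(** Local existence of a smooth reduced frame. Constant dimension alone is weaker, since a field of
    subspaces need not be smooth. *)
Definition regular x D := exists d v c, nframe x D d v c.

Lemma smod_in x s w D : smod x s w ->
  (forall i, (i < size s)%N -> \forall y \near x, nth (fun=> 0) s i y \in D y) ->
  \forall y \near x, w y \in D y.
Proof.
move=> [a [_ wE]] sD; apply: near_imp2 wE (near_lt sD) => y -> H.
by apply: memv_suml => i _; apply: memvZ; exact: H.
Qed.

(** The reduced frame built from [s] stays independent and inside [D] nearby; at x it fills [D], and
    constancy of the dimension makes it fill [D] nearby. *)
Lemma frame_of x D s : (forall i, (i < size s)%N -> smooth_near x (nth (fun=> 0) s i)) ->
  (forall i, (i < size s)%N -> \forall y \near x, nth (fun=> 0) s i y \in D y) ->
  (D x <= <<evals s x>>)%VS -> loc_const_dim x D ->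
  exists d v c, nframe x D d v c /\ forall i, (i < d)%N -> smod x s (v i).
Proof.
move=> ss sD Dx cD; have [d [v [c [sv dv mv spv]]]] := frame_of_list ss.
exists d, v, c; split=> //; split=> //.
have vD : \forall y \near x, forall i, (i < d)%N -> v i y \in D y.
  by apply: near_lt => i id; exact: smod_in (mv i id) sD.
have subD y : (forall i, (i < d)%N -> v i y \in D y) -> (<<mkseq (fun i => v i y) d>> <= D y)%VS.
  by move=> H; apply/span_subvP => z /mapP[i]; rewrite mem_iota => /andP[_ id] ->; exact: H.
have dimx : \dim (D x) = d.
  rewrite -(dual_free (near_at dv)); apply/eqP; rewrite eqn_leq.
  apply/andP; split; apply: dimvS; last exact: subD (near_at vD).
  apply: subv_trans Dx _; apply/span_subvP => z /(nthP 0)[i].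
  rewrite size_map => si <-; rewrite evals_nth //; apply/in_frame_span; exact: spv.
apply: near_imp3 dv vD cD => y dy vy cy z; rewrite in_frame_span.
suff -> : <<mkseq (fun i => v i y) d>>%VS = D y by [].
by apply/eqP; rewrite eqEdim subD //= cy dimx (dual_free dy).
Qed.

Lemma nframe_dim x D d v c : nframe x D d v c -> \forall y \near x, \dim (D y) = d.
Proof.
move=> [sv dv Dv]; apply: near_imp2 dv Dv => y dy Dy; rewrite -[RHS](dual_free dy).
congr (\dim _); apply/eqP; rewrite eqEsubv; apply/andP; split; apply/subvP => z.
  by rewrite Dy in_frame_span.
by rewrite -in_frame_span -Dy.
Qed.

Lemma regular_dim x D : regular x D -> loc_const_dim x D.
Proof.
move=> [d [v [c /nframe_dim H]]]; have := near_at H => dx.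
by apply: near_imp H => y ->.
Qed.

Lemma nframe_near x D d v c : nframe x D d v c -> \forall y \near x, nframe y D d v c.
Proof.
move=> [sv dv Dv].
have sv' : \forall y \near x, forall i, (i < d)%N -> smooth_near y (v i).
  by apply: near_lt => i id; exact: smooth_near_near (sv i id).
by apply: near_imp3 sv' (near_near dv) (near_near Dv) => y ? ? ?; split.
Qed.

Lemma regular_near_pt x D : regular x D -> \forall y \near x, regular y D.
Proof.
move=> [d [v [c /nframe_near H]]]; apply: near_imp H => y Hy.
by exists d, v, c.
Qed.

Lemma nframe_section x D d v c w : nframe x D d v c -> section_near D x w ->
  \forall y \near x, w y = \sum_(i < d) entry (w y) (c i) *: v i y.
Proof.
by move=> [_ dv Dv] [_ wD]; apply: near_imp3 dv Dv wD => y dy Dy /Dy; exact: in_frameE.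
Qed.

Lemma nframe_mem x D d v c i : nframe x D d v c -> (i < d)%N -> section_near D x (v i).
Proof.
move=> [sv _ Dv] id; split; first exact: sv.
by apply: near_imp Dv => y Dy; apply/Dy; exact: in_frame_mem.
Qed.

Lemma section_through x D (z : V) : regular x D -> z \in D x -> exists w, section_near D x w /\ w x = z.
Proof.
move=> [d [v [c F]]]; have [sv dv Dv] := F => zD; have [b zE] := (near_at Dv z).1 zD.
exists (fun y => \sum_(i < d) b i *: v i y); split=> //; split.
  apply: (smooth_near_ord (F := fun i y => b i *: v i y)) => i id.
  by apply: smooth_nearZc; exact: sv.
by apply: near_imp Dv => y Dy; apply/Dy; exists b.
Qed.

Lemma section_near_near x D w : section_near D x w -> \forall y \near x, section_near D y w.
Proof. by move=> [sw wD]; apply: near_imp2 (smooth_near_near sw) (near_near wD) => y; split. Qed.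

Lemma regular_eq x D E : germ_eq x D E -> regular x D -> regular x E.
Proof.
move=> DE [d [v [c [sv dv Dv]]]]; exists d, v, c; split=> //.
by apply: near_imp2 DE Dv => y <-.
Qed.

End Frames.

Lemma near_and {T : topologicalType} (x : T) (P Q : T -> Prop) :
  (\forall y \near x, P y) -> (\forall y \near x, Q y) -> \forall y \near x, P y /\ Q y.
Proof. by apply: near_imp2 => y; split. Qed.

Lemma near_and3 {T : topologicalType} (x : T) (P Q S : T -> Prop) :
  (\forall y \near x, P y) -> (\forall y \near x, Q y) -> (\forall y \near x, S y) ->
  \forall y \near x, [/\ P y, Q y & S y].
Proof. by apply: near_imp3 => y; split. Qed.

Section BracketLeibniz.
Context {R : realType} {n : nat}.
Local Notation V := 'rV[R]_n.
Local Notation vf := (V -> V).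
Implicit Types (x y : V) (D E : tdistribution R n) (s t : seq vf) (a u w : vf).

Lemma derive_scale (f : V -> R) w (h : V) y : smooth_near y f -> smooth_near y w ->
  'D_h (fun z => f z *: w z) y = 'D_h f y *: w y + f y *: 'D_h w y.
Proof.
move=> sf sw; have sfw := smooth_nearZ sf sw.
apply/rowP => j; rewrite (derive_rV j (@smooth_near_derivable _ _ _ _ h _ sfw)).
have swj := smooth_near_coord j sw.
have -> : 'D_h (fun z => (f z *: w z) 0 j) y = 'D_h (fun z => f z * w z 0 j) y.
  by apply: near_eq_derive; apply: near_W => z; rewrite mxE.
have E : 'D_h (fun z => f z * w z 0 j) y = f y *: 'D_h (fun z => w z 0 j) y + w y 0 j *: 'D_h f y.
  by apply: (@deriveM _ _ f (fun z => w z 0 j)); exact: smooth_near_derivable.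
apply: etrans E _; rewrite -(derive_rV j (@smooth_near_derivable _ _ _ _ h _ sw)).
rewrite [RHS]mxE [X in _ = X + _]mxE [X in _ = _ + X]mxE addrC.
by congr (_ + _); exact: mulrC.
Qed.

Lemma derive_vsum (m : nat) (F : nat -> vf) (h : V) y : (forall i, (i < m)%N -> smooth_near y (F i)) ->
  'D_h (fun z => \sum_(i < m) F i z) y = \sum_(i < m) 'D_h (F i) y.
Proof.
elim: m => [|m IH] sF.
  rewrite big_ord0 -[RHS](derive_cst (0 : V) y h); apply: near_eq_derive.
  by apply: near_W => z; rewrite big_ord0.
have sF' i : (i < m)%N -> smooth_near y (F i) by move=> im; apply: sF; exact: ltnW.
have E : 'D_h (fun z => \sum_(i < m) F i z + F m z) y = 'D_h (fun z => \sum_(i < m) F i z) y + 'D_h (F m) y.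
  by apply: (@deriveD _ _ _ (fun z => \sum_(i < m) F i z) (F m));
    apply: smooth_near_derivable; [exact: smooth_near_ord|exact: sF].
rewrite big_ord_recr /= -IH // -E.
by apply: near_eq_derive; apply: near_W => z; rewrite big_ord_recr.
Qed.

Lemma bracket_comb a (m : nat) (f : nat -> V -> R) (v : nat -> vf) y : smooth_near y a ->
  (forall i, (i < m)%N -> smooth_near y (f i)) -> (forall i, (i < m)%N -> smooth_near y (v i)) ->
  lie_bracket a (fun z => \sum_(i < m) f i z *: v i z) y =
  \sum_(i < m) (lied a (f i) y *: v i y + f i y *: lie_bracket a (v i) y).
Proof.
move=> sa sf sv; rewrite /lie_bracket.
rewrite (derive_vsum (F := fun i z => f i z *: v i z)); last first.
  by move=> i im; apply: smooth_nearZ; [exact: sf|exact: sv].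
rewrite (derive_dir_sum _ _ _ (smooth_near_diff sa)) -sumrB; apply: eq_bigr => i _.
rewrite (derive_scale _ (sf i _) (sv i _)) // (derive_dirZ _ _ (smooth_near_diff sa)).
by rewrite scalerBr addrA.
Qed.

Lemma bracket_near_eq a w w' y : (\forall z \near y, w z = w' z) ->
  lie_bracket a w y = lie_bracket a w' y.
Proof. by move=> ww; rewrite /lie_bracket (near_eq_derive _ ww) (near_at ww). Qed.

(** By the Leibniz rule the generators and their brackets determine the brackets of all smooth
    combinations; this makes distributions defined by all local sections computable from finite
    lists. *)
Lemma smod_bracket x s a w (W : {vspace V}) : smooth_near x a ->
  (forall i, (i < size s)%N -> smooth_near x (nth (fun=> 0) s i)) -> smod x s w ->
  (forall i, (i < size s)%N -> nth (fun=> 0) s i x \in W) ->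
  (forall i, (i < size s)%N -> lie_bracket a (nth (fun=> 0) s i) x \in W) ->
  lie_bracket a w x \in W.
Proof.
move=> sa ss [b [sb wb]] sW bW; rewrite (bracket_near_eq _ wb).
rewrite (bracket_comb (v := fun i => nth (fun=> 0) s i)) //.
by apply: memv_suml => i _; apply: memvD; apply: memvZ; [exact: sW|exact: bW].
Qed.

End BracketLeibniz.

Section Generators.
Context {R : realType} {n : nat}.
Local Notation V := 'rV[R]_n.
Local Notation vf := (V -> V).
Implicit Types (x y : V) (D E : tdistribution R n) (s t : seq vf) (a u w : vf).

Definition gen x s D := (forall i, (i < size s)%N -> smooth_near x (nth (fun=> 0) s i)) /\
  \forall y \near x, D y = <<evals s y>>%VS.

Lemma gen_near x s D : gen x s D -> \forall y \near x, gen y s D.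
Proof.
move=> [ss Ds]; have ss' : \forall y \near x, forall i, (i < size s)%N -> smooth_near y (nth (fun=> 0) s i).
  by apply: near_lt => i si; exact: smooth_near_near (ss i si).
by apply: near_imp2 ss' (near_near Ds) => y; split.
Qed.

Lemma lcd_near x D : loc_const_dim x D -> \forall y \near x, loc_const_dim y D.
Proof.
move=> H; apply: near_imp2 H (near_near H) => y Hy; apply: near_imp => z ->.
by rewrite Hy.
Qed.

Lemma gen_mem x s D i : gen x s D -> (i < size s)%N -> section_near D x (nth (fun=> 0) s i).
Proof.
move=> [ss Ds] si; split; first exact: ss.
apply: near_imp Ds => y ->; rewrite -evals_nth //; apply/memv_span/mem_nth.
by rewrite size_map.
Qed.

Lemma gen_frame x s D : gen x s D -> loc_const_dim x D ->
  exists d v c, nframe x D d v c /\ forall i, (i < d)%N -> smod x s (v i).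
Proof.
move=> gD cD; have [ss Ds] := gD; apply: frame_of => //.
  by move=> i si; have [] := gen_mem gD si.
by rewrite (near_at Ds).
Qed.

Lemma gen_regular x s D : gen x s D -> loc_const_dim x D -> regular x D.
Proof. by move=> gD cD; have [d [v [c [F _]]]] := gen_frame gD cD; exists d, v, c. Qed.

Lemma nframe_gen x D d v c : nframe x D d v c -> gen x (mkseq v d) D.
Proof.
move=> [sv dv Dv]; split=> [i|]; rewrite ?size_mkseq.
  by move=> id; rewrite nth_mkseq //; exact: sv.
apply: near_imp Dv => y Dy.
have -> : evals (mkseq v d) y = mkseq (fun i => v i y) d by rewrite /evals -map_comp.
by apply/eqP; rewrite eqEsubv; apply/andP; split; apply/subvP => z; rewrite Dy in_frame_span.
Qed.

(** The coefficients are the selected entries in a reduced frame, hence smooth, and the frame fields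
    are combinations of the generators. *)
Lemma section_smod x s D w : gen x s D -> loc_const_dim x D -> section_near D x w -> smod x s w.
Proof.
move=> gD cD Dw; have [d [v [c [F mv]]]] := gen_frame gD cD.
have := nframe_section F Dw => wE.
apply: (@smod_near _ _ x s (fun y => \sum_(i < d) entry (w y) (c i) *: v i y)).
  by apply: near_imp wE => y <-.
apply: (smod_sum (F := fun i y => entry (w y) (c i) *: v i y)) => i id.
by apply: smodZ (mv i id); apply: smooth_near_entry; have [] := Dw.
Qed.

Lemma evals_sub s y (W : {vspace V}) : (forall i, (i < size s)%N -> nth (fun=> 0) s i y \in W) ->
  (<<evals s y>> <= W)%VS.
Proof.
move=> H; apply/span_subvP => z /(nthP 0)[i]; rewrite size_map => si <-.
by rewrite evals_nth //; exact: H.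
Qed.

Lemma mem_evals s y i : (i < size s)%N -> nth (fun=> 0) s i y \in <<evals s y>>%VS.
Proof. by move=> si; rewrite -evals_nth //; apply/memv_span/mem_nth; rewrite size_map. Qed.

Lemma evals_cat s t y : <<evals (s ++ t) y>>%VS = (<<evals s y>> + <<evals t y>>)%VS.
Proof. by rewrite /evals map_cat span_cat. Qed.

Lemma gen_bracket_vd x s D a : gen x s D -> loc_const_dim x D -> smooth_near x a ->
  gen x (s ++ [seq lie_bracket a u | u <- s]) (addd D (bracket_vd a D)).
Proof.
move=> gD cD sa; have [ss _] := gD; split=> [i|].
  rewrite size_cat size_map nth_cat => si; case: ltnP => ilt; first exact: ss.
  have isz : (i - size s < size s)%N by rewrite ltn_subLR.
  by rewrite (nth_map (fun=> 0)) //; apply: smooth_near_bracket sa (ss _ isz).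
apply: near_imp3 (gen_near gD) (lcd_near cD) (smooth_near_near sa) => y gy cy say.
have [ssy Ds] := gy; rewrite evals_cat /addd (near_at Ds).
apply/eqP; rewrite eqEsubv !subv_add !addvSl /=; apply/andP; split.
  apply: vspan_sub => _ [w Dw <-].
  apply: (smod_bracket say ssy (section_smod gy cy Dw)) => i si.
    by apply: subvP (addvSl _ _) _ (mem_evals y si).
  apply: subvP (addvSr _ _) _ _; have := @mem_evals [seq lie_bracket a u | u <- s] y i.
  by rewrite size_map (nth_map (fun=> 0)) //; exact.
apply: evals_sub => i; rewrite size_map => si; rewrite (nth_map (fun=> 0)) //.
apply: subvP (addvSr _ _) _ _; apply: mem_vspan.
by exists (nth (fun=> 0) s i) => //; exact: gen_mem gy si.
Qed.

(** Leibniz in the second argument leaves terms in [E], in the first argument terms in [D]; the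
    inclusion of [D] in [E] absorbs the latter. *)
Lemma gen_bracket_dd x s t D E : gen x s D -> loc_const_dim x D -> gen x t E -> loc_const_dim x E ->
  germ_le x D E ->
  gen x (t ++ [seq lie_bracket u w | u <- s, w <- t]) (addd E (bracket_dd D E)).
Proof.
move=> gD cD gE cE DE; set L := [seq lie_bracket u w | u <- s, w <- t].
have [ss _] := gD; have [st _] := gE.
have LP i : (i < size L)%N -> exists j k, [/\ (j < size s)%N, (k < size t)%N &
    nth (fun=> 0) L i = lie_bracket (nth (fun=> 0) s j) (nth (fun=> 0) t k)].
  rewrite /L; elim: s {ss gD L} i => [|u s IH] i //=; rewrite size_cat size_map nth_cat size_map => iL.
  have [it|it] := ltnP i (size t).
    by exists 0%N, i; split=> //; rewrite (nth_map (fun=> 0)).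
  have [|j [k [js kt E1]]] := IH (i - size t)%N; first by rewrite ltn_subLR.
  by exists j.+1, k; split.
have PL j k : (j < size s)%N -> (k < size t)%N -> exists2 i, (i < size L)%N &
    nth (fun=> 0) L i = lie_bracket (nth (fun=> 0) s j) (nth (fun=> 0) t k).
  rewrite /L; elim: s j {ss gD L LP} => [|u s IH] [|j] //= js kt.
    exists k; rewrite ?size_cat ?nth_cat size_map ?kt ?(nth_map (fun=> 0)) //.
    by rewrite ltn_addr.
  have [i iL E1] := IH j js kt; exists (size t + i)%N; first by rewrite size_cat size_map ltn_add2l.
  by rewrite nth_cat size_map ltnNge leq_addr /= addKn.
split=> [i|].
  rewrite size_cat nth_cat => si; case: ltnP => ilt; first exact: st.
  have [|j [k [js kt ->]]] := LP (i - size t)%N; first by rewrite ltn_subLR.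
  by apply: smooth_near_bracket; [exact: ss|exact: st].
have nDE := near_and (gen_near gD) (lcd_near cD).
have nE := near_and (gen_near gE) (lcd_near cE).
apply: near_imp3 nDE nE DE => y [gy cy] [hy dy] DEy.
have [ssy Ds] := gy; have [sty Es] := hy; rewrite evals_cat /addd (near_at Es).
apply/eqP; rewrite eqEsubv !subv_add !addvSl /=; apply/andP; split; last first.
  apply: evals_sub => i /LP[j [k [js kt ->]]]; apply: subvP (addvSr _ _) _ _; apply: mem_vspan.
  exists (nth (fun=> 0) s j), (nth (fun=> 0) t k); split=> //; [exact: gen_mem gy js|exact: gen_mem hy kt].
apply: vspan_sub => _ [u [w [Du Ew ->]]].
have [su _] := Du; have [sw _] := Ew.
have key j : (j < size s)%N -> lie_bracket w (nth (fun=> 0) s j) y \in (<<evals t y>> + <<evals L y>>)%VS.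
  move=> js; rewrite bracketN memvN.
  apply: (smod_bracket (ssy j js) sty (section_smod hy dy Ew)) => k kt.
    exact: subvP (addvSl _ _) _ (mem_evals y kt).
  apply: subvP (addvSr _ _) _ _; have [i iL <-] := PL j k js kt; exact: mem_evals.
rewrite bracketN memvN; apply: (smod_bracket sw ssy (section_smod gy cy Du)) => j js; last exact: key.
apply: subvP (addvSl _ _) _ _; rewrite -(near_at Es); apply: subvP DEy _ _.
by rewrite (near_at Ds); exact: mem_evals.
Qed.

(** Finitely many characteristic fields span at x. They remain characteristic at nearby points, so
    [frame_of] applies to them. *)
Lemma regular_cauchy x D : loc_const_dim x (cauchy_char D) -> regular x (cauchy_char D).
Proof.
move=> cC; have [s [sS sE]] := vspan_seq [set z | exists w, [/\ section_near D x w,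
    \forall y \near x, (bracket_vd w D y <= D y)%VS & z = w x]].
have wex i : exists w, (i < size s)%N -> [/\ section_near D x w,
    \forall y \near x, (bracket_vd w D y <= D y)%VS & s`_i = w x].
  have [si|si] := ltnP i (size s); last by exists (fun=> 0).
  by have [w Hw] := sS _ (mem_nth 0 si); exists w.
pose W i := sval (cid (wex i)).
have WP i : (i < size s)%N -> [/\ section_near D x (W i),
    \forall y \near x, (bracket_vd (W i) D y <= D y)%VS & s`_i = W i x] by exact: (svalP (cid (wex i))).
have nW i : (i < size s)%N -> nth (fun=> 0) (mkseq W (size s)) i = W i by move=> si; rewrite nth_mkseq.
have [|||d [v [c [F _]]]] := @frame_of R n x (cauchy_char D) (mkseq W (size s)) _ _ _ cC.
- by move=> i; rewrite size_mkseq => si; rewrite nW //; have [[]] := WP i si.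
- move=> i; rewrite size_mkseq => si; rewrite nW //; have [Dw bw _] := WP i si.
  apply: near_imp2 (section_near_near Dw) (near_near bw) => y Dwy bwy.
  by apply: mem_vspan; exists (W i).
- rewrite /cauchy_char sE; apply/span_subvP => z /(nthP 0)[i si <-].
  have [_ _ ->] := WP i si; rewrite -(nW i si); apply: mem_evals.
  by rewrite size_mkseq.
by exists d, v, c.
Qed.

End Generators.

Section Frobenius.
Context {R : realType} {n : nat}.
Local Notation V := 'rV[R]_n.
Implicit Types (x y : V) (D : tdistribution R n).

Definition dotp (l z : V) : R := \sum_j l 0 j * z 0 j.

Lemma dotpD l z z' : dotp l (z + z') = dotp l z + dotp l z'.
Proof. by rewrite -big_split; apply: eq_bigr => j _; rewrite mxE mulrDr. Qed.

Lemma dotpZ l (b : R) z : dotp l (b *: z) = b * dotp l z.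
Proof. by rewrite mulr_sumr; apply: eq_bigr => j _; rewrite mxE mulrCA. Qed.

Lemma dotpB l z z' : dotp l (z - z') = dotp l z - dotp l z'.
Proof. by rewrite dotpD -scaleN1r dotpZ mulN1r. Qed.

Lemma smooth_near_dotp x l (w : V -> V) : smooth_near x w -> smooth_near x (fun y => dotp l (w y)).
Proof.
move=> sw; apply: smooth_near_sum => j _ _.
by apply: smooth_nearM; [exact: smooth_near_cst|exact: smooth_near_coord].
Qed.

Lemma derive_dotp x l (w : V -> V) h : smooth_near x w ->
  'D_h (fun y => dotp l (w y)) x = dotp l ('D_h w x).
Proof.
move=> sw; have sid := smooth_near_dotp l (smooth_near_id (w x)).
have E := derive_comp h (smooth_near_diff sw) (smooth_near_diff sid).
apply: etrans E _; set k := 'D_h w x.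
rewrite (derive_rVE k (smooth_near_diff sid)) /dotp; apply: eq_bigr => j _.
have dc (i : 'I_n) : differentiable (fun y : V => l 0 i * y 0 i) (w x).
  by apply: smooth_near_diff; apply: smooth_nearM; [exact: smooth_near_cst|exact: smooth_near_coord (smooth_near_id _)].
have -> : (fun y : V => \sum_j l 0 j * y 0 j) = \sum_i (fun y : V => l 0 i * y 0 i).
  by apply/funext => y; rewrite fct_sumE.
rewrite derive_sum; last by move=> i; exact: diff_derivable.
rewrite (bigD1 j) //= big1 => [|i ij].
  have E2 := @deriveMl _ _ (fun y : V => y 0 j) (l 0 j) (w x) (delta_mx 0 j)
     (smooth_near_derivable (smooth_near_coord j (smooth_near_id (w x)))).
  rewrite addr0; have -> : 'D_(delta_mx 0 j) (fun y : V => l 0 j * y 0 j) (w x) = l 0 j * 1.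
    by apply: etrans E2 _; rewrite derive_coord mxE !eqxx.
  by rewrite mulr1; exact: mulrC.
have E2 := @deriveMl _ _ (fun y : V => y 0 i) (l 0 i) (w x) (delta_mx 0 j)
   (smooth_near_derivable (smooth_near_coord i (smooth_near_id (w x)))).
by apply: etrans E2 _; rewrite derive_coord mxE (negbTE ij) andbF mulr0.
Qed.

(** In a reduced frame of an involutive [D] all brackets vanish: they lie in [D], and their selected
    entries are derivatives of constants. The projections along the frame fields are composed; the
    composite P is constant along [D] and its derivative at x is the identity modulo [D x], so l
    composed with P has the differential l there. *)
Theorem frobenius x D l : regular x D -> germ_involutive x D -> (forall z, z \in D x -> dotp l z = 0) ->
  exists phi : V -> R, [/\ smooth_near x phi,
    \forall y \near x, forall z, z \in D y -> 'D_z phi y = 0 &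
    forall h, 'D_h phi x = dotp l h].
Proof.
move=> [d [v [c F]]] inv lD; have [sv dv Dv] := F.
have lv i : (i < d)%N -> dotp l (v i x) = 0.
  by move=> id; apply: lD; have [_ /near_at] := nframe_mem F id.
have comm i j : (i < d)%N -> (j < d)%N -> \forall y \near x, lie_bracket (v i) (v j) y = 0.
  move=> id jd.
  have svi := smooth_near_near (sv i id); have svj := smooth_near_near (sv j jd).
  have n1 := near_and svi svj.
  have n2 := near_and (section_near_near (nframe_mem F id)) (section_near_near (nframe_mem F jd)).
  have n3 := near_and3 inv Dv (near_near dv).
  apply: near_imp3 n1 n2 n3 => y [siy sjy] [Diy Djy] [invy Dvy dvy].
  have : lie_bracket (v i) (v j) y \in D y.
    by apply: (subvP invy); apply: mem_vspan; exists (v i), (v j).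
  move=> /Dvy /(in_frameE (near_at dvy)) ->; apply: big1 => k _.
  suff -> : entry (lie_bracket (v i) (v j) y) (c k) = 0 by rewrite scale0r.
  rewrite /entry; case: insubP => [ck _ ckE|//].
  have cst m (b : R) : (m < d)%N -> (\forall z \near y, entry (v m z) (c k) = b) -> forall u, 'D_u (fun z => v m z 0 ck) y = 0.
    move=> md H u; rewrite -(derive_cst b y u); apply: near_eq_derive.
    by apply: near_imp H => z <-; rewrite -ckE entry_ord.
  rewrite bracket_coord // /lied.
  rewrite (cst j (j == k)%:R jd) ?(cst i (i == k)%:R id) ?subrr //.
    by apply: near_imp dvy => z /(_ i k id (ltn_ord k)).
  by apply: near_imp dvy => z /(_ j k jd (ltn_ord k)).
(* After k projections the first k frame fields are annihilated, while the others are still mapped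
   to themselves, which the next projection needs. *)
have step k : (k <= d)%N -> exists P : V -> V, [/\ smooth_near x P, P x = x,
    forall i, (i < k)%N -> \forall y \near x, 'D_(v i y) P y = 0,
    forall i, (k <= i < d)%N -> \forall y \near x, 'D_(v i y) P y = v i (P y) &
    forall h, dotp l ('D_h P x) = dotp l h].
  elim: k => [|k IH] kd.
    exists id; split=> // [|i _|h]; first exact: smooth_near_id.
      by apply: near_W => y; rewrite derive_id.
    by rewrite derive_id.
  have [P [sP Px P0 Pv Pl]] := IH (ltnW kd).
  have [ck ckE] : exists ck : 'I_n, c k = ck.
    have := near_at dv k k kd kd; rewrite eqxx /entry; case: insubP => [ck _ ckE _|_ /eqP].
      by exists ck.
    by rewrite eq_sym oner_eq0.
  have vck : \forall y \near x, v k y 0 ck = 1.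
    by apply: near_imp dv => y /(_ k k kd kd); rewrite ckE entry_ord eqxx.
  have [pi [spi pix piv pil piw]] := flow_projection (sv k kd) vck.
  have sPx : smooth_near (P x) pi by rewrite Px.
  have nP (Q : V -> Prop) : (\forall y \near x, Q y) -> \forall y \near x, Q (P y).
    by move=> nQ; apply: (near_comp (smooth_near_continuous sP)); rewrite Px.
  have dcomp : \forall y \near x, forall h, 'D_h (fun y => pi (P y)) y = 'D_('D_h P y) pi (P y).
    apply: near_imp2 (smooth_near_near sP) (nP _ (smooth_near_near spi)) => y sPy spiy h.
    exact: (derive_comp h (smooth_near_diff sPy) (smooth_near_diff spiy)).
  exists (fun y => pi (P y)); split.
  - exact: smooth_near_comp_rV sP sPx.
  - by rewrite Px.
  - move=> i; rewrite ltnS leq_eqVlt => /orP[/eqP ->|ik].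
      apply: near_imp3 dcomp (Pv k _) (nP _ piv) => [y -> -> //|].
      by rewrite leqnn.
    by apply: near_imp2 dcomp (P0 i ik) => y -> ->; rewrite derive0.
  - move=> i /andP[ki id].
    have wc : \forall y \near x, v i y 0 ck = 0.
      apply: near_imp dv => y /(_ i k id kd); rewrite ckE entry_ord => ->.
      by rewrite (gtn_eqF ki).
    apply: near_imp3 dcomp (Pv i _) (nP _ (piw (v i) (sv i id) (comm k i kd id) wc)) => [y -> -> //|].
    by rewrite id (ltnW ki).
  - move=> h; rewrite (near_at dcomp) Px pil dotpB dotpZ lv // mulr0 subr0.
    exact: Pl.
have [P [sP Px P0 _ Pl]] := step d (leqnn d).
exists (fun y => dotp l (P y)); split.
- exact: smooth_near_dotp.
- apply: near_imp3 Dv (near_lt P0) (smooth_near_near sP) => y Dy P0y sPy z /Dy[b ->].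
  rewrite (derive_dotp l _ sPy) (derive_dir_sum _ _ _ (smooth_near_diff sPy)).
  rewrite big1 => [|i _]; first by rewrite -(scale0r (0 : V)) dotpZ mul0r.
  by rewrite (derive_dirZ _ _ (smooth_near_diff sPy)) P0y // scaler0.
- by move=> h; rewrite (derive_dotp l h sP) Pl.
Qed.

End Frobenius.

(** * Functions with independent differentials, and drift chains *)

Section Functionals.
Context {R : realType} {n : nat}.
Local Notation V := 'rV[R]_n.
Implicit Types (x y z : V) (A B : {vspace V}) (f : nat -> V -> R).

Lemma vspan_linear (S : set V) (L : V -> R) : (forall v w, L (v + w) = L v + L w) ->
  (forall b v, L (b *: v) = b * L v) -> (forall v, S v -> L v = 0) -> forall z, z \in vspan S -> L z = 0.
Proof.
move=> LD LZ LS z; have [s [sS ->]] := vspan_seq S => /mem_spanP[b ->].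
have L0 : L 0 = 0 by rewrite -(scale0r (0 : V)) LZ mul0r.
rewrite (big_morph L LD L0) big1 // => i _.
by rewrite LZ LS ?mulr0 //; apply: sS; exact: mem_nth.
Qed.

Lemma linear_dotp (L : V -> R) : (forall v w, L (v + w) = L v + L w) ->
  (forall b v, L (b *: v) = b * L v) -> exists l, forall z, dotp l z = L z.
Proof.
move=> LD LZ; exists (\row_j L (delta_mx 0 j)) => z.
have L0 : L 0 = 0 by rewrite -(scale0r (0 : V)) LZ mul0r.
rewrite [in RHS](row_sumE z) (big_morph L LD L0); apply: eq_bigr => j _.
by rewrite mxE LZ mulrC.
Qed.

Lemma separation A z : z \notin A -> exists l, dotp l z = 1 /\ forall w, w \in A -> dotp l w = 0.
Proof.
move=> zA; pose s : seq (V -> V) := [seq (fun=> w) | w <- vbasis A].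
have [|d [v [c [_ /near_at dv mv spv]]]] := @frame_of_list R n 0 s.
  by move=> i; rewrite size_map => si; rewrite (nth_map 0) //; exact: smooth_near_cst.
pose res w := w - \sum_(i < d) entry w (c i) *: v i 0.
have resD w w' : res (w + w') = res w + res w'.
  rewrite /res addrACA -opprD -big_split /=; congr (_ - _); apply: eq_bigr => i _.
  by rewrite entryD scalerDl.
have resZ b w : res (b *: w) = b *: res w.
  rewrite /res scalerBr scaler_sumr; congr (_ - _); apply: eq_bigr => i _.
  by rewrite entryZ scalerA.
have res0 w : in_frame d v 0 w -> res w = 0 by move=> /(in_frameE dv) wE; rewrite /res -wE subrr.
have spA w : w \in A -> in_frame d v 0 w.
  move=> wA; have : w \in <<vbasis A>>%VS by rewrite (span_basis (vbasisP A)).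
  move=> /mem_spanP[b ->]; apply: in_frame_sum => i; apply: in_frameZ.
  have := spv i; rewrite size_map (nth_map 0) //; exact.
have vA i : (i < d)%N -> v i 0 \in A.
  move=> id; have [b [_ /near_at ->]] := mv i id; apply: memv_suml => j _; apply: memvZ.
  move: (nat_of_ord j) (ltn_ord j) => k; rewrite size_map => ks; rewrite (nth_map 0) //.
  by apply: vbasis_mem; exact: mem_nth.
have rz : res z != 0.
  apply: contra zA => /eqP; rewrite /res => /eqP; rewrite subr_eq0 => /eqP ->.
  by apply: memv_suml => i _; apply: memvZ; exact: vA.
have [k rk] : exists k, entry (res z) k != 0.
  move/eqP: rz; apply: contra_notP => H; apply/rowP => j; rewrite [RHS]mxE -entry_ord.
  by have [//|jk] := eqVneq (entry (res z) j) 0; case: H; exists j.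
have [||l lE] := @linear_dotp (fun w => (entry (res z) k)^-1 * entry (res w) k).
- by move=> w w'; rewrite resD entryD mulrDr.
- by move=> b w; rewrite resZ entryZ mulrCA.
exists l; split=> [|w /spA/res0 w0]; first by rewrite lE mulVf.
by rewrite lE w0 entry0 mulr0.
Qed.

Definition dindep x B f (m : nat) := forall c : nat -> R,
  (forall z, z \in B -> \sum_(j < m) c j * 'D_z (f j) x = 0) -> forall j, (j < m)%N -> c j = 0.

Definition kills x (D : tdistribution R n) (g : V -> R) :=
  \forall y \near x, forall z, z \in D y -> 'D_z g y = 0.

End Functionals.

Section FunctionalDim.
Context {R : realType} {n : nat}.
Local Notation V := 'rV[R]_n.
Implicit Types (x y z : V) (A B : {vspace V}) (f : nat -> V -> R).

(** Independence makes the joint differential map [B] onto the space of m-tuples, since a covector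
    vanishing on its image would be a relation. The rest is rank plus nullity. *)
Lemma dindep_dim x B f m : (forall j, (j < m)%N -> smooth_near x (f j)) -> dindep x B f m ->
  exists K : {vspace V}, (forall z, z \in K <-> z \in B /\ forall j, (j < m)%N -> 'D_z (f j) x = 0) /\
    (\dim K + m = \dim B)%N.
Proof.
move=> sf ind.
pose M : 'M[R]_(n, m) := \matrix_(i, j) 'D_(delta_mx 0 i) (f j) x.
pose g := linfun (mulmxr M : V -> 'rV[R]_m).
have gE z j : g z 0 j = 'D_z (f j) x.
  rewrite lfunE /= mxE (derive_rVE z (smooth_near_diff (sf j (ltn_ord j)))).
  by apply: eq_bigr => i _; rewrite mxE.
exists (B :&: lker g)%VS; split=> [z|].
  rewrite memv_cap memv_ker; split=> [/andP[zB /eqP g0]|[zB H]].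
    by split=> // j jm; rewrite -(gE z (Ordinal jm)) g0 mxE.
  by rewrite zB /=; apply/eqP/rowP => j; rewrite gE H // mxE.
rewrite -(limg_ker_dim g B); congr addn.
have -> : (g @: B)%VS = fullv.
  apply/eqP; rewrite eqEsubv subvf; apply/subvP => w _; apply: contraT => wB.
  have [l [lw lB]] := separation wB.
  pose c j := if insub j is Some k then l 0 k else 0 : R.
  have c0 : forall j, (j < m)%N -> c j = 0.
    apply: ind => z zB; apply: etrans _ (lB (g z) (memv_img g zB)).
    by apply: eq_bigr => j _; rewrite /c valK gE.
  have : dotp l w = 0.
    by apply: big1 => j _; have := c0 j (ltn_ord j); rewrite /c valK => ->; rewrite mul0r.
  by move=> l0; move: lw; rewrite l0 => /eqP; rewrite eq_sym oner_eq0.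
by rewrite dimvf /dim /= mul1n.
Qed.

Lemma dindep_le x A B f m : (forall j, (j < m)%N -> smooth_near x (f j)) -> dindep x B f m ->
  (A <= B)%VS -> (forall z j, z \in A -> (j < m)%N -> 'D_z (f j) x = 0) -> (\dim A + m <= \dim B)%N.
Proof.
move=> sf ind AB fA; have [K [KP <-]] := dindep_dim sf ind.
rewrite leq_add2r; apply: dimvS; apply/subvP => z zA; apply/KP; split; first exact: subvP AB _ zA.
by move=> j jm; exact: fA.
Qed.

Lemma dindep_ker x A B f m : (forall j, (j < m)%N -> smooth_near x (f j)) -> dindep x B f m ->
  (A <= B)%VS -> (forall z j, z \in A -> (j < m)%N -> 'D_z (f j) x = 0) -> (\dim B <= \dim A + m)%N ->
  forall z, z \in B -> (forall j, (j < m)%N -> 'D_z (f j) x = 0) -> z \in A.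
Proof.
move=> sf ind AB fA dA z zB z0; have [K [KP dK]] := dindep_dim sf ind.
suff -> : A = K by apply/KP.
apply/eqP; rewrite eqEdim; apply/andP; split.
  apply/subvP => w wA; apply/KP; split; first exact: subvP AB _ wA.
  by move=> j jm; exact: fA.
by rewrite -(leq_add2r m) dK.
Qed.

Lemma corank1 A B z : (A <= B)%VS -> (\dim B <= \dim A + 1)%N -> z \in B -> z \notin A ->
  forall w, w \in B -> exists c, w - c *: z \in A.
Proof.
move=> AB dAB zB zA w wB.
have E : (A + <[z]>)%VS = B.
  apply/eqP; rewrite eqEdim subv_add AB -memvE zB /=; apply: leq_trans dAB _.
  rewrite addn1; have : (A <= A + <[z]>)%VS by exact: addvSl.
  move=> /dimv_leqif_sup [_ H]; rewrite ltn_neqAle dimvS ?addvSl // andbT H.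
  by apply: contra zA => /subvP; apply; rewrite memvE addvSr.
move: wB; rewrite -E => /memv_addP[u uA [_ /vlineP[c ->] ->]].
by exists c; rewrite addrK.
Qed.

End FunctionalDim.

Section Chains.
Context {R : realType} {n : nat}.
Local Notation V := 'rV[R]_n.
Implicit Types (x y z : V) (A B C : tdistribution R n) (a : V -> V) (f : nat -> V -> R).

Lemma kills_section x D (g : V -> R) w : kills x D g -> section_near D x w ->
  \forall y \near x, lied w g y = 0.
Proof. by move=> kg [_ wD]; apply: near_imp2 kg wD => y H wy; exact: H. Qed.

Lemma kills_near x D (g : V -> R) : kills x D g -> \forall y \near x, kills y D g.
Proof. exact: near_near. Qed.

(** The mixed term vanishes because the derivative along [w] is constant. The resulting duality
    between brackets with the drift and drift derivatives of functions drives all chain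
    arguments. *)
Lemma bracket_kill x a w g (c : R) : smooth_near x a -> smooth_near x w -> smooth_near x g ->
  (\forall y \near x, lied w g y = c) -> lied w (lied a g) x = - lied (lie_bracket a w) g x.
Proof.
move=> sa sw sg wg; rewrite lied_bracket //.
have -> : lied a (lied w g) x = 0.
  by rewrite -(lied_cst a c x); exact: near_eq_derive.
by rewrite sub0r opprK.
Qed.

Lemma chain_kills x A B a g : smooth_near x a -> smooth_near x g -> regular x B ->
  germ_le x (bracket_vd a B) A -> germ_le x B A -> kills x A g -> kills x B (lied a g).
Proof.
move=> sa sg rB bA BA kg.
have n1 := near_and3 (smooth_near_near sa) (smooth_near_near sg) (regular_near_pt rB).
have n2 := near_and3 bA BA (near_near kg).
have n3 := near_near BA.
apply: near_imp3 n1 n2 n3 => y [say sgy rBy] [bAy BAy kgy] nBA z zB.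
have [w [Dw <-]] := section_through rBy zB.
have wg0 : \forall y' \near y, lied w g y' = 0.
  have [_ wD] := Dw; apply: near_imp3 kgy nBA wD => y' H1 H2 H3; apply: H1; exact: subvP H2 _ H3.
have [sw _] := Dw.
have := bracket_kill say sw sgy wg0; rewrite /lied => ->.
apply/eqP; rewrite oppr_eq0; apply/eqP; apply: (near_at kgy).
by apply: (subvP bAy); apply: mem_vspan; exists w.
Qed.

(** By [bracket_kill] a relation between the drift derivatives on [A] is a relation between the df_j
    on [a, A]; on [A] the df_j vanish anyway, so it is a relation on [C]. *)
Lemma chain_indep x A C a f m : smooth_near x a -> (forall j, (j < m)%N -> smooth_near x (f j)) ->
  (C x <= A x + bracket_vd a A x)%VS -> (forall j, (j < m)%N -> kills x A (f j)) ->
  regular x A -> dindep x (C x) f m -> dindep x (A x) (fun j => lied a (f j)) m.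
Proof.
move=> sa sf CA kf rA ind c cA; apply: ind.
pose L z := \sum_(j < m) c j * 'D_z (f j) x.
have LD v w : L (v + w) = L v + L w.
  rewrite /L -big_split; apply: eq_bigr => j _.
  by rewrite (derive_dirD v w (smooth_near_diff (sf j (ltn_ord j)))) mulrDr.
have LZ b v : L (b *: v) = b * L v.
  rewrite /L mulr_sumr; apply: eq_bigr => j _.
  rewrite (derive_dirZ b v (smooth_near_diff (sf j (ltn_ord j)))); exact: mulrCA.
have LA z : z \in A x -> L z = 0.
  by move=> zA; apply: big1 => j _; rewrite (near_at (kf j (ltn_ord j))) ?mulr0.
have Lb : forall z, z \in bracket_vd a A x -> L z = 0.
  apply: vspan_linear => // _ [w Dw <-]; have [sw wD] := Dw.
  apply/eqP; rewrite -oppr_eq0; apply/eqP; rewrite -(cA (w x) (near_at wD)) -sumrN.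
  apply: eq_bigr => j _; rewrite -mulrN; congr (_ * _).
  exact: (esym (bracket_kill sa sw (sf j (ltn_ord j)) (kills_section (kf j (ltn_ord j)) Dw))).
move=> z zC; have /memv_addP[u uA [w wb ->]] := subvP CA _ zC.
by apply: etrans (LD u w) _; rewrite LA // Lb // addr0.
Qed.

(** While the common kernel in [A0] exceeds [B x], a vector of it outside [B x] is separated from
    [B x] by a covector, which Frobenius realizes by a first integral of [B]. There cannot be more
    independent functions than the dimension of [A0], which ends the process. *)
Lemma dindep_extend x B (A0 : {vspace V}) f m : regular x B -> germ_involutive x B -> (B x <= A0)%VS ->
  (forall j, (j < m)%N -> smooth_near x (f j)) -> (forall j, (j < m)%N -> kills x B (f j)) ->
  dindep x A0 f m ->
  exists m' f', [/\ (m <= m')%N, forall j, (j < m)%N -> f' j = f j,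
    forall j, (j < m')%N -> smooth_near x (f' j) /\ kills x B (f' j), dindep x A0 f' m' &
    forall z, z \in A0 -> (forall j, (j < m')%N -> 'D_z (f' j) x = 0) -> z \in B x].
Proof.
move=> rB iB BA; have [k] : exists k, (\dim A0 < m + k)%N by exists (\dim A0).+1; rewrite addnS ltnS leq_addl.
elim: k m f => [|k IH] m f dk sf kf ind.
  have := dindep_le sf ind (sub0v A0); rewrite dimv0 add0n => H.
  exfalso; move: dk; rewrite addn0 ltnNge => /negP; apply; apply: H => w j.
  by rewrite memv0 => /eqP -> _; rewrite derive0.
have [H|/existsNP[z /not_implyP[zA /not_implyP[z0 /negP zB]]]] :=
  pselect (forall z, z \in A0 -> (forall j, (j < m)%N -> 'D_z (f j) x = 0) -> z \in B x).
  by exists m, f; split=> // j jm; split; [exact: sf|exact: kf].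
have [l [lz lB]] := separation zB; have [phi [sphi kphi dphi]] := frobenius rB iB lB.
pose f' j := if (j < m)%N then f j else phi.
have sf' j : (j < m.+1)%N -> smooth_near x (f' j).
  by rewrite /f'; case: ifP => // jm _; exact: sf.
have kf' j : (j < m.+1)%N -> kills x B (f' j).
  by rewrite /f'; case: ifP => // jm _; exact: kf.
have f'm : f' m = phi by rewrite /f' ltnn.
have f'E j : (j < m)%N -> f' j = f j by rewrite /f' => ->.
have sumE (c : nat -> R) w : \sum_(j < m.+1) c j * 'D_w (f' j) x =
    \sum_(j < m) c j * 'D_w (f j) x + c m * 'D_w phi x.
  rewrite big_ord_recr /= f'm; congr (_ + _); apply: eq_bigr => j _.
  by rewrite (f'E j (ltn_ord j)).
have ind' : dindep x A0 f' m.+1.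
  move=> c cA; have cm : c m = 0.
    have := cA z zA; rewrite sumE big1 ?add0r ?dphi ?lz ?mulr1 // => j _.
    by rewrite z0 ?mulr0.
  move=> j; rewrite ltnS leq_eqVlt => /orP[/eqP -> //|jm]; apply: (ind c) => // w wA.
  by have := cA w wA; rewrite sumE cm mul0r addr0.
have [|m' [g [mm' gE sg ig Hg]]] := IH m.+1 f' _ sf' kf' ind'.
  by rewrite addSnnS.
exists m', g; split=> //; first exact: ltnW.
by move=> j jm; rewrite gE ?ltnS ?(ltnW jm) // f'E.
Qed.

(** Downward induction: functions constant along G_(b+1) and independent on G_(b+2) have drift
    derivatives constant along G_b and independent on G_(b+1); first integrals of G_b complete these
    and start new chains. The length l_j counts the levels since chain j was started. *)
Lemma drift_chains x a (G : nat -> tdistribution R n) (s : nat) : smooth_near x a ->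
  (forall i, (i <= s)%N -> regular x (G i)) -> (forall i, (i <= s)%N -> germ_involutive x (G i)) ->
  (forall i, germ_eq x (G i.+1) (addd (G i) (bracket_vd a (G i)))) -> germ_full x (G s) ->
  exists m (phi : nat -> V -> R) (l : nat -> nat),
    [/\ forall j, (j < m)%N -> smooth_near x (phi j) /\ (0 < l j)%N,
        forall j k, (j < m)%N -> (k < l j)%N -> kills x (G 0%N) (iter k (lied a) (phi j)),
        forall z, (forall j k, (j < m)%N -> (k < l j)%N -> 'D_z (iter k (lied a) (phi j)) x = 0) ->
          z \in G 0%N x,
        dindep x (G 1%N x) (fun j => iter (l j).-1 (lied a) (phi j)) m &
        (\dim (G 0%N x) + \sum_(j < m) l j = n)%N /\ (\dim (G 0%N x) + m = \dim (G 1%N x))%N].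
Proof.
move=> sa rG iG GS Gs.
have siter k (g : V -> R) : smooth_near x g -> smooth_near x (iter k (lied a) g).
  by move=> sg; elim: k => // k IH; exact: smooth_near_lied.
suff H i : (i <= s)%N -> exists m (phi : nat -> V -> R) (l : nat -> nat),
    [/\ forall j, (j < m)%N -> smooth_near x (phi j) /\ (0 < l j)%N,
        forall j k, (j < m)%N -> (k < l j)%N -> kills x (G (s - i)%N) (iter k (lied a) (phi j)),
        forall z, (forall j k, (j < m)%N -> (k < l j)%N -> 'D_z (iter k (lied a) (phi j)) x = 0) ->
          z \in G (s - i)%N x,
        dindep x (G (s - i).+1 x) (fun j => iter (l j).-1 (lied a) (phi j)) m &
        (\dim (G (s - i)%N x) + \sum_(j < m) l j = n)%N /\
        (\dim (G (s - i)%N x) + m = \dim (G (s - i).+1 x))%N].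
  by have := H s (leqnn s); rewrite subnn.
elim: i => [|i IH] is_.
  exists 0%N, (fun=> fun=> 0), (fun=> 1%N); split=> // [z _|].
    by rewrite subn0 (near_at Gs) memvf.
  rewrite subn0 (near_at (GS s)) /addd (near_at Gs) big_ord0 !addn0 (addv_idPl (subvf _)).
  by rewrite dimvf /= /dim /= mul1n.
have [m [phi [l [sphi kphi zphi iphi [dphi _]]]]] := IH (ltnW is_).
set b := (s - i.+1)%N; have bS : (s - i)%N = b.+1 by rewrite /b subnSK.
rewrite bS in kphi zphi iphi dphi.
have bs : (b.+1 <= s)%N by rewrite -bS leq_subr.
have rB := rG b (ltnW bs); have rA := rG b.+1 bs.
have BA : germ_le x (G b) (G b.+1).
  by apply: near_imp (GS b) => y ->; exact: addvSl.
have bA : germ_le x (bracket_vd a (G b)) (G b.+1).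
  by apply: near_imp (GS b) => y ->; exact: addvSr.
have CA : (G b.+2 x <= G b.+1 x + bracket_vd a (G b.+1) x)%VS by rewrite (near_at (GS b.+1)).
pose top j := iter (l j).-1 (lied a) (phi j).
have stop j : (j < m)%N -> smooth_near x (top j) by move=> /sphi[? _]; exact: siter.
have ktop j : (j < m)%N -> kills x (G b.+1) (top j).
  by move=> jm; apply: kphi => //; have [_] := sphi j jm; case: (l j) => // k _ /=.
have ytop j : (j < m)%N -> iter (l j) (lied a) (phi j) = lied a (top j).
  by move=> jm; rewrite /top; have [_] := sphi j jm; case: (l j).
have ky j : (j < m)%N -> kills x (G b) (lied a (top j)).
  by move=> jm; apply: (chain_kills sa (stop j jm) rB bA BA); exact: ktop.
have iy := chain_indep sa stop CA ktop rA iphi.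
have sy j : (j < m)%N -> smooth_near x (lied a (top j)) by move=> jm; exact: smooth_near_lied sa (stop j jm).
have [m' [f' [mm' f'E sf' if' zf']]] := dindep_extend rB (iG b (ltnW bs)) (near_at BA) sy ky iy.
exists m', (fun j => if (j < m)%N then phi j else f' j), (fun j => if (j < m)%N then (l j).+1 else 1%N).
split.
- move=> j jm'; case: ifP => [jm|_]; last by split=> //; have [] := sf' j jm'.
  by split=> //; have [] := sphi j jm.
- move=> j k jm'; case: ifP => [jm|_]; last by case: k => // _; have [] := sf' j jm'.
  rewrite ltnS leq_eqVlt => /orP[/eqP ->|kl]; first by rewrite ytop //; exact: ky.
  have := kphi j k jm kl; apply: near_imp2 BA => y H1 H2 z zB; apply: H2; exact: subvP H1 _ zB.
- move=> z Hz; apply: zf'.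
    apply: zphi => j k jm kl; have := Hz j k (leq_trans jm mm'); rewrite jm; apply.
    exact: ltnW.
  move=> j jm'; have [jm|jm] := boolP (j < m)%N.
    by have := Hz j (l j) jm'; rewrite jm f'E // -ytop //; apply.
  by have := Hz j 0%N jm'; rewrite (negbTE jm); exact.
- move=> c cA; apply: (if' c) => z zA; rewrite -[RHS](cA z zA); apply: eq_bigr => j _.
  congr (_ * _); case: ifP => [jm|//].
  by rewrite f'E // -ytop.
- have [|K [HK dK]] := dindep_dim _ if'; first by move=> j jm; have [] := sf' j jm.
  have BK : G b x = K.
    apply/eqP; rewrite eqEsubv; apply/andP; split; apply/subvP => z.
      move=> zB; apply/HK; split=> [|j jm]; first exact: subvP (near_at BA) _ zB.
      by have [_ /near_at/(_ _ zB)] := sf' j jm.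
    by move/HK => [zA z0]; exact: zf'.
  have -> : (\sum_(j < m') (if (j < m)%N then (l j).+1 else 1) = \sum_(j < m) l j + m')%N.
    transitivity (\sum_(j < m') ((if (j < m)%N then l j else 0) + 1))%N.
      by apply: eq_bigr => j _; case: ifP => _; rewrite ?addn1.
    by rewrite big_split /= sum1_card card_ord (big_ord_widen _ l mm') [in RHS]big_mkcond.
  by rewrite BK; split=> //; move: dK dphi; lia.
Qed.

End Chains.

(** * Contact forms *)

Section Contact.
Context {R : realType} {n : nat}.
Local Notation V := 'rV[R]_n.
Implicit Types (x y z : V) (F : nat -> tdistribution R n) (D : tdistribution R n) (a e u w v : V -> V)
  (X : nat -> V -> R).

(** The Cartan formula for theta = df - g dy1 on two fields that it annihilates: theta([u1, u2]) =
    (dg ^ dy1)(u1, u2). *)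
Lemma theta_bracket y u1 u2 (f g y1 : V -> R) :
  smooth_near y u1 -> smooth_near y u2 -> smooth_near y f -> smooth_near y g -> smooth_near y y1 ->
  (\forall z \near y, lied u1 f z = g z * lied u1 y1 z) ->
  (\forall z \near y, lied u2 f z = g z * lied u2 y1 z) ->
  lied (lie_bracket u1 u2) f y - g y * lied (lie_bracket u1 u2) y1 y =
  lied u1 g y * lied u2 y1 y - lied u2 g y * lied u1 y1 y.
Proof.
move=> s1 s2 sf sg sy e1 e2.
have E1 : lied u1 (lied u2 f) y = g y * lied u1 (lied u2 y1) y + lied u2 y1 y * lied u1 g y.
  rewrite -(liedM u1 sg (smooth_near_lied s2 sy)); exact: near_eq_derive.
have E2 : lied u2 (lied u1 f) y = g y * lied u2 (lied u1 y1) y + lied u1 y1 y * lied u2 g y.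
  rewrite -(liedM u2 sg (smooth_near_lied s1 sy)); exact: near_eq_derive.
have gen (A B C A' B' p q r s t k : R) : A = A' - B' -> A' = k * p + q * r -> B' = k * s + t * C ->
    B = p - s -> A - k * B = r * q - C * t.
  by move=> -> -> -> ->; ring.
exact: (gen _ _ _ _ _ _ _ _ _ _ _ (lied_bracket s1 s2 sf) E1 E2 (lied_bracket s1 s2 sy)).
Qed.

(* The condition theta_k(z) = 0 for the contact forms theta_k = dX_k - X_{k+1} dX_1, 2 <= k <= t. *)
Definition theta_in X (t : nat) y z :=
  forall k, (2 <= k <= t)%N -> 'D_z (X k) y = X k.+1 y * 'D_z (X 1%N) y.

(** Going down from F_A to F_B, A = B + 1: since [F_B, v] lies in F_A, where theta_t vanishes,
    [theta_bracket] shows that theta_(t+1) vanishes on F_B; the codimension is one and theta_(t+1)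
    is not zero on F_A, so it cuts out F_B. If dX_(t+2) were a multiple of dX_1 on F_B, theta_(t+1)
    would vanish on [F_B, F_B] and hence on F_A; this keeps the next form nondegenerate. *)
Theorem goursat x (q : nat) F v X : (3 <= q)%N ->
  (forall j, (j <= q - 2)%N -> regular x (F j)) ->
  (forall j, (j < q - 2)%N -> germ_eq x (F j.+1) (addd (F j) (bracket_dd (F j) (F j)))) ->
  (forall j, (j < q - 2)%N -> \forall y \near x, \dim (F j.+1 y) = (\dim (F j y) + 1)%N) ->
  (forall k, (1 <= k <= q)%N -> smooth_near x (X k)) ->
  section_near (F 0%N) x v -> (\forall y \near x, lied v (X 1%N) y = 1) ->
  (forall k, (2 <= k < q)%N -> \forall y \near x, lied v (X k) y = X k.+1 y) ->
  (\forall y \near x, forall z, z \in F (q - 3)%N y -> 'D_z (X 2) y = X 3 y * 'D_z (X 1%N) y) ->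
  (\forall y \near x, exists2 z, z \in F (q - 2)%N y & 'D_z (X 1%N) y = 0 /\ 'D_z (X 2) y != 0) ->
  forall t, (1 <= t <= q - 1)%N ->
    (\forall y \near x, forall z, z \in F (q - 1 - t)%N y <-> z \in F (q - 2)%N y /\ theta_in X t y z) /\
    (\forall y \near x, exists2 z, z \in F (q - 1 - t)%N y & 'D_z (X 1%N) y = 0 /\ 'D_z (X t.+1) y != 0).
Proof.
move=> q3 rF FS dF sX vF v1 vX base nd1.
have Fle j j' : (j <= j')%N -> (j' <= q - 2)%N -> germ_le x (F j) (F j').
  move=> /subnK <-; elim: (j' - j)%N => [|i IH] ij; first by apply: near_W => y.
  apply: near_imp2 (IH (ltnW ij)) (FS _ ij) => y H; rewrite addSn => ->.
  exact: subv_trans H (addvSl _ _).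
elim=> [//|t IH] /andP[_ tq].
have [->|t0] := posnP t.
  have -> : (q - 1 - 1 = q - 2)%N by lia.
  split=> //; apply: near_W => y z; split=> [zF|[]//].
  by split=> // k; lia.
have h1 : (1 <= 1 <= q)%N by lia.
have h2 : (1 <= t.+1 <= q)%N by lia.
have h3 : (1 <= t.+2 <= q)%N by lia.
have h4 : (2 <= t.+1 <= t.+1)%N by lia.
have [cl nd] := IH ltac:(lia).
set A := (q - 1 - t)%N in cl nd *; set B := (q - 1 - t.+1)%N.
have AB : A = B.+1 by rewrite /A /B; lia.
have Bq : (B < q - 2)%N by rewrite /B; lia.
have smX : \forall y \near x, forall k, (k < q)%N -> smooth_near y (X k.+1).
  by apply: near_lt => k kq; apply: smooth_near_near; apply: sX; lia.
have vB : germ_le x (F 0%N) (F B) by apply: Fle; lia.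
have nsec := near_and3 (regular_near_pt (rF B (ltnW Bq))) (section_near_near vF) (near_near vB).
have sub : \forall y \near x, forall z, z \in F B y -> 'D_z (X t.+1) y = X t.+2 y * 'D_z (X 1%N) y.
  (* There is no theta_1 to differentiate; the relation for theta_2 is the hypothesis [base]. *)
  have [t1|t1] := eqVneq t 1%N.
    have -> : B = (q - 3)%N by rewrite /B; lia.
    by rewrite t1.
  have vXt := vX t.+1 ltac:(lia).
  have clB := near_and3 (near_near cl) (Fle B A ltac:(lia) ltac:(rewrite AB; lia)) (near_near (FS B Bq)).
  have nv := near_and3 (near_near v1) vXt (near_near (Fle B A ltac:(lia) ltac:(rewrite AB; lia))).
  apply: near_imp3 (near_and smX nv) nsec clB => y [sXy [v1y vXy nBA]] [rBy vy nvB] [cly BAy FSy] z zB.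
  have [w [Dw <-]] := section_through rBy zB.
  have [sw wB] := Dw; have [sv v0] := vy.
  have th u : smooth_near y u -> (\forall y' \near y, u y' \in F A y') ->
      \forall y' \near y, lied u (X t) y' = X t.+1 y' * lied u (X 1%N) y'.
    move=> su uA; apply: near_imp2 uA cly => y' uy /(_ (u y'))[+ _] => /(_ uy)[_ /(_ t)].
    by apply; rewrite leqnn andbT; lia.
  have wA : \forall y' \near y, w y' \in F A y'.
    by apply: near_imp2 wB nBA => y' H1 H2; exact: subvP H2 _ H1.
  have vvB : \forall y' \near y, v y' \in F B y'.
    by apply: near_imp2 v0 nvB => y' H1 H2; exact: subvP H2 _ H1.
  have vA : \forall y' \near y, v y' \in F A y'.
    by apply: near_imp2 vvB nBA => y' H1 H2; exact: subvP H2 _ H1.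
  have sXt : smooth_near y (X t) by have := sXy t.-1 ltac:(lia); rewrite prednK.
  have E := theta_bracket sw sv sXt (sXy t (proj2 (andP h2))) (sXy 0%N (proj2 (andP h1))) (th w sw wA) (th v sv vA).
  have bA : lie_bracket w v y \in F A y.
    rewrite AB (near_at FSy); apply: subvP (addvSr _ _) _ _; apply: mem_vspan.
    by exists w, v.
  have [_ /(_ t)] := ((near_at cly) _).1 bA; rewrite leqnn andbT => /(_ ltac:(lia)) E2.
  move: E; rewrite /lied E2 subrr -/(lied v (X 1%N) y) -/(lied v (X t.+1) y) (near_at v1y) vXy mulr1.
  by move=> /esym/eqP; rewrite subr_eq0 => /eqP.
have clt : \forall y \near x, forall z, z \in F B y <-> z \in F (q - 2)%N y /\ theta_in X t.+1 y z.
  have FB2 := Fle B (q - 2)%N ltac:(lia) ltac:(lia).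
  have FBA := Fle B A ltac:(lia) ltac:(rewrite AB; lia).
  have n1 := near_and3 cl nd sub.
  apply: near_imp3 n1 (near_and3 (dF B Bq) FBA FB2) smX => y [cly [z0 z0A [z01 z0t]] suby] [dy BAy B2y] sXy z.
  split=> [zB|[z2 zt]].
    split; first exact: subvP B2y _ zB.
    move=> k; have [kt|kt] := leqP k t; last first.
      move=> H; have -> : k = t.+1 by lia.
      exact: suby.
    move=> H; have [_ H2] := (cly z).1 (subvP BAy _ zB); apply: H2.
    by have /andP[-> _] := H.
  have zA : z \in F A y by apply/cly; split=> // k H; apply: zt; lia.
  (* Otherwise [z] spans F_A modulo F_B, and theta_(t+1), zero on F_B and on [z], would vanish on
     [z0]. *)
  apply: contrapT => /negP zB.
  have dAB : (\dim (F A y) <= \dim (F B y) + 1)%N by rewrite AB dy.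
  have [c cz] := corank1 BAy dAB zA zB z0A.
  have ds k : (1 <= k <= q)%N -> differentiable (X k) y.
    by case: k => // k /andP[_ kq]; exact: smooth_near_diff (sXy k kq).
  have := suby _ cz; rewrite (derive_dirB _ _ (ds t.+1 h2)) (derive_dirB _ _ (ds 1%N h1)).
  rewrite (derive_dirZ _ _ (ds t.+1 h2)) (derive_dirZ _ _ (ds 1%N h1)) z01.
  rewrite (zt t.+1 h4) => E; move: z0t; suff -> : 'D_z0 (X t.+1) y = 0 by rewrite eqxx.
  have gen (p c' k s : R) : p - c' * (k * s) = k * (0 - c' * s) -> p = 0.
    by move=> H; apply: (addIr (- (c' * (k * s)))); rewrite H; ring.
  exact: (gen _ _ _ _ E).
split=> //.
have n1 := near_and3 nd sub (near_near sub).
have n2 := near_and3 (section_near_near vF) (near_near vB) (regular_near_pt (rF B (ltnW Bq))).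
apply: near_imp3 n1 n2 (near_and3 v1 (FS B Bq) smX) => y [[z0 z0A [z01 z0t]] suby nsub] [vy nvB rBy] [v1y FSy sXy].
apply: contrapT => Hno.
have ds k : (1 <= k <= q)%N -> differentiable (X k) y.
  by case: k => // k /andP[_ kq]; exact: smooth_near_diff (sXy k kq).
have [sv v0] := vy.
have vB0 : v y \in F B y by exact: subvP (near_at nvB) _ (near_at v0).
(* Since [Hno] leaves no vector with dX_1 = 0 and dX_(t+2) nonzero, subtracting the dX_1-part along
   [v] makes the two differentials proportional on F_B. *)
have th2 z : z \in F B y -> 'D_z (X t.+2) y = lied v (X t.+2) y * 'D_z (X 1%N) y.
  move=> zB; apply: contrapT => zt; apply: Hno.
  exists (z - 'D_z (X 1%N) y *: v y); first by apply: memvB => //; exact: memvZ.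
  have d1 := ds 1%N h1; have d2 := ds t.+2 h3.
  rewrite (derive_dirB _ _ d1) (derive_dirZ _ _ d1) (derive_dirB _ _ d2) (derive_dirZ _ _ d2).
  rewrite -/(lied v (X 1%N) y) v1y -/(lied v (X t.+2) y); split.
    by rewrite [_ *: _]mulr1 subrr.
  by apply/eqP => /eqP; rewrite subr_eq0 => /eqP E; apply: zt; rewrite E; exact: mulrC.
pose L z := 'D_z (X t.+1) y - X t.+2 y * 'D_z (X 1%N) y.
have LD z z' : L (z + z') = L z + L z'.
  rewrite /L (derive_dirD _ _ (ds t.+1 h2)) (derive_dirD _ _ (ds 1%N h1)).
  have gen (p r k p' r' : R) : p + p' - k * (r + r') = p - k * r + (p' - k * r') by ring.
  exact: gen.
have LZ b z : L (b *: z) = b * L z.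
  rewrite /L (derive_dirZ _ _ (ds t.+1 h2)) (derive_dirZ _ _ (ds 1%N h1)).
  have gen (p r k : R) : b * p - k * (b * r) = b * (p - k * r) by ring.
  exact: gen.
have LB z : z \in F B y -> L z = 0 by move=> zB; rewrite /L suby // subrr.
have Lb : forall z, z \in bracket_dd (F B) (F B) y -> L z = 0.
  apply: vspan_linear => // _ [u1 [u2 [D1 D2 ->]]]; have [s1 uB1] := D1; have [s2 uB2] := D2.
  have th u : section_near (F B) y u -> \forall y' \near y, lied u (X t.+1) y' = X t.+2 y' * lied u (X 1%N) y'.
    by move=> [_ uB]; apply: near_imp2 uB nsub => y' H1 H2; exact: H2.
  have := theta_bracket s1 s2 (sXy t (proj2 (andP h2))) (sXy t.+1 (proj2 (andP h3))) (sXy 0%N (proj2 (andP h1))) (th u1 D1) (th u2 D2).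
  rewrite /L /lied => ->; rewrite (th2 _ (near_at uB1)) (th2 _ (near_at uB2)); ring.
have : z0 \in F A y by [].
rewrite AB FSy => /memv_addP[u uB [w wb z0E]].
have : L z0 = 0 by rewrite z0E LD LB // Lb // addr0.
by rewrite /L z01 mulr0 subr0 => /eqP; rewrite (negbTE z0t).
Qed.

(** For a characteristic field w, theta = df - g dy1 vanishes on [w, D], so (dg ^ dy1)(w, u) = 0 for
    all u in D: a vector u with dy1 = 0 and dg nonzero forces dy1(w) = 0, and then u = v forces
    dg(w) = 0. *)
Lemma cauchy_kernel x D v (f g y1 : V -> R) : regular x D ->
  smooth_near x f -> smooth_near x g -> smooth_near x y1 ->
  section_near D x v -> (\forall y \near x, lied v y1 y = 1) ->
  (\forall y \near x, forall z, z \in D y -> 'D_z f y = g y * 'D_z y1 y) ->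
  (\forall y \near x, exists2 z, z \in D y & 'D_z y1 y = 0 /\ 'D_z g y != 0) ->
  \forall y \near x, forall z, z \in cauchy_char D y -> 'D_z y1 y = 0 /\ 'D_z g y = 0.
Proof.
move=> rD sf sg sy vD v1 fD nd.
have n1 := near_and3 (smooth_near_near sf) (smooth_near_near sg) (smooth_near_near sy).
have n2 := near_and3 (near_near fD) nd (section_near_near vD).
apply: near_imp3 n1 n2 (near_and v1 (regular_near_pt rD)) => y [sfy sgy syy] [fDy [z1 z1D [z11 z1g]] vDy] [v1y rDy] z zC.
have H : forall z, z \in cauchy_char D y -> 'D_z y1 y = 0.
  apply: vspan_linear => [p r|b p|_ [w [Dw bw ->]]].
  - exact: derive_dirD (smooth_near_diff syy).
  - exact: derive_dirZ (smooth_near_diff syy).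
  have [u [Du uz]] := section_through rDy z1D.
  have [sw wD] := Dw; have [su uD] := Du.
  have th s : section_near D y s -> \forall y' \near y, lied s f y' = g y' * lied s y1 y'.
    by move=> [_ sD]; apply: near_imp2 fDy sD => y' H1 H2; exact: H1.
  have := theta_bracket sw su sfy sgy syy (th w Dw) (th u Du).
  have bD : lie_bracket w u y \in D y by apply: (subvP (near_at bw)); apply: mem_vspan; exists u.
  rewrite /lied ((near_at fDy) _ bD) subrr uz z11 mulr0 sub0r => /esym/eqP.
  by rewrite oppr_eq0 mulf_eq0 (negbTE z1g) /= => /eqP.
split; first exact: H.
have D0 w : section_near D y w -> (\forall y' \near y, (bracket_vd w D y' <= D y')%VS) -> 'D_(w y) g y = 0.
  move=> Dw bw; have [sw wD] := Dw; have [su uD] := vDy.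
  have w1 : 'D_(w y) y1 y = 0 by apply: H; apply: mem_vspan; exists w.
  have th s : section_near D y s -> \forall y' \near y, lied s f y' = g y' * lied s y1 y'.
    by move=> [_ sD]; apply: near_imp2 fDy sD => y' H1 H2; exact: H1.
  have := theta_bracket sw su sfy sgy syy (th w Dw) (th v vDy).
  have bD : lie_bracket w v y \in D y by apply: (subvP (near_at bw)); apply: mem_vspan; exists v.
  rewrite v1y; rewrite /lied ((near_at fDy) _ bD) subrr w1 mulr0 subr0 mulr1.
  by move=> /esym.
move: z zC; apply: vspan_linear => [p r|b p|_ [w [Dw bw ->]]]; last exact: D0.
- exact: derive_dirD (smooth_near_diff sgy).
- exact: derive_dirZ (smooth_near_diff sgy).
Qed.

(** For w in D the value theta_k([e, w]) involves only the e-derivatives of X_(k+1) and X_1, which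
    vanish; involutivity keeps [e, w] in Dbar. This is the converse of [cauchy_kernel]. *)
Lemma kernel_cauchy x D (Dbar : tdistribution R n) e X (t : nat) : (forall k, (1 <= k <= t.+1)%N -> smooth_near x (X k)) ->
  (\forall y \near x, forall z, z \in D y <-> z \in Dbar y /\ theta_in X t y z) ->
  germ_involutive x Dbar -> section_near Dbar x e ->
  (forall k, (1 <= k <= t.+1)%N -> \forall y \near x, lied e (X k) y = 0) ->
  section_near D x e /\ \forall y \near x, (bracket_vd e D y <= D y)%VS.
Proof.
move=> sX DP iD De eX; have [se eD] := De.
have eX' : \forall y \near x, forall k, (k < t.+1)%N -> lied e (X k.+1) y = 0.
  by apply: near_lt => k kt; apply: eX; lia.
have sX' : \forall y \near x, forall k, (k < t.+1)%N -> smooth_near y (X k.+1).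
  by apply: near_lt => k kt; apply: smooth_near_near; apply: sX; lia.
have eD' : section_near D x e.
  split=> //; apply: near_imp3 eX' eD DP => y H1 H2 Dy; apply/Dy; split=> // k kt.
  have := H1 k.-1 ltac:(lia); rewrite prednK; last by lia.
  rewrite /lied => ->; have := H1 0%N isT; rewrite /lied => ->.
  by rewrite mulr0.
split=> //.
have n1 := near_and3 (near_near eX') sX' (near_near DP).
apply: near_imp3 n1 (near_and (section_near_near De) (section_near_near eD')) iD => y [eXy sXy DPy] [Dey D'ey] iy.
apply: vspan_sub => _ [w Dw <-]; have [sw wD] := Dw; have [sey _] := Dey.
apply/(near_at DPy); split.
  apply: (subvP iy); apply: mem_vspan; exists e, w; split=> //; split=> //.
  by apply: near_imp2 wD DPy => y' H1 H2; have [] := (H2 _).1 H1.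
move=> k kt; have sXk : smooth_near y (X k) by have := sXy k.-1 ltac:(lia); rewrite prednK //; lia.
have th s : section_near D y s -> \forall y' \near y, lied s (X k) y' = X k.+1 y' * lied s (X 1%N) y'.
  move=> [_ sD]; apply: near_imp2 sD DPy => y' H1 H2.
  by have [_ /(_ k kt)] := (H2 _).1 H1.
have e0 j : (j < t.+1)%N -> lied e (X j.+1) y = 0 by move=> jt; have := near_at eXy; exact.
have := theta_bracket sey sw sXk (sXy k ltac:(lia)) (sXy 0%N isT) (th e D'ey) (th w Dw).
rewrite (e0 k ltac:(lia)) (e0 0%N isT) mul0r mulr0 subr0 => /eqP.
by rewrite subr_eq0 => /eqP.
Qed.

(** Since e annihilates f, g and y1, the function theta(a), for theta = df - g dy1, changes along e
    by -theta([a, e]). It is therefore constant in the directions whose brackets with the drift lie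
    in the kernel of theta. *)
Lemma drift_kill y a e (f g y1 : V -> R) :
  smooth_near y a -> smooth_near y e -> smooth_near y f -> smooth_near y g -> smooth_near y y1 ->
  (\forall z \near y, lied e f z = 0) -> (\forall z \near y, lied e g z = 0) ->
  (\forall z \near y, lied e y1 z = 0) ->
  lied e (fun z => lied a f z - g z * lied a y1 z) y =
  - (lied (lie_bracket a e) f y - g y * lied (lie_bracket a e) y1 y).
Proof.
move=> sa se sf sg sy ef eg ey.
rewrite (liedB e (smooth_near_lied sa sf) (smooth_nearM sg (smooth_near_lied sa sy))).
rewrite (liedM e sg (smooth_near_lied sa sy)) (near_at eg) mulr0 addr0.
rewrite (bracket_kill sa se sf ef) (bracket_kill sa se sy ey); ring.
Qed.

End Contact.

(** * Cauchy characteristics *)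

Section CauchyTheory.
Context {R : realType} {n : nat}.
Local Notation V := 'rV[R]_n.
Local Notation vf := (V -> V).
Implicit Types (x y : V) (A B D E K : tdistribution R n) (s : seq vf) (a e u v w : vf).

Lemma frame_of_gen x D s : (forall i, (i < size s)%N -> smooth_near x (nth (fun=> 0) s i)) ->
  (forall i, (i < size s)%N -> \forall y \near x, nth (fun=> 0) s i y \in D y) ->
  (D x <= <<evals s x>>)%VS -> loc_const_dim x D -> gen x s D.
Proof.
move=> ss sD Dx cD; split=> //; have [d [v [c [[_ _ Dv] mv]]]] := frame_of ss sD Dx cD.
have vs : \forall y \near x, forall i, (i < d)%N -> v i y \in <<evals s y>>%VS.
  apply: near_lt => i id; have [f [_ vE]] := mv i id; apply: near_imp vE => y ->.
  by apply: memv_suml => j _; apply: memvZ; exact: mem_evals.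
apply: near_imp3 Dv vs (near_lt sD) => y Dy vy sy.
apply/eqP; rewrite eqEsubv evals_sub // andbT; apply/subvP => z /Dy[b ->].
by apply: memv_suml => i _; apply: memvZ; exact: vy.
Qed.

Lemma extend_gen x A B s : gen x s A -> regular x B -> germ_le x A B ->
  exists t : seq vf, [/\ size t = (\dim (B x) - \dim (A x))%N,
    (forall i, (i < size t)%N -> section_near B x (nth (fun=> 0) t i)) & gen x (s ++ t) B].
Proof.
move=> gA rB AB; pose Z := vbasis (B x :\: A x)%VS.
have ZB z : z \in Z -> z \in B x by move=> /vbasis_mem; exact: subvP (diffvSl _ _) z.
have wex i : exists w, (i < size Z)%N -> section_near B x w /\ w x = Z`_i.
  have [si|si] := ltnP i (size Z); last by exists (fun=> 0).
  by have [w Hw] := section_through rB (ZB _ (mem_nth 0 si)); exists w.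
pose W i := sval (cid (wex i)).
have WP i : (i < size Z)%N -> section_near B x (W i) /\ W i x = Z`_i by exact: (svalP (cid (wex i))).
pose t := mkseq W (size Z).
have tP i : (i < size t)%N -> section_near B x (nth (fun=> 0) t i) /\ nth (fun=> 0) t i x = Z`_i.
  by rewrite size_mkseq => si; rewrite nth_mkseq //; exact: WP.
exists t; split.
- rewrite size_mkseq size_tuple; have := dimv_cap_compl (B x) (A x).
  have -> : (B x :&: A x = A x)%VS by apply/capv_idPr; exact: near_at AB.
  by move=> <-; rewrite addKn.
- by move=> i /tP[].
have ss i : (i < size (s ++ t))%N -> section_near B x (nth (fun=> 0) (s ++ t) i).
  rewrite size_cat nth_cat => si; case: ltnP => ilt.
    have [s1 s2] := gen_mem gA ilt; split=> //.
    by apply: near_imp2 s2 AB => y h1 h2; exact: subvP h2 _ h1.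
  by have [] := tP (i - size s)%N ltac:(by rewrite ltn_subLR).
apply: frame_of_gen (regular_dim rB) => [i /ss[]//|i /ss[]//|].
rewrite evals_cat -(near_at gA.2).
have -> : <<evals t x>>%VS = (B x :\: A x)%VS.
  rewrite -(span_basis (vbasisP (B x :\: A x)%VS)); congr span; apply: (@eq_from_nth _ 0).
    by rewrite size_map size_mkseq.
  by move=> i; rewrite size_map => si; rewrite evals_nth //; have [] := tP i si.
by rewrite addvC -{1}(addv_diff_cap (B x) (A x)); apply: addvS => //; exact: capvSr.
Qed.

(** Brackets of [a] with sections of [A] lie in [W] already, so by Leibniz only those with a
    complementary list of sections of [B] can be new. *)
Lemma ext_dim x a A B (W : {vspace V}) : smooth_near x a -> regular x A -> regular x B ->
  germ_le x A B -> (B x <= W)%VS -> (bracket_vd a A x <= W)%VS ->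
  (\dim (W + bracket_vd a B x) <= \dim W + (\dim (B x) - \dim (A x)))%N.
Proof.
move=> sa [d [v [c F]]] rB AB BW bW; have gA := nframe_gen F.
have [t [<- tB gB]] := extend_gen gA rB AB.
pose T := <<evals [seq lie_bracket a u | u <- t] x>>%VS.
have dT : (\dim T <= size t)%N by apply: leq_trans (dim_span _) _; rewrite !size_map.
apply: (@leq_trans (\dim (W + T))); last first.
  have := dimv_sum_cap W T => H; apply: leq_trans (_ : \dim W + \dim T <= _)%N; last by rewrite leq_add2l.
  by rewrite -H leq_addr.
apply: dimvS; rewrite subv_add addvSl /=; apply: vspan_sub => _ [w Bw <-].
have BmW i : (i < size (mkseq v d ++ t))%N -> nth (fun=> 0) (mkseq v d ++ t) i x \in B x.
  by move=> si; have [_ /near_at] := gen_mem gB si.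
apply: (smod_bracket sa gB.1 (section_smod gB (regular_dim rB) Bw)) => i si.
  by apply: subvP (addvSl _ _) _ _; apply: subvP BW _ _; exact: BmW.
rewrite nth_cat; case: ltnP => ilt.
  apply: subvP (addvSl _ _) _ _; apply: subvP bW _ _; apply: mem_vspan.
  by exists (nth (fun=> 0) (mkseq v d) i) => //; exact: gen_mem gA ilt.
apply: subvP (addvSr _ _) _ _.
have it : (i - size (mkseq v d) < size t)%N by rewrite ltn_subLR // -size_cat.
have := @mem_evals R n [seq lie_bracket a u | u <- t] x (i - size (mkseq v d))%N.
by rewrite size_map (nth_map (fun=> 0)) //; exact.
Qed.

Lemma gen_cauchy x D : loc_const_dim x (cauchy_char D) -> exists s, gen x s (cauchy_char D) /\
  forall i, (i < size s)%N -> section_near D x (nth (fun=> 0) s i) /\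
    \forall y \near x, (bracket_vd (nth (fun=> 0%R) s i) D y <= D y)%VS.
Proof.
move=> cC; have [s [sS sE]] := vspan_seq [set z | exists w, [/\ section_near D x w,
    \forall y \near x, (bracket_vd w D y <= D y)%VS & z = w x]].
have wex i : exists w, (i < size s)%N -> [/\ section_near D x w,
    \forall y \near x, (bracket_vd w D y <= D y)%VS & s`_i = w x].
  have [si|si] := ltnP i (size s); last by exists (fun=> 0).
  by have [w Hw] := sS _ (mem_nth 0 si); exists w.
pose W i := sval (cid (wex i)).
have WP i : (i < size s)%N -> [/\ section_near D x (W i),
    \forall y \near x, (bracket_vd (W i) D y <= D y)%VS & s`_i = W i x] by exact: (svalP (cid (wex i))).
have nW i : (i < size s)%N -> nth (fun=> 0) (mkseq W (size s)) i = W i by move=> si; rewrite nth_mkseq.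
exists (mkseq W (size s)); split; last first.
  by move=> i; rewrite size_mkseq => si; rewrite nW //; have [] := WP i si.
apply: frame_of_gen => //.
- by move=> i; rewrite size_mkseq => si; rewrite nW //; have [[]] := WP i si.
- move=> i; rewrite size_mkseq => si; rewrite nW //; have [Dw bw _] := WP i si.
  apply: near_imp2 (section_near_near Dw) (near_near bw) => y Dwy bwy.
  by apply: mem_vspan; exists (W i).
rewrite /cauchy_char sE; apply/span_subvP => z /(nthP 0)[i si <-].
have [_ _ ->] := WP i si; rewrite -(nW i si); apply: mem_evals.
by rewrite size_mkseq.
Qed.

Lemma cauchy_sub x D : loc_const_dim x (cauchy_char D) -> germ_le x (cauchy_char D) D.
Proof.
move=> cC; have [s [gs sP]] := gen_cauchy cC.
have sD : \forall y \near x, forall i, (i < size s)%N -> nth (fun=> 0) s i y \in D y.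
  by apply: near_lt => i si; have [[_ ]] := sP i si.
by apply: near_imp2 gs.2 sD => y -> H; exact: evals_sub.
Qed.

(** Characteristic fields form a module: the extra term in [f s, w] is a multiple of s, which lies
    in D. So every section of their span is characteristic, not only the spanning fields. *)
Lemma cauchy_section x D e : loc_const_dim x (cauchy_char D) -> section_near (cauchy_char D) x e ->
  \forall y \near x, (bracket_vd e D y <= D y)%VS.
Proof.
move=> cC Ce; have [s [gs sP]] := gen_cauchy cC; have [f [sf eE]] := section_smod gs cC Ce.
have sD : \forall y \near x, forall i, (i < size s)%N -> nth (fun=> 0) s i y \in D y.
  by apply: near_lt => i si; have [[_ ]] := sP i si.
have bD : \forall y \near x, forall i, (i < size s)%N -> (bracket_vd (nth (fun=> 0%R) s i) D y <= D y)%VS.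
  by apply: near_lt => i si; have [_] := sP i si.
have sfn : \forall y \near x, forall i, (i < size s)%N -> smooth_near y (f i).
  by apply: near_lt => i si; exact: smooth_near_near (sf i).
have ssn : \forall y \near x, forall i, (i < size s)%N -> smooth_near y (nth (fun=> 0) s i).
  by apply: near_lt => i si; exact: smooth_near_near (gs.1 i si).
apply: near_imp3 (near_and sD bD) (near_and sfn ssn) (near_near eE) => y [sDy bDy] [sfy ssy] eEy.
apply: vspan_sub => _ [w Dw <-]; have [sw _] := Dw.
rewrite bracketN memvN (bracket_near_eq w eEy) (bracket_comb (v := fun i => nth (fun=> 0) s i)) //.
apply: memv_suml => i _; apply: memvD; apply: memvZ; first exact: sDy.
by rewrite bracketN memvN; apply: (subvP (bDy i (ltn_ord i))); apply: mem_vspan; exists w.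
Qed.

(** By the Jacobi identity, bracketing with [u, w] is a difference of iterated brackets with u and
    w, each of which preserves D. *)
Lemma cauchy_involutive x D : loc_const_dim x (cauchy_char D) -> germ_involutive x (cauchy_char D).
Proof.
move=> cC; apply: near_imp2 (lcd_near cC) (near_near (cauchy_sub cC)) => y cy suby.
apply: vspan_sub => _ [u [w [Cu Cw ->]]]; apply: mem_vspan; exists (lie_bracket u w).
have [su uC] := Cu; have [sw wC] := Cw.
have bu := cauchy_section cy Cu; have bw := cauchy_section cy Cw.
have Dw : section_near D y w by split=> //; apply: near_imp2 wC suby => z h1 h2; exact: subvP h2 _ h1.
split; [|clear Dw|reflexivity].
  split; first exact: (smooth_near_bracket su sw).
  apply: near_imp2 bu (section_near_near Dw) => z h1 h2; apply: (subvP h1).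
  by apply: mem_vspan; exists w.
have n1 := near_and (near_near bu) (near_near bw).
apply: near_imp3 n1 (smooth_near_near su) (smooth_near_near sw) => z [buz bwz] suz swz.
apply: vspan_sub => _ [r Dr <-]; have [sr _] := Dr.
have J := jacobi suz swz sr.
have -> : lie_bracket (lie_bracket u w) r z =
    lie_bracket u (lie_bracket w r) z - lie_bracket w (lie_bracket u r) z by rewrite J addrK.
have bsec (k : vf) : smooth_near z k -> (\forall z' \near z, (bracket_vd k D z' <= D z')%VS) ->
    section_near D z (lie_bracket k r).
  move=> sk bk; split; first exact: smooth_near_bracket.
  apply: near_imp2 bk (section_near_near Dr) => z' h1 h2; apply: (subvP h1).
  by apply: mem_vspan; exists r.
apply: memvB.
  by apply: (subvP (near_at buz)); apply: mem_vspan; exact: (ex_intro2 _ _ (lie_bracket w r) (bsec w swz bwz) erefl).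
by apply: (subvP (near_at bwz)); apply: mem_vspan; exact: (ex_intro2 _ _ (lie_bracket u r) (bsec u suz buz) erefl).
Qed.

(** K is generated by characteristic fields and at most one more section; brackets with the former
    stay in D, and the bracket of the latter with itself is zero. *)
Lemma almost_cauchy x D K : loc_const_dim x (cauchy_char D) -> regular x K ->
  germ_le x (cauchy_char D) K -> germ_le x K D -> (\dim (K x) <= \dim (cauchy_char D x) + 1)%N ->
  germ_le x (bracket_dd K K) D.
Proof.
move=> cC rK CK KD dK.
have n1 := near_and3 (lcd_near cC) (regular_near_pt rK) (near_near CK).
have n2 := near_and3 (near_near KD) cC (regular_dim rK).
apply: near_imp2 n1 n2 => y [cy rKy CKy] [KDy dCy dKy].
have [s [gs sP]] := gen_cauchy cy.
have [t [st tK gK]] := extend_gen gs rKy CKy.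
have t1 : (size t <= 1)%N by rewrite st dCy dKy leq_subLR addnC; move: dK; rewrite addnC.
apply: vspan_sub => _ [u [w [Ku Kw ->]]].
have KinD r : section_near K y r -> section_near D y r.
  by move=> [sr rr]; split=> //; apply: near_imp2 rr KDy => z h1 h2; exact: subvP h2 _ h1.
have cK := regular_dim rKy.
have [su _] := Ku; have [sw _] := Kw.
have stD i : (i < size (s ++ t))%N -> nth (fun=> 0) (s ++ t) i y \in D y.
  by move=> si; have [_ /near_at] := KinD _ (gen_mem gK si).
have cau r i : section_near D y r -> (i < size s)%N -> lie_bracket r (nth (fun=> 0) s i) y \in D y.
  move=> Dr si; have [_ /near_at H] := sP i si; rewrite bracketN memvN.
  by apply: (subvP H); apply: mem_vspan; exists r.
have br r : section_near K y r -> (forall i, (i < size t)%N -> lie_bracket r (nth (fun=> 0) t i) y \in D y) ->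
    forall r', section_near K y r' -> lie_bracket r r' y \in D y.
  move=> Kr tD r' Kr'; have [sr _] := Kr.
  apply: (smod_bracket sr gK.1 (section_smod gK cK Kr')) => // i si; rewrite nth_cat.
  case: ltnP => ilt; first exact: cau (KinD _ Kr) ilt.
  by apply: tD; rewrite ltn_subLR // -size_cat.
apply: (br u Ku _ w Kw) => i it; rewrite bracketN memvN; apply: (br _ (tK i it) _ u Ku) => j jt.
have -> : j = i by move: (leq_trans it t1) (leq_trans jt t1); rewrite !ltnS !leqn0 => /eqP -> /eqP ->.
by rewrite /lie_bracket subrr mem0v.
Qed.

(** The form is a coordinate of the residue modulo a reduced frame of D, divided by its value on
    z. *)
Lemma hyperplane_covector x D z : regular x D -> smooth_near x z -> z x \notin D x ->
  exists Lam : V -> V -> R, [/\ forall y (r r' : V), Lam y (r + r') = Lam y r + Lam y r',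
    forall y b (r : V), Lam y (b *: r) = b * Lam y r,
    forall w, smooth_near x w -> smooth_near x (fun y => Lam y (w y)),
    \forall y \near x, forall r : V, r \in D y -> Lam y r = 0 &
    \forall y \near x, Lam y (z y) = 1].
Proof.
move=> [d [v [c F]]] sz zD; have [sv dv Dv] := F.
pose res y (w : V) := w - \sum_(i < d) entry w (c i) *: v i y.
have resD y (w w' : V) : res y (w + w') = res y w + res y w'.
  rewrite /res addrACA -opprD -big_split /=; congr (_ - _); apply: eq_bigr => i _.
  by rewrite entryD scalerDl.
have resZ y b (w : V) : res y (b *: w) = b *: res y w.
  rewrite /res scalerBr scaler_sumr; congr (_ - _); apply: eq_bigr => i _.
  by rewrite entryZ scalerA.
have sres w : smooth_near x w -> smooth_near x (fun y => res y (w y)).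
  move=> sw; apply: (smooth_nearB sw).
  apply: (smooth_near_ord (F := fun i y => entry (w y) (c i) *: v i y)) => i id.
  by apply: smooth_nearZ; [exact: (smooth_near_entry (c i) sw)|exact: sv].
have rz : res x (z x) != 0.
  apply: contra zD; rewrite /res subr_eq0 => /eqP zE.
  by apply/(near_at Dv); exists (fun i => entry (z x) (c i)).
have [k rk] : exists k, entry (res x (z x)) k != 0.
  move/eqP: rz; apply: contra_notP => H; apply/rowP => j; rewrite [RHS]mxE -entry_ord.
  by have [//|jk] := eqVneq (entry (res x (z x)) j) 0; case: H; exists j.
have sk := smooth_near_entry k (sres _ sz).
exists (fun y (w : V) => (entry (res y (z y)) k)^-1 * entry (res y w) k); split.
- by move=> y u w; rewrite resD entryD mulrDr.
- by move=> y b w; rewrite resZ entryZ mulrCA.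
- by move=> w sw; apply: smooth_nearM (smooth_near_entry k (sres _ sw)); exact: smooth_nearV.
- apply: near_imp2 dv Dv => y dy Dy w /Dy/(in_frameE dy) wE.
  by rewrite /res -wE subrr entry0 mulr0.
- by apply: near_imp (near_neq0 (smooth_near_continuous sk) rk) => y H; rewrite mulVf.
Qed.

End CauchyTheory.

Section ContactFunctions.
Context {R : realType} {n : nat}.
Local Notation V := 'rV[R]_n.
Local Notation vf := (V -> V).
Implicit Types (x y z : V) (A B D E K P : tdistribution R n) (s : seq vf) (a e u v w : vf).

Lemma bracket_dd_sub y D E (W : {vspace V}) : (forall u w, section_near D y u -> section_near E y w ->
  lie_bracket u w y \in W) -> (bracket_dd D E y <= W)%VS.
Proof. by move=> H; apply: vspan_sub => _ [u [w [Du Ew ->]]]; exact: H. Qed.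

Lemma section_sub x D E w : germ_le x D E -> section_near D x w -> section_near E x w.
Proof. by move=> DE [sw wD]; split=> //; apply: near_imp2 wD DE => y h1 h2; exact: subvP h2 _ h1. Qed.

Lemma bracket_mem x D E u w : section_near D x u -> section_near E x w ->
  lie_bracket u w x \in bracket_dd D E x.
Proof. by move=> Du Ew; apply: mem_vspan; exists u, w. Qed.

Let bracket_regroup (A B C E q : V) (f g : R) :
  A - g *: B - (C - (f *: q + g *: E)) = A - C - (g *: B - g *: E) + f *: q.
Proof. by apply/rowP => k; rewrite !mxE; ring. Qed.

(* With z = [p0, v0] spanning Dbar modulo D, the fields p - lambda([p, v0]) p0 for p
   in P are characteristic. *)
Lemma cauchy_codim2 x P D Dbar : regular x P -> regular x D -> regular x Dbar ->
  germ_le x P D -> germ_le x D Dbar -> germ_le x (bracket_dd P P) D ->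
  germ_le x (bracket_dd D D) Dbar ->
  (\dim (D x) = \dim (P x) + 1)%N -> (\dim (Dbar x) = \dim (D x) + 1)%N ->
  ~ (bracket_dd D D x <= D x)%VS ->
  (\dim (P x) <= \dim (cauchy_char D x) + 1)%N.
Proof.
move=> rP rD rB PD DB bP bD dD dB nD.
have [d [p [c F]]] := rP; have gP := nframe_gen F.
have [t [st tD gD]] := extend_gen gP rD PD.
have t1 : size t = 1%N by rewrite st dD addKn.
pose v0 := nth (fun=> 0) t 0; have Dv0 : section_near D x v0 by apply: tD; rewrite t1.
have cD := regular_dim rD.
(* P and v0 generate D and [P, P] lies in D, so some [p_i, v0] leaves D; otherwise D would be closed
   under brackets at x. *)
have [i0 i0d pv0] : exists2 i, (i < d)%N & lie_bracket (p i) v0 x \notin D x.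
  apply: contra_notP nD => H; apply: bracket_dd_sub => u w Du Dw.
  have pv i : (i < d)%N -> lie_bracket (p i) v0 x \in D x.
    by move=> id; apply: contrapT => /negP pi; apply: H; exists i.
  have pD i : (i < d)%N -> section_near D x (p i).
    by move=> id; apply: section_sub PD (nframe_mem F id).
  have pw w' i : section_near D x w' -> (i < d)%N -> lie_bracket (p i) w' x \in D x.
    move=> Dw' id; have [sp _] := pD i id.
    apply: (smod_bracket sp gD.1 (section_smod gD cD Dw')) => j js.
      by have [_ /near_at] := gen_mem gD js.
    rewrite nth_cat size_mkseq; case: ltnP => jd.
      rewrite nth_mkseq //; apply: (subvP (near_at bP)).
      by apply: bracket_mem; exact: nframe_mem F _.
    have -> : (j - d = 0)%N by move: js; rewrite size_cat size_mkseq t1; lia.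
    exact: pv.
  have [su _] := Du; rewrite bracketN memvN.
  have [sw _] := Dw; apply: (smod_bracket sw gD.1 (section_smod gD cD Du)) => j js.
    by have [_ /near_at] := gen_mem gD js.
  rewrite bracketN memvN nth_cat size_mkseq; case: ltnP => jd.
    by rewrite nth_mkseq //; exact: pw.
  have -> : (j - d = 0)%N by move: js; rewrite size_cat size_mkseq t1; lia.
  have [sv0 _] := Dv0; apply: (smod_bracket sv0 gD.1 (section_smod gD cD Dw)) => k ks.
    by have [_ /near_at] := gen_mem gD ks.
  rewrite nth_cat size_mkseq; case: ltnP => kd.
    by rewrite nth_mkseq // bracketN memvN; exact: pv.
  have -> : (k - d = 0)%N by move: ks; rewrite size_cat size_mkseq t1; lia.
  by rewrite /lie_bracket subrr mem0v.
have [sp0 _] := nframe_mem F i0d; have [sv0 _] := Dv0.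
pose z := lie_bracket (p i0) v0; have sz : smooth_near x z by exact: smooth_near_bracket.
have [Lam [LD LZ sL L0 L1]] := hyperplane_covector rD sz pv0.
pose h i y := Lam y (lie_bracket (p i) v0 y).
have sh i : (i < d)%N -> smooth_near x (h i).
  by move=> id; apply: sL; apply: smooth_near_bracket => //; have [] := nframe_mem F id.
pose e i y := p i y - h i y *: p i0 y.
have se i : (i < d)%N -> smooth_near x (e i).
  by move=> id; apply: smooth_nearB; [have [] := nframe_mem F id|exact: smooth_nearZ (sh i id) sp0].
have Pe i : (i < d)%N -> section_near P x (e i).
  move=> id; split; first exact: se.
  have [_ pi] := nframe_mem F id; have [_ p0] := nframe_mem F i0d.
  by apply: near_imp2 pi p0 => y h1 h2; apply: memvB => //; exact: memvZ.
have zDbar : \forall y \near x, (Dbar y <= D y + <[z y]>)%VS.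
  have n1 := near_and3 (section_near_near (section_sub PD (nframe_mem F i0d))) (section_near_near Dv0) bD.
  have n2 := near_and3 DB (regular_dim rB) (regular_dim rD).
  apply: near_imp3 n1 n2 (near_and L0 L1) => y [py vy bDy] [DBy dBy dDy] [L0y L1y].
  have zB : z y \in Dbar y by apply: (subvP bDy); exact: bracket_mem.
  have zD : z y \notin D y.
    by apply/negP => /L0y; rewrite L1y => /eqP; rewrite oner_eq0.
  apply/subvP => w wB; have [|b bD'] := corank1 DBy _ zB zD wB; first by rewrite dBy dDy dB.
  by rewrite -[w](subrK (b *: z y)); apply: memv_add => //; apply: memvZ; exact: memv_line.
have Cen : forall i, (i < d)%N -> \forall y \near x, (bracket_vd (e i) D y <= D y)%VS.
  move=> i id.
  have gDn := near_and3 (gen_near gD) (lcd_near cD) (section_near_near (section_sub PD (Pe i id))).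
  have n2 := near_and3 (near_and zDbar PD) L0 L1.
  have n3 := near_and3 bD bP (section_near_near (Pe i id)).
  have n4 := near_and3 (section_near_near (nframe_mem F id)) (section_near_near (nframe_mem F i0d)) (section_near_near Dv0).
  have n5 := near_and (near_lt (fun j jd => section_near_near (nframe_mem F jd))) (smooth_near_near (sh i id)).
  apply: near_imp3 (near_and gDn n2) (near_and n3 n4) n5 => y [[gy cy Dey] [[zy PDy] L0y L1y]] [[bDy bPy Pey] [piy p0y v0y]] [pjy shy].
  apply: vspan_sub => _ [w Dw <-].
  have [sey _] := Dey.
  apply: (smod_bracket sey gy.1 (section_smod gy cy Dw)) => j js.
    by have [_ /near_at] := gen_mem gy js.
  rewrite nth_cat size_mkseq; case: ltnP => jd.
    rewrite nth_mkseq //; apply: (subvP bPy); apply: bracket_mem => //; exact: pjy.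
  have -> : (j - d = 0)%N by move: js; rewrite size_cat size_mkseq t1; lia.
  rewrite -/v0.
  have : lie_bracket (e i) v0 y \in (D y + <[z y]>)%VS by apply: (subvP zy); apply: (subvP bDy); exact: bracket_mem.
  move=> /memv_addP[r rD' [_ /vlineP[b ->] E]].
  (* [Lam] reads off the component along z; it cancels by the choice of h_i, since Lam(z) = 1 and
     Lam vanishes on p_i0. *)
  have b0 : b = 0.
    have : Lam y (lie_bracket (e i) v0 y) = b by rewrite E LD LZ L0y // L1y add0r mulr1.
    move=> <-; have [spi _] := piy; have [sp0y p0P] := p0y; have [sv0y _] := v0y.
    have Ee : lie_bracket (e i) v0 y = lie_bracket (p i) v0 y - h i y *: z y + lied v0 (h i) y *: p i0 y.
      rewrite /lie_bracket /e (derive_dirB _ _ (smooth_near_diff sv0y)) (derive_dirZ _ _ (smooth_near_diff sv0y)).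
      have sph : smooth_near y (fun y => h i y *: p i0 y) by exact: smooth_nearZ.
      have -> : 'D_(v0 y) (fun y0 => p i y0 - h i y0 *: p i0 y0) y =
          'D_(v0 y) (p i) y - 'D_(v0 y) (fun y0 => h i y0 *: p i0 y0) y.
        by apply: (@deriveB _ _ _ (p i) (fun y0 => h i y0 *: p i0 y0)); exact: smooth_near_derivable.
      rewrite (derive_scale _ shy sp0y) /z /lie_bracket scalerBr /lied.
      exact: bracket_regroup.
    have Lp0 : Lam y (p i0 y) = 0 by apply: L0y; exact: subvP PDy _ (near_at p0P).
    have LL (A B C : V) (b1 b2 : R) : Lam y (A - b1 *: B + b2 *: C) = Lam y A - b1 * Lam y B + b2 * Lam y C.
      by rewrite -scaleNr !LD !LZ mulNr.
    rewrite Ee LL.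
    have gen (r1 r2 l1 l0 : R) : l1 = 1 -> l0 = 0 -> r1 - r1 * l1 + r2 * l0 = 0 by move=> -> ->; ring.
    exact: (gen (h i y) _ _ _ L1y Lp0).
  by rewrite E b0 scale0r addr0.
have eC i : (i < d)%N -> e i x \in cauchy_char D x.
  by move=> id; apply: mem_vspan; exists (e i); split=> //; [exact: section_sub PD (Pe i id)|exact: Cen].
have sub : (P x <= cauchy_char D x + <[p i0 x]>)%VS.
  rewrite (near_at gP.2); apply: evals_sub => i; rewrite size_mkseq => id; rewrite nth_mkseq //.
  have -> : p i x = e i x + h i x *: p i0 x by rewrite /e subrK.
  by apply: memv_add; [exact: eC|apply: memvZ; exact: memv_line].
apply: leq_trans (dimvS sub) _.
apply: leq_trans (leq_addr (\dim (cauchy_char D x :&: <[p i0 x]>)) _) _.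
by rewrite dimv_sum_cap leq_add2l dim_vline leq_b1.
Qed.

End ContactFunctions.

Section SecondContactFunction.
Context {R : realType} {n : nat}.
Local Notation V := 'rV[R]_n.
Local Notation vf := (V -> V).
Implicit Types (x y z : V) (A B D E K P : tdistribution R n) (a e u v w : vf).

Definition ker_in D (f : V -> R) : tdistribution R n := fun y => vspan [set z | z \in D y /\ 'D_z f y = 0].

Lemma ker_inP D (f : V -> R) y : smooth_near y f ->
  forall z, z \in ker_in D f y <-> z \in D y /\ 'D_z f y = 0.
Proof.
move=> sf z; have df := smooth_near_diff sf; split=> [zK|]; last exact: mem_vspan.
split; first by move: z zK; apply/subvP; apply: vspan_sub => z [].
apply: (vspan_linear (L := fun z => 'D_z f y)) zK => [v w|b v|v []//].
  exact: derive_dirD.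
exact: derive_dirZ.
Qed.

Lemma ker_shift (z w : V) (f : V -> R) y : smooth_near y f -> 'D_w f y = 1 ->
  'D_(z - 'D_z f y *: w) f y = 0.
Proof.
move=> sf w1; have df := smooth_near_diff sf.
rewrite (derive_dirB _ _ df) (derive_dirZ _ _ df) w1.
have gen (r : R) : r - r * 1 = 0 by ring.
exact: gen.
Qed.

(** Subtracting from each frame field the multiple of v that restores df = 0 gives smooth generators
    of the kernel. *)
Lemma ker_in_regular x D v (f : V -> R) : regular x D -> smooth_near x f ->
  section_near D x v -> (\forall y \near x, lied v f y = 1) ->
  regular x (ker_in D f) /\ \forall y \near x, (\dim (ker_in D f y) + 1 = \dim (D y))%N.
Proof.
move=> rD sf [sv vD] v1.
have dK : \forall y \near x, (\dim (ker_in D f y) + 1 = \dim (D y))%N.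
  apply: near_imp3 (smooth_near_near sf) vD v1 => y sfy vy v1y.
  have [|c cz [|j]//|K [HK dK]] := @dindep_dim R n y (D y) (fun=> f) 1.
  - by [].
  - by have := cz _ vy; rewrite big_ord1 -[X in _ * X]/(lied v f y) v1y mulr1.
  rewrite -dK; congr (\dim _ + _)%N; apply/eqP; rewrite eqEsubv; apply/andP; split; apply/subvP => z.
    by move=> /(ker_inP D sfy)[zD z0]; apply/HK; split.
  by move=> /HK[zD z0]; apply/(ker_inP D sfy); split=> //; exact: (z0 0%N).
split=> //.
have cD := regular_dim rD; have dKx := near_at dK; have cK : loc_const_dim x (ker_in D f).
  by apply: near_imp2 dK cD => y h1 h2; apply/eqP; rewrite -(eqn_add2r 1) h1 dKx h2.
have [d [p [c F]]] := rD; have [sp _ Dp] := F.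
pose k i : vf := fun y => p i y - lied (p i) f y *: v y.
have sk i : (i < d)%N -> smooth_near x (k i).
  move=> id; apply: smooth_nearB; first exact: sp.
  by apply: smooth_nearZ => //; apply: smooth_near_lied => //; exact: sp.
have sm : forall i, (i < size (mkseq k d))%N -> smooth_near x (nth (fun=> 0%R) (mkseq k d) i).
  by move=> i; rewrite size_mkseq => id; rewrite nth_mkseq //; exact: sk.
apply: (@gen_regular _ _ x (mkseq k d)) => //; apply: frame_of_gen => //.
  move=> i; rewrite size_mkseq => id; rewrite nth_mkseq //.
  have [_ piD] := nframe_mem F id.
  apply: near_imp3 (near_and piD vD) v1 (smooth_near_near sf) => y [piy vy] v1y sfy.
  apply/(ker_inP D sfy); split; last exact: ker_shift.
  by apply: memvB => //; exact: memvZ.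
apply/subvP => z /(ker_inP D sf)[/(near_at Dp)[b ->] z0].
have -> : \sum_(i < d) b i *: p i x = \sum_(i < d) b i *: k i x + (\sum_(i < d) b i * 'D_(p i x) f x) *: v x.
  rewrite scaler_suml -big_split; apply: eq_bigr => i _; rewrite /= /k scalerBr scalerA.
  by rewrite /lied subrK.
have -> : \sum_(i < d) b i * 'D_(p i x) f x = 0.
  rewrite -[RHS]z0 (derive_dir_sum _ _ _ (smooth_near_diff sf)); apply: eq_bigr => i _.
  by rewrite (derive_dirZ _ _ (smooth_near_diff sf)).
rewrite scale0r addr0; apply: memv_suml => i _; apply: memvZ.
rewrite -(nth_mkseq (fun=> 0%R) k (ltn_ord i)); apply: mem_evals.
by rewrite size_mkseq.
Qed.

Lemma bracket_ker y u w (f : V -> R) : smooth_near y u -> smooth_near y w -> smooth_near y f ->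
  (\forall z \near y, lied u f z = 0) -> (\forall z \near y, lied w f z = 0) ->
  'D_(lie_bracket u w y) f y = 0.
Proof.
move=> su sw sf u0 w0; have := bracket_kill su sw sf w0.
rewrite -[X in _ = - X]/('D_(lie_bracket u w y) f y) => H.
apply/eqP; rewrite -oppr_eq0 -H; apply/eqP.
by rewrite (near_at (near_lied_eq w u0)) lied_cst.
Qed.

(** A section through z0 is corrected by a multiple of v so that it stays in the kernel of df; by
    continuity dg remains nonzero on it. *)
Lemma nondeg_near x D v (f g : V -> R) z0 : regular x D -> smooth_near x f -> smooth_near x g ->
  section_near D x v -> (\forall y \near x, lied v f y = 1) ->
  z0 \in D x -> 'D_z0 f x = 0 -> 'D_z0 g x != 0 ->
  \forall y \near x, exists2 z, z \in D y & 'D_z f y = 0 /\ 'D_z g y != 0.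
Proof.
move=> rD sf sg [sv vD] v1 z0D z0f z0g.
have [w [[sw wD] wz0]] := section_through rD z0D.
pose w' y := w y - lied w f y *: v y.
have sw' : smooth_near x w' by apply: smooth_nearB => //; apply: smooth_nearZ => //; exact: smooth_near_lied.
have w'x : w' x = z0 by rewrite /w' /lied wz0 z0f scale0r subr0.
have : lied w' g x != 0 by rewrite /lied w'x.
move/(near_neq0 (smooth_near_continuous (smooth_near_lied sw' sg))) => nz.
apply: near_imp3 (near_and wD nz) (near_and v1 vD) (smooth_near_near sf).
move=> y [wy nzy] [v1y vy] s1; exists (w' y); last first.
  by split; [exact: ker_shift s1 v1y|exact: nzy].
exact: memvB wy (memvZ _ vy).
Qed.

(** The kernel K of dy1 in D exceeds the characteristics by at most one dimension, so [K, K] lies in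
    D by [almost_cauchy], and dy1 vanishes on it: K is involutive. A covector zero on K but not on a
    vector of Dbar outside D, corrected along v to have dy1 = 0, integrates to y2; on D the
    differential of y2 is then a multiple of dy1. *)
Lemma choose_y2 x D Dbar v (y1 : V -> R) : regular x D -> regular x Dbar -> germ_le x D Dbar ->
  loc_const_dim x (cauchy_char D) -> smooth_near x y1 -> section_near D x v ->
  (\forall y \near x, lied v y1 y = 1) -> kills x (cauchy_char D) y1 ->
  (\dim (D x) <= \dim (cauchy_char D x) + 2)%N -> (\dim (D x) < \dim (Dbar x))%N ->
  exists y2 : V -> R, [/\ smooth_near x y2,
    \forall y \near x, forall z, z \in D y -> 'D_z y2 y = lied v y2 y * 'D_z y1 y &
    \forall y \near x, exists2 z, z \in Dbar y & 'D_z y1 y = 0 /\ 'D_z y2 y != 0].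
Proof.
move=> rD rB DB cC sy1 Dv v1 Ey1 dD dB.
have [rK dK] := ker_in_regular rD sy1 Dv v1; have [sv vD] := Dv.
set K := ker_in D y1 in rK dK *.
have KD : germ_le x K D.
  by apply: near_imp (smooth_near_near sy1) => y sy; apply/subvP => z /(ker_inP D sy)[].
have iK : germ_involutive x K.
  have aK : germ_le x (bracket_dd K K) D.
    apply: almost_cauchy => //; last by have := near_at dK; lia.
    have h := near_and (smooth_near_near sy1) Ey1.
    apply: near_imp2 h (cauchy_sub cC) => y [sy Ey] CD; apply/subvP => z zE.
    by apply/(ker_inP D sy); split; [exact: subvP CD _ zE|exact: Ey].
  apply: near_imp2 aK (near_near (smooth_near_near sy1)) => y aKy nsy.
  have sy := near_at nsy.
  apply: bracket_dd_sub => u w Ku Kw; apply/(ker_inP D sy); split.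
    by apply: (subvP aKy); exact: bracket_mem.
  have [[su uK] [sw wK]] := (Ku, Kw).
  apply: bracket_ker => //.
    by apply: near_imp2 nsy uK => z sz /(ker_inP D sz)[].
  by apply: near_imp2 nsy wK => z sz /(ker_inP D sz)[].
have /subvPn[z0 z0B z0D] : ~~ (Dbar x <= D x)%VS by apply/negP => /dimvS; rewrite leqNgt dB.
pose z' := z0 - 'D_z0 y1 x *: v x.
have z'K : z' \notin K x.
  apply/negP => /(subvP (near_at KD)) z'D; move/negP: z0D; apply.
  by rewrite -[z0](subrK ('D_z0 y1 x *: v x)); apply: memvD => //; exact: memvZ (near_at vD).
have [l [lz' lK]] := separation z'K.
have [y2 [sy2 Ky2 ly2]] := frobenius rK iK lK.
exists y2; split=> //.
  have h := near_and3 (smooth_near_near sy1) (smooth_near_near sy2) Ky2.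
  apply: near_imp3 h vD v1 => y [s1 s2 Ky] vy v1y z zD.
  have : 'D_(z - 'D_z y1 y *: v y) y2 y = 0.
    apply: Ky; apply/(ker_inP D s1); split; last exact: ker_shift.
    by apply: memvB => //; exact: memvZ.
  have d2 := smooth_near_diff s2; rewrite (derive_dirB _ _ d2) (derive_dirZ _ _ d2) => /eqP.
  by rewrite subr_eq0 => /eqP ->; exact: mulrC.
have z'B : z' \in Dbar x.
  by apply: memvB => //; apply: memvZ; exact: subvP (near_at DB) _ (near_at vD).
apply: (nondeg_near rB sy1 sy2 _ v1 z'B); first exact: section_sub DB Dv.
  exact: ker_shift sy1 (near_at v1).
by rewrite ly2 lz' oner_eq0.
Qed.

End SecondContactFunction.

(** * Dimensions of the flags under (a) and (b) *)

Section Flags.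
Context {R : realType} {n : nat}.
Local Notation V := 'rV[R]_n.
Local Notation vf := (V -> V).
Implicit Types (x : V) (D : tdistribution R n) (L : seq vf) (a b : vf) (i j : nat).

(** Explicit generators of the D_i, kept as lists because the ranks of such lists single out the
    generic points. *)
Fixpoint Dlist a b1 b2 i : seq vf :=
  match i with
  | 0 => [::]
  | 1 => [:: b1; b2]
  | i'.+1 => Dlist a b1 b2 i' ++ [seq lie_bracket a u | u <- Dlist a b1 b2 i']
  end.

Fixpoint Flist L j : seq vf :=
  if j is j'.+1 then Flist L j' ++ [seq lie_bracket u w | u <- Flist L j', w <- Flist L j'] else L.

Lemma gen_Dlist x a b1 b2 : smooth_near x a -> smooth_near x b1 -> smooth_near x b2 ->
  (forall i, loc_const_dim x (Dseq a b1 b2 i)) -> forall i, gen x (Dlist a b1 b2 i) (Dseq a b1 b2 i).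
Proof.
move=> sa s1 s2 cD; elim=> [|[_|i IH]].
- by split=> //; apply: near_W => y; rewrite /evals /= span_nil.
- split; first by case=> [|[|]].
  by apply: near_W => y; rewrite /evals /= span_cons span_seq1.
- exact: gen_bracket_vd IH (cD i.+1) sa.
Qed.

Lemma gen_Flist x D L : gen x L D -> (forall j, loc_const_dim x (derived_flag D j)) ->
  forall j, gen x (Flist L j) (derived_flag D j).
Proof.
move=> gD cD; elim=> [|j IH] //=.
by apply: gen_bracket_dd => //; apply: near_W => y; exact: subvv.
Qed.

Lemma bracket_vd0 a x : (bracket_vd a (fun=> 0%VS) x <= 0)%VS.
Proof.
apply: vspan_sub => _ [w [sw w0] <-]; have w00 : \forall y \near x, w y = 0.
  by apply: near_imp w0 => y; rewrite memv0 => /eqP.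
rewrite (bracket_near_eq a (w' := fun=> 0) w00) /lie_bracket derive_cst derive0 subrr; exact: mem0v.
Qed.

Lemma Dseq_sub a b1 b2 x i : (Dseq a b1 b2 i x <= Dseq a b1 b2 i.+1 x)%VS.
Proof. case: i => [|i]; [exact: sub0v|exact: addvSl]. Qed.

Lemma Dseq_bracket a b1 b2 x i : (bracket_vd a (Dseq a b1 b2 i) x <= Dseq a b1 b2 i.+1 x)%VS.
Proof. case: i => [|i]; [exact: subv_trans (bracket_vd0 a x) (sub0v _)|exact: addvSr]. Qed.

Lemma flag_mono D x i j : (i <= j)%N -> (derived_flag D i x <= derived_flag D j x)%VS.
Proof.
move=> /subnK <-; elim: (j - i)%N => [|k IH]; first exact: subvv.
by rewrite addSn; apply: subv_trans IH _; exact: addvSl.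
Qed.

Lemma Dseq_growth x a b1 b2 i : smooth_near x a -> (forall i, regular x (Dseq a b1 b2 i)) ->
  (\dim (Dseq a b1 b2 i.+2 x) <=
    \dim (Dseq a b1 b2 i.+1 x) + (\dim (Dseq a b1 b2 i.+1 x) - \dim (Dseq a b1 b2 i x)))%N.
Proof.
move=> sa rD; apply: ext_dim sa (rD i) (rD i.+1) _ (subvv _) (Dseq_bracket _ _ _ _ _).
by apply: near_W => y; exact: Dseq_sub.
Qed.

Lemma bracket_vd_mono x a D D' : germ_le x D D' -> (bracket_vd a D x <= bracket_vd a D' x)%VS.
Proof.
move=> DD; apply: vspan_sub => _ [w Dw <-]; apply: mem_vspan; exists w => //.
exact: section_sub DD Dw.
Qed.

Lemma regular_Gseq x a D : smooth_near x a -> regular x D -> (forall i, loc_const_dim x (Gseq a D i)) ->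
  forall i, regular x (Gseq a D i).
Proof.
move=> sa rD cG; elim=> [|i [d [v [c F]]]] //.
by apply: gen_regular (gen_bracket_vd (nframe_gen F) (cG i) sa) (cG i.+1).
Qed.

End Flags.

Section FlagDimensions.
Context {R : realType} {n : nat} (x : 'rV[R]_n) (a b1 b2 : 'rV[R]_n -> 'rV[R]_n)
  (r q : nat) (Dbar : tdistribution R n).
Local Notation V := 'rV[R]_n.
Local Notation D := (Dseq a b1 b2).
Local Notation DF := (derived_flag (D r.+1)).
Context (sa : smooth_near x a) (sb1 : smooth_near x b1) (sb2 : smooth_near x b2).
Context (N3 : is_n3 x a b1 b2 r) (iB : is_involutive_closure x (D r.+1) Dbar)
  (N2 : is_n2 x (D r.+1) Dbar q) (reg : regular_near x a b1 b2 Dbar r q).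

Lemma D_regular i : regular x (D i).
Proof. by have [cD _ _ _ _] := reg; apply: gen_regular (cD i); exact: gen_Dlist. Qed.

Lemma DF_regular j : regular x (DF j).
Proof.
have [cD cF _ _ _] := reg; apply: gen_regular (cF j); apply: gen_Flist cF j.
exact: gen_Dlist.
Qed.

Lemma DF_Dbar : germ_eq x (DF (q - 2)) Dbar.
Proof. by have [] := N2. Qed.

Lemma Dbar_regular : regular x Dbar.
Proof. exact: regular_eq DF_Dbar (DF_regular _). Qed.

Lemma Dbar_inv : germ_involutive x Dbar.
Proof. by have [] := iB. Qed.

Lemma DF_sub_Dbar j : (j <= q - 2)%N -> germ_le x (DF j) Dbar.
Proof. by move=> jq; apply: near_imp DF_Dbar => y <-; exact: flag_mono. Qed.

(** For n2 = 2 the distribution D_(n3+1) would be its own involutive closure, against the choice of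
    n3. *)
Lemma q_ge3 : (3 <= q)%N.
Proof.
have [q2 _ _] := N2; rewrite ltn_neqAle q2 andbT; apply/eqP => q2'.
have [nD _] := N3; apply: nD; have := DF_Dbar; rewrite -q2' /= => DB.
have h := near_near DB; have iB' := Dbar_inv.
apply: near_imp2 iB' h => y iy eq; rewrite (near_at eq); apply: subv_trans iy.
apply: bracket_dd_sub => u w Du Dw; apply: bracket_mem.
  by apply: section_sub Du; apply: near_imp eq => z ->; exact: subvv.
by apply: section_sub Dw; apply: near_imp eq => z ->; exact: subvv.
Qed.

Context (cA : germ_eq x (cauchy_char (D r.+1)) (D r)).

(** The increments of dim D_i do not increase ([Dseq_growth]), the first is at most 2, and the last
    is at least 2: otherwise D_(r+1) would exceed its characteristics D_r by at most one dimension
    and be involutive by [almost_cauchy]. So all are 2. *)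
Lemma D_dim i : (i <= r.+1)%N -> \dim (D i x) = (2 * i)%N.
Proof.
have [_ _ cC _ _] := reg; have cC0 := cC 0%N.
have gr i0 := @Dseq_growth R n x a b1 b2 i0 sa D_regular.
have mono i0 : (\dim (D i0 x) <= \dim (D i0.+1 x))%N by apply: dimvS; exact: Dseq_sub.
have top : (\dim (D r x) + 2 <= \dim (D r.+1 x))%N.
  rewrite leqNgt; apply/negP => H; have [nD _] := N3; apply: nD.
  apply: almost_cauchy cC0 (D_regular _) (cauchy_sub cC0) _ _; first by apply: near_W => y; exact: subvv.
  by rewrite [in leqRHS]/= (near_at cA); move: H; rewrite addn2 addn1 ltnS.
have low k : (k <= r)%N -> (\dim (D (r - k) x) + 2 <= \dim (D (r - k).+1 x))%N.
  elim: k => [|k IH] kr; first by rewrite subn0.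
  have E : (r - k)%N = (r - k.+1).+1 by rewrite subnSK.
  have := IH (ltnW kr); have := gr (r - k.+1)%N; have := mono (r - k.+1)%N; rewrite E.
  by move: (\dim _) (\dim _) (\dim _) => d1 d2 d3; lia.
have d1 : (\dim (D 1 x) <= 2)%N.
  apply: leq_trans (leq_addr (\dim (<[b1 x]> :&: <[b2 x]>)) _) _.
  by rewrite dimv_sum_cap !dim_vline; case: (_ != _); case: (_ != _).
have d0 : \dim (D 0 x) = 0%N by rewrite /= dimv0.
have low' i0 : (i0 <= r)%N -> (\dim (D i0 x) + 2 <= \dim (D i0.+1 x))%N.
  by move=> i0r; have := low (r - i0)%N (leq_subr _ _); rewrite subKn.
suff H k : (k <= r)%N -> \dim (D k x) = (2 * k)%N /\ \dim (D k.+1 x) = (2 * k.+1)%N.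
  by rewrite leq_eqVlt ltnS => /orP[/eqP ->|/H[]//]; have [] := H r (leqnn r).
elim: k => [|k IH] kr.
  by have := low' 0%N kr; rewrite d0; split=> //; apply/eqP; rewrite eqn_leq d1.
have [e1 e2] := IH (ltnW kr); split=> //.
have := low' k.+1 kr; have := gr k; rewrite e1 e2; move: (\dim _) => d; lia.
Qed.

Context (cB : forall i, (1 <= i <= q - 2)%N ->
  \forall y \near x, \dim (DF i y) = (\dim (D r.+1 y) + i)%N).

Lemma DF_dim j : (j <= q - 2)%N -> \forall y \near x, \dim (DF j y) = (2 * r.+1 + j)%N.
Proof.
move=> jq; have E : \dim (DF j x) = (2 * r.+1 + j)%N.
  rewrite -(D_dim (leqnn _)); case: j jq => [|j] jq; first by rewrite addn0.
  have jj : (1 <= j.+1 <= q - 2)%N by rewrite jq.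
  exact: near_at (cB jj).
by rewrite -E; exact: regular_dim (DF_regular j).
Qed.

Lemma Dbar_dim : \forall y \near x, \dim (Dbar y) = (2 * r + q)%N.
Proof.
have q3 := q_ge3; apply: near_imp2 DF_Dbar (DF_dim (leqnn _)) => y <- ->; lia.
Qed.

Local Notation E := (cauchy_char (DF (q - 3))).

(** For q = 3 this is (a) with [D_dim]; for larger q the preceding member of the flag plays the role
    of P in [cauchy_codim2]. *)
Lemma char_codim : (\dim (DF (q - 3) x) <= \dim (E x) + 2)%N.
Proof.
have q3 := q_ge3; have [q4|q4] := ltnP 3 q; last first.
  have -> : (q - 3 = 0)%N by lia.
  by rewrite (near_at cA) (D_dim (leqnSn _)) (D_dim (leqnn _)); lia.
have e3 : (q - 3 = (q - 4).+1)%N by lia.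
have l4 : (q - 4 <= q - 2)%N by lia.
have l3 : (q - 3 <= q - 2)%N by lia.
have d4 := near_at (DF_dim l4); have d3 := near_at (DF_dim l3); have dB := near_at Dbar_dim.
have e2 : (q - 2 = (q - 3).+1)%N by lia.
have sub j : germ_le x (DF j) (DF j.+1) by apply: near_W => y; exact: flag_mono.
have H : (\dim (DF (q - 4) x) <= \dim (E x) + 1)%N.
  apply: (@cauchy_codim2 _ _ x (DF (q - 4)) (DF (q - 3)) Dbar) (DF_regular _) (DF_regular _) Dbar_regular _ (DF_sub_Dbar l3) _ _ _ _ _.
  - by rewrite e3; exact: sub.
  - by rewrite e3; apply: near_W => y; exact: addvSr.
  - by apply: near_imp DF_Dbar => y <-; rewrite e2; exact: addvSr.
  - by rewrite d3 d4; lia.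
  - by rewrite d3 dB; lia.
  - move=> H; have := near_at DF_Dbar; rewrite e2 /= /addd => eB.
    have : (Dbar x <= DF (q - 3) x)%VS by rewrite -eB subv_add subvv.
    by move/dimvS; rewrite d3 dB; lia.
by move: H; rewrite d3 d4; lia.
Qed.

Context (cC1 : forall i, (1 <= i <= q - 3)%N ->
  germ_le x (bracket_vd a (cauchy_char (DF i))) (DF i)).

(** Condition (c) starts at j = 1; at j = 0 the characteristics are D_r by (a), and [a, D_r] lies in
    D_(r+1) by construction. *)
Lemma drift_char j : (j <= q - 3)%N -> germ_le x (bracket_vd a (cauchy_char (DF j))) (DF j).
Proof.
case: j => [_|j jq]; last by apply: cC1; rewrite jq.
have h := near_near cA; apply: near_imp h => y h.
apply: subv_trans (Dseq_bracket a b1 b2 y r); apply: bracket_vd_mono.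
by apply: near_imp h => z ->; exact: subvv.
Qed.

End FlagDimensions.

(** * Contact data: the chains, y1, y2 and the field v *)

Section ContactData.
Context {R : realType} {n : nat}.
Local Notation V := 'rV[R]_n.
Local Notation vf := (V -> V).
Implicit Types (x y z : V) (D E K : tdistribution R n) (a e u v w : vf) (f g : V -> R).

Lemma bracket_affine a u w (c : R) y : smooth_near y a -> smooth_near y u -> smooth_near y w ->
  lie_bracket a (fun z => c *: u z + w z) y = c *: lie_bracket a u y + lie_bracket a w y.
Proof.
move=> sa su sw; rewrite /lie_bracket.
have -> : 'D_(a y) (fun z => c *: u z + w z) y = c *: 'D_(a y) u y + 'D_(a y) w y.
  have scu := smooth_nearZc c su.
  rewrite (@deriveD _ _ _ (fun z => c *: u z) w); try exact: smooth_near_derivable.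
  by congr (_ + _); apply: (@deriveZ _ _ _ u); exact: smooth_near_derivable.
rewrite (derive_dirD _ _ (smooth_near_diff sa)) (derive_dirZ _ _ (smooth_near_diff sa)).
have gen (A B C E : V) : c *: A + B - (c *: C + E) = c *: (A - C) + (B - E).
  by rewrite scalerBr opprD addrACA.
exact: gen.
Qed.

Lemma bracket_vanish x D a w : regular x D -> smooth_near x a -> section_near D x w -> w x = 0 ->
  lie_bracket a w x \in D x.
Proof.
move=> [d [v [c F]]] sa Dw w0; have [sv _ _] := F; have [sw _] := Dw.
rewrite (bracket_near_eq a (nframe_section F Dw)).
rewrite (bracket_comb (f := fun i z => entry (w z) (c i))) //; last first.
  by move=> i _; exact: smooth_near_entry.
apply: memv_suml => i _; rewrite w0 entry0 scale0r addr0; apply: memvZ.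
by have [_ /near_at] := nframe_mem F (ltn_ord i).
Qed.

(** The difference of the two sections vanishes at x, and its bracket lies in D there: in a frame
    all its coefficients are zero at x and only their derivatives survive. So modulo D the bracket
    with [a] depends on values only. *)
Lemma bracket_pointwise x D a u w (W : {vspace V}) : regular x D -> smooth_near x a ->
  section_near D x u -> section_near D x w -> u x = w x -> (D x <= W)%VS ->
  lie_bracket a u x \in W -> lie_bracket a w x \in W.
Proof.
move=> rD sa Du Dw uw DW aW; have [su uD] := Du; have [sw wD] := Dw.
pose h z : V := (-1) *: u z + w z.
have Dh : section_near D x h.
  split; first by apply: smooth_nearD => //; exact: smooth_nearZc.
  by apply: near_imp2 uD wD => y h1 h2; apply: memvD => //; exact: memvZ.
have h0 : h x = 0 by rewrite /h uw scaleN1r addNr.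
have := bracket_vanish rD sa Dh h0; rewrite /h (bracket_affine (-1) sa su sw) => /(subvP DW) H.
have -> : lie_bracket a w x = lie_bracket a u x + (-1 *: lie_bracket a u x + lie_bracket a w x).
  by rewrite scaleN1r addrA subrr add0r.
exact: memvD.
Qed.

Lemma normalize_section x D u f : section_near D x u -> smooth_near x f -> lied u f x != 0 ->
  exists v, section_near D x v /\ \forall y \near x, lied v f y = 1.
Proof.
move=> [su uD] sf nz; have sl := smooth_near_lied su sf.
have nzn := near_neq0 (smooth_near_continuous sl) nz.
exists (fun y => (lied u f y)^-1 *: u y); split; first split.
- by apply: smooth_nearZ => //; exact: smooth_nearV.
- by apply: near_imp uD => y h; exact: memvZ.
apply: near_imp2 nzn (smooth_near_near sf) => y nzy sfy.
have -> : lied (fun y => (lied u f y)^-1 *: u y) f y = (lied u f y)^-1 * lied u f y.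
  exact: derive_dirZ (smooth_near_diff sfy).
exact: mulVf.
Qed.

(* The elements of Dbar extending to sections u with [a, u] in Dbar form an involutive
   distribution containing D. *)
Lemma drift_closure x a D Dbar : smooth_near x a -> regular x D -> regular x Dbar ->
  is_involutive_closure x D Dbar -> germ_le x (bracket_vd a D) Dbar ->
  germ_le x (bracket_vd a Dbar) Dbar.
Proof.
move=> sa rD rB [DB iB minB] aD.
pose S y z := exists u, [/\ section_near Dbar y u, u y = z & lie_bracket a u y \in Dbar y].
pose F y := vspan [set z | S y z].
have FS y : smooth_near y a -> forall z, z \in F y -> S y z.
  move=> say z; rewrite /F; have [s [sS ->]] := vspan_seq [set z | S y z].
  elim: s z sS => [|v s IH] z sS.
    rewrite span_nil memv0 => /eqP ->; exists (fun=> 0); split=> //.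
      by split; [exact: smooth_near_cst|apply: near_W => ?; exact: mem0v].
    by rewrite /lie_bracket derive_cst derive0 subrr; exact: mem0v.
  rewrite span_cons => /memv_addP[_ /vlineP[c ->] [z' z's ->]].
  have [|u [[su uB] uz auB]] := IH z' _ z's; first by move=> w ws; apply: sS; rewrite inE ws orbT.
  have [|w [[sw wB] wz awB]] := sS v; first by rewrite inE eqxx.
  exists (fun y => c *: w y + u y); split; last 2 first.
  - by rewrite wz uz.
  - by rewrite (bracket_affine c say sw su); exact: memvD (memvZ _ awB) auB.
  split; first by apply: smooth_nearD => //; exact: smooth_nearZc.
  by apply: near_imp2 wB uB => t h1 h2; apply: memvD => //; exact: memvZ.
have Fbr y u : smooth_near y a -> regular y Dbar -> section_near Dbar y u -> u y \in F y ->
    lie_bracket a u y \in Dbar y.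
  move=> say ry Bu /(FS y say)[w [Bw wu aw]].
  exact: bracket_pointwise ry say Bw Bu wu (subvv _) aw.
have n1 := near_and (smooth_near_near sa) (regular_near_pt rB).
have DF : germ_le x D F.
  have n2 := near_and3 (regular_near_pt rD) (near_near DB) aD.
  apply: near_imp2 n1 n2 => y [say rBy] [rDy DBy aDy]; apply/subvP => z zD.
  have [w [Dw wz]] := section_through rDy zD; apply: mem_vspan; exists w; split=> //.
    exact: section_sub DBy Dw.
  by apply: (subvP aDy); apply: mem_vspan; exists w.
have FB y : smooth_near y a -> (F y <= Dbar y)%VS.
  by move=> say; apply/subvP => z /(FS y say)[u [[_ /near_at uB] <- _]].
have iF : germ_involutive x F.
  apply: near_imp2 (near_near n1) (near_and iB (near_near iB)) => y n1y [iy niy].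
  have [say rBy] := near_at n1y.
  have FBy : germ_le y F Dbar by apply: near_imp n1y => t [st _]; exact: FB.
  have sec u : section_near F y u -> section_near Dbar y (lie_bracket a u).
    move=> Fu; have Bu := section_sub FBy Fu; have [su uF] := Fu; split; first exact: smooth_near_bracket.
    apply: near_imp3 n1y uF (section_near_near Bu) => t [st rt] ut But; exact: Fbr.
  have brB u w : section_near Dbar y u -> section_near Dbar y w -> section_near Dbar y (lie_bracket u w).
    move=> Bu Bw; have [[su _] [sw _]] := (Bu, Bw); split; first exact: smooth_near_bracket.
    apply: near_imp3 niy (section_near_near Bu) (section_near_near Bw) => t it But Bwt.
    by apply: (subvP it); exact: bracket_mem.
  apply: bracket_dd_sub => u w Fu Fw; have [[su _] [sw _]] := (Fu, Fw).
  have [Bu Bw] := (section_sub FBy Fu, section_sub FBy Fw).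
  apply: mem_vspan; exists (lie_bracket u w); split=> //; first exact: brB.
  rewrite jacobi //; apply: memvD; apply: (subvP iy); apply: bracket_mem => //; exact: sec.
apply: near_imp2 n1 (minB F DF iF) => y [say rBy] BF.
apply: vspan_sub => _ [w Bw <-]; apply: Fbr => //; have [_ /near_at wB] := Bw.
exact: subvP BF _ wB.
Qed.

Definition contact_data x a D D' Dbar p1 p2 (f1 f2 : V -> R) v :=
  let y1 := iter p1 (lied a) f1 in let y2 := iter p2 (lied a) f2 in
  [/\ smooth_near x f1 /\ smooth_near x f2,
    (forall k, (k < p1)%N -> kills x Dbar (iter k (lied a) f1)) /\
    (forall k, (k < p2)%N -> kills x Dbar (iter k (lied a) f2)),
    (forall z, (forall k, (k < p1)%N -> 'D_z (iter k (lied a) f1) x = 0) ->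
      (forall k, (k < p2)%N -> 'D_z (iter k (lied a) f2) x = 0) -> z \in Dbar x) /\
    (\dim (Dbar x) + p1 + p2 = n)%N,
    section_near D x v /\ (\forall y \near x, lied v y1 y = 1) &
    (\forall y \near x, forall z, z \in D' y -> 'D_z y2 y = lied v y2 y * 'D_z y1 y) /\
    (\forall y \near x, exists2 z, z \in Dbar y & 'D_z y1 y = 0 /\ 'D_z y2 y != 0)].

(** The function y1 is a first integral of C(D') that some section of D moves. Genericity enters
    through [genA], which carries the inclusion of [D, D'] in D' from x to a neighbourhood; D then
    consists of characteristics of D' there. *)
Lemma contact_full x a D D' Dbar : regular x D -> regular x D' -> regular x Dbar ->
  germ_le x D D' -> germ_le x D' Dbar -> is_involutive_closure x D Dbar ->
  loc_const_dim x (cauchy_char D') -> (\dim (D' x) <= \dim (cauchy_char D' x) + 2)%N ->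
  (\dim (D' x) < \dim (Dbar x))%N -> germ_full x Dbar ->
  ((bracket_dd D D' x <= D' x)%VS -> germ_le x (bracket_dd D D') D') ->
  exists f1 f2 v, contact_data x a D D' Dbar 0 0 f1 f2 v.
Proof.
move=> rD rD' rB DD' DB cl cC codim dB full genA.
have CD := cauchy_sub cC; have iE := cauchy_involutive cC.
have rE := regular_cauchy cC.
have /subvPn[z0 z0D z0E] : ~~ (D x <= cauchy_char D' x)%VS.
  apply/negP => DE; have /genA bD : (bracket_dd D D' x <= D' x)%VS.
    apply: bracket_dd_sub => w u Dw D'u; have [_ /near_at wD] := Dw; have [su _] := D'u.
    have [e [Ee ew]] := section_through rE (subvP DE _ wD).
    rewrite bracketN memvN; apply: (bracket_pointwise rD' su _ _ ew (subvv _)).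
    - exact: section_sub CD Ee.
    - exact: section_sub DD' Dw.
    rewrite bracketN memvN; apply: (subvP (near_at (cauchy_section cC Ee))).
    by apply: mem_vspan; exists u.
  have [_ _ minB] := cl.
  have : germ_le x Dbar (cauchy_char D').
    apply: minB => //; apply: near_imp3 (near_near bD) (regular_near_pt rD) (near_near DD') => y bDy rDy DDy.
    apply/subvP => z zD; have [w [Dw wz]] := section_through rDy zD.
    apply: mem_vspan; exists w; split=> //; first exact: section_sub DDy Dw.
    apply: near_imp2 bDy (section_near_near Dw) => t bt Dwt; apply: vspan_sub => _ [u D'u <-].
    by apply: (subvP bt); exact: bracket_mem.
  by move=> /near_at /dimvS; have := dimvS (near_at CD); move: dB; lia.
have [l [lz lE]] := separation z0E.
have [y1 [sy1 Ey1 ly1]] := frobenius rE iE lE.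
have [u [Du uz]] := section_through rD z0D.
have [|v [Dv v1]] := normalize_section Du sy1; first by rewrite /lied uz ly1 lz oner_eq0.
have [y2 [sy2 base nd]] := choose_y2 rD' rB DB cC sy1 (section_sub DD' Dv) v1 Ey1 codim dB.
exists y1, y2, v; split=> //=; split=> // [z _ _|]; first by rewrite (near_at full) memvf.
by rewrite (near_at full) dimvf /dim /= mul1n !addn0.
Qed.

(** There are m = dim G_1 - dim Dbar chains; [top j] ends chain j and [Y j] is its drift derivative.
    On any part of Dbar the differentials of the [Y j] mirror those of the tops on the brackets with
    the drift, so dimension counts turn into relations between y1 and y2. *)
Lemma contact_chains x a D D' Dbar s : smooth_near x a ->
  regular x D -> regular x D' -> regular x Dbar ->
  germ_le x D D' -> germ_le x D' Dbar -> is_involutive_closure x D Dbar ->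
  loc_const_dim x (cauchy_char D') -> (\dim (D' x) <= \dim (cauchy_char D' x) + 2)%N ->
  (\dim (Dbar x) = \dim (D' x) + 1)%N -> germ_le x (bracket_vd a (cauchy_char D')) D' ->
  (forall i, regular x (Gseq a Dbar i)) -> (forall i, germ_involutive x (Gseq a Dbar i)) ->
  germ_full x (Gseq a Dbar s) ->
  (\forall y \near x, \dim (Dbar y + bracket_vd a D' y)%VS = (\dim (Dbar y) + 1)%N) ->
  ((bracket_vd a D x <= Dbar x)%VS -> germ_le x (bracket_vd a D) Dbar) ->
  exists p1 p2 f1 f2 v, contact_data x a D D' Dbar p1 p2 f1 f2 v.
Proof.
move=> sa rD rD' rB DD' DB cl cC codim dB aE rG iG Gs c2 genA.
have c2x := near_at c2; have CD := cauchy_sub cC.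
have siter k (g : V -> R) : smooth_near x g -> smooth_near x (iter k (lied a) g).
  by move=> sg; elim: k => // k IH; exact: smooth_near_lied.
have [|m [phi [l [sphi kphi zphi ind [dsum dm]]]]] := drift_chains sa (fun i _ => rG i) (fun i _ => iG i) _ Gs.
  by move=> i; apply: near_W.
rewrite /= in kphi zphi dsum dm.
pose top j := iter (l j).-1 (lied a) (phi j).
pose Y j := iter (l j) (lied a) (phi j).
have YE j : (j < m)%N -> Y j = lied a (top j).
  by move=> jm; rewrite /Y /top; have [_] := sphi j jm; case: (l j).
have stop j : (j < m)%N -> smooth_near x (top j) by move=> /sphi[? _]; exact: siter.
have sY j : (j < m)%N -> smooth_near x (Y j) by move=> /sphi[? _]; exact: siter.
have ktop j : (j < m)%N -> kills x Dbar (top j).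
  by move=> jm; apply: kphi => //; have [_] := sphi j jm; case: (l j) => // k _ /=.
have indB : dindep x (Dbar x) Y m.
  have := chain_indep (C := Gseq a Dbar 1) sa stop (subvv _) ktop rB ind.
  by move=> H c cA; apply: (H c) => z zB; rewrite -[RHS](cA z zB); apply: eq_bigr => j _; rewrite YE.
(* Without chains Dbar would be everything, leaving no room for the extra dimension in (c). *)
have m0 : (0 < m)%N.
  rewrite lt0n; apply/negP => /eqP m0; move: dsum; rewrite m0 big_ord0 addn0 => dn.
  have := dimvS (subvf (Dbar x + bracket_vd a D' x)); rewrite c2x dimvf /dim /= mul1n dn.
  by rewrite addn1 ltnn.
(* Dbar has one dimension more than D', so bracketing all of Dbar adds at most one dimension to Dbar
   + [a, D'], which by (c) exceeds Dbar by one. *)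
have m2 : (m <= 2)%N.
  have H := ext_dim sa rD' rB DB (addvSl (Dbar x) (bracket_vd a D' x)) (addvSr _ _).
  have : (\dim (Dbar x) + m <= \dim (Dbar x + bracket_vd a D' x) + (\dim (Dbar x) - \dim (D' x)))%N.
    by rewrite dm; apply: leq_trans H; apply: dimvS; apply: addvS (addvSl _ _) (subvv _).
  by rewrite c2x dB; lia.
have DDbar : germ_le x D Dbar by apply: near_imp2 DD' DB => y h1 h2; exact: subv_trans h1 h2.
have brtop y w j : (j < m)%N -> smooth_near y a -> smooth_near y (top j) -> kills y Dbar (top j) ->
    section_near Dbar y w -> 'D_(w y) (Y j) y = - 'D_(lie_bracket a w y) (top j) y.
  move=> jm say st kt Bw; have [sw _] := Bw; rewrite (YE j jm).
  exact: bracket_kill say sw st (kills_section kt Bw).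
(* Otherwise [a, D] is in the kernel of all tops, hence in Dbar, at x; [genA] spreads this to a
   neighbourhood, [drift_closure] extends it to [a, Dbar], and (c) is violated. *)
have [j0 [j0m [u [Du nz]]]] : exists j, (j < m)%N /\ exists u, section_near D x u /\ lied u (Y j) x != 0.
  apply: contrapT => H; have /genA aD : (bracket_vd a D x <= Dbar x)%VS.
    apply: vspan_sub => _ [w Dw <-]; have Bw := section_sub DDbar Dw.
    apply: (dindep_ker stop ind (addvSl _ _)) => [z j zB jm||| j jm].
    - by apply: (near_at (ktop j jm)).
    - by rewrite -dm.
    - by apply: (subvP (addvSr _ _)); apply: mem_vspan; exists w.
    have := brtop x w j jm sa (stop j jm) (ktop j jm) Bw.
    have -> : 'D_(w x) (Y j) x = 0.
      by apply: contrapT => /eqP nz; apply: H; exists j; split=> //; exists w.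
    by move/esym/eqP; rewrite oppr_eq0 => /eqP.
  have aB := near_at (drift_closure sa rD rB cl aD).
  have : (bracket_vd a D' x <= Dbar x)%VS.
    by apply: subv_trans aB; exact: bracket_vd_mono.
  by move=> /addv_idPl E; move: c2x; rewrite E; move: (\dim _) => k; clear; lia.
have [v [Dv v1]] := normalize_section Du (sY j0 j0m) nz; have [sv vD] := Dv.
(* With a single chain the second function is not a drift derivative; it comes from [choose_y2],
   which needs y1 constant along C(D'). The inclusion [aE] of [a, C(D')] in D' provides this. *)
have [m1|mn1] := eqVneq m 1%N.
  have j00 : j0 = 0%N by move: j0m; rewrite m1; case: (j0).
  rewrite j00 in v1.
  have Ey1 : kills x (cauchy_char D') (Y 0%N).
    rewrite (YE 0%N m0); have CB : germ_le x (cauchy_char D') Dbar.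
      by apply: near_imp2 CD DB => y h1 h2; exact: subv_trans h1 h2.
    apply: (chain_kills sa (stop 0%N m0) (regular_cauchy cC) _ CB (ktop 0%N m0)).
    by apply: near_imp2 aE DB => y h1 h2; exact: subv_trans h1 h2.
  have [|y2 [sy2 base nd]] := choose_y2 rD' rB DB cC (sY 0%N m0) (section_sub DD' Dv) v1 Ey1 codim.
    by rewrite dB addn1.
  exists (l 0%N), 0%N, (phi 0%N), y2, v; split=> //.
  - by split=> //; have [] := sphi 0%N m0.
  - by split=> // k kl; exact: kphi.
  - split; last by move: dsum; rewrite m1 big_ord1 addn0.
    by move=> z z0 _; apply: zphi => j k; rewrite m1 ltnS leqn0 => /eqP -> kl; exact: z0.
have me : m = 2%N by move: m0 m2 mn1; clear; case: m => [|[|[|]]].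
pose j1 := (1 - j0)%N; have j0lt : (j0 < 2)%N by rewrite -me.
have j1m : (j1 < m)%N by rewrite me /j1; move: j0lt; clear; case: j0 => [|[|]].
have jcase j : (j < m)%N -> j = j0 \/ j = j1.
  rewrite me /j1; move: j0lt; clear; case: j0 => [|[|//]] _; case: j => [|[|//]] _; by [left|right].
have sum2 (F : nat -> R) : \sum_(j < m) F j = F j0 + F j1.
  by rewrite me big_ord_recr big_ord1 /= /j1; move: j0lt; clear; case: j0 => [|[|]] //= _; rewrite addrC.
have sum2n : (\sum_(j < m) l j = l j0 + l j1)%N.
  by rewrite me big_ord_recr big_ord1 /= /j1; move: j0lt; clear; case: j0 => [|[|]] //= _; rewrite addnC.
have n1 : \forall y \near x, (smooth_near y a /\ section_near D' y v) /\
    forall j, (j < m)%N -> [/\ smooth_near y (top j), smooth_near y (Y j) & kills y Dbar (top j)].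
  apply: near_and; first exact: near_and (smooth_near_near sa) (section_near_near (section_sub DD' Dv)).
  apply: near_lt => j jm.
  exact: near_and3 (smooth_near_near (stop j jm)) (smooth_near_near (sY j jm)) (kills_near (ktop j jm)).
(* If dY_j1 were not a multiple of dY_j0 on D', the two tops would be independent on Dbar + [a, D']
   while vanishing on Dbar, which takes two extra dimensions instead of the one in (c). *)
have base : \forall y \near x, forall z, z \in D' y -> 'D_z (Y j1) y = lied v (Y j1) y * 'D_z (Y j0) y.
  have n2 := near_and3 (regular_near_pt rD') (near_near DB) c2.
  apply: near_imp3 n1 n2 v1 => y [[say D'v] Hj] [rDy DBy c2y] v1y z zD.
  apply: contrapT => /eqP ne; have [[_ s0 _] [_ s1 _]] := (Hj j0 j0m, Hj j1 j1m).
  have vyD : v y \in D' y by have [_ /near_at] := D'v.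
  have d1 := smooth_near_diff s1; have d0 := smooth_near_diff s0.
  pose w := z - 'D_z (Y j0) y *: v y.
  have wD : w \in D' y by apply: memvB => //; exact: memvZ.
  have w0 : 'D_w (Y j0) y = 0 by exact: ker_shift s0 v1y.
  have w1 : 'D_w (Y j1) y != 0.
    rewrite (derive_dirB _ _ d1) (derive_dirZ _ _ d1) subr_eq0; move: ne; rewrite /lied mulrC; exact.
  have indC : dindep y (Dbar y + bracket_vd a D' y)%VS top m.
    move=> c cA; have cY z' : z' \in D' y -> \sum_(j < m) c j * 'D_z' (Y j) y = 0.
      move=> z'D; have [h [Dh hz]] := section_through rDy z'D.
      have bC : lie_bracket a h y \in (Dbar y + bracket_vd a D' y)%VS.
        by apply: (subvP (addvSr _ _)); apply: mem_vspan; exists h.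
      apply: (@etrans _ _ (- \sum_(j < m) c j * 'D_(lie_bracket a h y) (top j) y)); last by rewrite (cA _ bC) oppr0.
      rewrite -sumrN; apply: eq_bigr => j _.
      have [st _ kt] := Hj j (ltn_ord j); rewrite -mulrN -hz; congr (_ * _).
      exact: brtop (ltn_ord j) say st kt (section_sub DBy Dh).
    have c1 : c j1 = 0.
      have := cY _ wD; rewrite (sum2 (fun j => c j * 'D_w (Y j) y)) w0 mulr0 add0r => /eqP.
      by rewrite mulf_eq0 (negbTE w1) orbF => /eqP.
    have c0 : c j0 = 0.
      have := cY _ vyD; rewrite (sum2 (fun j => c j * 'D_(v y) (Y j) y)) c1 mul0r addr0.
      by rewrite -[X in _ * X]/(lied v (Y j0) y) v1y mulr1.
    by move=> j /jcase [] ->.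
  have sty j : (j < m)%N -> smooth_near y (top j) by move=> jm; have [] := Hj j jm.
  have kty z' j : z' \in Dbar y -> (j < m)%N -> 'D_z' (top j) y = 0.
    by move=> z'B jm; have [_ _ k0] := Hj j jm; exact: (near_at k0).
  have := dindep_le sty indC (addvSl _ _) kty; rewrite c2y leq_add2l me.
  by [].
have [z0 z0B [z00 z01]] : exists2 z, z \in Dbar x & 'D_z (Y j0) x = 0 /\ 'D_z (Y j1) x != 0.
  apply: contrapT => H; have d1 := smooth_near_diff (sY j1 j1m).
  pose c j : R := if j == j1 then 1 else - lied v (Y j1) x.
  have j01 : (j0 == j1) = false by rewrite /j1; move: j0lt; clear; case: j0 => [|[|]].
  have := indB c; rewrite /c => /(_ _ j1 j1m); rewrite eqxx => H1.
  have /eqP : (1 : R) = 0; last by rewrite oner_eq0.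
  apply: H1 => z zB; rewrite (sum2 (fun j => (if j == j1 then 1 else - lied v (Y j1) x) * 'D_z (Y j) x)).
  rewrite eqxx j01 mul1r addrC mulNr.
  have : 'D_(z - 'D_z (Y j0) x *: v x) (Y j1) x = 0.
    apply: contrapT => /eqP nz1; apply: H; exists (z - 'D_z (Y j0) x *: v x).
      by apply: memvB => //; apply: memvZ; exact: subvP (near_at DDbar) _ (near_at vD).
    by split=> //; exact: ker_shift (sY j0 j0m) (near_at v1).
  by rewrite (derive_dirB _ _ d1) (derive_dirZ _ _ d1) mulrC.
exists (l j0), (l j1), (phi j0), (phi j1), v; split.
- by split; [have [] := sphi j0 j0m|have [] := sphi j1 j1m].
- by split=> k kl; exact: kphi.
- split; last by rewrite -addnA -sum2n.
  by move=> z h0 h1; apply: zphi => j k /jcase [] -> kl; [exact: h0|exact: h1].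
- by split.
- split; first exact: base.
  exact: nondeg_near rB (sY j0 j0m) (sY j1 j1m) (section_sub DDbar Dv) v1 z0B z00 z01.
Qed.

End ContactData.

(** * Transformation to the triangular form *)

Section AdaptedFunctions.
Context {R : realType} {n : nat} (x : 'rV[R]_n) (a b1 b2 : 'rV[R]_n -> 'rV[R]_n)
  (r q : nat) (Dbar : tdistribution R n) (p1 p2 : nat) (f1 f2 : 'rV[R]_n -> R) (v : 'rV[R]_n -> 'rV[R]_n).
Local Notation V := 'rV[R]_n.
Local Notation D := (Dseq a b1 b2).
Local Notation DF := (derived_flag (D r.+1)).
Local Notation y1 := (iter p1 (lied a) f1).
Local Notation y2 := (iter p2 (lied a) f2).
Context (sa : smooth_near x a) (q3 : (3 <= q)%N) (rD : forall i, regular x (D i))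
  (rF : forall j, regular x (DF j)) (FB : germ_eq x (DF (q - 2)) Dbar)
  (dD : forall i, (i <= r.+1)%N -> \dim (D i x) = (2 * i)%N)
  (dF : forall j, (j <= q - 2)%N -> \forall y \near x, \dim (DF j y) = (2 * r.+1 + j)%N)
  (cA : germ_eq x (cauchy_char (D r.+1)) (D r))
  (aC : forall j, (j <= q - 3)%N -> germ_le x (bracket_vd a (cauchy_char (DF j))) (DF j))
  (iB : germ_involutive x Dbar)
  (cd : contact_data x a (D r.+1) (DF (q - 3)) Dbar p1 p2 f1 f2 v).

(** X_1 = y1 and X_k = v^(k-2) y2 for k >= 2; index 0 falls to the default y1. *)
Definition chained k := if k is k'.+2 then iter k' (lied v) y2 else y1.
Local Notation X := chained.

Lemma smooth_iter (u : V -> V) k y (g : V -> R) : smooth_near y u -> smooth_near y g ->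
  smooth_near y (iter k (lied u) g).
Proof. by move=> su sg; elim: k => // k IH; exact: smooth_near_lied. Qed.

Lemma smooth_chained y k : smooth_near y a -> smooth_near y v -> smooth_near y f1 -> smooth_near y f2 ->
  smooth_near y (X k).
Proof. by move=> ? ? ? ?; case: k => [|[|k]] /=; do !apply: smooth_iter. Qed.

Lemma chained_smooth k : smooth_near x (X k).
Proof. by have [[s1 s2] _ _ [[sv _] _] _] := cd; exact: smooth_chained. Qed.

Lemma chained_goursat t : (1 <= t <= q - 1)%N ->
  (\forall y \near x, forall z, z \in DF (q - 1 - t) y <-> z \in Dbar y /\ theta_in X t y z) /\
  (\forall y \near x, exists2 z, z \in DF (q - 1 - t) y & 'D_z (X 1) y = 0 /\ 'D_z (X t.+1) y != 0).
Proof.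
move=> tq; have [_ _ _ [Dv v1] [base nd]] := cd.
have [] := @goursat R n x q (fun j => DF j) v X q3 (fun j _ => rF j) _ _ (fun k _ => chained_smooth k) Dv v1 _ base _ t tq.
- by move=> j _; apply: near_W.
- move=> j jq; apply: near_imp2 (dF jq) (dF (ltnW jq)) => y -> ->; lia.
- by move=> [|[|k]] // _; exact: near_W.
- by apply: near_imp2 FB nd => y ->.
move=> H1 H2; split=> //; apply: near_imp2 H1 FB => y H1y E z.
by rewrite -E; exact: H1y.
Qed.

Let q1 : (1 <= q - 1 <= q - 1)%N. Proof. by rewrite leqnn andbT subn_gt0; apply: leq_trans q3. Qed.
Let qq : (q - 1 - (q - 1) = 0)%N. Proof. exact: subnn. Qed.
Let qS : ((q - 1).+1 = q)%N. Proof. by rewrite subn1 prednK //; apply: leq_trans q3. Qed.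

(** By (a), D_r consists of the characteristics of D_(r+1), along which X_1 and X_q are constant by
    [cauchy_kernel]. This is where the two chains of the x_3-subsystem start. *)
Lemma Dr_kernel : \forall y \near x, forall z, z \in D r y -> 'D_z y1 y = 0 /\ 'D_z (X q) y = 0.
Proof.
have [_ _ _ [Dv v1] _] := cd; have [H1 H2] := chained_goursat q1; rewrite qq qS in H1 H2.
have := @cauchy_kernel R n x (D r.+1) v (X (q - 1)) (X q) y1 (rD _) (chained_smooth _) (chained_smooth _)
  (chained_smooth 1) Dv v1 _ H2.
have H : \forall y \near x, forall z, z \in D r.+1 y -> 'D_z (X (q - 1)) y = X q y * 'D_z y1 y.
  apply: near_imp H1 => y H z /H[_ th]; have := th (q - 1)%N; rewrite qS; apply.
  by rewrite leqnn andbT; move: q3; case: (q) => [|[|[|]]].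
by move=> /(_ H); apply: near_imp2 cA => y ->.
Qed.

(* As in Defs, j = 0 is the chain of X_q and j = 1 that of X_1. *)
Definition pair_fun k (j : nat) := iter k (lied a) (if j == 0%N then X q else y1).

Lemma smooth_pair k j : smooth_near x (pair_fun k j).
Proof.
rewrite /pair_fun; apply: smooth_iter => //.
case: ifP => _; [exact: chained_smooth|exact: (chained_smooth 1)].
Qed.

Lemma pair_kills k j : (k <= r)%N -> kills x (D (r - k)) (pair_fun k j).
Proof.
elim: k => [|k IH] kr.
  by rewrite subn0; apply: near_imp Dr_kernel => y H z /H[h1 h2]; rewrite /pair_fun /=; case: ifP.
have E : (r - k)%N = (r - k.+1).+1 by rewrite subnSK.
apply: (@chain_kills _ _ x (D (r - k)) (D (r - k.+1))) sa (smooth_pair k j) (rD _) _ _ (IH (ltnW kr)).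
  by rewrite E; apply: near_W => y; exact: Dseq_bracket.
by rewrite E; apply: near_W => y; exact: Dseq_sub.
Qed.

(** At k = 0 a vector with dX_1 = 0 and dX_q nonzero, and the field v with dX_1 = 1, make the pair
    independent on D_(r+1); [chain_indep] carries this down. *)
Lemma pair_indep k : (k <= r)%N -> dindep x (D (r - k).+1 x) (pair_fun k) 2.
Proof.
elim: k => [|k IH] kr; last first.
  have E : (r - k)%N = (r - k.+1).+1 by rewrite subnSK.
  have := IH (ltnW kr); rewrite E => H.
  apply: (@chain_indep _ _ x (D (r - k.+1).+1) (D (r - k.+1).+2)) sa (fun j _ => smooth_pair k j) (subvv _) _ (rD _) H.
  by rewrite -E => j _; apply: pair_kills; exact: ltnW.
rewrite subn0; have [_ _ _ [[_ /near_at vD] /near_at v1] _] := cd.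
have [_ /near_at] := chained_goursat q1; rewrite qq qS => -[z zD [z1 zq]] c cz.
have c0 : c 0%N = 0.
  have := cz z zD; rewrite big_ord_recr big_ord1 /= /pair_fun /= z1 mulr0 addr0 => /eqP.
  by rewrite mulf_eq0 (negbTE zq) orbF => /eqP.
have c1 : c 1%N = 0.
  have := cz _ vD; rewrite big_ord_recr big_ord1 /= /pair_fun /= c0 mul0r add0r.
  by rewrite -[X in _ * X]/(lied v y1 x) v1 mulr1.
by case=> [|[|]].
Qed.

Lemma pair_kernel k z : (k <= r)%N -> z \in D (r - k).+1 x ->
  (forall j, (j < 2)%N -> 'D_z (pair_fun k j) x = 0) -> z \in D (r - k) x.
Proof.
move=> kr zD z0; apply: (dindep_ker (fun j _ => smooth_pair k j) (pair_indep kr) (Dseq_sub _ _ _ _ _)) zD z0.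
  by move=> w j wD _; apply: (near_at (pair_kills j kr)).
have h : (r - k <= r)%N by exact: leq_subr.
by rewrite dD // dD; [lia|exact: leqW].
Qed.

(** The order of the blocks is that of [x11], [x12], [x2] and [x3]. X_1 and X_q stand in the
    x_2-block, so the x_3-chains begin with the first drift derivatives of X_q and of X_1. *)
Definition coordf i : V -> R :=
  if (i < p1)%N then iter i (lied a) f1
  else if (i < p1 + p2)%N then iter (i - p1) (lied a) f2
  else if (i < p1 + p2 + q)%N then X (i - (p1 + p2)).+1
  else if (i < p1 + p2 + q + r)%N then pair_fun (i - (p1 + p2 + q)).+1 0
  else pair_fun (i - (p1 + p2 + q + r)).+1 1.

Definition adapted_map (y : V) : V := \row_(i < n) coordf i y.

Lemma dim_count : n = (p1 + p2 + q + 2 * r)%N.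
Proof.
have [_ _ [_ dB] _ _] := cd; have := near_at FB; have := near_at (dF (leqnn _)).
by move=> d1 E; move: dB; rewrite -E d1; move: q3; clear; lia.
Qed.

Lemma coordf1 k : (k < p1)%N -> coordf k = iter k (lied a) f1.
Proof. by rewrite /coordf => ->. Qed.

Lemma coordf2 k : (k < p2)%N -> coordf (p1 + k) = iter k (lied a) f2.
Proof. by move=> kp; rewrite /coordf ltnNge leq_addr /= ltn_add2l kp addKn. Qed.

Lemma coordfX k : (k < q)%N -> coordf (p1 + p2 + k) = X k.+1.
Proof.
move=> kq; rewrite /coordf ltnNge -addnA leq_addr /= addnA ltnNge leq_addr /= ltn_add2l kq addKn.
by [].
Qed.

Lemma coordf_pair j k : (j < 2)%N -> (k < r)%N -> coordf (p1 + p2 + q + j * r + k) = pair_fun k.+1 j.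
Proof.
move=> j2 kr; rewrite /coordf.
have -> : (p1 + p2 + q + j * r + k < p1)%N = false by lia.
have -> : (p1 + p2 + q + j * r + k < p1 + p2)%N = false by lia.
have -> : (p1 + p2 + q + j * r + k < p1 + p2 + q)%N = false by lia.
case: j j2 => [|[|]] // _; first by rewrite mul0n addn0 ltn_add2l kr addKn.
by rewrite mul1n [(_ < _ + r)%N]ltnNge leq_addr /= addKn.
Qed.

Lemma coordf_smooth y i : smooth_near y a -> smooth_near y v -> smooth_near y f1 -> smooth_near y f2 ->
  smooth_near y (coordf i).
Proof.
move=> s0 sv s1 s2; have sX := smooth_chained _ s0 sv s1 s2.
rewrite /coordf /pair_fun; do !case: ifP => _ //; apply: smooth_iter => //.
exact: (sX 1%N).
Qed.

Lemma adapted_smooth y : smooth_near y a -> smooth_near y v -> smooth_near y f1 -> smooth_near y f2 ->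
  smooth_near y adapted_map.
Proof.
move=> s0 sv s1 s2; apply/smooth_near_rVP => j; apply: smooth_near_eq (coordf_smooth j s0 sv s1 s2).
by apply: near_W => z; rewrite mxE.
Qed.

Lemma derive_adapted y h (j : 'I_n) : smooth_near y adapted_map -> ('D_h adapted_map y) 0 j = 'D_h (coordf j) y.
Proof.
move=> /smooth_near_derivable sm; rewrite (derive_rV j) //.
by apply: near_eq_derive; apply: near_W => z; rewrite mxE.
Qed.

(** A vector annihilated by all coordinates lies in Dbar by the chains, in D_(r+1) by the contact
    forms, and then descends through D_r, D_(r-1), ... to D_0 = 0 by [pair_kernel]. *)
Lemma adapted_injective h : 'D_h adapted_map x = 0 -> h = 0.
Proof.
have [[s1 s2] _ [kB _] [[sv _] _] _] := cd.
have sm := adapted_smooth sa sv s1 s2; move=> h0.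
have c0 i : (i < n)%N -> 'D_h (coordf i) x = 0.
  by move=> i_n; rewrite -(derive_adapted h (Ordinal i_n) sm) h0 mxE.
have dc := dim_count.
have hB : h \in Dbar x.
  apply: kB => k kp.
    by rewrite -coordf1 //; apply: c0; rewrite dc; move: kp; clear; lia.
  by rewrite -coordf2 //; apply: c0; rewrite dc; move: kp; clear; lia.
have hX k : (k < q)%N -> 'D_h (X k.+1) x = 0.
  by move=> kq; rewrite -coordfX //; apply: c0; rewrite dc; move: kq; clear; lia.
have [/near_at H _] := chained_goursat q1; rewrite qq in H.
have hD : h \in D r.+1 x.
  apply/H; split=> // k /andP[k2 kq]; rewrite (hX 0%N) ?mulr0; last by apply: leq_trans q3.
  case: k k2 kq => // k _ kq; rewrite hX //; apply: leq_trans kq _; exact: leq_subr.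
suff hk k : (k <= r.+1)%N -> h \in D (r.+1 - k) x.
  by have := hk r.+1 (leqnn _); rewrite subnn /= memv0 => /eqP.
elim: k => [|k IH] kr; first by rewrite subn0.
rewrite subSS; apply: pair_kernel => //; first by rewrite -subSn //; apply: IH; exact: ltnW.
case: k kr {IH} => [|k] kr j j2.
  by rewrite /pair_fun /=; case: ifP => _; [rewrite -{1}qS; apply: hX; rewrite qS|apply: (hX 0%N); apply: leq_trans q3].
rewrite -coordf_pair //; apply: c0; rewrite dc; case: j j2 => [|[|]] // _; move: kr; clear; lia.
Qed.

End AdaptedFunctions.

Section SmoothMatrixFunctions.
Context {R : realType} {V : normedModType R}.

Lemma Ck_scale {W : normedModType R} k (U : set V) (s : V -> R) (A : W) : open U ->
  Ck_on k U s -> Ck_on k U (fun y => s y *: A).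
Proof.
move=> Uo; elim: k s => [|k IH] s; first by move=> sc x Ux; apply: cvgZr_tmp; exact: sc.
move=> [ds Ds]; split=> [x Ux|v]; first by apply: differentiableZl; exact: ds.
apply: Ck_on_eq (IH _ (Ds v)) => // x Ux.
rewrite (deriveE _ (differentiableZl _ (ds x Ux))) (diffZl _ (ds x Ux)).
by rewrite (deriveE _ (ds x Ux)).
Qed.

Lemma smooth_near_mx {m p} x (f : V -> 'M[R]_(m.+1, p.+1)) :
  (forall i j, smooth_near x (fun y => f y i j)) -> smooth_near x f.
Proof.
move=> H.
have sc : smooth_near x (fun y => \sum_(i < m.+1) \sum_(j < p.+1) (f y i j *: delta_mx i j)).
  apply: smooth_near_sum => i _ _; apply: smooth_near_sum => j _ _; have [U [Uo Ux sf]] := H i j.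
  by exists U; split=> // k; apply: Ck_scale.
by apply: smooth_near_eq sc; apply: near_W => y; rewrite -matrix_sum_delta.
Qed.

Lemma smooth_on_local {W : normedModType R} (U : set V) (f : V -> W) :
  (forall y, U y -> smooth_near y f) -> smooth_on U f.
Proof.
move=> H k; have {}H y : U y -> exists U', [/\ open U', U' y & Ck_on k U' f].
  by move=> /H[U' [? ? sf]]; exists U'; split=> //; exact: sf.
elim: k f H => [|k IH] f H; first by move=> x /H[U' [_ Ux]]; exact.
split=> [x /H[U' [_ Ux [+ _]]]|v]; first exact.
by apply: IH => y /H[U' [Uo Uy [_ Df]]]; exists U'; split=> //; exact: Df.
Qed.

End SmoothMatrixFunctions.

Section TriangularTransform.
Context {R : realType} {n : nat} (a b1 b2 : 'rV[R]_n -> 'rV[R]_n)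
  (r q : nat) (Dbar : tdistribution R n) (p1 p2 : nat) (f1 f2 : 'rV[R]_n -> R) (v : 'rV[R]_n -> 'rV[R]_n).
Local Notation V := 'rV[R]_n.
Local Notation D := (Dseq a b1 b2).
Local Notation DF := (derived_flag (D r.+1)).
Local Notation y1 := (iter p1 (lied a) f1).
Local Notation y2 := (iter p2 (lied a) f2).
Local Notation X := (chained a p1 p2 f1 f2 v).
Local Notation pairf := (pair_fun a q p1 p2 f1 f2 v).
Local Notation crd := (coordf a r q p1 p2 f1 f2 v).
Local Notation Phi := (adapted_map a r q p1 p2 f1 f2 v).

(** The germ conditions at x restated at a single point: the coordinate change needs them with the
    same functions at every point of a neighbourhood. *)
Definition adapted (y : V) : Prop :=
  [/\ [/\ smooth_near y a, smooth_near y b1 & smooth_near y b2] /\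
      [/\ smooth_near y v, smooth_near y f1 & smooth_near y f2],
    (forall t, (1 <= t <= q - 1)%N -> forall z, z \in DF (q - 1 - t) y <-> z \in Dbar y /\ theta_in X t y z) /\
    (forall k j, (k <= r)%N -> forall z, z \in D (r - k) y -> 'D_z (pairf k j) y = 0),
    (forall k, (k < p1)%N -> forall z, z \in Dbar y -> 'D_z (iter k (lied a) f1) y = 0) /\
    (forall k, (k < p2)%N -> forall z, z \in Dbar y -> 'D_z (iter k (lied a) f2) y = 0),
    \dim (Dbar y) = (2 * r + q)%N /\ (bracket_dd Dbar Dbar y <= Dbar y)%VS &
    forall j, (j <= q - 3)%N -> (bracket_vd a (cauchy_char (DF j)) y <= DF j y)%VS].

(** The functions [pairf r] are the first of the x_3-chains whose derivatives contain the inputs;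
    [gain] and [offset] are the input and drift parts of these derivatives, which become the new
    inputs. *)
Definition gain (y : V) : 'M[R]_2 := \matrix_(i, j) lied (if j == 0 then b1 else b2) (pairf r i) y.
Definition offset (y : V) : 'cV[R]_2 := \col_i lied a (pairf r i) y.
Definition input_field (y : V) (u : 'cV[R]_2) : V := u 0 0 *: b1 y + u 1 0 *: b2 y.
(** This is theta_k(a), the candidate for a_2^k. *)
Definition tri_drift k (y : V) : R := lied a (X k) y - X k.+1 y * lied a y1 y.

Context (q3 : (3 <= q)%N) (dn : n = (p1 + p2 + q + 2 * r)%N).

Lemma smooth_pair_at y k j : adapted y -> smooth_near y (pairf k j).
Proof.
move=> [[[s0 _ _] [sv s1 s2]] _ _ _ _]; have sX := smooth_chained p1 p2 _ s0 sv s1 s2.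
rewrite /pair_fun; apply: smooth_iter => //; case: ifP => _; [exact: sX|exact: (sX 1%N)].
Qed.

Lemma input_field_mem y u i : (0 < i)%N -> input_field y u \in D i y.
Proof.
move=> i0; have H : (D 1 y <= D i y)%VS.
  rewrite -(subnK i0); elim: (i - 1)%N => [|k IH]; first exact: subvv.
  by apply: subv_trans IH _; rewrite addSn; exact: Dseq_sub.
by apply: (subvP H); apply: memv_add; apply: memvZ; exact: memv_line.
Qed.

Lemma gain_mul y u : adapted y -> forall i : 'I_2, 'D_(input_field y u) (pairf r i) y = (gain y *m u) i 0.
Proof.
move=> P i; have d := smooth_near_diff (smooth_pair_at r i P).
rewrite (derive_dirD _ _ d) !(derive_dirZ _ _ d) !mxE big_ord_recr big_ord1 /= !mxE.
by rewrite /lied [X in X + _]mulrC [X in _ + X]mulrC; congr (_ * u _ 0 + _ * u _ 0); apply: val_inj.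
Qed.

(** Input fields lie in every D_i with i > 0, so they annihilate the chain functions, all pairs but
    the last, and the contact forms; in these places only the drift contributes. *)
Lemma adapted_along y u : adapted y ->
  let w := a y + input_field y u in
  let ub := offset y + gain y *m u in
  [/\ forall k, (k < p1)%N -> 'D_w (iter k (lied a) f1) y = iter k.+1 (lied a) f1 y,
      forall k, (k < p2)%N -> 'D_w (iter k (lied a) f2) y = iter k.+1 (lied a) f2 y,
      forall k (j : 'I_2), (k < r)%N -> 'D_w (pairf k j) y = pairf k.+1 j y,
      forall j : 'I_2, 'D_w (pairf r j) y = ub j 0 &
      forall k, (2 <= k <= q.-1)%N -> 'D_w (X k) y = X k.+1 y * 'D_w y1 y + tri_drift k y].
Proof.
move=> P w ub; have [[[s0 sb1 sb2] [sv s1 s2]] [Th pk] [k1 k2] _ _] := P.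
have sX k : smooth_near y (X k) by exact: smooth_chained.
have kill (f : V -> R) : smooth_near y f -> 'D_(input_field y u) f y = 0 -> 'D_w f y = lied a f y.
  by move=> sf H; rewrite (derive_dirD _ _ (smooth_near_diff sf)) H addr0.
have q1 : (1 <= q - 1 <= q - 1)%N by rewrite leqnn andbT subn_gt0; apply: leq_trans q3.
have [uB th] : input_field y u \in Dbar y /\ theta_in X (q - 1) y (input_field y u).
  by apply/(Th _ q1); rewrite subnn; exact: (@input_field_mem y u r.+1).
split.
- by move=> k kp; rewrite kill //; [exact: smooth_iter|exact: k1].
- by move=> k kp; rewrite kill //; [exact: smooth_iter|exact: k2].
- move=> k j kr; rewrite kill //; first exact: smooth_pair_at.
  by apply: pk (ltnW kr) _ _; apply: input_field_mem; rewrite subn_gt0.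
- move=> j; have sp := smooth_pair_at r j P.
  by rewrite (derive_dirD _ _ (smooth_near_diff sp)) gain_mul // !mxE.
- move=> k kq; have kq' : (2 <= k <= q - 1)%N by rewrite subn1.
  have E1 := derive_dirD (a y) (input_field y u) (smooth_near_diff (sX k)).
  have E2 := derive_dirD (a y) (input_field y u) (smooth_near_diff (sX 1%N)).
  have gen (A B C E A' B' C' : R) : C' = B * C -> A' = A + C' -> B' = E + C -> A' = B * B' + (A - B * E).
    by move=> -> -> ->; ring.
  exact: gen (th k kq') E1 E2.
Qed.

Lemma entry_lt (z : V) i (i_n : (i < n)%N) : entry z i = z 0 (Ordinal i_n).
Proof. by rewrite -entry_ord. Qed.

Lemma adapted_triangular y u (a2 : nat -> V -> R) : adapted y ->
  (forall k, a2 k (Phi y) = tri_drift k y) ->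
  triangular_eqs p1 p2 q r a2 (Phi y) (offset y + gain y *m u) ('D_(a y + input_field y u) Phi y).
Proof.
move=> P a2E; have [e1 e2 e3 e4 eX] := adapted_along u P.
have [[[s0 sb1 sb2] [sv s1 s2]] _ _ _ _] := P.
set w := a y + _ in e1 e2 e3 e4 eX *; set ub := offset y + _ in e4 *.
have eP i : (i < n)%N -> entry (Phi y) i = crd i y by move=> i_n; rewrite (entry_lt _ i_n) mxE.
have eD i : (i < n)%N -> entry ('D_w Phi y) i = 'D_w (crd i) y.
  by move=> i_n; rewrite (entry_lt _ i_n) derive_adapted //; exact: adapted_smooth.
have n1 k : (k < p1)%N -> (k < n)%N by rewrite dn; clear; lia.
have n2 k : (k < p2)%N -> (p1 + k < n)%N by rewrite dn; clear; lia.
have nX k : (k < q)%N -> (p1 + p2 + k < n)%N by rewrite dn; clear; lia.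
have n3 k (j : 'I_2) : (k < r)%N -> (p1 + p2 + q + j * r + k < n)%N.
  by rewrite dn; case: j => [[|[|]]] //= _; clear; lia.
have pr k : (0 < k)%N -> (k.-1 < k)%N by case: k.
have in1 k : (1 <= k <= p1)%N -> x11 (Phi y) k = iter k.-1 (lied a) f1 y.
  by move=> /andP[k0 kp]; have h := leq_trans (pr k k0) kp; rewrite /x11 eP ?n1 // coordf1.
have in2 k : (1 <= k <= p2)%N -> x12 p1 (Phi y) k = iter k.-1 (lied a) f2 y.
  by move=> /andP[k0 kp]; have h := leq_trans (pr k k0) kp; rewrite /x12 eP ?n2 // coordf2.
have inX k : (1 <= k <= q)%N -> x2 p1 p2 (Phi y) k = X k y.
  by move=> /andP[k0 kp]; have h := leq_trans (pr k k0) kp; rewrite /x2 eP ?nX // coordfX // prednK.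
have in3 k (j : 'I_2) : (1 <= k <= r)%N -> x3 p1 p2 q r j (Phi y) k = pairf k j y.
  by move=> /andP[k0 kp]; have h := leq_trans (pr k k0) kp; rewrite /x3 eP ?n3 // coordf_pair // prednK.
have d1 k : (1 <= k <= p1)%N -> x11 ('D_w Phi y) k = iter k (lied a) f1 y.
  by move=> /andP[k0 kp]; have h := leq_trans (pr k k0) kp; rewrite /x11 eD ?n1 // coordf1 // e1 // prednK.
have d2 k : (1 <= k <= p2)%N -> x12 p1 ('D_w Phi y) k = iter k (lied a) f2 y.
  by move=> /andP[k0 kp]; have h := leq_trans (pr k k0) kp; rewrite /x12 eD ?n2 // coordf2 // e2 // prednK.
have dX k : (1 <= k <= q)%N -> x2 p1 p2 ('D_w Phi y) k = 'D_w (X k) y.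
  by move=> /andP[k0 kp]; have h := leq_trans (pr k k0) kp; rewrite /x2 eD ?nX // coordfX // prednK.
have d3 k (j : 'I_2) : (1 <= k <= r)%N -> x3 p1 p2 q r j ('D_w Phi y) k = 'D_w (pairf k j) y.
  by move=> /andP[k0 kp]; have h := leq_trans (pr k k0) kp; rewrite /x3 eD ?n3 // coordf_pair // prednK.
have inp (j : 'I_2) : 'D_w (pairf 0 j) y = x2_input p1 p2 q r j (Phi y) ub.
  rewrite /x2_input; have [r0|r0] := eqVneq r 0%N; first by have := e4 j; rewrite r0.
  by rewrite in3 ?lt0n ?r0 // e3 // lt0n.
have q0 : (0 < q)%N by apply: leq_trans q3.
split; first split.
- by move=> k /andP[k0 kp]; rewrite d1 ?k0 ?(ltnW kp) // in1 //= kp.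
- by move=> p0; rewrite d1 ?p0 ?leqnn // inX //=.
- by move=> k /andP[k0 kp]; rewrite d2 ?k0 ?(ltnW kp) // in2 //= kp.
- by move=> p0; rewrite d2 ?p0 ?leqnn // inX //=; apply: ltnW.
- split; first by rewrite dX ?q0 //; exact: (inp 1).
    move=> k kq; have /andP[k2 kq1] := kq; have kq' : (k < q)%N by rewrite -(prednK q0) ltnS.
    rewrite dX ?(ltnW k2) ?(ltnW kq') // inX ?kq' // eX // a2E -(inp 1).
    by [].
  by rewrite dX ?q0 ?leqnn //; exact: (inp 0).
move=> j; split=> [k /andP[k0 kr]|r0].
  by rewrite d3 ?k0 ?(ltnW kr) // in3 ?kr // e3.
by rewrite d3 ?r0 ?leqnn // e4.
Qed.

End TriangularTransform.

Section Sufficiency.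
Context {R : realType} {n : nat} (a b1 b2 : 'rV[R]_n -> 'rV[R]_n)
  (r q : nat) (Dbar : tdistribution R n) (p1 p2 : nat) (f1 f2 : 'rV[R]_n -> R) (v : 'rV[R]_n -> 'rV[R]_n).
Local Notation V := 'rV[R]_n.
Local Notation D := (Dseq a b1 b2).
Local Notation DF := (derived_flag (D r.+1)).
Local Notation y1 := (iter p1 (lied a) f1).
Local Notation X := (chained a p1 p2 f1 f2 v).
Local Notation pairf := (pair_fun a q p1 p2 f1 f2 v).
Local Notation crd := (coordf a r q p1 p2 f1 f2 v).
Local Notation Phi := (adapted_map a r q p1 p2 f1 f2 v).
Local Notation adapted := (adapted a b1 b2 r q Dbar p1 p2 f1 f2 v).
Local Notation tri_drift := (tri_drift a p1 p2 f1 f2 v).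
Local Notation gain := (gain a b1 b2 r q p1 p2 f1 f2 v).
Local Notation offset := (offset a r q p1 p2 f1 f2 v).
Local Notation input_field := (input_field b1 b2).
Context (q3 : (3 <= q)%N) (dn : n = (p1 + p2 + q + 2 * r)%N).

Lemma segment_const (V' : set V) (F : V -> R) (z h : V) :
  (forall c : R, 0 <= c <= 1 -> V' (z + c *: h)) -> (forall y, V' y -> differentiable F y) ->
  (forall y, V' y -> 'D_h F y = 0) -> F (z + h) = F z.
Proof.
move=> seg dF F0; have [|c c01] := segment_MVT (f := F) (y := z) (v := h).
  by move=> s s01; apply: diff_derivable; apply: dF; exact: seg.
by rewrite F0; [move/eqP; rewrite subr_eq0 => /eqP|exact: seg].
Qed.

Lemma ball_segment (z0 z h : V) (rho : R) : `|z - z0| < rho -> `|z + h - z0| < rho ->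
  forall c : R, 0 <= c <= 1 -> `|z + c *: h - z0| < rho.
Proof.
move=> H0 H1 c /andP[c0 c1].
have -> : z + c *: h - z0 = (1 - c) *: (z - z0) + c *: (z + h - z0).
  by rewrite scalerBl scale1r !scalerBr scalerDr; apply/rowP => j; rewrite !mxE; ring.
apply: le_lt_trans (ler_normD _ _) _; rewrite !normrZ (ger0_norm c0) (ger0_norm (_ : 0 <= 1 - c)) ?subr_ge0 //.
have [->|cn] := eqVneq c 0; first by rewrite subr0 mul0r addr0 mul1r.
have cp : 0 < c by rewrite lt_neqAle eq_sym cn.
have -> : rho = (1 - c) * rho + c * rho by ring.
by apply: ler_ltD; [apply: ler_wpM2l; [rewrite subr_ge0|exact: ltW]|rewrite ltr_pM2l].
Qed.

Section Chart.
Context (U V' : set V) (Psi : V -> V) (Uo : open U) (Vo : open V') (UV : Phi @` U = V')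
  (sPsi : smooth_on V' Psi) (PsiK : forall y, U y -> Psi (Phi y) = y) (PU : forall y, U y -> adapted y).

Let VPhi y : U y -> V' (Phi y). Proof. by move=> Uy; rewrite -UV; exists y. Qed.

Let PhiK z : V' z -> Phi (Psi z) = z /\ U (Psi z).
Proof. by rewrite -UV => -[y Uy <-]; rewrite PsiK. Qed.

Let sPsi_at z : V' z -> smooth_near z Psi.
Proof. by move=> Vz; exists V'. Qed.

Lemma Phi_smooth_at y : U y -> smooth_near y Phi.
Proof. by move=> /PU[[[s0 _ _] [sv s1 s2]] _ _ _ _]; exact: adapted_smooth. Qed.

Lemma crd_smooth_at y i : U y -> smooth_near y (crd i).
Proof. by move=> /PU[[[s0 _ _] [sv s1 s2]] _ _ _ _]; exact: coordf_smooth. Qed.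

(** The coordinate field of the chart [Phi] in the direction [h], constant in the new
    coordinates. *)
Definition chart_field (h : V) (y : V) : V := 'D_h Psi (Phi y).

Lemma chart_field_smooth h y : U y -> smooth_near y (chart_field h).
Proof.
move=> Uy; apply: (smooth_near_comp_rV (f := Phi) (g := fun z => 'D_h Psi z)); first exact: Phi_smooth_at.
by apply: smooth_near_dir; apply: sPsi_at; exact: VPhi.
Qed.

Lemma chart_field_crd (h : V) y (i : 'I_n) : U y -> 'D_(chart_field h y) (crd i) y = h 0 i.
Proof.
move=> Uy; have Vy := VPhi Uy.
have d1 := smooth_near_diff (sPsi_at Vy); have sP := Phi_smooth_at Uy.
have d2 : differentiable Phi (Psi (Phi y)) by rewrite PsiK //; exact: smooth_near_diff.
have := derive_comp h d1 d2; rewrite PsiK // => E.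
have id : 'D_h (Phi \o Psi) (Phi y) = h.
  rewrite -[RHS](derive_id (Phi y) h); apply: near_eq_derive.
  by apply: near_imp (near_open Vo Vy) => z /PhiK[].
by rewrite -(derive_adapted _ _ sP) -/(chart_field h y) -[RHS](congr1 (fun z : V => z 0 i) id) E.
Qed.

(** The first p1 + p2 coordinates have independent differentials and their number is the codimension
    of Dbar, so Dbar is exactly their common kernel. *)
Lemma chart_field_Dbar (h : V) y : U y -> (forall i : 'I_n, (i < p1 + p2)%N -> h 0 i = 0) ->
  chart_field h y \in Dbar y.
Proof.
move=> Uy h0; have [_ _ [k1 k2] [dB _] _] := PU Uy.
have pn : (p1 + p2 <= n)%N by rewrite dn; clear; lia.
have sc j : (j < p1 + p2)%N -> smooth_near y (crd j) by move=> _; exact: crd_smooth_at.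
have kc z j : z \in Dbar y -> (j < p1 + p2)%N -> 'D_z (crd j) y = 0.
  move=> zB jp; have [j1|j1] := ltnP j p1; first by rewrite coordf1 // k1.
  have j2 : (j - p1 < p2)%N by rewrite ltn_subLR.
  by rewrite -(subnKC j1) coordf2 // k2.
have ind : dindep y fullv crd (p1 + p2).
  move=> c cz j jp; have jn : (j < n)%N by exact: leq_trans jp pn.
  have := cz (chart_field (delta_mx 0 (Ordinal jn)) y) (memvf _).
  rewrite (bigD1 (Ordinal jp)) //= big1 ?addr0 => [|i ij].
    by rewrite (chart_field_crd _ (Ordinal jn) Uy) mxE !eqxx mulr1.
  have i_n : (i < n)%N by exact: leq_trans (ltn_ord i) pn.
  rewrite (chart_field_crd _ (Ordinal i_n) Uy) mxE eqxx /=.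
  by rewrite (_ : _ == _ = false) ?mulr0 //; apply: negbTE; move: ij; rewrite -!val_eqE.
apply: (dindep_ker sc ind (subvf _) kc) (memvf _) _.
  by rewrite dB dimvf /dim /= mul1n [in leqLHS]dn; clear; lia.
move=> j jp; have jn : (j < n)%N by exact: leq_trans jp pn.
by rewrite (chart_field_crd _ (Ordinal jn) Uy) h0.
Qed.

Lemma tri_drift_smooth k y : U y -> smooth_near y (tri_drift k).
Proof.
move=> /PU[[[s0 _ _] [sv s1 s2]] _ _ _ _]; have sX j := smooth_chained p1 p2 j s0 sv s1 s2.
apply: smooth_nearB; first exact: smooth_near_lied.
by apply: smooth_nearM => //; apply: smooth_near_lied => //; exact: (sX 1%N).
Qed.

(** The coordinate field e lies in Dbar and annihilates X_1, ..., X_(k+1), so by [kernel_cauchy] it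
    is characteristic for the member of the flag cut out by theta_2, ..., theta_k. By (c) its
    bracket with the drift stays in that member, where theta_k vanishes, and [drift_kill]
    concludes. *)
Lemma tri_drift_local k (h : V) y : (2 <= k <= q.-1)%N -> U y ->
  (forall i : 'I_n, (i < p1 + p2 + k.+1)%N -> h 0 i = 0) -> 'D_(chart_field h y) (tri_drift k) y = 0.
Proof.
move=> kq Uy h0; have /andP[k2 kq1] := kq; have q0 : (0 < q)%N by apply: leq_trans q3.
have kq' : (k < q)%N by rewrite -(prednK q0) ltnS.
have h0' i : (i < p1 + p2)%N -> (i < p1 + p2 + k.+1)%N by move=> /leq_trans; apply; exact: leq_addr.
have [[[s0 _ _] [sv s1 s2]] _ _ _ _] := PU Uy; have sX j := smooth_chained p1 p2 j s0 sv s1 s2.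
have Un := near_open Uo Uy; pose e := chart_field h.
have se : smooth_near y e by exact: chart_field_smooth.
have eB z : U z -> e z \in Dbar z by move=> Uz; apply: chart_field_Dbar => // i /h0'; exact: h0.
have eX j : (1 <= j <= k.+1)%N -> \forall z \near y, lied e (X j) z = 0.
  move=> /andP[j1 jk]; apply: near_imp Un => z Uz.
  have jq : (j.-1 < q)%N by rewrite prednK //; exact: leq_trans jk kq'.
  have jn : (p1 + p2 + j.-1 < n)%N by rewrite dn; move: jq; clear; lia.
  have -> : X j = crd (Ordinal jn) by rewrite /= coordfX // prednK.
  by rewrite /lied chart_field_crd // h0 //= ltn_add2l prednK.
have tq : (1 <= k <= q - 1)%N by rewrite subn1 (ltnW k2).
have jq : (q - 1 - k <= q - 3)%N by move: k2; clear; lia.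
have Th : \forall z \near y, forall w, w \in DF (q - 1 - k) z <-> w \in Dbar z /\ theta_in X k z w.
  by apply: near_imp Un => z /PU[_ [Th _] _ _ _]; exact: Th.
have inv : germ_involutive y Dbar by apply: near_imp Un => z /PU[_ _ _ [_ ?] _].
have Be : section_near Dbar y e by split=> //; apply: near_imp Un => z; exact: eB.
have [De Ce] := kernel_cauchy (fun j _ => sX j) Th inv Be eX.
have Ee : section_near (cauchy_char (DF (q - 1 - k))) y e.
  split=> //; apply: near_imp2 (section_near_near De) (near_near Ce) => z Dz Cz.
  by apply: mem_vspan; exists e.
have : lie_bracket a e y \in DF (q - 1 - k) y.
  have [_ _ _ _ aC] := PU Uy; apply: (subvP (aC _ jq)); apply: mem_vspan.
  by exists e.
move/(near_at Th) => [_ th].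
have := drift_kill s0 se (sX k) (sX k.+1) (sX 1%N) (eX k _) (eX k.+1 _) (eX 1%N _).
rewrite leqnn (ltnW k2) leqnSn /= => /(_ isT isT isT) E.
apply: etrans E _; apply/eqP; rewrite oppr_eq0 subr_eq0; apply/eqP; apply: th.
by rewrite k2 leqnn.
Qed.

End Chart.

End Sufficiency.

Section Equivalence.
Context {R : realType} {n : nat} (x : 'rV[R]_n) (a b1 b2 : 'rV[R]_n -> 'rV[R]_n)
  (r q : nat) (Dbar : tdistribution R n) (p1 p2 : nat) (f1 f2 : 'rV[R]_n -> R) (v : 'rV[R]_n -> 'rV[R]_n).
Local Notation V := 'rV[R]_n.
Local Notation D := (Dseq a b1 b2).
Local Notation DF := (derived_flag (D r.+1)).
Local Notation pairf := (pair_fun a q p1 p2 f1 f2 v).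
Local Notation Phi := (adapted_map a r q p1 p2 f1 f2 v).
Local Notation adapted := (adapted a b1 b2 r q Dbar p1 p2 f1 f2 v).
Local Notation tri_drift := (tri_drift a p1 p2 f1 f2 v).
Local Notation gain := (gain a b1 b2 r q p1 p2 f1 f2 v).
Local Notation offset := (offset a r q p1 p2 f1 f2 v).
Local Notation input_field := (input_field b1 b2).
Context (sa : smooth_near x a) (sb1 : smooth_near x b1) (sb2 : smooth_near x b2)
  (q3 : (3 <= q)%N) (rD : forall i, regular x (D i))
  (rF : forall j, regular x (DF j)) (FB : germ_eq x (DF (q - 2)) Dbar)
  (dD : forall i, (i <= r.+1)%N -> \dim (D i x) = (2 * i)%N)
  (dF : forall j, (j <= q - 2)%N -> \forall y \near x, \dim (DF j y) = (2 * r.+1 + j)%N)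
  (dB : \forall y \near x, \dim (Dbar y) = (2 * r + q)%N)
  (cA : germ_eq x (cauchy_char (D r.+1)) (D r))
  (aC : forall j, (j <= q - 3)%N -> germ_le x (bracket_vd a (cauchy_char (DF j))) (DF j))
  (iB : germ_involutive x Dbar)
  (cd : contact_data x a (D r.+1) (DF (q - 3)) Dbar p1 p2 f1 f2 v).

Lemma near_leq m (P : nat -> V -> Prop) (I : pred nat) : (forall i, I i -> (i <= m)%N) ->
  (forall i, I i -> \forall y \near x, P i y) -> \forall y \near x, forall i, I i -> P i y.
Proof.
move=> Im H; have : \forall y \near x, forall i, (i < m.+1)%N -> I i -> P i y.
  apply: near_lt => i _; have [Ii|nI] := boolP (I i); first by apply: near_imp (H i Ii) => y h _.
  by apply: near_W.
by apply: near_imp => y h i Ii; apply: h => //; rewrite ltnS Im.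
Qed.

Lemma adapted_near : \forall y \near x, adapted y.
Proof.
have [[s1 s2] [k1 k2] _ [[sv _] _] _] := cd.
have h1 := near_and (near_and3 (smooth_near_near sa) (smooth_near_near sb1) (smooth_near_near sb2))
  (near_and3 (smooth_near_near sv) (smooth_near_near s1) (smooth_near_near s2)).
have h2 : \forall y \near x, forall t, (1 <= t <= q - 1)%N ->
    forall z, z \in DF (q - 1 - t) y <-> z \in Dbar y /\ theta_in (chained a p1 p2 f1 f2 v) t y z.
  apply: (@near_leq (q - 1)) => t tq; first by case/andP: tq.
  by have [] := chained_goursat sa q3 rF FB dF cd tq.
have h3 : \forall y \near x, forall k, (k <= r)%N -> forall j, (j < 2)%N -> forall z, z \in D (r - k) y ->
    'D_z (pairf k j) y = 0.
  apply: (@near_leq r) => // k kr; apply: near_lt => j _.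
  have H := pair_kills sa q3 rD rF FB dF cA cd j kr.
  exact: H.
have h4 := near_and (near_lt k1) (near_lt k2).
have h5 : \forall y \near x, forall j, (j <= q - 3)%N -> (bracket_vd a (cauchy_char (DF j)) y <= DF j y)%VS.
  exact: (@near_leq (q - 3)).
apply: near_imp3 h1 (near_and3 h2 h3 h4) (near_and3 dB iB h5) => y [S1 S2] [H2 H3 [K1 K2]] [H4 H5 H6].
split=> //; split=> // k j kr z zD.
have := H3 k kr (j != 0%N) _ z zD; rewrite /pair_fun; case: (j == 0%N) => /=; apply=> //.
Qed.

(** On D_1, which the input fields span, the last pair is independent: this is [pair_indep] for k =
    r. *)
Lemma gain_unit : gain x \in unitmx.
Proof.
apply: mulmx_injective_unit => h h0.
have ind := pair_indep sa q3 rD rF FB dF cA cd (leqnn r); rewrite subnn in ind.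
have P := near_at adapted_near.
have sp j := smooth_pair_at r j P.
pose c j : R := h 0 (inord j).
have E k : \sum_(j < 2) c j * lied (if k == 0 :> 'I_2 then b1 else b2) (pairf r j) x = 0.
  have := congr1 (fun M : 'rV_2 => M 0 k) h0; rewrite !mxE => H; apply: etrans H; apply: eq_bigr => j _.
  by rewrite mxE /c inord_val.
apply/rowP => j; rewrite [RHS]mxE -[j]inord_val; apply: (ind c) => // z /memv_addP[_ /vlineP[u ->] [_ /vlineP[w ->] ->]].
have -> : \sum_(j < 2) c j * 'D_(u *: b1 x + w *: b2 x) (pairf r j) x =
    u * \sum_(j < 2) c j * lied b1 (pairf r j) x + w * \sum_(j < 2) c j * lied b2 (pairf r j) x.
  rewrite !mulr_sumr -big_split; apply: eq_bigr => j' _ /=; have d := smooth_near_diff (sp j').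
  rewrite (derive_dirD _ _ d) !(derive_dirZ _ _ d) /lied.
  have gen (e1 e2 e3 e4 e5 : R) : e1 * (e2 * e3 + e4 * e5) = e2 * (e1 * e3) + e4 * (e1 * e5) by ring.
  exact: gen.
by rewrite (E 0) (E 1) !mulr0 addr0.
Qed.

Lemma gain_smooth y i j : adapted y -> smooth_near y (fun z => gain z i j).
Proof.
move=> P; have [[[s0 sb1' sb2'] _] _ _ _ _] := P; have sp := smooth_pair_at r i P.
have H : smooth_near y (lied (if j == 0 then b1 else b2) (pairf r i)).
  by apply: smooth_near_lied => //; case: ifP.
by apply: smooth_near_eq H; apply: near_W => z; rewrite mxE.
Qed.

Lemma offset_smooth y i : adapted y -> smooth_near y (fun z => offset z i 0).
Proof.
move=> P; have [[[s0 _ _] _] _ _ _ _] := P; have sp := smooth_pair_at r i P.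
have H := smooth_near_lied s0 sp.
by apply: smooth_near_eq H; apply: near_W => z; rewrite mxE.
Qed.

Lemma input_fieldD y u w : input_field y (u + w) = input_field y u + input_field y w.
Proof. by rewrite /input_field !mxE !scalerDl addrACA. Qed.

Lemma input_fieldZ y (c : R) u : input_field y (c *: u) = c *: input_field y u.
Proof. by rewrite /input_field !mxE scalerDr !scalerA. Qed.

Theorem triangular_equivalence : equivalent_to_triangular x a b1 b2 p1 p2 q r.
Proof.
have dn := dim_count q3 FB dF cd; have gu := gain_unit.
have Px := near_at adapted_near.
have [[[_ _ _] [sv s1 s2]] _ _ _ _] := Px.
have inj := @adapted_injective _ _ _ _ _ _ _ _ _ _ _ _ _ _ sa q3 rD rF FB dD dF cA cd.
have ngain := near_unitmx (fun i j => gain_smooth i j Px) gu.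
have [U [Psi [rho [rho0 Uo Ux UV [sPhi sPsi PsiK PU]]]]] :=
  inverse_function (adapted_smooth r q p1 p2 sa sv s1 s2) inj (near_and adapted_near ngain).
set V' := [set y | _] in UV sPsi.
have Vo : open V' by exact: open_ball_norm.
have PU1 y : U y -> adapted y by move=> /PU[].
have PU2 y : U y -> gain y \in unitmx by move=> /PU[].
have PhiK z : V' z -> Phi (Psi z) = z /\ U (Psi z).
  by rewrite -UV => -[y Uy <-]; rewrite PsiK.
(* The inverse feedback: u is [ctl] of the new input minus [offset]. The fields of the triangular
   system are the given ones under this feedback, transported by [Phi]. *)
pose ctl y (ub : 'cV[R]_2) := invmx (gain y) *m ub.
pose abar z : V := 'D_(a (Psi z) - input_field (Psi z) (ctl (Psi z) (offset (Psi z)))) Phi (Psi z).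
pose bbar (j : 'I_2) z : V := 'D_(input_field (Psi z) (ctl (Psi z) (delta_mx j 0))) Phi (Psi z).
have dynE y u : U y -> dynamics abar (bbar 0) (bbar 1) (Phi y) (offset y + gain y *m u) =
    'D_(a y + input_field y u) Phi y.
  move=> Uy; rewrite /dynamics /abar /bbar PsiK //.
  have d := smooth_near_diff (Phi_smooth_at PU1 Uy).
  rewrite -!(derive_dirZ _ _ d) -!(derive_dirD _ _ d) -!input_fieldZ.
  have gen (A B C E : V) : A - B + C + E = A + ((-1) *: B + (C + E)).
    by rewrite scaleN1r !addrA.
  rewrite gen -!input_fieldZ -!input_fieldD; congr ('D_(a y + input_field y _) Phi y).
  rewrite /ctl !scalemxAr -!mulmxDr; set ub := offset y + _.
  have -> : ub 0 0 *: delta_mx 0 0 + ub 1 0 *: delta_mx 1 0 = ub.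
    rewrite [RHS]matrix_sum_delta big_ord_recr big_ord1 /= !big_ord1.
    by congr (_ *: _ + _ *: _); congr (ub _ _); apply: val_inj.
  by rewrite scaleN1r /ub addKr mulKmx ?PU2.
have dynE0 y u : dynamics a b1 b2 y u = a y + input_field y u by rewrite /dynamics addrA.
exists V', abar, (bbar 0), (bbar 1); split.
  split=> //; exists (fun k z => tri_drift k (Psi z)); split.
  - move=> k kq; apply: smooth_on_local => z Vz; have [_ Uz] := PhiK z Vz.
    apply: (smooth_near_comp (f := Psi) (g := tri_drift k)); first by exists V'.
    refine (tri_drift_smooth PU1 k Uz).
  (* Two states with equal leading entries are joined by a segment inside the ball [V']; along it
     the derivative vanishes by [tri_drift_local]. *)
  - move=> k kq z z' Vz Vz' zz'; have q0 : (2 <= k <= q.-1)%N by [].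
    pose h := z' - z.
    have h0 (i : 'I_n) : (i < p1 + p2 + k.+1)%N -> h 0 i = 0 by move=> ik; rewrite !mxE zz' // subrr.
    have zh : z + h = z' by rewrite addrC subrK.
    rewrite -zh.
    apply/esym; apply: (@segment_const _ _ V' (fun z => tri_drift k (Psi z))).
    + by apply: ball_segment => //; rewrite zh.
    + move=> w Vw; have [_ Uw] := PhiK w Vw; apply: smooth_near_diff.
      apply: (smooth_near_comp (f := Psi) (g := tri_drift k)); first by exists V'.
      refine (tri_drift_smooth PU1 k Uw).
    + move=> w Vw; have [Ew Uw] := PhiK w Vw.
      have d1 : differentiable Psi w by apply: smooth_near_diff; exists V'.
      have d2 := smooth_near_diff (tri_drift_smooth PU1 k Uw).
      have H := tri_drift_local q3 dn Uo Vo UV sPsi PsiK PU1 kq Uw h0.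
      rewrite /chart_field Ew in H.
      refine (etrans (derive_comp h d1 d2) H).
  - move=> z ub Vz; have [Ez Uz] := PhiK z Vz.
    move: (Psi z) Ez Uz => y Ez Uy; pose u := ctl y (ub - offset y).
    have -> : ub = offset y + gain y *m u by rewrite /u /ctl mulKVmx ?PU2 // addrC subrK.
    rewrite -Ez dynE //; apply: adapted_triangular => //; first exact: PU1.
    by move=> k; rewrite PsiK.
exists U, Phi, Psi, offset, gain; split=> //.
- split=> //; apply: smooth_on_local => y Uy; apply: smooth_near_mx => i j.
    rewrite (ord1 j); exact: offset_smooth (PU1 y Uy).
  exact: gain_smooth (PU1 y Uy).
- by move=> y u Uy; rewrite dynE0 dynE.
Qed.

End Equivalence.

(** * Sufficiency of the conditions in both cases *)

Section SufficientConditions.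
Context {R : realType} {n : nat} (x : 'rV[R]_n) (a b1 b2 : 'rV[R]_n -> 'rV[R]_n)
  (r q : nat) (Dbar : tdistribution R n).
Local Notation D := (Dseq a b1 b2).
Local Notation DF := (derived_flag (D r.+1)).
Context (sa : smooth_near x a) (sb1 : smooth_near x b1) (sb2 : smooth_near x b2).
Context (N3 : is_n3 x a b1 b2 r) (iB : is_involutive_closure x (D r.+1) Dbar)
  (N2 : is_n2 x (D r.+1) Dbar q) (reg : regular_near x a b1 b2 Dbar r q).
Context (cA : germ_eq x (cauchy_char (D r.+1)) (D r))
  (cB : forall i, (1 <= i <= q - 2)%N -> \forall y \near x, \dim (DF i y) = (\dim (D r.+1 y) + i)%N)
  (cC1 : forall i, (1 <= i <= q - 3)%N -> germ_le x (bracket_vd a (cauchy_char (DF i))) (DF i)).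

Let q3 : (3 <= q)%N. Proof. exact: q_ge3 N3 iB N2. Qed.
Let rD := D_regular sa sb1 sb2 reg.
Let rF := DF_regular sa sb1 sb2 reg.
Let rB := Dbar_regular sa sb1 sb2 N2 reg.
Let FB := DF_Dbar N2.
Let dF := DF_dim sa sb1 sb2 N3 reg cA cB.
Let dB := Dbar_dim sa sb1 sb2 N3 iB N2 reg cA cB.
Let l3 : (q - 3 <= q - 2)%N. Proof. by rewrite leq_sub2l. Qed.

Let equiv p1 p2 f1 f2 v : contact_data x a (D r.+1) (DF (q - 3)) Dbar p1 p2 f1 f2 v ->
  equivalent_to_triangular x a b1 b2 p1 p2 q r.
Proof.
apply: triangular_equivalence sa sb1 sb2 q3 rD rF FB _ dF dB cA _ (Dbar_inv iB).
  by move=> i ir; refine (D_dim sa sb1 sb2 N3 reg cA ir).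
by move=> j jq; refine (drift_char cA cC1 jq).
Qed.

Let DDF : germ_le x (D r.+1) (DF (q - 3)).
Proof. by apply: near_W => y; exact: (@flag_mono _ _ (D r.+1) y 0 (q - 3)). Qed.

Let cC : loc_const_dim x (cauchy_char (DF (q - 3))).
Proof. by have [_ _ H _ _] := reg. Qed.

Let codim := char_codim sa sb1 sb2 N3 iB N2 reg cA cB.

Let dBx : (\dim (Dbar x) = \dim (DF (q - 3) x) + 1)%N.
Proof. by rewrite (near_at dB) (near_at (dF l3)); move: q3; clear; lia. Qed.

Lemma sufficient_full : germ_full x Dbar ->
  ((bracket_dd (D r.+1) (DF (q - 3)) x <= DF (q - 3) x)%VS ->
    germ_le x (bracket_dd (D r.+1) (DF (q - 3))) (DF (q - 3))) ->
  exists q' r', equivalent_to_triangular x a b1 b2 0 0 q' r'.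
Proof.
move=> full genA; exists q, r.
have [|f1 [f2 [v cd]]] := contact_full a (rD _) (rF _) rB DDF (DF_sub_Dbar N2 l3) iB cC codim _ full genA.
  by rewrite dBx addn1.
exact: equiv cd.
Qed.

Lemma sufficient_chains s :
  (\forall y \near x, \dim (Dbar y + bracket_vd a (DF (q - 3)) y)%VS = (\dim (Dbar y) + 1)%N) ->
  (forall i, germ_involutive x (Gseq a Dbar i.+1)) -> germ_full x (Gseq a Dbar s) ->
  ((bracket_vd a (D r.+1) x <= Dbar x)%VS -> germ_le x (bracket_vd a (D r.+1)) Dbar) ->
  exists p1 p2 q' r', equivalent_to_triangular x a b1 b2 p1 p2 q' r'.
Proof.
move=> c2 iG Gs genA.
have rG := regular_Gseq sa rB (let: And5 _ _ _ H _ := reg in H).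
have iG' i : germ_involutive x (Gseq a Dbar i) by case: i => [|i]; [exact: Dbar_inv iB|exact: iG].
have [p1 [p2 [f1 [f2 [v cd]]]]] := contact_chains sa (rD _) (rF _) rB DDF (DF_sub_Dbar N2 l3) iB cC codim dBx
  (drift_char cA cC1 (leqnn _)) rG iG' Gs c2 genA.
by exists p1, p2, q, r; exact: equiv cd.
Qed.

End SufficientConditions.

(** * Flags of the triangular form *)

Section LinearPredicates.
Context {R : realType} {n : nat}.
Local Notation V := 'rV[R]_n.
Implicit Types (S : V -> Prop) (y z : V).

Definition lin_closed S := S 0 /\ forall (c : R) u w, S u -> S w -> S (c *: u + w).

Lemma mem_vspan_closed S : lin_closed S -> forall z, z \in vspan [set z | S z] <-> S z.
Proof.
move=> [S0 SL] z; split=> [|Sz]; last exact: mem_vspan.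
have [s [sS ->]] := vspan_seq [set z | S z].
elim: s z sS => [|v s IH] z sS; first by rewrite span_nil memv0 => /eqP ->.
rewrite span_cons => /memv_addP[_ /vlineP[c ->] [w ws ->]]; apply: SL.
  by apply: sS; rewrite inE eqxx.
by apply: IH ws => u us; apply: sS; rewrite inE us orbT.
Qed.

Lemma lin_closed_and S S' : lin_closed S -> lin_closed S' -> lin_closed (fun z => S z /\ S' z).
Proof. by move=> [a1 a2] [c1 c2]; split=> // k u w [? ?] [? ?]; split; [exact: a2|exact: c2]. Qed.

Lemma lin_closed_all (I : Type) (Q : I -> Prop) (F : I -> V -> Prop) :
  (forall i, Q i -> lin_closed (F i)) -> lin_closed (fun z => forall i, Q i -> F i z).
Proof.
by move=> H; split=> [i /H[]//|c u w Su Sw i Qi]; have [_] := H i Qi; apply; [exact: Su|exact: Sw].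
Qed.

Lemma lin_closed_derive y (f g : V -> R) (c : R) : smooth_near y f -> smooth_near y g ->
  lin_closed (fun z => 'D_z f y = c * 'D_z g y).
Proof.
move=> /smooth_near_diff df /smooth_near_diff dg; split; first by rewrite !derive0 mulr0.
move=> k u w Eu Ew; rewrite (derive_dirD _ _ df) (derive_dirD _ _ dg) (derive_dirZ _ _ df) (derive_dirZ _ _ dg).
have gen (A B : R) : k * (c * A) + c * B = c * (k * A + B) by ring.
by rewrite Eu Ew; exact: gen.
Qed.

Lemma lin_closed_ker y (f : V -> R) : smooth_near y f -> lin_closed (fun z => 'D_z f y = 0).
Proof.
move=> sf; have [H1 H2] := lin_closed_derive 0 sf sf; split; first by rewrite derive0.
by move=> k u w Eu Ew; rewrite H2 ?mul0r.
Qed.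

Lemma derive_dir_comb y (f : V -> R) z (A B : V) (c c' : R) : smooth_near y f ->
  'D_(z - c *: A - c' *: B) f y = 'D_z f y - c * 'D_A f y - c' * 'D_B f y.
Proof.
by move=> /smooth_near_diff d; rewrite !(derive_dirB _ _ d) !(derive_dirZ _ _ d).
Qed.

Lemma lin_closed_sub S (c : R) u w : lin_closed S -> S u -> S w -> S (u - c *: w).
Proof. by move=> [_ SL] Su Sw; rewrite addrC -scaleNr; exact: SL. Qed.

End LinearPredicates.

Section TriangularFlags.
Context {R : realType} {n : nat}.
Local Notation V := 'rV[R]_n.
Context (U : set V) (Uo : open U) (p1 p2 q r : nat) (q3 : (3 <= q)%N) (dn : n = (p1 + p2 + q + 2 * r)%N)
  (xi : nat -> V -> R) (e : nat -> V -> V) (a b1 b2 : V -> V) (al : nat -> V -> R).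

(* The families are prolonged, fC j (clen j) = X_{j+1} and fZ 0 0 = X_q, fZ 1 0 = X_1, so that
   the drift shifts the second index along a whole chain. *)
Definition clen (j : nat) := if j == 0%N then p1 else p2.
Definition ixC j k := if j == 0%N then k else (p1 + k)%N.
Definition ixX k := (p1 + p2 + k.-1)%N.
Definition ixZ j k := (p1 + p2 + q + j * r + k.-1)%N.
Definition fX k := xi (ixX k).
Definition fC j k := if (k < clen j)%N then xi (ixC j k) else fX j.+1.
Definition fZ j k := if k == 0%N then (if j == 0%N then fX q else fX 1) else xi (ixZ j k).
Definition inp (l : nat) := if l == 0%N then b1 else b2.

Context (sxi : forall y i, U y -> smooth_near y (xi i)) (se : forall y i, U y -> smooth_near y (e i))
  (sa : forall y, U y -> smooth_near y a) (sb : forall y l, U y -> smooth_near y (inp l))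
  (sal : forall y k, U y -> smooth_near y (al k))
  (dual : forall y i j, U y -> (i < n)%N -> (j < n)%N -> 'D_(e i y) (xi j) y = (i == j)%:R)
  (inj : forall y z, U y -> (forall i, (i < n)%N -> 'D_z (xi i) y = 0) -> z = 0)
  (eC : forall y j k, U y -> (j < 2)%N -> (k < clen j)%N -> lied a (fC j k) y = fC j k.+1 y)
  (eZ : forall y j k, U y -> (j < 2)%N -> (k < r)%N -> lied a (fZ j k) y = fZ j k.+1 y)
  (eX : forall y k, U y -> (2 <= k <= q.-1)%N -> lied a (fX k) y = fX k.+1 y * lied a (fX 1) y + al k y)
  (alK : forall y k z, U y -> (2 <= k <= q.-1)%N ->
    (forall j i, (j < 2)%N -> (i < clen j)%N -> 'D_z (fC j i) y = 0) ->
    (forall i, (1 <= i <= k.+1)%N -> 'D_z (fX i) y = 0) -> 'D_z (al k) y = 0)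
  (bC : forall y l j k, U y -> (l < 2)%N -> (j < 2)%N -> (k < clen j)%N -> lied (inp l) (fC j k) y = 0)
  (bZ : forall y l j k, U y -> (l < 2)%N -> (j < 2)%N -> (k < r)%N -> lied (inp l) (fZ j k) y = 0)
  (bX : forall y l k, U y -> (l < 2)%N -> (2 <= k <= q.-1)%N ->
    lied (inp l) (fX k) y = fX k.+1 y * lied (inp l) (fX 1) y)
  (bS : forall y (lam : nat -> R), U y -> exists c1 c2 : R,
    forall j, (j < 2)%N -> 'D_(c1 *: b1 y + c2 *: b2 y) (fZ j r) y = lam j).

Local Notation D := (Dseq a b1 b2).
Local Notation DF := (derived_flag (D r.+1)).

(** The last i functions of each integrator chain are left free; this will describe G_i. The two
    indices form one variable so that [lin_closed_all] applies. *)
Definition chain_ker i y z := forall jk : nat * nat, (jk.1 < 2)%N && (jk.2 + i < clen jk.1)%N ->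
  'D_z (fC jk.1 jk.2) y = 0.
(** t is the index of the last contact form imposed; member j of the derived flag will be the case t
    = q - 1 - j. *)
Definition theta_ker t y z := chain_ker 0 y z /\
  forall k, (2 <= k <= t)%N -> 'D_z (fX k) y = fX k.+1 y * 'D_z (fX 1) y.
(** For i <= r + 1 this will describe D_i: of the r + 1 pairs, the last i are left free. *)
Definition D_ker i y z := theta_ker (q - 1) y z /\
  forall jk : nat * nat, (jk.1 < 2)%N && (jk.2 + i <= r)%N -> 'D_z (fZ jk.1 jk.2) y = 0.

Lemma fX_smooth y k : U y -> smooth_near y (fX k). Proof. exact: sxi. Qed.
Lemma fC_smooth y j k : U y -> smooth_near y (fC j k).
Proof. by move=> Uy; rewrite /fC; case: ifP => _; exact: sxi. Qed.
Lemma fZ_smooth y j k : U y -> smooth_near y (fZ j k).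
Proof. by move=> Uy; rewrite /fZ; do ?case: ifP => _; exact: sxi. Qed.

Lemma chain_ker_closed i y : U y -> lin_closed (chain_ker i y).
Proof. by move=> Uy; apply: lin_closed_all => -[j k] _; apply: lin_closed_ker; exact: fC_smooth. Qed.

Lemma theta_ker_closed t y : U y -> lin_closed (theta_ker t y).
Proof.
move=> Uy; apply: lin_closed_and (chain_ker_closed 0 Uy) _.
by apply: (lin_closed_all (F := fun k z => 'D_z (fX k) y = _ * 'D_z (fX 1) y)) => k _; apply: lin_closed_derive; exact: fX_smooth.
Qed.

Lemma D_ker_closed i y : U y -> lin_closed (D_ker i y).
Proof.
move=> Uy; apply: lin_closed_and (theta_ker_closed _ Uy) _.
by apply: lin_closed_all => -[j k] _; apply: lin_closed_ker; exact: fZ_smooth.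
Qed.

Lemma chainP i y z : chain_ker i y z <->
  forall j k, (j < 2)%N -> (k + i < clen j)%N -> 'D_z (fC j k) y = 0.
Proof.
split=> [H j k j2 ki|H [j k] /andP[j2 ki]]; last exact: H.
by apply: (H (j, k)); rewrite /= j2 ki.
Qed.

Lemma D_kerP i y z : D_ker i y z <-> theta_ker (q - 1) y z /\
  forall j k, (j < 2)%N -> (k + i <= r)%N -> 'D_z (fZ j k) y = 0.
Proof.
split=> -[H1 H]; split=> //; first by move=> j k j2 ki; apply: (H (j, k)); rewrite /= j2 ki.
by move=> [j k] /andP[j2 ki]; exact: H.
Qed.

Let q0 : (0 < q)%N. Proof. by apply: leq_trans q3. Qed.
Let qm k : (2 <= k <= q - 1)%N = (2 <= k <= q.-1)%N. Proof. by rewrite subn1. Qed.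

Lemma X_of_theta t y z : theta_ker t y z -> 'D_z (fX 1) y = 0 ->
  forall k, (1 <= k <= t)%N -> 'D_z (fX k) y = 0.
Proof.
move=> [_ th] z1 [|[|k]] // kt; by rewrite th ?z1 ?mulr0 //; case/andP: kt.
Qed.

Lemma all_zero y z : U y -> theta_ker (q - 1) y z ->
  (forall j k, (j < 2)%N -> (k <= r)%N -> 'D_z (fZ j k) y = 0) -> z = 0.
Proof.
move=> Uy thz zZ; have z1 : 'D_z (fX 1) y = 0 by exact: (zZ 1%N 0%N).
have zq : 'D_z (fX q) y = 0 by exact: (zZ 0%N 0%N).
have zX k : (1 <= k <= q)%N -> 'D_z (fX k) y = 0.
  move=> /andP[k1 kq]; have [->//|kq'] := eqVneq k q.
  by apply: X_of_theta thz z1 _ _; rewrite k1 subn1 -ltnS prednK // ltn_neqAle kq' kq.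
have [/chainP zC _] := thz.
apply: inj Uy _ => i i_n.
have [i1|i1] := ltnP i p1.
  by have := zC 0%N i isT; rewrite addn0 /fC /clen /ixC /= i1; apply.
have [i2|i2] := ltnP i (p1 + p2).
  have := zC 1%N (i - p1)%N isT; rewrite addn0 /fC /clen /ixC /= ltn_subLR // i2 subnKC //; apply=> //.
have [iq|iq] := ltnP i (p1 + p2 + q).
  have := zX (i - (p1 + p2)).+1; rewrite /fX /ixX /= subnKC //; apply.
  by rewrite ltn_subLR.
have [ir|ir] := ltnP i (p1 + p2 + q + r).
  have := zZ 0%N (i - (p1 + p2 + q)).+1 isT; rewrite /fZ /ixZ /= mul0n addn0 subnKC //; apply.
  by rewrite ltn_subLR.
have := zZ 1%N (i - (p1 + p2 + q + r)).+1 isT; rewrite /fZ /ixZ /= mul1n subnKC //; apply.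
by rewrite ltn_subLR // -addnA addnn -mul2n -dn.
Qed.

Lemma bracket_a y w (f : V -> R) : U y -> smooth_near y w -> smooth_near y f ->
  (\forall z \near y, lied w f z = 0) -> 'D_(lie_bracket a w y) f y = - lied w (lied a f) y.
Proof.
move=> Uy sw sf wf; have := bracket_kill (sa Uy) sw sf wf.
by rewrite -[X in _ = - X]/('D_(lie_bracket a w y) f y) => ->; rewrite opprK.
Qed.

Lemma bracket_a_eq y w (f h : V -> R) : U y -> smooth_near y w -> smooth_near y f ->
  (\forall z \near y, lied w f z = 0) -> (forall z, U z -> lied a f z = h z) ->
  'D_(lie_bracket a w y) f y = - lied w h y.
Proof.
move=> Uy sw sf wf afh; rewrite bracket_a //; congr (- _).
have H : \forall z \near y, lied a f z = h z by apply: near_imp (near_open Uo Uy) => z; exact: afh.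
exact: near_at (near_lied_eq w H).
Qed.

(* This is where the triangular dependence of the alpha_k enters: a field annihilating the
   chains and X_1, ..., X_{t+1} annihilates alpha_2, ..., alpha_t. *)
Lemma drift_theta y w t : U y -> smooth_near y w -> (t <= q - 1)%N ->
  (\forall z \near y, chain_ker 0 z (w z)) ->
  (\forall z \near y, forall k, (1 <= k <= t.+1)%N -> 'D_(w z) (fX k) z = 0) ->
  forall k, (2 <= k <= t)%N -> 'D_(lie_bracket a w y) (fX k) y = fX k.+1 y * 'D_(lie_bracket a w y) (fX 1) y.
Proof.
move=> Uy sw tq wC wX k /andP[k2 kt].
have kq : (2 <= k <= q.-1)%N by rewrite k2 -subn1 (leq_trans kt).
have wXk i : (1 <= i <= k.+1)%N -> \forall z \near y, lied w (fX i) z = 0.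
  move=> /andP[i1 ik]; apply: near_imp wX => z H; apply: H.
  by rewrite i1 (leq_trans ik) // ltnS.
have wk : \forall z \near y, lied w (fX k) z = 0 by apply: wXk; rewrite (ltnW k2) leqnSn.
have w1 : \forall z \near y, lied w (fX 1) z = 0 by exact: wXk.
have wk1 : lied w (fX k.+1) y = 0 by apply: near_at (wXk k.+1 _); rewrite leqnn.
rewrite (bracket_a_eq Uy sw (fX_smooth k Uy) wk (fun z Uz => eX Uz kq)).
rewrite (bracket_a Uy sw (fX_smooth 1 Uy) w1).
have s1 := smooth_near_lied (sa Uy) (fX_smooth 1 Uy).
rewrite (liedD w (smooth_nearM (fX_smooth k.+1 Uy) s1) (sal k Uy)) (liedM w (fX_smooth k.+1 Uy) s1).
have wal : lied w (al k) y = 0.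
  apply: alK => //; first by have /chainP H := near_at wC; move=> j i j2 ij; apply: H => //; rewrite addn0.
  by move=> i ik; apply: (near_at (wXk i ik)).
rewrite wk1 wal.
have gen (A B C : R) : - (A * B + C * 0 + 0) = A * - B by ring.
exact: gen.
Qed.

(** The drift shifts the index along a chain, so each bracket with it frees one more function at the
    end of each chain. *)
Lemma drift_chain y w i : U y -> smooth_near y w -> (\forall z \near y, chain_ker i z (w z)) ->
  forall j k, (j < 2)%N -> (k + i < clen j)%N -> 'D_(lie_bracket a w y) (fC j k) y = - 'D_(w y) (fC j k.+1) y.
Proof.
move=> Uy sw wC j k j2 ki; have kj : (k < clen j)%N by apply: leq_ltn_trans ki; exact: leq_addr.
rewrite (bracket_a_eq Uy sw (fC_smooth j k Uy) _ (fun z Uz => eC Uz j2 kj)) //.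
by apply: near_imp wC => z /chainP; apply.
Qed.

Let ixX_lt k : (k.-1 < q)%N -> (ixX k < n)%N. Proof. by rewrite /ixX dn; clear; lia. Qed.
Let ixZ_lt j k : (j < 2)%N -> (0 < k <= r)%N -> (ixZ j k < n)%N.
Proof. by rewrite /ixZ dn; clear; case: j => [|[|]] // _; lia. Qed.
Let ixC_lt j k : (j < 2)%N -> (k < clen j)%N -> (ixC j k < p1 + p2)%N.
Proof. by rewrite /ixC /clen; clear; case: j => [|[|]] //= _; lia. Qed.
Let pn : (p1 + p2 <= n)%N. Proof. by rewrite dn; clear; lia. Qed.
Let qlt k : (1 <= k <= q)%N -> (k.-1 < q)%N. Proof. by case: k. Qed.

Lemma dualXX y k m : U y -> (1 <= k <= q)%N -> (1 <= m <= q)%N ->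
  'D_(e (ixX k) y) (fX m) y = (k == m)%:R.
Proof.
move=> Uy kq mq; rewrite dual ?ixX_lt ?qlt // /ixX eqn_add2l.
by case/andP: kq => k1 _; case/andP: mq => m1 _; rewrite -[in RHS](prednK k1) -[in RHS](prednK m1).
Qed.

Lemma dualXC y k j i : U y -> (1 <= k <= q)%N -> (j < 2)%N -> (i < clen j)%N -> 'D_(e (ixX k) y) (fC j i) y = 0.
Proof.
move=> Uy kq j2 ij; have h := ixC_lt j2 ij; have h' := leq_trans h pn.
rewrite /fC ij dual ?ixX_lt ?qlt // eqn_leq [(_ <= ixC _ _)%N]leqNgt.
by rewrite (leq_trans h) //= /ixX leq_addr.
Qed.

Lemma dualZC y j' k j i : U y -> (j' < 2)%N -> (0 < k <= r)%N -> (j < 2)%N -> (i < clen j)%N ->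
  'D_(e (ixZ j' k) y) (fC j i) y = 0.
Proof.
move=> Uy j2' kr j2 ij; have h := ixC_lt j2 ij; have h' := leq_trans h pn.
rewrite /fC ij dual ?ixZ_lt // eqn_leq [(_ <= ixC _ _)%N]leqNgt.
by rewrite (leq_trans h) //= /ixZ -!addnA addnA leq_addr.
Qed.

Lemma dualZX y j k m : U y -> (j < 2)%N -> (0 < k <= r)%N -> (1 <= m <= q)%N -> 'D_(e (ixZ j k) y) (fX m) y = 0.
Proof.
move=> Uy j2 kr mq; rewrite dual ?ixZ_lt ?ixX_lt ?qlt // eqn_leq [(_ <= ixX _)%N]leqNgt.
suff -> : (ixX m < ixZ j k)%N by [].
by have := qlt mq; rewrite /ixX /ixZ; clear; lia.
Qed.

Lemma dualZZ y j k j' i : U y -> (j < 2)%N -> (0 < k <= r)%N -> (j' < 2)%N -> (i <= r)%N ->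
  'D_(e (ixZ j k) y) (fZ j' i) y = ((j == j') && (k == i))%:R.
Proof.
move=> Uy j2 kr j2' ir; have k0 : (k == 0%N) = false by case: k kr.
rewrite /fZ; have [->|i0] := eqVneq i 0%N.
  rewrite k0 andbF; case: ifP => _; apply: dualZX => //; by rewrite ?q0 leqnn.
have i1 : (0 < i <= r)%N by rewrite lt0n i0.
rewrite (dual Uy (ixZ_lt j2 kr) (ixZ_lt j2' i1)); suff -> : (ixZ j k == ixZ j' i) = (j == j') && (k == i) by [].
move: j2 j2' kr ir i0; rewrite /ixZ; clear; case: j => [|[|]] // _; case: j' => [|[|]] // _ /=.
- by move=> /andP[k0 kr] ir i0; rewrite !mul0n !addn0 eqn_add2l -!subn1; apply/eqP/eqP; lia.
- by move=> /andP[k0 kr] ir i0; apply/negbTE/eqP; lia.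
- by move=> /andP[k0 kr] ir i0; apply/negbTE/eqP; lia.
- by move=> /andP[k0 kr] ir i0; rewrite eqn_add2l -!subn1; apply/eqP/eqP; lia.
Qed.

Lemma D_ker_X i y z : D_ker i y z -> (i <= r)%N -> forall k, (1 <= k <= q)%N -> 'D_z (fX k) y = 0.
Proof.
move=> /D_kerP[th zZ] ir k /andP[k1 kq].
have z1 : 'D_z (fX 1) y = 0 by apply: (zZ 1%N 0%N).
have zq : 'D_z (fX q) y = 0 by apply: (zZ 0%N 0%N).
have [->//|kq'] := eqVneq k q.
by apply: X_of_theta th z1 _ _; rewrite k1 subn1 -ltnS prednK // ltn_neqAle kq' kq.
Qed.

Lemma D_ker_bracket i y w : U y -> (i <= r)%N -> smooth_near y w -> (\forall z \near y, D_ker i z (w z)) ->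
  theta_ker (q - 1) y (lie_bracket a w y) /\
  forall j k, (j < 2)%N -> (k + i <= r)%N -> (k < r)%N ->
    'D_(lie_bracket a w y) (fZ j k) y = - 'D_(w y) (fZ j k.+1) y.
Proof.
move=> Uy ir sw wD.
have wC : \forall z \near y, chain_ker 0 z (w z) by apply: near_imp wD => z [[]].
have wX : \forall z \near y, forall k, (1 <= k <= q)%N -> 'D_(w z) (fX k) z = 0.
  by apply: near_imp wD => z /D_ker_X; apply.
split.
  split; last first.
    apply: (drift_theta Uy sw (leqnn _) wC); apply: near_imp wX => z H k kq; apply: H.
    by move: kq; rewrite subn1 prednK.
  apply/chainP => j k j2 kj; rewrite (drift_chain Uy sw wC j2 kj).
  have [kl|kl] := ltnP k.+1 (clen j).
    by have /chainP H := near_at wC; rewrite H ?oppr0 // addn0.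
  rewrite /fC ltnNge kl /= (near_at wX) ?oppr0 //.
  by move: j2 q3; clear; case: j => [|[|]] // _; lia.
move=> j k j2 ki kr; rewrite (bracket_a_eq Uy sw (fZ_smooth j k Uy) _ (fun z Uz => eZ Uz j2 kr)) //.
by apply: near_imp wD => z /D_kerP[_]; apply.
Qed.

(** One inclusion is the shift of indices by the drift. For the other, a vector is corrected by
    brackets of the drift with two coordinate fields, one for each x_3-chain, until pair number r -
    i - 1 vanishes on it; then it lies in D_(i+1). [bS] gives the case of the input fields. *)
Lemma Dseq_ker i : (i <= r.+1)%N -> forall y, U y -> forall z, z \in D i y <-> D_ker i y z.
Proof.
elim: i => [|[_|i IH]] ir y Uy z.
- rewrite /= memv0; split=> [/eqP ->|/D_kerP[th zZ]]; first by have [] := D_ker_closed 0 Uy.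
  by apply/eqP; apply: (all_zero Uy th) => j k j2 kr; apply: zZ; rewrite ?addn0.
- have bD l : (l < 2)%N -> D_ker 1 y (inp l y).
    move=> l2; apply/D_kerP; split.
      split; first by apply/chainP => j k j2; rewrite addn0; exact: bC.
      by move=> k; rewrite qm; exact: bX.
    by move=> j k j2; rewrite addn1; exact: bZ.
  have [D0 DL] := D_ker_closed 1 Uy.
  split=> [/memv_addP[_ /vlineP[c1 ->] [_ /vlineP[c2 ->] ->]]|zD].
    by apply: (DL _ _ _ (bD 0%N isT)); rewrite -[c2 *: _]addr0; exact: (DL _ _ _ (bD 1%N isT) D0).
  have [c1 [c2 cS]] := bS (fun j => 'D_z (fZ j r) y) Uy.
  pose u := c1 *: b1 y + c2 *: b2 y.
  have uD : D_ker 1 y u.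
    by apply: (DL _ _ _ (bD 0%N isT)); rewrite -[c2 *: _]addr0; exact: (DL _ _ _ (bD 1%N isT) D0).
  have : z - 1 *: u = 0.
    have /D_kerP[th zZ] := lin_closed_sub 1 (D_ker_closed 1 Uy) zD uD.
    apply: (all_zero Uy th) => j k j2; rewrite leq_eqVlt => /orP[/eqP ->|kr]; last by apply: zZ; rewrite ?addn1.
    have d := smooth_near_diff (fZ_smooth j r Uy).
    by rewrite (derive_dirB _ _ d) scale1r cS // subrr.
  rewrite scale1r => /eqP; rewrite subr_eq0 => /eqP ->.
  by apply: memv_add; apply: memvZ; exact: memv_line.
have {}IH y' : U y' -> forall z, z \in D i.+1 y' <-> D_ker i.+1 y' z by apply: IH; exact: ltnW.
have ir' : (i.+1 <= r)%N by [].
have Dw w y' : U y' -> section_near (D i.+1) y' w -> \forall z \near y', D_ker i.+1 z (w z).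
  by move=> Uy' [_ wD]; apply: near_imp2 wD (near_open Uo Uy') => t tD Ut; apply/IH.
have up z' : D_ker i.+1 y z' -> D_ker i.+2 y z'.
  by move=> /D_kerP[th zZ]; apply/D_kerP; split=> // j k j2 ki; apply: zZ => //; move: ki; clear; lia.
have D2 := D_ker_closed i.+2 Uy.
split=> [|zD].
  have sub : (D i.+2 y <= vspan [set z | D_ker i.+2 y z])%VS.
    rewrite /= subv_add; apply/andP; split.
      by apply/subvP => z' /(IH _ Uy)/up H; exact: mem_vspan.
    apply: vspan_sub => _ [w Dww <-]; apply: mem_vspan; have [sw _] := Dww.
    have [th bZ'] := D_ker_bracket Uy ir' sw (Dw _ _ Uy Dww); apply/D_kerP; split=> // j k j2 ki.
    have kr : (k < r)%N by move: ki; clear; lia.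
    rewrite bZ' //; last by move: ki; clear; lia.
    by have /D_kerP[_ H] := near_at (Dw _ _ Uy Dww); rewrite H ?oppr0 // addSn -addnS.
  by move=> /(subvP sub)/(mem_vspan_closed D2).
pose m := (r - i.+1)%N; have mi : (m + i.+1 = r)%N by rewrite subnK.
have mr : (m < r)%N by rewrite -mi addnS ltnS leq_addr.
pose w j := e (ixZ j m.+1).
have m1 : (0 < m.+1 <= r)%N by [].
have wsec j : (j < 2)%N -> section_near (D i.+1) y (w j).
  move=> j2; split; first exact: se.
  apply: near_imp (near_open Uo Uy) => t Ut; apply/IH => //; apply/D_kerP; split.
    split; first by apply/chainP => j' k j2' kj; apply: dualZC => //; rewrite -[k]addn0.
    move=> k /andP[k2 kq]; have kq' : (1 <= k <= q)%N by rewrite (ltnW k2) (leq_trans kq) // leq_subr.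
    by rewrite !dualZX ?mulr0 // ?q0.
  move=> j' k j2' ki; rewrite dualZZ //; last by move: ki; clear; lia.
  have -> : (m.+1 == k) = false by apply: negbTE; rewrite neq_ltn; move: ki mi; clear; lia.
  by rewrite andbF.
have br j : (j < 2)%N -> lie_bracket a (w j) y \in D i.+2 y.
  by move=> j2; apply: (subvP (addvSr _ _)); apply: mem_vspan; exists (w j) => //; exact: wsec.
have brD j : (j < 2)%N -> theta_ker (q - 1) y (lie_bracket a (w j) y) /\
    forall j' k, (j' < 2)%N -> (k + i.+1 <= r)%N -> 'D_(lie_bracket a (w j) y) (fZ j' k) y = - ((j == j') && (k == m))%:R.
  move=> j2; have [sw _] := wsec j j2.
  have [th H] := D_ker_bracket Uy ir' sw (Dw _ _ Uy (wsec j j2)); split=> // j' k j2' ki.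
  have kr : (k < r)%N by move: ki; clear; lia.
  by rewrite H // dualZZ // eqSS [m == k]eq_sym.
have [th zZ] := (D_kerP _ _ _).1 zD.
have [th0 b0] := brD 0%N isT; have [th1 b1'] := brD 1%N isT.
pose A0 := lie_bracket a (w 0%N) y; pose A1 := lie_bracket a (w 1%N) y.
pose l j := 'D_z (fZ j m) y.
(* On pair m the two brackets take the value -1, whence the signs of the coefficients. *)
have zE (z' A B : V) (c c' : R) : z' = (z' - (- c) *: A - (- c') *: B) - c *: A - c' *: B.
  by apply/rowP => i'; rewrite !mxE; ring.
rewrite (zE z A0 A1 (l 0%N) (l 1%N)); apply: memvB; last by apply: memvZ; exact: br.
apply: memvB; last by apply: memvZ; exact: br.
have B0 j k (j2 : (j < 2)%N) (ki : (k + i.+1 <= r)%N) : 'D_A0 (fZ j k) y = - ((0%N == j) && (k == m))%:R := b0 j k j2 ki.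
have B1 j k (j2 : (j < 2)%N) (ki : (k + i.+1 <= r)%N) : 'D_A1 (fZ j k) y = - ((1%N == j) && (k == m))%:R := b1' j k j2 ki.
have T0 : theta_ker (q - 1) y A0 := th0.
have T1 : theta_ker (q - 1) y A1 := th1.
move: A0 A1 B0 B1 T0 T1 {th0 th1 b0 b1' br brD} => A0 A1 B0 B1 T0 T1.
apply: (subvP (addvSl _ _)); apply/(IH _ Uy)/D_kerP.
have cl := theta_ker_closed (q - 1) Uy.
have th' := lin_closed_sub (- l 1%N) cl (lin_closed_sub (- l 0%N) cl th T0) T1.
split; first exact: th'.
move=> j k j2 ki; apply: etrans (derive_dir_comb z A0 A1 _ _ (fZ_smooth j k Uy)) _; rewrite B0 // B1 //.
have [->|km] := eqVneq k m; last first.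
  rewrite zZ //; last by move: km ki mi => /eqP; clear; lia.
  have gen (A B : R) : 0 - A * - 0 - B * - 0 = 0 by ring.
  by rewrite !andbF; exact: gen.
rewrite !andbT; have gen0 (A B : R) : A - - A * - 1 - B * - 0 = 0 by ring.
have gen1 (A B : R) : A - B * - 0 - - A * - 1 = 0 by ring.
by case: j j2 => [|[|]].
Qed.

(** The field with dX_1 = 1 that annihilates the chains and theta_2, ..., theta_t. *)
Definition hatX t : V -> V := fun y => e (ixX 1) y + \sum_(k < t.+1) (if (2 <= k)%N then fX k.+1 y else 0) *: e (ixX k) y.

Lemma hatX_smooth t y : U y -> smooth_near y (hatX t).
Proof.
move=> Uy; apply: smooth_nearD; first exact: se.
apply: (smooth_near_ord (F := fun (k : nat) y => (if (2 <= k)%N then fX k.+1 y else 0) *: e (ixX k) y)) => k kt.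
apply: smooth_nearZ; last exact: se.
by case: (2 <= k)%N; [exact: fX_smooth|exact: smooth_near_cst].
Qed.

Lemma hatX_derive t y (f : V -> R) : smooth_near y f -> 'D_(hatX t y) f y =
  'D_(e (ixX 1) y) f y + \sum_(k < t.+1) (if (2 <= k)%N then fX k.+1 y else 0) * 'D_(e (ixX k) y) f y.
Proof.
move=> /smooth_near_diff d; rewrite (derive_dirD _ _ d) (derive_dir_sum _ _ _ d); congr (_ + _).
by apply: eq_bigr => k _; rewrite (derive_dirZ _ _ d).
Qed.

Lemma hatX_C t y j i : U y -> (t <= q)%N -> (j < 2)%N -> (i < clen j)%N -> 'D_(hatX t y) (fC j i) y = 0.
Proof.
move=> Uy tq j2 ij; rewrite (hatX_derive _ (fC_smooth j i Uy)) dualXC ?q0 // add0r big1 // => k _.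
case: ifP => [k2|_]; last by rewrite mul0r.
by rewrite dualXC ?mulr0 // (ltnW k2) (leq_trans _ tq) // -ltnS.
Qed.

Lemma hatX_X t y m : U y -> (t <= q)%N -> (1 <= m <= q)%N ->
  'D_(hatX t y) (fX m) y = (m == 1%N)%:R + (if (2 <= m <= t)%N then fX m.+1 y else 0).
Proof.
move=> Uy tq mq; rewrite (hatX_derive _ (fX_smooth m Uy)) (dualXX Uy _ mq) ?q0 // eq_sym; congr (_ + _).
have tX k : (k < t.+1)%N -> (2 <= k)%N -> 'D_(e (ixX k) y) (fX m) y = (k == m)%:R.
  by move=> kt k2; rewrite (dualXX Uy _ mq) // (ltnW k2) (leq_trans _ tq).
case: ifP => [/andP[m2 mt]|mt].
  have mt' : (m < t.+1)%N by [].
  rewrite (bigD1 (Ordinal mt')) //= m2 tX // eqxx mulr1 big1 ?addr0 // => k km.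
  case: ifP => [k2|]; last by rewrite mul0r.
  by rewrite tX // (_ : _ == _ = false) ?mulr0 //; apply: negbTE.
rewrite big1 // => k _; case: ifP => [k2|]; last by rewrite mul0r.
rewrite tX // (_ : _ == _ = false) ?mulr0 //; apply/negbTE/eqP => km; move: mt; rewrite -km k2 /=.
by rewrite -ltnS ltn_ord.
Qed.

Lemma hatX_theta t y : U y -> (t <= q - 1)%N -> theta_ker t y (hatX t y).
Proof.
move=> Uy tq; have tq' : (t <= q)%N by apply: leq_trans tq _; exact: leq_subr.
split; first by apply/chainP => j k j2; rewrite addn0; exact: hatX_C.
move=> k /andP[k2 kt]; have k1q : (1 <= k <= q)%N by rewrite (ltnW k2) (leq_trans kt).
rewrite (hatX_X Uy tq' k1q) (hatX_X (m := 1) Uy tq') ?q0 // k2 kt /=.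
by rewrite (_ : (k == 1)%N = false) ?add0r ?addr0 ?mulr1 //; case: k k2 {kt k1q} => [|[|]].
Qed.

Lemma eX_theta t y : U y -> (t < q)%N -> theta_ker t y (e (ixX t.+1) y).
Proof.
move=> Uy tq; split; first by apply/chainP => j k j2; rewrite addn0; exact: dualXC.
move=> k /andP[k2 kt]; have k1 := ltnW k2; have t0 : (0 < t)%N by apply: leq_trans kt.
have k1q : (1 <= k <= q)%N by rewrite k1 (leq_trans kt) // ltnW.
have t1q : (1 <= t.+1 <= q)%N by [].
rewrite (dualXX Uy t1q k1q) (dualXX (m := 1) Uy t1q) ?q0 //.
have f1 : (t.+1 == k) = false by apply: negbTE; rewrite neq_ltn [(k < _)%N]ltnS kt orbT.
have f2 : (t.+1 == 1%N) = false by rewrite eqSS; apply: negbTE; rewrite -lt0n.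
by rewrite f1 f2 mulr0.
Qed.

Lemma theta_ker_mono t t' y z : (t <= t')%N -> theta_ker t' y z -> theta_ker t y z.
Proof. by move=> tt [zC th]; split=> // k /andP[k2 kt]; apply: th; rewrite k2 (leq_trans kt). Qed.

Lemma chain_bracket i y u w : U y -> smooth_near y u -> smooth_near y w ->
  (\forall z \near y, chain_ker i z (u z)) -> (\forall z \near y, chain_ker i z (w z)) ->
  chain_ker i y (lie_bracket u w y).
Proof.
move=> Uy su sw uC wC; apply/chainP => j k j2 ki.
apply: (bracket_ker su sw (fC_smooth j k Uy)).
  by apply: near_imp uC => z /chainP; exact.
by apply: near_imp wC => z /chainP; exact.
Qed.

Lemma theta_ker_bracket t y u w k : U y -> smooth_near y u -> smooth_near y w ->
  (\forall z \near y, theta_ker t z (u z)) -> (\forall z \near y, theta_ker t z (w z)) -> (2 <= k <= t)%N ->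
  'D_(lie_bracket u w y) (fX k) y = fX k.+1 y * 'D_(lie_bracket u w y) (fX 1) y +
  ('D_(u y) (fX k.+1) y * 'D_(w y) (fX 1) y - 'D_(w y) (fX k.+1) y * 'D_(u y) (fX 1) y).
Proof.
move=> Uy su sw ut wt kt.
have ue : \forall z \near y, lied u (fX k) z = fX k.+1 z * lied u (fX 1) z by apply: near_imp ut => z [_]; exact.
have we : \forall z \near y, lied w (fX k) z = fX k.+1 z * lied w (fX 1) z by apply: near_imp wt => z [_]; exact.
have := theta_bracket su sw (fX_smooth k Uy) (fX_smooth k.+1 Uy) (fX_smooth 1 Uy) ue we.
have gen (A B C : R) : A - B = C -> A = B + C by move=> <-; ring.
exact: gen.
Qed.

(** The witness is the bracket of the coordinate field of X_(t+1) with [hatX t]: by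
    [theta_ker_bracket] its value under theta_k is the derivative of X_(k+1) along that coordinate
    field, 1 for k = t and 0 for k < t. *)
Lemma theta_gap (E : tdistribution R n) t y : U y -> (2 <= t <= q - 1)%N -> (forall y' z, U y' -> z \in E y' <-> theta_ker t y' z) ->
  exists eta : V, [/\ eta \in bracket_dd E E y, theta_ker t.-1 y eta &
    'D_eta (fX t) y = fX t.+1 y * 'D_eta (fX 1) y + 1].
Proof.
move=> Uy /andP[t2 tq] HE; pose u := e (ixX t.+1); pose w := hatX t.
have tq' : (t < q)%N by rewrite -(prednK q0) ltnS -subn1.
have ut : \forall z \near y, theta_ker t z (u z) by apply: near_imp (near_open Uo Uy) => z Uz; exact: eX_theta.
have wt : \forall z \near y, theta_ker t z (w z) by apply: near_imp (near_open Uo Uy) => z Uz; exact: hatX_theta.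
have su : smooth_near y u by exact: se.
have sw : smooth_near y w by exact: hatX_smooth.
have uE : section_near E y u by split=> //; apply: near_imp2 ut (near_open Uo Uy) => z h Uz; apply/HE.
have wE : section_near E y w by split=> //; apply: near_imp2 wt (near_open Uo Uy) => z h Uz; apply/HE.
have t1q : (1 <= t.+1 <= q)%N by [].
have wX1 : 'D_(w y) (fX 1) y = 1 by rewrite hatX_X ?q0 ?(ltnW tq') //= addr0.
have uX1 : 'D_(u y) (fX 1) y = 0.
  have f1 : (t.+1 == 1%N) = false by rewrite eqSS; apply: negbTE; rewrite -lt0n ltnW.
  by rewrite (dualXX (m := 1) Uy t1q) ?q0 // f1.
exists (lie_bracket u w y); split; first exact: bracket_mem.
  split.
    by apply: (chain_bracket Uy su sw); [apply: near_imp ut => z []|apply: near_imp wt => z []].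
  move=> k /andP[k2 kt]; have kt' : (k < t)%N by rewrite -(prednK (ltnW t2)) ltnS.
  rewrite (theta_ker_bracket Uy su sw ut wt) ?k2 ?(ltnW kt') // uX1 wX1 mulr0 subr0 mulr1.
  rewrite (dualXX Uy t1q) ?(ltn_trans kt') //.
  by rewrite (_ : (t.+1 == k.+1) = false) ?addr0 // eqSS; apply: negbTE; rewrite neq_ltn kt' orbT.
rewrite (theta_ker_bracket Uy su sw ut wt) ?t2 ?leqnn // uX1 wX1 mulr0 subr0 mulr1.
by rewrite (dualXX Uy t1q) // eqxx.
Qed.

(** Since theta_t(eta) = 1, the coefficient is theta_t(z). *)
Lemma theta_split t y (z eta : V) : U y -> (2 <= t)%N -> theta_ker t.-1 y z -> theta_ker t.-1 y eta ->
  'D_eta (fX t) y = fX t.+1 y * 'D_eta (fX 1) y + 1 -> exists c : R, theta_ker t y (z - c *: eta).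
Proof.
move=> Uy t2 zt et e1; pose lam := 'D_z (fX t) y - fX t.+1 y * 'D_z (fX 1) y.
exists lam; have [zC th] := lin_closed_sub lam (theta_ker_closed _ Uy) zt et.
split=> // k /andP[k2 kt]; have [kE|kn] := eqVneq k t; last first.
  by apply: th; rewrite k2 -ltnS prednK ?(ltnW t2) // ltn_neqAle kn.
have [dt d1] := (smooth_near_diff (fX_smooth t Uy), smooth_near_diff (fX_smooth 1 Uy)).
rewrite kE (derive_dirB _ _ dt) (derive_dirB _ _ d1) (derive_dirZ _ _ dt) (derive_dirZ _ _ d1) e1 /lam.
have gen (A B C E : R) : A - (A - B * C) * (B * E + 1) = B * (C - (A - B * C) * E) by ring.
exact: gen.
Qed.

(** For k < t, dX_(k+1) is a multiple of dX_1 on fields annihilated by theta_2, ..., theta_t, so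
    theta_k also vanishes on their brackets and only theta_t is lost. [theta_gap] shows that the one
    new direction is reached. *)
Lemma flag_ker j : (j <= q - 2)%N -> forall y z, U y -> z \in DF j y <-> theta_ker (q - 1 - j) y z.
Proof.
elim: j => [|j IH] jq y z Uy.
  rewrite subn0 /=; split=> [/(Dseq_ker (leqnn _) Uy)/D_kerP[]//|th].
  by apply/(Dseq_ker (leqnn _) Uy)/D_kerP; split=> // j k _; rewrite addnS ltnNge leq_addl.
have {}IH := IH (ltnW jq); set t := (q - 1 - j)%N in IH.
have tE : (q - 1 - j.+1 = t.-1)%N by rewrite /t subnS.
have t2 : (2 <= t <= q - 1)%N by rewrite /t; move: jq q3; clear; lia.
rewrite tE; have tp : (t.-1 <= t)%N by exact: leq_pred.
have secE u : section_near (DF j) y u -> \forall z \near y, theta_ker t z (u z).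
  by move=> [_ uD]; apply: near_imp2 uD (near_open Uo Uy) => t' h Ut; apply/IH.
split.
  have sub : (DF j.+1 y <= vspan [set z | theta_ker t.-1 y z])%VS.
    rewrite /= subv_add; apply/andP; split.
      by apply/subvP => z' /(IH _ _ Uy)/(theta_ker_mono tp) H; exact: mem_vspan.
    apply: bracket_dd_sub => u w Du Dw; apply: mem_vspan; have [[su _] [sw _]] := (Du, Dw).
    have [ut wt] := (secE _ Du, secE _ Dw); split.
      by apply: (chain_bracket Uy su sw); [apply: near_imp ut => z' []|apply: near_imp wt => z' []].
    move=> k /andP[k2 kt]; have kt' : (k < t)%N by rewrite -(prednK (ltnW (proj1 (andP t2)))) ltnS.
    rewrite (theta_ker_bracket Uy su sw ut wt) ?k2 ?(ltnW kt') //.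
    have [[_ Hu] [_ Hw]] := (near_at ut, near_at wt).
    have Hk : (2 <= k.+1 <= t)%N by rewrite ltnS (ltnW k2).
    rewrite (Hu k.+1 Hk) (Hw k.+1 Hk).
    have gen (A B C E : R) : A + (B * C * E - B * E * C) = A by ring.
    exact: gen.
  by move=> /(subvP sub)/(mem_vspan_closed (theta_ker_closed _ Uy)).
move=> zt; have [eta [eB et e1]] := theta_gap Uy t2 IH.
have [c zc] := theta_split Uy (proj1 (andP t2)) zt et e1.
by rewrite -[z](subrK (c *: eta)); apply: memv_add; [apply/IH|apply: memvZ].
Qed.

Lemma dim_add_line (A B : {vspace V}) z0 : (A <= B)%VS -> z0 \in B -> z0 \notin A ->
  (forall z, z \in B -> exists c : R, z - c *: z0 \in A) -> (\dim B = \dim A + 1)%N.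
Proof.
move=> AB z0B z0A H; apply/eqP; rewrite eqn_leq; apply/andP; split.
  have BA : (B <= A + <[z0]>)%VS.
    apply/subvP => z /H[c zc]; rewrite -[z](subrK (c *: z0)); apply: memv_add => //.
    by apply: memvZ; exact: memv_line.
  apply: leq_trans (dimvS BA) _; apply: leq_trans (leq_addr (\dim (A :&: <[z0]>)) _) _.
  by rewrite dimv_sum_cap leq_add2l dim_vline leq_b1.
rewrite addn1 ltn_neqAle dimvS // andbT; apply: contra z0A => dAB.
by have /eqP -> : (A == B)%VS by rewrite eqEdim AB (eqP dAB) leqnn.
Qed.

Lemma flag_dim j y : (j < q - 2)%N -> U y -> (\dim (DF j.+1 y) = \dim (DF j y) + 1)%N.
Proof.
move=> jq Uy; pose t := (q - 1 - j)%N.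
have t2 : (2 <= t <= q - 1)%N by rewrite /t; move: jq q3; clear; lia.
have tE : (q - 1 - j.+1 = t.-1)%N by rewrite /t subnS.
have IH y' z : U y' -> z \in DF j y' <-> theta_ker t y' z by exact: (flag_ker (ltnW jq)).
have IH' z : z \in DF j.+1 y <-> theta_ker t.-1 y z by have := flag_ker jq z Uy; rewrite tE.
have [eta [eB et e1]] := theta_gap Uy t2 IH.
apply: (@dim_add_line _ _ eta).
- exact: addvSl.
- exact/IH'.
- apply/negP => /(IH _ _ Uy)[_ /(_ t)]; rewrite leqnn andbT (proj1 (andP t2)) e1 => /(_ isT)/eqP.
  by rewrite -subr_eq0 addrAC subrr add0r oner_eq0.
- by move=> z /IH' zt; have [c zc] := theta_split Uy (proj1 (andP t2)) zt et e1; exists c; apply/IH.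
Qed.

Lemma closure_ker y z : U y -> z \in DF (q - 2) y <-> chain_ker 0 y z.
Proof.
move=> Uy; have -> : chain_ker 0 y z <-> theta_ker 1 y z.
  by split=> [|[]] // H; split=> // -[|[|]].
have := flag_ker (leqnn _) z Uy; have -> : (q - 1 - (q - 2) = 1)%N by move: q3; clear; lia.
by [].
Qed.

Lemma chain_involutive i (E : tdistribution R n) y (U1 : set V) : open U1 -> U1 y -> (forall z, U1 z -> U z) ->
  (forall y' z, U1 y' -> z \in E y' <-> chain_ker i y' z) -> (bracket_dd E E y <= E y)%VS.
Proof.
move=> U1o U1y U1U HE; apply: bracket_dd_sub => u w [su uE] [sw wE]; apply/(HE _ _ U1y).
apply: (chain_bracket (U1U _ U1y) su sw).
  by apply: near_imp2 uE (near_open U1o U1y) => t h Ut; apply/HE.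
by apply: near_imp2 wE (near_open U1o U1y) => t h Ut; apply/HE.
Qed.

Lemma cauchy_le (E : tdistribution R n) y : (cauchy_char E y <= E y)%VS.
Proof. by apply: vspan_sub => _ [w [[_ /near_at wE] _ ->]]. Qed.

(** With t = q - 1 - j, [cauchy_kernel] gives dX_1 = dX_(t+1) = 0 on characteristics; the contact
    forms then annihilate the X_k in between. *)
Lemma cauchy_flag j y : U y -> (j <= q - 3)%N -> regular y (DF j) ->
  \forall y' \near y, forall z, z \in cauchy_char (DF j) y' ->
    theta_ker (q - 1 - j) y' z /\ forall k, (1 <= k <= q - j)%N -> 'D_z (fX k) y' = 0.
Proof.
move=> Uy jq rF; pose t := (q - 1 - j)%N.
have t2 : (2 <= t <= q - 1)%N by rewrite /t; move: jq q3; clear; lia.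
have tS : (q - j = t.+1)%N by rewrite /t; move: jq q3; clear; lia.
have [t1 tq] := andP t2; have tq' : (t < q)%N by rewrite -(prednK q0) ltnS -subn1.
have jq' : (j <= q - 2)%N by move: jq; clear; lia.
have HE y' z : U y' -> z \in DF j y' <-> theta_ker t y' z by exact: (flag_ker jq').
have Un := near_open Uo Uy.
have sec : section_near (DF j) y (hatX t).
  split; first exact: hatX_smooth.
  by apply: near_imp Un => z Uz; apply/HE => //; exact: hatX_theta.
have v1 : \forall z \near y, lied (hatX t) (fX 1) z = 1.
  by apply: near_imp Un => z Uz; rewrite /lied hatX_X ?q0 ?(ltnW tq') //= addr0.
have th : \forall y' \near y, forall z, z \in DF j y' -> 'D_z (fX t) y' = fX t.+1 y' * 'D_z (fX 1) y'.
  by apply: near_imp Un => y' Uy' z /(HE _ _ Uy')[_]; apply; rewrite t1 leqnn.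
have nd : \forall y' \near y, exists2 z, z \in DF j y' & 'D_z (fX 1) y' = 0 /\ 'D_z (fX t.+1) y' != 0.
  apply: near_imp Un => y' Uy'; exists (e (ixX t.+1) y'); first by apply/HE => //; exact: eX_theta.
  have t1q : (1 <= t.+1 <= q)%N by [].
  rewrite (dualXX Uy' t1q t1q) eqxx oner_eq0 (dualXX (m := 1) Uy' t1q) ?q0 //; split=> //.
  by rewrite eqSS; case: (t) t1.
have := cauchy_kernel rF (fX_smooth t Uy) (fX_smooth t.+1 Uy) (fX_smooth 1 Uy) sec v1 th nd.
move=> ck; apply: near_imp2 ck Un => y' H Uy' z zC; have [z1 zt] := H z zC.
have tz : theta_ker t y' z by apply/(HE _ _ Uy'); exact: subvP (cauchy_le _ _) _ zC.
split=> // k; rewrite tS => /andP[k1 kt]; have [->//|kn] := eqVneq k t.+1.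
by apply: (X_of_theta tz z1); rewrite k1 -ltnS ltn_neqAle kn.
Qed.

(** Characteristics of D_(r+1) annihilate every X_k, in particular the pair X_q, X_1 that separates
    D_r from D_(r+1); the converse is [kernel_cauchy]. *)
Lemma cauchy_top y : U y -> regular y (D r) -> regular y (D r.+1) -> germ_eq y (cauchy_char (D r.+1)) (D r).
Proof.
move=> Uy rD rD1; have Un := near_open Uo Uy.
have ck := cauchy_flag (j := 0) Uy (leq0n _) rD1.
apply: near_imp3 ck Un (regular_near_pt rD) => y' H Uy' rDy.
apply/eqP; rewrite eqEsubv; apply/andP; split; apply/subvP => z.
  move=> /H[]; rewrite !subn0 => th zX; apply/(Dseq_ker (leqnSn _) Uy')/D_kerP; split=> // j k j2.
  rewrite -[leqRHS]add0n leq_add2r leqn0 => /eqP ->; rewrite /fZ /=.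
  by case: ifP => _; apply: zX; rewrite ?leqnn ?q0.
move=> zD; have [w [Dw wz]] := section_through rDy zD; have [sw wD] := Dw.
have Un' := near_open Uo Uy'.
have wk : \forall t \near y', D_ker r t (w t).
  by apply: near_imp2 wD Un' => t h Ut; apply/(Dseq_ker (leqnSn _)).
have HE : \forall t \near y', forall z, z \in D r.+1 t <-> z \in DF (q - 2) t /\ theta_in fX (q - 1) t z.
  apply: near_imp Un' => t Ut z'; have := flag_ker (leq0n _) z' Ut; rewrite subn0 => h.
  split=> [/h[zC th]|[/(closure_ker _ Ut) zC th]]; first by split=> //; apply/closure_ker.
  by apply/h; split.
have inv : germ_involutive y' (DF (q - 2)).
  by apply: near_imp Un' => t Ut; exact: (chain_involutive (i := 0) Uo Ut (fun _ h => h) (fun _ z' Uz => closure_ker z' Uz)).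
have Cw : section_near (DF (q - 2)) y' w.
  by split=> //; apply: near_imp2 wk Un' => t [[wC _] _] Ut; apply/closure_ker.
have qS : ((q - 1).+1 = q)%N by rewrite subn1 prednK.
have wX k : (1 <= k <= (q - 1).+1)%N -> \forall t \near y', lied w (fX k) t = 0.
  by rewrite qS => kq; apply: near_imp wk => t /D_ker_X; apply.
have [sec ch] := kernel_cauchy (fun k _ => fX_smooth k Uy') HE inv Cw wX.
by apply: mem_vspan; exists w.
Qed.

(** Characteristics annihilate the leading X_k, so by the triangular dependence in [drift_theta]
    their brackets with the drift satisfy the contact forms; the ends X_1, X_2 of the chains are
    annihilated too, which keeps the brackets in Dbar. *)
Lemma cauchy_drift j y : U y -> (1 <= j <= q - 3)%N -> regular y (DF j) ->
  (bracket_vd a (cauchy_char (DF j)) y <= DF j y)%VS.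
Proof.
move=> Uy /andP[j1 jq] rF; have ck := cauchy_flag Uy jq rF.
have jq' : (j <= q - 2)%N by move: jq; clear; lia.
apply: vspan_sub => _ [w [sw wE] <-]; apply/(flag_ker jq' _ Uy).
have wk : \forall y' \near y, theta_ker (q - 1 - j) y' (w y') /\
    forall k, (1 <= k <= q - j)%N -> 'D_(w y') (fX k) y' = 0.
  by apply: near_imp2 ck wE => y' H1 H2; exact: H1.
have wC : \forall z \near y, chain_ker 0 z (w z) by apply: near_imp wk => z [[]].
have wX : \forall z \near y, forall k, (1 <= k <= (q - 1 - j).+1)%N -> 'D_(w z) (fX k) z = 0.
  by apply: near_imp wk => z [_ H] k kq; apply: H; move: kq j1 jq q3; clear; lia.
split; last by apply: (drift_theta Uy sw _ wC wX); rewrite leq_subLR leq_addl.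
apply/chainP => i k i2 ki; rewrite (drift_chain Uy sw wC i2 ki).
have [kl|kl] := ltnP k.+1 (clen i).
  by have /chainP H := near_at wC; rewrite H ?oppr0 // addn0.
rewrite /fC ltnNge kl /= (near_at wX) ?oppr0 //.
by move: i2 j1 jq q3; clear; case: i => [|[|]] // _; lia.
Qed.

Lemma D_not_involutive y : U y -> ~ (bracket_dd (D r.+1) (D r.+1) y <= D r.+1 y)%VS.
Proof.
move=> Uy; have HE y' z : U y' -> z \in D r.+1 y' <-> theta_ker (q - 1) y' z.
  by move=> Uy'; have := flag_ker (leq0n _) z Uy'; rewrite subn0.
have t2 : (2 <= q - 1 <= q - 1)%N by rewrite leqnn andbT; move: q3; clear; lia.
have [eta [eB _ e1]] := theta_gap Uy t2 HE.
move=> /subvP/(_ _ eB)/(HE _ _ Uy)[_ /(_ _ t2)]; rewrite e1 => /eqP.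
by rewrite -subr_eq0 addrAC subrr add0r oner_eq0.
Qed.

Lemma D_involutive i y : U y -> (i <= r)%N -> (bracket_dd (D i) (D i) y <= D i y)%VS.
Proof.
move=> Uy ir; have ir' := leqW ir.
apply: bracket_dd_sub => u w [su uD] [sw wD]; apply/(Dseq_ker ir' Uy)/D_kerP.
have Hu : \forall z \near y, D_ker i z (u z) by apply: near_imp2 uD (near_open Uo Uy) => t h Ut; apply/(Dseq_ker ir').
have Hw : \forall z \near y, D_ker i z (w z) by apply: near_imp2 wD (near_open Uo Uy) => t h Ut; apply/(Dseq_ker ir').
have bX' k : (1 <= k <= q)%N -> 'D_(lie_bracket u w y) (fX k) y = 0.
  move=> kq; apply: (bracket_ker su sw (fX_smooth k Uy)).
    by apply: near_imp Hu => z /D_ker_X; exact.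
  by apply: near_imp Hw => z /D_ker_X; exact.
split; first split.
- by apply: (chain_bracket Uy su sw); [apply: near_imp Hu => z [[]]|apply: near_imp Hw => z [[]]].
- move=> k /andP[k2 kq]; rewrite !bX' ?mulr0 ?q0 // (ltnW k2) (leq_trans kq) //; exact: leq_subr.
move=> j k j2 ki; apply: (bracket_ker su sw (fZ_smooth j k Uy)).
  by apply: near_imp Hu => z /D_kerP[_]; exact.
by apply: near_imp Hw => z /D_kerP[_]; exact.
Qed.

Lemma dualCC y j k j' i : U y -> (j < 2)%N -> (k < clen j)%N -> (j' < 2)%N -> (i <= clen j')%N ->
  'D_(e (ixC j k) y) (fC j' i) y = ((j == j') && (k == i) && (i < clen j')%N)%:R.
Proof.
move=> Uy j2 kj j2' ij; have h := ixC_lt j2 kj; have h' := leq_trans h pn.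
rewrite /fC; have [il|il] := ltnP i (clen j').
  have g := ixC_lt j2' il; have g' := leq_trans g pn; rewrite (dual Uy h' g') andbT.
  suff -> : (ixC j k == ixC j' i) = (j == j') && (k == i) by [].
  move: j2 kj j2' il; rewrite /ixC /clen; clear; case: j => [|[|]] // _; case: j' => [|[|]] // + _ /=.
  - by move=> /= h1 h2; apply/negbTE/eqP; move: h1 h2; clear; lia.
  - by move=> /= h1 h2; apply/negbTE/eqP; move: h1 h2; clear; lia.
  - by move=> _ _; rewrite eqn_add2l.
rewrite andbF; have jq : (1 <= j'.+1 <= q)%N by move: j2' q3; clear; lia.
rewrite /fX (dual Uy h' (ixX_lt (qlt jq))); suff -> : (ixC j k == ixX j'.+1) = false by [].
by apply: negbTE; rewrite neq_ltn (leq_trans h) // /ixX leq_addr.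
Qed.

(** The coordinate field of the function i places before the end of the prolonged chain j, with
    X_(j+1) at place 0; it is 0 from i = [clen j] on, when the chain needs no further correction. *)
Definition chain_field i j : V -> V := if (i < clen j)%N then
  (if i == 0%N then e (ixX j.+1) else e (ixC j (clen j - i))) else fun=> 0.

Lemma chain_field_smooth i j y : U y -> smooth_near y (chain_field i j).
Proof. by move=> Uy; rewrite /chain_field; do 2?case: ifP => _; by [exact: se|exact: smooth_near_cst]. Qed.

Lemma chain_fieldC i j y j' k : U y -> (j < 2)%N -> (j' < 2)%N -> (k + i <= clen j')%N -> (i < clen j')%N ->
  'D_(chain_field i j y) (fC j' k) y = ((j == j') && (k + i == clen j')%N)%:R.
Proof.
move=> Uy j2 j2' ki il'; rewrite /chain_field; case: ifP => il; last first.
  rewrite derive0; case: eqP => [jj|//]; by rewrite -jj il in il'.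
have jq m : (m < 2)%N -> (1 <= m.+1 <= q)%N by move: q3; clear; lia.
case: eqP => [i0|i0].
  rewrite i0 addn0 in ki *; have [kl|kl] := ltnP k (clen j').
    by rewrite dualXC ?jq // andbC (_ : (k == clen j') = false) //; apply: negbTE; rewrite neq_ltn kl.
  have -> : k = clen j' by apply/eqP; rewrite eqn_leq ki kl.
  by rewrite /fC ltnn dualXX ?jq // eqSS eqxx andbT.
have h : (clen j - i < clen j)%N by move: il i0; clear; lia.
rewrite dualCC //; last by move: ki; clear; lia.
have kl : (k < clen j')%N by move: ki i0; clear; lia.
rewrite kl andbT; case: eqP => [jj|//] /=; suff -> : (clen j - i == k)%N = (k + i == clen j')%N by [].
by rewrite -jj in ki il' *; move: ki il i0; clear; move=> *; apply/eqP/eqP; lia.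
Qed.

Section DriftFlag.
Context (U1 : set V) (U1o : open U1) (U1U : forall y, U1 y -> U y) (Dbar : tdistribution R n)
  (HB : forall y z, U1 y -> z \in Dbar y <-> chain_ker 0 y z).

(** As in [Dseq_ker], the drift frees one function per chain, and a vector is corrected by the
    brackets of the drift with the two fields [chain_field i]. *)
Lemma Gseq_ker i y z : U1 y -> z \in Gseq a Dbar i y <-> chain_ker i y z.
Proof.
elim: i y z => [|i IH] y z U1y; first exact: HB.
have Uy := U1U U1y; have secG w : section_near (Gseq a Dbar i) y w -> \forall t \near y, chain_ker i t (w t).
  by move=> [_ wD]; apply: near_imp2 wD (near_open U1o U1y) => t h Ut; apply/IH.
have cl := chain_ker_closed i Uy; split.
  have sub : (Gseq a Dbar i.+1 y <= vspan [set z | chain_ker i.+1 y z])%VS.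
    rewrite /= subv_add; apply/andP; split.
      apply/subvP => z' /(IH _ _ U1y)/chainP H; apply: mem_vspan; apply/chainP => j k j2 ki.
      by apply: H => //; move: ki; clear; lia.
    apply: vspan_sub => _ [w Gw <-]; apply: mem_vspan; have [sw _] := Gw.
    apply/chainP => j k j2 ki; have wk := secG _ Gw.
    rewrite (drift_chain Uy sw wk j2); last by move: ki; clear; lia.
    by have /chainP H := near_at wk; rewrite H ?oppr0 // addSn -addnS.
  by move=> /(subvP sub)/(mem_vspan_closed (chain_ker_closed _ Uy)).
move=> /chainP zC; pose w j := chain_field i j.
have wk j : (j < 2)%N -> \forall t \near y, chain_ker i t (w j t).
  move=> j2; apply: near_imp (near_open U1o U1y) => t U1t; apply/chainP => j' k j2' ki.
  rewrite chain_fieldC ?(ltnW ki) //; [|exact: U1U|by move: ki; clear; lia].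
  by rewrite (_ : (k + i == _)%N = false) ?andbF //; apply: negbTE; rewrite neq_ltn ki.
have wsec j : (j < 2)%N -> section_near (Gseq a Dbar i) y (w j).
  move=> j2; split; first exact: chain_field_smooth.
  by apply: near_imp2 (wk j j2) (near_open U1o U1y) => t h Ut; apply/IH.
have br j : (j < 2)%N -> lie_bracket a (w j) y \in Gseq a Dbar i.+1 y.
  by move=> j2; apply: (subvP (addvSr _ _)); apply: mem_vspan; exists (w j) => //; exact: wsec.
have brD j j' k : (j < 2)%N -> (j' < 2)%N -> (k + i < clen j')%N ->
    'D_(lie_bracket a (w j) y) (fC j' k) y = - ((j == j') && (k.+1 + i == clen j')%N)%:R.
  move=> j2 j2' ki; have [sw _] := wsec j j2; rewrite (drift_chain Uy sw (wk j j2) j2' ki).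
  by rewrite chain_fieldC //; move: ki; clear; lia.
pose l j := if (i < clen j)%N then 'D_z (fC j (clen j - i.+1)) y else 0.
have A0 := br 0%N isT; have A1 := br 1%N isT.
have B0 j' k := brD 0%N j' k isT; have B1 j' k := brD 1%N j' k isT.
move: (lie_bracket a (w 0%N) y) (lie_bracket a (w 1%N) y) A0 A1 B0 B1 => a0 a1 A0 A1 B0 B1.
have zE (z' A B : V) (c c' : R) : z' = (z' - (- c) *: A - (- c') *: B) - c *: A - c' *: B.
  by apply/rowP => i'; rewrite !mxE; ring.
rewrite (zE z a0 a1 (l 0%N) (l 1%N)); apply: memvB; last by apply: memvZ.
apply: memvB; last by apply: memvZ.
apply: (subvP (addvSl _ _)); apply/(IH _ _ U1y)/chainP => j k j2 ki.
apply: etrans (derive_dir_comb z a0 a1 _ _ (fC_smooth j k Uy)) _; rewrite B0 // B1 //.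
have [kE|kn] := eqVneq (k.+1 + i)%N (clen j); last first.
  have -> : 'D_z (fC j k) y = 0 by apply: zC => //; move: ki kn; clear; lia.
  have gen (A B : R) : 0 - A * - 0 - B * - 0 = 0 by ring.
  by rewrite !andbF; exact: gen.
have -> : 'D_z (fC j k) y = l j.
  rewrite /l ifT; last by move: ki; clear; lia.
  by rewrite (_ : clen j - i.+1 = k)%N //; move: kE; clear; lia.
rewrite !andbT; have gen0 (A B : R) : A - - A * - 1 - B * - 0 = 0 by ring.
have gen1 (A B : R) : A - B * - 0 - - A * - 1 = 0 by ring.
by case: j j2 {ki kE} => [|[|]].
Qed.

Lemma Gseq_involutive i y : U1 y -> (bracket_dd (Gseq a Dbar i) (Gseq a Dbar i) y <= Gseq a Dbar i y)%VS.
Proof. by move=> U1y; apply: (chain_involutive (i := i) U1o U1y U1U) => y' z; exact: Gseq_ker. Qed.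

Lemma Gseq_full y : U1 y -> Gseq a Dbar (p1 + p2) y = fullv.
Proof.
move=> U1y; apply/eqP; rewrite eqEsubv subvf /=; apply/subvP => z _; apply/Gseq_ker => //.
apply/chainP => j k j2; rewrite /clen; case: ifP => _ h; exfalso; move: h; clear; lia.
Qed.

(** At the ends of the chains [a, w] takes the values -dX_1(w) and -X_3 dX_1(w), because dX_2 = X_3
    dX_1 on this member of the flag. So modulo Dbar all brackets are multiples of the one for
    [hatX 2], which is outside Dbar if the first chain exists, or if the second does and X_3 is not
    zero. *)
Lemma drift_extension y : U1 y ->
  (0 < p1)%N || ((0 < p2)%N && (fX 3 y != 0)) ->
  (\dim (Dbar y + bracket_vd a (DF (q - 3)) y)%VS = \dim (Dbar y) + 1)%N.
Proof.
move=> U1y pos; have Uy := U1U U1y; have Un := near_open Uo Uy.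
have q3' : (q - 3 <= q - 2)%N by rewrite leq_sub2l.
have HE y' z : U y' -> z \in DF (q - 3) y' <-> theta_ker 2 y' z.
  by move=> Uy'; have := flag_ker q3' z Uy'; rewrite (_ : q - 1 - (q - 3) = 2)%N //; move: q3; clear; lia.
have q2 : (2 <= q - 1)%N by move: q3; clear; lia.
pose h := hatX 2; have sh : smooth_near y h by exact: hatX_smooth.
have hth : \forall t \near y, theta_ker 2 t (h t) by apply: near_imp Un => t Ut; exact: hatX_theta.
have hsec : section_near (DF (q - 3)) y h.
  by split=> //; apply: near_imp2 hth Un => t H Ut; apply/HE.
have brC w : section_near (DF (q - 3)) y w -> forall j k, (j < 2)%N -> (k < clen j)%N ->
    'D_(lie_bracket a w y) (fC j k) y =
    if k.+1 == clen j then - ((if j == 0%N then 1 else fX 3 y) * 'D_(w y) (fX 1) y) else 0.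
  move=> [sw wD] j k j2 kj.
  have wth : \forall t \near y, theta_ker 2 t (w t) by apply: near_imp2 wD Un => t H Ut; apply/HE.
  have wC : \forall t \near y, chain_ker 0 t (w t) by apply: near_imp wth => t [].
  have kj0 : (k + 0 < clen j)%N by rewrite addn0.
  rewrite (drift_chain Uy sw wC j2 kj0); case: eqP => [ke|ke]; last first.
    have /chainP H := near_at wC; rewrite H ?oppr0 // addn0; move: kj ke; clear; lia.
  rewrite ke /fC ltnn; have [_ th] := near_at wth.
  have e2 := th 2%N isT; case: j j2 {kj ke kj0} => [|[|j]] j2; last by [].
    by rewrite mul1r.
  by congr (- _); exact: e2.
have h1 : 'D_(h y) (fX 1) y = 1 by rewrite hatX_X ?q0 ?(ltnW q3) //= addr0.
apply: (@dim_add_line _ _ (lie_bracket a h y)).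
- exact: addvSl.
- by apply: (subvP (addvSr _ _)); apply: mem_vspan; exists h.
- apply/negP => /(HB _ U1y)/chainP zC; case/orP: pos => [p10|/andP[p20 x3]].
    have := zC 0%N p1.-1 isT; rewrite addn0 /clen /= prednK // leqnn => /(_ isT).
    rewrite (brC h hsec) // /clen /= ?prednK // eqxx h1 mulr1 => /eqP.
    by rewrite oppr_eq0 oner_eq0.
  have := zC 1%N p2.-1 isT; rewrite addn0 /clen /= prednK // leqnn => /(_ isT).
  rewrite (brC h hsec) // /clen /= ?prednK // eqxx h1 mulr1 => /eqP.
  by rewrite oppr_eq0 (negbTE x3).
have decomp w : section_near (DF (q - 3)) y w ->
    lie_bracket a w y - 'D_(w y) (fX 1) y *: lie_bracket a h y \in Dbar y.
  move=> Dw; apply/HB => //; apply/chainP => j k j2; rewrite addn0 => kj.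
  have d := smooth_near_diff (fC_smooth j k Uy); have e1 := brC w Dw j k j2 kj; have e2 := brC h hsec j k j2 kj.
  rewrite (derive_dirB _ _ d) (derive_dirZ _ _ d).
  have gen (A1 A2 A3 A4 c : R) (t : bool) : A4 = 1 -> A1 = (if t then - (c * A3) else 0) ->
      A2 = (if t then - (c * A4) else 0) -> A1 - A3 * A2 = 0.
    by case: t => a4 a1 a2; rewrite a1 a2 ?a4; ring.
  exact: gen h1 e1 e2.
have sub : (Dbar y + bracket_vd a (DF (q - 3)) y <= Dbar y + <[lie_bracket a h y]>)%VS.
  rewrite subv_add addvSl /=; apply: vspan_sub => _ [w Dw <-].
  rewrite -[lie_bracket a w y](subrK ('D_(w y) (fX 1) y *: lie_bracket a h y)).
  by apply: memv_add; [exact: decomp|apply: memvZ; exact: memv_line].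
move=> z /(subvP sub)/memv_addP[z1 z1D [_ /vlineP[c ->] ->]]; exists c.
by rewrite addrK.
Qed.

End DriftFlag.

Lemma flag_dim_sum j y : (j <= q - 2)%N -> U y -> (\dim (DF j y) = \dim (D r.+1 y) + j)%N.
Proof.
elim: j => [|j IH] jq Uy; first by rewrite addn0.
by rewrite (flag_dim jq Uy) (IH (ltnW jq) Uy) -addnA addn1.
Qed.

Theorem flag_conditions x n3 n2 Dbar : U x -> is_n3 x a b1 b2 n3 ->
  is_involutive_closure x (D n3.+1) Dbar -> is_n2 x (D n3.+1) Dbar n2 -> regular_near x a b1 b2 Dbar n3 n2 ->
  [/\ germ_eq x (cauchy_char (D n3.+1)) (D n3),
    forall i, (1 <= i <= n2 - 2)%N ->
      \forall y \near x, \dim (derived_flag (D n3.+1) i y) = (\dim (D n3.+1 y) + i)%N,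
    forall i, (1 <= i <= n2 - 3)%N ->
      germ_le x (bracket_vd a (cauchy_char (derived_flag (D n3.+1) i))) (derived_flag (D n3.+1) i) &
    ~ germ_full x Dbar ->
    [/\ \forall y \near x, \dim (Dbar y + bracket_vd a (derived_flag (D n3.+1) (n2 - 3)) y)%VS = (\dim (Dbar y) + 1)%N,
      forall i, germ_involutive x (Gseq a Dbar i.+1) & exists s, germ_full x (Gseq a Dbar s)]].
Proof.
move=> Ux [N3 N3'] iB N2 reg; have Un := near_open Uo Ux.
(* D_i is involutive for i <= r and D_(r+1) is not, which determines n3. *)
have n3r : n3 = r.
  have [lt|gt|//] := ltngtP n3 r.
    by exfalso; apply: N3; apply: near_imp Un => y Uy; exact: D_involutive.
  by exfalso; exact: D_not_involutive Ux (near_at (N3' r gt)).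
subst n3; have [DB inv minB] := iB.
have DFB : germ_eq x (DF (q - 2)) Dbar.
  have le1 : germ_le x Dbar (DF (q - 2)).
    apply: minB; first by apply: near_W => y; exact: (@flag_mono _ _ (D r.+1) y 0 (q - 2)).
    by apply: near_imp Un => y Uy; exact: (chain_involutive (i := 0) Uo Uy (fun _ h => h) (fun _ z Uz => closure_ker z Uz)).
  have le2 j : germ_le x (DF j) Dbar.
    elim: j => // j IH; apply: near_imp3 IH (near_near IH) inv => y h1 h2 h3.
    rewrite /= subv_add h1; apply: subv_trans h3; apply: bracket_dd_sub => u w Du Dw.
    by apply: bracket_mem; [exact: section_sub h2 Du|exact: section_sub h2 Dw].
  by apply: near_imp2 le1 (le2 (q - 2)%N) => y h1 h2; apply/eqP; rewrite eqEsubv h1 h2.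
(* The dimensions of the derived flag grow strictly up to index q - 2, so the closure is not reached
   earlier. *)
have n2q : n2 = q.
  have [n2_2 eqB minN] := N2; have [lt|gt|//] := ltngtP n2 q; last first.
    by exfalso; apply: (minN q) => //; rewrite (ltnW q3) gt.
  exfalso; have le2 : (n2 - 2 <= q - 2)%N by rewrite leq_sub2r // ltnW.
  have := flag_dim_sum le2 Ux; rewrite (near_at eqB) -(near_at DFB) (flag_dim_sum (leqnn _) Ux) => /eqP.
  by rewrite eqn_add2l => /eqP; move: n2_2 lt; clear; lia.
subst n2.
have sax := sa Ux; have s1x : smooth_near x b1 := sb 0 Ux; have s2x : smooth_near x b2 := sb 1 Ux.
have rD := D_regular sax s1x s2x reg; have rF := DF_regular sax s1x s2x reg.
split.
- exact: cauchy_top Ux (rD _) (rD _).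
- by move=> i /andP[_ iq]; apply: near_imp Un => y; exact: flag_dim_sum.
- move=> i iq; apply: near_imp2 Un (regular_near_pt (rF i)) => y Uy rFy; exact: cauchy_drift.
move=> nfull.
have [U1 [U1o U1x HU1]] : exists U1, [/\ open U1, U1 x & forall y, U1 y -> U y /\ DF (q - 2) y = Dbar y].
  have : nbhs x [set y | U y /\ DF (q - 2) y = Dbar y] by exact: near_and Un DFB.
  by rewrite nbhsE => -[U1 [U1o U1x] H]; exists U1; split.
have U1U y : U1 y -> U y by move=> /HU1[].
have HB y z : U1 y -> z \in Dbar y <-> chain_ker 0 y z.
  by move=> /HU1[Uy <-]; exact: closure_ker.
have U1n := near_open U1o U1x.
(* With both chains empty Dbar would be the whole tangent space. *)
have p0 : (0 < p1 + p2)%N.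
  rewrite lt0n; apply/eqP => p0; apply: nfull; apply: near_imp U1n => y U1y.
  by have := Gseq_full U1o U1U HB U1y; rewrite p0.
split; last 2 first.
- by move=> i; apply: near_imp U1n => y; exact: Gseq_involutive.
- by exists (p1 + p2)%N; apply: near_imp U1n => y; exact: Gseq_full.
have [p10|p10] := ltnP 0 p1.
  by apply: near_imp U1n => y U1y; have := @drift_extension _ U1U _ HB _ U1y; rewrite p10; apply.
have p20 : (0 < p2)%N by move: p10 p0; clear; lia.
have [_ _ _ lG lW] := reg; have lB := lG 0%N; rewrite /= in lB.
(* Here p1 = 0 and X_3 may vanish at x. If the dimension dropped at x it would, by regularity, drop
   on a neighbourhood, where X_3 would then vanish; but X_3 is a coordinate. *)
have dimx : (\dim (Dbar x + bracket_vd a (DF (q - 3)) x)%VS = \dim (Dbar x) + 1)%N.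
  apply: contrapT => ne; have X0 : \forall y \near x, fX 3 y = 0.
    apply: near_imp3 U1n lB lW => y U1y dB dW; apply: contrapT => /eqP x3; apply: ne.
    have := @drift_extension _ U1U _ HB _ U1y; rewrite p20 x3 orbT => /(_ isT) dE.
    by rewrite -dB -dE; apply/esym; exact: dW.
  have q33 : (1 <= 3 <= q)%N by [].
  have := near_at (near_lied_eq (e (ixX 3)) X0); rewrite lied_cst /lied dualXX // eqxx => /eqP.
  by rewrite oner_eq0.
by apply: near_imp2 lB lW => y dB dW; rewrite dB -dimx; exact: dW.
Qed.

End TriangularFlags.

(** * Necessity: triangular coordinates pulled back to the given system *)

Section NecessaryConditions.
Context {R : realType} {n : nat}.
Local Notation V := 'rV[R]_n.

Lemma derive_line_const (F : V -> R) (z h : V) :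
  (\forall t \near (0 : R), F (z + t *: h) = F z) -> 'D_h F z = 0.
Proof.
move=> H; have := derive_line F z h 0; rewrite scale0r addr0 => <-.
rewrite -[RHS](derive_cst (F z) (0 : R) 1); exact: near_eq_derive.
Qed.

Context (x : V) (a b1 b2 : V -> V) (p1 p2 q r : nat).

Section Transport.
Context (V' : set V) (abar b1bar b2bar : V -> V) (U : set V) (Phi Psi : V -> V)
  (g : V -> 'cV[R]_2) (m : V -> 'M[R]_2) (a2 : nat -> V -> R).
Context (sa2 : forall k, (2 <= k <= q.-1)%N -> smooth_on V' (a2 k))
  (loc : forall k, (2 <= k <= q.-1)%N -> forall z z', V' z -> V' z' ->
    (forall i : 'I_n, (i < p1 + p2 + k.+1)%N -> z 0 i = z' 0 i) -> a2 k z = a2 k z')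
  (tri : forall z u, V' z -> triangular_eqs p1 p2 q r a2 z u (dynamics abar b1bar b2bar z u))
  (Uo : open U) (Ux : U x) (Vo : open V') (UV : Phi @` U = V')
  (sPhi : smooth_on U Phi) (sPsi : smooth_on V' Psi) (PsiK : forall y, U y -> Psi (Phi y) = y)
  (eqv : forall y u, U y -> 'D_(dynamics a b1 b2 y u) Phi y = dynamics abar b1bar b2bar (Phi y) (g y + m y *m u)).

Let VPhi y : U y -> V' (Phi y). Proof. by move=> Uy; rewrite -UV; exists y. Qed.
Let sPhi_at y : U y -> smooth_near y Phi. Proof. by move=> Uy; exists U. Qed.
Let sPsi_at z : V' z -> smooth_near z Psi. Proof. by move=> Vz; exists V'. Qed.

Definition tcoord i : V -> R := fun y => entry (Phi y) i.
Definition tfield (i : nat) : V -> V := fun y => 'D_(\row_(j < n) (i == j :> nat)%:R) Psi (Phi y).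
(** Zero outside the range of k, since the triangular form gives smoothness of a_2^k only inside
    it. *)
Definition talpha k : V -> R := if (2 <= k <= q.-1)%N then fun y => a2 k (Phi y) else fun=> 0.

Lemma tcoord_smooth y i : U y -> smooth_near y (tcoord i).
Proof. by move=> Uy; apply: smooth_near_entry; exact: sPhi_at. Qed.

Lemma derive_tcoord y z i : U y -> 'D_z (tcoord i) y = entry ('D_z Phi y) i.
Proof.
move=> Uy; rewrite /tcoord /entry; case: insubP => [j _ _|_]; last by rewrite derive_cst.
by rewrite derive_rV //; exact: smooth_near_derivable (sPhi_at Uy).
Qed.

Lemma tfield_smooth y i : U y -> smooth_near y (tfield i).
Proof.
move=> Uy; apply: (smooth_near_comp_rV (f := Phi) (g := fun z => 'D_(_) Psi z)); first exact: sPhi_at.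
by apply: smooth_near_dir; apply: sPsi_at; exact: VPhi.
Qed.

Lemma tfield_dual y i j : U y -> (i < n)%N -> (j < n)%N -> 'D_(tfield i y) (tcoord j) y = (i == j)%:R.
Proof.
move=> Uy i_n jn; have Vy := VPhi Uy; rewrite derive_tcoord //; pose h : V := \row_(l < n) (i == l :> nat)%:R.
have d1 := smooth_near_diff (sPsi_at Vy).
have d2 : differentiable Phi (Psi (Phi y)) by rewrite PsiK //; exact: smooth_near_diff (sPhi_at Uy).
have := derive_comp h d1 d2; rewrite PsiK // => E.
have id : 'D_h (Phi \o Psi) (Phi y) = h.
  rewrite -[RHS](derive_id (Phi y) h); apply: near_eq_derive.
  by apply: near_imp (near_open Vo Vy) => z; rewrite -UV => -[t Ut <-] /=; rewrite PsiK.
have -> : 'D_(tfield i y) Phi y = h by rewrite -id E.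
by rewrite (entry_lt _ jn) mxE.
Qed.

Lemma tcoord_injective y z : U y -> (forall i, (i < n)%N -> 'D_z (tcoord i) y = 0) -> z = 0.
Proof.
move=> Uy H; have P0 : 'D_z Phi y = 0.
  by apply/rowP => i; rewrite [RHS]mxE -entry_ord -derive_tcoord // H.
have d1 := smooth_near_diff (sPhi_at Uy); have d2 := smooth_near_diff (sPsi_at (VPhi Uy)).
have := derive_comp z d1 d2; rewrite P0 derive0 => E.
rewrite -[LHS](derive_id y z) -E; apply: near_eq_derive.
by apply: near_imp (near_open Uo Uy) => t Ut /=; rewrite PsiK.
Qed.

Lemma talpha_smooth y k : U y -> smooth_near y (talpha k).
Proof.
move=> Uy; rewrite /talpha; case: ifP => kq; last exact: smooth_near_cst.
apply: (smooth_near_comp (f := Phi) (g := a2 k)); first exact: sPhi_at.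
by exists V'; split; [exact: Vo|exact: VPhi|exact: sa2].
Qed.

Local Notation tX := (fX p1 p2 tcoord).
Local Notation tC := (fC p1 p2 tcoord).
Local Notation tZ := (fZ p1 p2 q r tcoord).
Local Notation len := (clen p1 p2).

(** The image of z under the differential of [Phi] has zero leading entries, so a_2^k is constant on
    a short segment in that direction. *)
Lemma talpha_kill y k z : U y -> (2 <= k <= q.-1)%N ->
  (forall j i, (j < 2)%N -> (i < len j)%N -> 'D_z (tC j i) y = 0) ->
  (forall i, (1 <= i <= k.+1)%N -> 'D_z (tX i) y = 0) -> 'D_z (talpha k) y = 0.
Proof.
move=> Uy kq zC zX; rewrite /talpha kq.
have Vy := VPhi Uy; have d1 := smooth_near_diff (sPhi_at Uy).
have s2 : smooth_near (Phi y) (a2 k) by exists V'; split=> //; exact: sa2.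
rewrite (derive_comp z d1 (smooth_near_diff s2)); set h := 'D_z Phi y.
have h0 (i : 'I_n) : (i < p1 + p2 + k.+1)%N -> h 0 i = 0.
  move=> ik; rewrite -entry_ord -derive_tcoord //.
  have [i1|i1] := ltnP i p1.
    by have := zC 0%N i isT; rewrite /fC /clen /ixC /= i1; apply.
  have [i2|i2] := ltnP i (p1 + p2).
    by have := zC 1%N (i - p1)%N isT; rewrite /fC /clen /ixC /= ltn_subLR // i2 subnKC //; apply.
  have := zX (i - (p1 + p2)).+1; rewrite /fX /ixX /= subnKC //; apply.
  by rewrite ltn_subLR.
apply: derive_line_const.
have cl : {for 0, continuous (fun t : R => Phi y + t *: h)}.
  by move=> ?; apply: cvgD; [exact: cvg_cst|apply: cvgZr_tmp; exact: cvg_id].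
have V0 : V' (Phi y + 0 *: h) by rewrite scale0r addr0.
have Hn : nbhs (0 : R) (fun t : R => V' (Phi y + t *: h)) := cl V' (open_nbhs_nbhs (conj Vo V0)).
apply: (filterS _ Hn) => t Vt.
by apply: loc => // i ik; rewrite !mxE h0 // mulr0 addr0.
Qed.

(** The equations hold for every input; drift and input parts are separated later by subtracting the
    case u = 0. *)
Lemma triangular_along y u : U y ->
  let w := dynamics a b1 b2 y u in
  [/\ forall j k, (j < 2)%N -> (k < len j)%N -> 'D_w (tC j k) y = tC j k.+1 y,
    forall k, (2 <= k <= q.-1)%N -> 'D_w (tX k) y = tX k.+1 y * 'D_w (tX 1) y + talpha k y,
    forall j k, (j < 2)%N -> (k < r)%N -> 'D_w (tZ j k) y = tZ j k.+1 y &
    forall j : 'I_2, 'D_w (tZ j r) y = (g y + m y *m u) j 0].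
Proof.
move=> Uy w; have := tri (g y + m y *m u) (VPhi Uy); rewrite -eqv // -/w.
set ub := g y + m y *m u; move=> [[c1 c1' c2 c2'] [x1 xk xq] z3].
have dE i : 'D_w (tcoord i) y = entry ('D_w Phi y) i by exact: derive_tcoord.
have inp (j : 'I_2) : 'D_w (tZ j 0) y = x2_input p1 p2 q r j (Phi y) ub.
  case: j => [[|[|//]] h]; rewrite /fZ /= /fX dE /ixX.
    by rewrite -[LHS]/(x2 p1 p2 ('D_w Phi y) q) xq; congr x2_input; apply: val_inj.
  by rewrite -[LHS]/(x2 p1 p2 ('D_w Phi y) 1) x1; congr x2_input; apply: val_inj.
have ZS (j : 'I_2) k : (k < r)%N -> 'D_w (tZ j k) y = tZ j k.+1 y.
  case: k => [|k] kr.
    by rewrite inp /x2_input; case: eqP kr => [->//|_ _].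
  rewrite {1}/fZ /= dE; have [H _] := z3 j; exact: (H k.+1 kr).
have Zr (j : 'I_2) : 'D_w (tZ j r) y = ub j 0.
  have [r0|r0] := posnP r; first by rewrite r0 inp /x2_input r0.
  rewrite /fZ -[r == 0%N]negbK -lt0n r0 /= dE; have [_ H] := z3 j; exact: H.
split=> //.
- case=> [|[|//]] k _ kl; rewrite /clen /= in kl.
    rewrite {1}/fC /clen /= kl dE /fC /clen /=; case: ifP => kl'; first exact: (c1 k.+1 kl').
    have ke : p1 = k.+1 by apply/eqP; rewrite eqn_leq kl leqNgt kl'.
    by have := c1' (leq_ltn_trans (leq0n _) kl); rewrite [X in x11 _ X]ke.
  rewrite {1}/fC /clen /= kl dE /fC /clen /=; case: ifP => kl'; first exact: (c2 k.+1 kl').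
  have ke : p2 = k.+1 by apply/eqP; rewrite eqn_leq kl leqNgt kl'.
  by have := c2' (leq_ltn_trans (leq0n _) kl); rewrite [X in x12 _ _ X]ke.
- move=> k kq; rewrite {1}/fX dE -[LHS]/(x2 p1 p2 ('D_w Phi y) k) xk // /talpha kq.
  by congr (_ * _ + _); rewrite -x1 /fX dE.
- by move=> j k j2 kr; exact: (ZS (Ordinal j2)).
Qed.

End Transport.

Theorem necessary_conditions n3 n2 Dbar : smooth_near x a -> smooth_near x b1 -> smooth_near x b2 ->
  equivalent_to_triangular x a b1 b2 p1 p2 q r ->
  is_n3 x a b1 b2 n3 -> is_involutive_closure x (Dseq a b1 b2 n3.+1) Dbar ->
  is_n2 x (Dseq a b1 b2 n3.+1) Dbar n2 -> regular_near x a b1 b2 Dbar n3 n2 ->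
  let D := Dseq a b1 b2 in let DF := derived_flag (D n3.+1) in
  [/\ germ_eq x (cauchy_char (D n3.+1)) (D n3),
    forall i, (1 <= i <= n2 - 2)%N -> \forall y \near x, \dim (DF i y) = (\dim (D n3.+1 y) + i)%N,
    forall i, (1 <= i <= n2 - 3)%N -> germ_le x (bracket_vd a (cauchy_char (DF i))) (DF i) &
    ~ germ_full x Dbar ->
    [/\ \forall y \near x, \dim (Dbar y + bracket_vd a (DF (n2 - 3)%N) y)%VS = (\dim (Dbar y) + 1)%N,
      forall i, germ_involutive x (Gseq a Dbar i.+1) & exists s, germ_full x (Gseq a Dbar s)]].
Proof.
move=> sa sb1 sb2 [V' [abar [b1bar [b2bar [[q3 dn [a2 [sa2 loc tri]]]]]]]].
move=> [U [Phi [Psi [g [m [[Uo Ux Vo UV] [sPhi sPsi PsiK] [_ _ mu] eqv]]]]]] N3 iB N2 reg D DF.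
have : nbhs x [set y | [/\ smooth_near y a, smooth_near y b1 & smooth_near y b2]].
  exact: near_and3 (smooth_near_near sa) (smooth_near_near sb1) (smooth_near_near sb2).
rewrite nbhsE => -[W [Wo Wx] HW].
pose U1 := U `&` W; have U1o : open U1 by exact: openI.
have U1U y : U1 y -> U y by case.
have sab y : U1 y -> [/\ smooth_near y a, smooth_near y b1 & smooth_near y b2] by move=> [_ /HW].
have along := triangular_along tri Uo UV sPhi eqv.
have dyn0 y : dynamics a b1 b2 y 0 = a y by rewrite /dynamics !mxE !scale0r !addr0.
have dynD y (u : 'cV[R]_2) (f : V -> R) : smooth_near y f ->
    'D_(u 0 0 *: b1 y + u 1 0 *: b2 y) f y = 'D_(dynamics a b1 b2 y u) f y - 'D_(a y) f y.
  move=> /smooth_near_diff d; rewrite /dynamics -addrA (derive_dirD (a y) _ d).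
  by rewrite addrAC subrr add0r.
have alongI y l : U1 y -> (l < 2)%N -> exists u : 'cV[R]_2, u 0 0 *: b1 y + u 1 0 *: b2 y = inp b1 b2 l y.
  move=> _ l2; exists (\col_(i < 2) (i == l :> nat)%:R); rewrite !mxE.
  by case: l l2 => [|[|]] // _; rewrite /inp /= ?scale1r ?scale0r ?addr0 ?add0r.
pose xi := tcoord Phi; pose al := talpha Phi a2.
have sxi y i : U1 y -> smooth_near y (xi i) by move=> /U1U; exact: tcoord_smooth.
have sC y j k : U1 y -> smooth_near y (fC p1 p2 xi j k) by move=> Uy; rewrite /fC; case: ifP => _; exact: sxi.
have sZ y j k : U1 y -> smooth_near y (fZ p1 p2 q r xi j k) by move=> Uy; rewrite /fZ; do ?case: ifP => _; exact: sxi.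
have eqa y : U1 y -> _ := fun U1y => along y 0 (U1U y U1y).
apply: (@flag_conditions R n U1 U1o p1 p2 q r q3 dn xi (tfield Phi Psi) a b1 b2 al) => //.
- by move=> y i /U1U Uy; exact: (tfield_smooth Uo Vo UV sPhi sPsi i Uy).
- by move=> y /sab[].
- by move=> y l /sab[_ h1 h2]; rewrite /inp; case: ifP.
- by move=> y k /U1U Uy; exact: (talpha_smooth sa2 Uo Vo UV sPhi k Uy).
- by move=> y i j /U1U Uy; exact: (tfield_dual Uo Vo UV sPhi sPsi PsiK Uy).
- by move=> y z /U1U; exact: (tcoord_injective Uo Vo UV sPhi sPsi PsiK).
- by move=> y j k Uy j2 kl; have [H _ _ _] := eqa y Uy; rewrite dyn0 in H; exact: H.
- by move=> y j k Uy j2 kr; have [_ _ H _] := eqa y Uy; rewrite dyn0 in H; exact: H.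
- by move=> y k Uy kq; have [_ H _ _] := eqa y Uy; rewrite dyn0 in H; exact: H.
- by move=> y k z /U1U Uy; exact: (talpha_kill sa2 loc Uo Vo UV sPhi Uy).
- move=> y l j k Uy l2 j2 kl; have [u uE] := alongI y l Uy l2; have [H _ _ _] := eqa y Uy.
  have [H' _ _ _] := along y u (U1U y Uy); rewrite dyn0 in H.
  by rewrite /lied -uE dynD; [rewrite H // H' // subrr|exact: sC].
- move=> y l j k Uy l2 j2 kr; have [u uE] := alongI y l Uy l2; have [_ _ H _] := eqa y Uy.
  have [_ _ H' _] := along y u (U1U y Uy); rewrite dyn0 in H.
  by rewrite /lied -uE dynD; [rewrite H // H' // subrr|exact: sZ].
- move=> y l k Uy l2 kq; have [u uE] := alongI y l Uy l2; have [_ H _ _] := eqa y Uy.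
  have [_ H' _ _] := along y u (U1U y Uy); rewrite dyn0 in H.
  have e1 := H k kq; have e2 := H' k kq.
  rewrite /lied -uE dynD; last exact: sxi.
  rewrite (@dynD y u (fX p1 p2 xi 1)); last exact: sxi.
  have gen (A B C E F1 G : R) : A = F1 * B + G -> C = F1 * E + G -> C - A = F1 * (E - B) by move=> -> ->; ring.
  exact: gen e1 e2.
(* The inputs reach every value on the last pair because the feedback matrix is invertible. *)
- move=> y lam Uy; pose c : 'cV[R]_2 := invmx (m y) *m \col_(i < 2) lam i.
  exists (c 0 0), (c 1 0) => j j2; have [_ _ _ H] := eqa y Uy; have [_ _ _ H'] := along y c (U1U y Uy).
  rewrite dyn0 in H; rewrite dynD; last exact: sZ.
  have e1 := H (Ordinal j2); have e2 := H' (Ordinal j2).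
  rewrite mulmx0 addr0 in e1; rewrite mulKVmx ?mu in e2; last exact: U1U.
  rewrite e1 e2 !mxE.
  have gen (A B : R) : A + B - A = B by ring.
  exact: gen.
by split.
Qed.

End NecessaryConditions.

(** * Generic points *)

Section BracketWords.
Context {R : realType} {n : nat}.
Local Notation V := 'rV[R]_n.
Local Notation vf := (V -> V).

(** Formal brackets name the same field in every chart; the generic set is defined through ranks of
    lists of them and has to be independent of charts. *)
Inductive bword := WA | WB1 | WB2 | Wbr of bword & bword.

Fixpoint wval (a b1 b2 : vf) (w : bword) : vf :=
  match w with
  | WA => a | WB1 => b1 | WB2 => b2
  | Wbr u v => lie_bracket (wval a b1 b2 u) (wval a b1 b2 v)
  end.

Fixpoint Dwords i : seq bword :=
  match i with
  | 0 => [::]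
  | 1 => [:: WB1; WB2]
  | i'.+1 => Dwords i' ++ [seq Wbr WA u | u <- Dwords i']
  end.

Fixpoint Fwords L j : seq bword :=
  if j is j'.+1 then Fwords L j' ++ [seq Wbr u w | u <- Fwords L j', w <- Fwords L j'] else L.

Lemma Dlist_words a b1 b2 i : Dlist a b1 b2 i = map (wval a b1 b2) (Dwords i).
Proof.
elim: i => [|[|i] IH] //.
rewrite -[LHS]/(Dlist a b1 b2 i.+1 ++ [seq lie_bracket a u | u <- Dlist a b1 b2 i.+1]).
rewrite -[Dwords i.+2]/(Dwords i.+1 ++ [seq Wbr WA u | u <- Dwords i.+1]).
by rewrite map_cat IH; congr (_ ++ _); rewrite -!map_comp.
Qed.

Lemma pairs_words a b1 b2 L L' : [seq lie_bracket u w | u <- map (wval a b1 b2) L, w <- map (wval a b1 b2) L'] =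
  map (wval a b1 b2) [seq Wbr u w | u <- L, w <- L'].
Proof. by rewrite map_allpairs allpairs_mapl allpairs_mapr. Qed.

Lemma Flist_words a b1 b2 L j : Flist (map (wval a b1 b2) L) j = map (wval a b1 b2) (Fwords L j).
Proof. by elim: j => //= j ->; rewrite map_cat pairs_words. Qed.

Definition wrank (a b1 b2 : vf) S (y : V) := \dim << evals (map (wval a b1 b2) S) y >>.

Lemma wval_smooth a b1 b2 y w : smooth_near y a -> smooth_near y b1 -> smooth_near y b2 ->
  smooth_near y (wval a b1 b2 w).
Proof. by move=> sa s1 s2; elim: w => //= u su v sv; exact: smooth_near_bracket. Qed.

Lemma wlist_smooth a b1 b2 y S : smooth_near y a -> smooth_near y b1 -> smooth_near y b2 ->
  forall i, (i < size (map (wval a b1 b2) S))%N -> smooth_near y (nth (fun=> 0) (map (wval a b1 b2) S) i).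
Proof.
move=> sa s1 s2 i; rewrite size_map => iS; rewrite (nth_map WA) //; exact: wval_smooth.
Qed.

(** A frame extracted at y consists of smooth combinations of the list and stays independent
    nearby. *)
Lemma wrank_lsc a b1 b2 S y : smooth_near y a -> smooth_near y b1 -> smooth_near y b2 ->
  \forall z \near y, (wrank a b1 b2 S y <= wrank a b1 b2 S z)%N.
Proof.
move=> sa s1 s2; set s := map (wval a b1 b2) S.
have [d [v [c [sv dv mv sin]]]] := frame_of_list (wlist_smooth (S := S) sa s1 s2).
have rd : (wrank a b1 b2 S y <= d)%N.
  rewrite -(dual_free (near_at dv)); apply: dimvS; apply: evals_sub => i im.
  by apply/in_frame_span; exact: sin.
have vs : \forall z \near y, forall i, (i < d)%N -> v i z \in <<evals s z>>%VS.
  apply: near_lt => i id; have [al [_ Hv]] := mv i id; apply: near_imp Hv => z ->.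
  by apply: memv_suml => j _; apply: memvZ; exact: mem_evals.
apply: near_imp2 dv vs => z dz vz; apply: leq_trans rd _; rewrite -(dual_free dz); apply: dimvS.
apply/span_subvP => w /mapP[i]; rewrite mem_iota => /andP[_ id] ->; exact: vz.
Qed.

Definition related (A : set V) (tau : vf) (v v' : vf) := forall y, A y -> v' (tau y) = 'D_(v y) tau y.

(** On the coordinates of tau, derivatives along a field of the target pull back to derivatives
    along the related field; a bracket is a commutator of such derivatives. *)
Lemma related_bracket (A : set V) tau v w v' w' : open A -> (forall y, A y -> smooth_near y tau) ->
  (forall y, A y -> smooth_near y v) -> (forall y, A y -> smooth_near y w) ->
  (forall y, A y -> smooth_near (tau y) v') -> (forall y, A y -> smooth_near (tau y) w') ->
  related A tau v v' -> related A tau w w' -> related A tau (lie_bracket v w) (lie_bracket v' w').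
Proof.
move=> Ao st sv sw sv' sw' rv rw y Ay.
have An := near_open Ao Ay; apply/rowP => j.
have sj := smooth_near_coord j (st y Ay).
have dt z u : A z -> 'D_u (fun t => tau t 0 j) z = ('D_u tau z) 0 j.
  by move=> Az; rewrite derive_rV //; exact: smooth_near_derivable (st z Az).
rewrite -(dt y _ Ay) -[RHS]/(lied (lie_bracket v w) (fun t => tau t 0 j) y) (lied_bracket (sv y Ay) (sw y Ay) sj).
rewrite (bracket_coord j (sv' y Ay) (sw' y Ay)).
have key (u u' : vf) (z' z'' : vf) : related A tau u u' -> related A tau z' z'' -> smooth_near (tau y) z'' ->
    lied u' (fun z => z'' z 0 j) (tau y) = lied u (lied z' (fun t => tau t 0 j)) y.
  move=> ru rz s''.
  have H : \forall t \near y, lied z' (fun t => tau t 0 j) t = z'' (tau t) 0 j.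
    by apply: near_imp An => t At; rewrite /lied dt // rz.
  rewrite (near_at (near_lied_eq u H)) /lied ru //.
  apply/esym; apply: (derive_comp (f := tau) (g := fun z => z'' z 0 j)).
    exact: smooth_near_diff (st y Ay).
  exact: smooth_near_diff (smooth_near_coord j s'').
by congr (_ - _); [exact: (key v v' w w' rv rw (sw' y Ay))|exact: (key w w' v v' rw rv (sv' y Ay))].
Qed.

Lemma related_words (A : set V) tau a b1 b2 a' b1' b2' : open A -> (forall y, A y -> smooth_near y tau) ->
  (forall y, A y -> [/\ smooth_near y a, smooth_near y b1 & smooth_near y b2]) ->
  (forall y, A y -> [/\ smooth_near (tau y) a', smooth_near (tau y) b1' & smooth_near (tau y) b2']) ->
  related A tau a a' -> related A tau b1 b1' -> related A tau b2 b2' ->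
  forall w, related A tau (wval a b1 b2 w) (wval a' b1' b2' w).
Proof.
move=> Ao st s s' ra r1 r2; elim=> [|||u ru v rv]; [exact: ra|exact: r1|exact: r2|].
by apply: (related_bracket Ao st _ _ _ _ ru rv) => y Ay;
  [have [? ? ?] := s y Ay|have [? ? ?] := s y Ay|have [? ? ?] := s' y Ay|have [? ? ?] := s' y Ay]; exact: wval_smooth.
Qed.

(** The values in the target are the images of the values in the source under the differential of
    tau, and a linear map does not raise dimensions. *)
Lemma related_rank (A : set V) tau a b1 b2 a' b1' b2' S y : A y -> differentiable tau y ->
  (forall w, related A tau (wval a b1 b2 w) (wval a' b1' b2' w)) ->
  (wrank a' b1' b2' S (tau y) <= wrank a b1 b2 S y)%N.
Proof.
move=> Ay dt rel; pose J : 'Hom('rV[R]_n, 'rV[R]_n) := linfun ('d tau y).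
rewrite /wrank; have -> : evals (map (wval a' b1' b2') S) (tau y) = [seq J z | z <- evals (map (wval a b1 b2) S) y].
  rewrite /evals -!map_comp; apply: eq_map => w /=; rewrite rel // lfunE /= deriveE //.
by rewrite -limg_span -(limg_ker_dim J <<evals (map (wval a b1 b2) S) y>>) leq_addl.
Qed.

End BracketWords.

Section RankSpread.
Context {R : realType} {n : nat}.
Local Notation V := 'rV[R]_n.
Local Notation vf := (V -> V).
Implicit Types (x y : V) (D E : tdistribution R n) (s t K : seq vf) (a : vf).

Lemma evals_memP s y (v : V) : v \in evals s y <-> exists2 i, (i < size s)%N & v = nth (fun=> 0%R) s i y.
Proof.
split=> [/(nthP 0)[i]|[i si ->]]; first by rewrite size_map => si <-; exists i => //; rewrite evals_nth.
by rewrite -evals_nth //; apply: mem_nth; rewrite size_map.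
Qed.

(** At x the enlarged list spans just E. Its rank and dim E are constant near x and it always spans
    at least E, so it spans exactly E near x. *)
Lemma rank_spread x E s K : gen x s E -> loc_const_dim x E ->
  (\forall y \near x, \dim << evals (s ++ K) y >> = \dim << evals (s ++ K) x >>) ->
  (forall v, v \in evals K x -> v \in E x) -> \forall y \near x, forall v, v \in evals K y -> v \in E y.
Proof.
move=> [_ sE] cE cT HK; have Tx : \dim << evals (s ++ K) x >> = \dim (E x).
  rewrite evals_cat -(near_at sE); congr (\dim _); apply/addv_idPl; apply/span_subvP => v; exact: HK.
apply: near_imp3 sE cE cT => y Ey dE dT v vK.
have le : (E y <= << evals (s ++ K) y >>)%VS by rewrite evals_cat -Ey addvSl.
have /eqP -> : (E y == << evals (s ++ K) y >>)%VS by rewrite eqEdim le dT Tx dE leqnn.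
by rewrite evals_cat; apply: (subvP (addvSr _ _)); exact: memv_span.
Qed.

Lemma evals_pairs s t y : evals [seq lie_bracket u w | u <- s, w <- t] y =
  [seq lie_bracket (nth (fun=> 0%R) s i) (nth (fun=> 0%R) t k) y | i <- iota 0 (size s), k <- iota 0 (size t)].
Proof.
rewrite /evals map_allpairs -{1}(mkseq_nth (fun=> 0%R) s) -{1}(mkseq_nth (fun=> 0%R) t) /mkseq.
by rewrite allpairs_mapl allpairs_mapr.
Qed.

(* If the rank of the list does not jump at x, an inclusion at x is an inclusion of germs. *)
Lemma generic_bracket_dd x D E s t : germ_le x D E -> gen x s D -> loc_const_dim x D -> gen x t E ->
  loc_const_dim x E ->
  (\forall y \near x, \dim << evals (t ++ [seq lie_bracket u w | u <- s, w <- t]) y >> =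
    \dim << evals (t ++ [seq lie_bracket u w | u <- s, w <- t]) x >>) ->
  (bracket_dd D E x <= E x)%VS -> germ_le x (bracket_dd D E) E.
Proof.
move=> DE gD cD gE cE cT brE.
have H : \forall y \near x, forall v, v \in evals [seq lie_bracket u w | u <- s, w <- t] y -> v \in E y.
  apply: (rank_spread gE cE cT) => v; rewrite evals_pairs => /allpairsP[[i k] /= [+ + ->]].
  rewrite !mem_iota !add0n => /andP[_ si] /andP[_ tk]; apply: (subvP brE).
  by apply: bracket_mem; [exact: gen_mem gD si|exact: gen_mem gE tk].
have n1 := near_and3 (gen_near gD) (lcd_near cD) (near_near DE).
apply: near_imp3 n1 (near_and (gen_near gE) (lcd_near cE)) H => y [gDy cDy DEy] [gEy cEy] Hy.
have st i k : (i < size s)%N -> (k < size t)%N ->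
    lie_bracket (nth (fun=> 0%R) s i) (nth (fun=> 0%R) t k) y \in E y.
  move=> si tk; apply: Hy; rewrite evals_pairs.
  by apply: (allpairs_f (fun i k => lie_bracket (nth (fun=> 0%R) s i) (nth (fun=> 0%R) t k) y)); rewrite mem_iota.
apply: bracket_dd_sub => u w Du Ew; have [su _] := Du.
apply: (smod_bracket su gEy.1 (section_smod gEy cEy Ew)) => k tk.
  by have [_ /near_at] := gen_mem gEy tk.
rewrite bracketN memvN; apply: (smod_bracket (gEy.1 k tk) gDy.1 (section_smod gDy cDy Du)) => i si.
  by have [_ /near_at h] := gen_mem gDy si; exact: subvP (near_at DEy) _ h.
by rewrite bracketN memvN; exact: st.
Qed.

Lemma generic_bracket_vd x a D E s t : smooth_near x a -> germ_le x D E -> gen x s D -> loc_const_dim x D -> gen x t E ->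
  loc_const_dim x E ->
  (\forall y \near x, \dim << evals (t ++ [seq lie_bracket a u | u <- s]) y >> =
    \dim << evals (t ++ [seq lie_bracket a u | u <- s]) x >>) ->
  (bracket_vd a D x <= E x)%VS -> germ_le x (bracket_vd a D) E.
Proof.
move=> sa DE gD cD gE cE cT brE.
have nE i y : (i < size s)%N -> nth (fun=> 0%R) [seq lie_bracket a u | u <- s] i y = lie_bracket a (nth (fun=> 0%R) s i) y.
  by move=> si; rewrite (nth_map (fun=> 0%R)).
have H : \forall y \near x, forall v, v \in evals [seq lie_bracket a u | u <- s] y -> v \in E y.
  apply: (rank_spread gE cE cT) => v /evals_memP[i]; rewrite size_map => si ->; rewrite nE //.
  by apply: (subvP brE); apply: mem_vspan; exists (nth (fun=> 0%R) s i) => //; exact: gen_mem gD si.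
have n1 := near_and3 (gen_near gD) (lcd_near cD) (near_near DE).
apply: near_imp3 n1 (smooth_near_near sa) H => y [gDy cDy DEy] say Hy.
apply: vspan_sub => _ [w Dw <-]; apply: (smod_bracket say gDy.1 (section_smod gDy cDy Dw)) => i si.
  by have [_ /near_at h] := gen_mem gDy si; exact: subvP (near_at DEy) _ h.
by apply: Hy; apply/evals_memP; exists i; rewrite ?size_map // nE.
Qed.

End RankSpread.

Section GenericPoints.
Context {R : realType} {n : nat} {X : smoothManifold R n} (a b1 b2 : vectorField X).
Local Notation V := 'rV[R]_n.
Implicit Types (p : X) (c d : mchart X) (S : seq bword).

Definition chart_at p : mchart X := sval (cid (m_cover p)).

Lemma chart_atP p : mdom (chart_at p) p. Proof. by rewrite /chart_at; case: (cid _). Qed.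

Definition crank c S (y : V) := wrank (a c) (b1 c) (b2 c) S y.
Definition prank S p := crank (chart_at p) S (mcoord (chart_at p) p).

Lemma vf_smooth_at (v : vectorField X) c p : mdom c p -> smooth_near (mcoord c p) (v c).
Proof.
move=> cp; exists (mcoord c @` mdom c); split; [exact: mimage_open|by exists p|exact: vf_smooth].
Qed.

Lemma overlap_open c d : open (mcoord c @` (mdom c `&` mdom d)).
Proof.
rewrite openE => y [p [cp dp] <-]; rewrite /interior.
have h1 : nbhs (mcoord c p) (mcoord c @` mdom c).
  by apply: open_nbhs_nbhs; split; [exact: mimage_open|exists p].
have h2 : nbhs (mcoord c p) (mpoint c @^-1` mdom d).
  have := mpoint_continuous cp; apply; rewrite mcoordK //.
  by apply: open_nbhs_nbhs; split=> //; exact: mdom_open.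
apply: near_imp2 h1 h2 => z [p' cp' <-]; rewrite /= mcoordK // => dp'.
by exists p'.
Qed.

(** Transition maps relate the coordinate representations of the fields, so the rank does not grow
    from one chart to another; exchanging the charts gives equality. *)
Lemma crank_le c d p S : mdom c p -> mdom d p -> (crank d S (mcoord d p) <= crank c S (mcoord c p))%N.
Proof.
move=> cp dp; pose A := mcoord c @` (mdom c `&` mdom d).
have Ay : A (mcoord c p) by exists p.
have st y : A y -> smooth_near y (mcoord d \o mpoint c).
  by move=> Ay'; exists A; split=> //; [exact: overlap_open|exact: mtransition_smooth].
have tE p' : mdom c p' -> (mcoord d \o mpoint c) (mcoord c p') = mcoord d p' by move=> cp'; rewrite /= mcoordK.
have rel (v : vectorField X) : related A (mcoord d \o mpoint c) (v c) (v d).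
  by move=> _ [p' [cp' dp'] <-]; rewrite tE //; exact: vf_compat.
have Ao : open A by exact: overlap_open.
have s1 y : A y -> [/\ smooth_near y (a c), smooth_near y (b1 c) & smooth_near y (b2 c)].
  by move=> [p' [cp' dp'] <-]; split; exact: vf_smooth_at.
have s2 y : A y -> [/\ smooth_near ((mcoord d \o mpoint c) y) (a d), smooth_near ((mcoord d \o mpoint c) y) (b1 d) &
    smooth_near ((mcoord d \o mpoint c) y) (b2 d)].
  by move=> [p' [cp' dp'] <-]; rewrite tE //; split; exact: vf_smooth_at.
have relw := related_words Ao st s1 s2 (rel a) (rel b1) (rel b2).
have := related_rank S Ay (smooth_near_diff (st _ Ay)) relw.
by rewrite tE.
Qed.

Lemma prankE c p S : mdom c p -> prank S p = crank c S (mcoord c p).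
Proof. by move=> cp; apply/eqP; rewrite eqn_leq !crank_le //; exact: chart_atP. Qed.

Lemma dom_near c p : mdom c p -> nbhs p (mdom c).
Proof. by move=> cp; apply: open_nbhs_nbhs; split=> //; exact: mdom_open. Qed.

Lemma prank_lsc S p : \forall p' \near p, (prank S p <= prank S p')%N.
Proof.
pose c := chart_at p; have cp : mdom c p := chart_atP p.
have lsc := wrank_lsc S (vf_smooth_at a cp) (vf_smooth_at b1 cp) (vf_smooth_at b2 cp).
have near_p := mcoord_continuous cp lsc.
by apply: near_imp2 (dom_near cp) near_p => p' cp' H; rewrite (prankE S cp') (prankE S cp).
Qed.

(* Under (a) and (b) the dimensions give n3 < n and n2 - 2 <= n, so finitely many lists suffice. *)
Definition family (k : bool * 'I_n.+1 * 'I_n.+1) : seq bword :=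
  let: (t, i, j) := k in Fwords (Dwords i) j ++
    (if t then [seq Wbr WA u | u <- Dwords i] else [seq Wbr u w | u <- Dwords i, w <- Fwords (Dwords i) j]).

Definition stable S p := \forall p' \near p, prank S p' = prank S p.

Definition generic_set : set X := [set p | forall k, stable (family k) p].

Lemma generic_open : open generic_set.
Proof.
rewrite openE => p Hp; rewrite /interior.
have H : \forall p' \near p, forall k, stable (family k) p'.
  apply: near_all => k; have h := Hp k; apply: near_imp2 h (near_near h) => p' e h'.
  by apply: near_imp h' => p'' ->; rewrite e.
exact: H.
Qed.

(* The ranks are lower semicontinuous and bounded, so they are locally constant at a point
   where their sum is maximal. *)
Lemma generic_dense : dense generic_set.
Proof.
move=> B [p0 Bp0] Bo; pose N p := (\sum_k prank (family k) p)%N.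
pose P m := `[< exists2 p, B p & N p = m >].
have exP : exists m, P m by exists (N p0); apply/asboolP; exists p0.
have ub m : P m -> (m <= #|{: bool * 'I_n.+1 * 'I_n.+1}| * n)%N.
  move=> /asboolP[p _ <-]; rewrite -sum_nat_const; apply: leq_sum => k _.
  by apply: leq_trans (dimvS (subvf _)) _; rewrite dimvf /dim /= mul1n.
case: (ex_maxnP exP ub) => m /asboolP[p Bp Np] mx; exists p; split=> // k.
have lsc : \forall p' \near p, forall i, (prank (family i) p <= prank (family i) p')%N.
  by apply: near_all => i; exact: prank_lsc.
have Bn : nbhs p B by apply: open_nbhs_nbhs.
apply: near_imp2 lsc Bn => p' H Bp'; apply/eqP; rewrite eqn_leq H // andbT leqNgt; apply/negP => lt.
have : (N p' <= N p)%N by rewrite Np; apply: mx; apply/asboolP; exists p'.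
rewrite leqNgt => /negP; apply; rewrite /N (bigD1 k) //= [X in (_ < X)%N](bigD1 k) //=.
by rewrite -addSn; apply: leq_add => //; apply: leq_sum => i _; exact: H.
Qed.

Lemma generic_chart c p S : mdom c p -> stable S p ->
  \forall y \near mcoord c p, crank c S y = crank c S (mcoord c p).
Proof.
move=> cp Hs; have near_x : nbhs (mcoord c p) (mpoint c @^-1` [set p' | prank S p' = prank S p]).
  by have := mpoint_continuous cp; apply; rewrite mcoordK.
have im : nbhs (mcoord c p) (mcoord c @` mdom c).
  by apply: open_nbhs_nbhs; split; [exact: mimage_open|exists p].
apply: near_imp2 im near_x => y [p' cp' <-]; rewrite /= mcoordK // => E.
by rewrite -(prankE S cp') E (prankE S cp).
Qed.

Lemma generic_rank c p k : mdom c p -> generic_set p ->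
  \forall y \near mcoord c p, \dim << evals (map (wval (a c) (b1 c) (b2 c)) (family k)) y >> =
    \dim << evals (map (wval (a c) (b1 c) (b2 c)) (family k)) (mcoord c p) >>.
Proof. by move=> cp gp; exact: generic_chart cp (gp k). Qed.

End GenericPoints.

Theorem theorem1 (R : realType) (n : nat) (X : smoothManifold R n)
    (a b1 b2 : vectorField X) :
  exists O : set X, [/\ open O, dense O &
    forall (p : X) (c : mchart X), O p -> mdom c p ->
    let x := mcoord c p in
    forall (n3 n2 : nat) (Dbar : tdistribution R n),
    let D := Dseq (a c) (b1 c) (b2 c) in
    let DF := derived_flag (D n3.+1) in
    let G := Gseq (a c) Dbar in
    is_n3 x (a c) (b1 c) (b2 c) n3 ->
    is_involutive_closure x (D n3.+1) Dbar ->
    is_n2 x (D n3.+1) Dbar n2 ->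
    regular_near x (a c) (b1 c) (b2 c) Dbar n3 n2 ->
    let cond_a := germ_eq x (cauchy_char (D n3.+1)) (D n3) in
    let cond_b := forall i, (1 <= i <= n2 - 2)%N ->
      \forall y \near x, \dim (DF i y) = (\dim (D n3.+1 y) + i)%N in
    let cond_c1 := forall i, (1 <= i <= n2 - 3)%N ->
      germ_le x (bracket_vd (a c) (cauchy_char (DF i))) (DF i) in
    let cond_c2 := \forall y \near x,
      \dim (Dbar y + bracket_vd (a c) (DF (n2 - 3)%N) y)%VS
      = (\dim (Dbar y) + 1)%N in
    let cond_d := forall i, germ_involutive x (G i.+1) in
    let cond_e := exists s, germ_full x (G s) in
    (~ germ_full x Dbar ->
      (exists p1 p2 q r,
         equivalent_to_triangular x (a c) (b1 c) (b2 c) p1 p2 q r) <->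
      [/\ cond_a, cond_b, cond_c1 /\ cond_c2, cond_d & cond_e]) /\
    (germ_full x Dbar ->
      (exists q r,
         equivalent_to_triangular x (a c) (b1 c) (b2 c) 0 0 q r) <->
      [/\ cond_a, cond_b & cond_c1])].
Proof.
exists (generic_set a b1 b2); split; [exact: generic_open|exact: generic_dense|].
move=> p c gp cp x n3 n2 Dbar D DF G N3 iB N2 reg cond_a cond_b cond_c1 cond_c2 cond_d cond_e.
have sa : smooth_near x (a c) by exact: vf_smooth_at.
have sb1 : smooth_near x (b1 c) by exact: vf_smooth_at.
have sb2 : smooth_near x (b2 c) by exact: vf_smooth_at.
have nec p1 p2 q r := @necessary_conditions R n x (a c) (b1 c) (b2 c) p1 p2 q r n3 n2 Dbar sa sb1 sb2.
have [cD cF _ _ _] := reg.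
have gD := gen_Dlist sa sb1 sb2 cD n3.+1; have gF := gen_Flist gD cF.
have DB : germ_le x (D n3.+1) Dbar by have [] := iB.
have q3 := q_ge3 N3 iB N2.
(* The dimensions 2(n3 + 1) and 2(n3 + 1) + n2 - 2 are at most n, so the lists used below belong to
   the finite family. *)
have bounds : cond_a -> cond_b -> (n3.+1 <= n)%N /\ (n2 - 2 <= n)%N.
  move=> cA cB; have d1 := D_dim sa sb1 sb2 N3 reg cA (leqnn _).
  have d2 := near_at (DF_dim sa sb1 sb2 N3 reg cA cB (leqnn (n2 - 2))).
  have := dimvS (subvf (D n3.+1 x)); have := dimvS (subvf (DF (n2 - 2)%N x)).
  rewrite dimvf /dim /= mul1n d2 -/D d1; clear; lia.
(* Near x the closure Dbar is generated by the words of the derived flag at index n2 - 2; together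
   with the words for [a, D] they form a member of the family with flag [true]. *)
have A1 : cond_a -> cond_b -> (bracket_vd (a c) (D n3.+1) x <= Dbar x)%VS ->
    germ_le x (bracket_vd (a c) (D n3.+1)) Dbar.
  move=> cA cB; have [h1 h2] := bounds cA cB.
  have eB : germ_eq x (DF (n2 - 2)%N) Dbar by have [] := N2.
  have cB' : loc_const_dim x Dbar.
    have eBx := near_at eB; have eB' := eB.
    by apply: near_imp2 eB' (cF (n2 - 2)%N) => y <- ->; rewrite -eBx.
  have gB : gen x (Flist (Dlist (a c) (b1 c) (b2 c) n3.+1) (n2 - 2)) Dbar.
    have [gs ge] := gF (n2 - 2)%N; split; first exact: gs.
    by apply: near_imp2 eB ge => y e1 e2; rewrite -e2; exact: esym e1.
  have H := generic_bracket_vd sa DB gD (cD n3.+1) gB cB'; apply: H.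
  have := generic_rank (true, inord n3.+1, inord (n2 - 2)) cp gp.
  rewrite /family !inordK ?ltnS // map_cat -Flist_words -Dlist_words.
  by rewrite Dlist_words -!map_comp.
(* The words for D' and for [D, D'] form a member of the family with flag [false]. *)
have A2 : cond_a -> cond_b -> (bracket_dd (D n3.+1) (DF (n2 - 3)%N) x <= DF (n2 - 3)%N x)%VS ->
    germ_le x (bracket_dd (D n3.+1) (DF (n2 - 3)%N)) (DF (n2 - 3)%N).
  move=> cA cB; have [h1 h2] := bounds cA cB.
  have h3 : (n2 - 3 <= n)%N by apply: leq_trans h2; exact: leq_sub2l.
  have DFl : germ_le x (D n3.+1) (DF (n2 - 3)%N).
    by apply: near_W => y; exact: (@flag_mono _ _ (D n3.+1) y 0 (n2 - 3)).
  have H := generic_bracket_dd DFl gD (cD n3.+1) (gF (n2 - 3)%N) (cF (n2 - 3)%N); apply: H.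
  have := generic_rank (false, inord n3.+1, inord (n2 - 3)) cp gp.
  by rewrite /family !inordK ?ltnS // map_cat -pairs_words -Flist_words -Dlist_words.
split=> [nfull|full]; split.
- move=> [p1 [p2 [q [r eqv]]]].
  by have [h1 h2 h3 /(_ nfull)[h4 h5 h6]] := nec p1 p2 q r eqv N3 iB N2 reg; split.
- move=> [cA cB [c1 c2] dG [s Gs]].
  exact: (sufficient_chains sa sb1 sb2 N3 iB N2 reg cA cB c1 c2 dG Gs (A1 cA cB)).
- move=> [q [r eqv]].
  by have [h1 h2 h3 _] := nec 0%N 0%N q r eqv N3 iB N2 reg; split.
- move=> [cA cB c1].
  exact: (sufficient_full sa sb1 sb2 N3 iB N2 reg cA cB c1 full (A2 cA cB)).
Qed.
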